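(* Let $K\subset\mathbb{C}$ be an imaginary quadratic field, and let $S\subset\mathbb{P}^4_K$ be the surface defined by $$x_0x_1-x_2x_3=x_0x_3+x_1x_3+x_2x_4=0.$$ Let $U\subset S$ be the complement of the lines on $S$. For $B\ge 3$, $$N_{U,H}(B)=c_{S,H}\,B(\log B)^5+O\big(B(\log B)^4\log\log B\big),$$ where $$c_{S,H}=\frac{1}{4320}\cdot\frac{(2\pi)^6h_K^6}{\Delta_K^4\,\omega_K^6}\cdot\prod_{\mathfrak p}\Big(1-\frac{1}{\mathrm N\mathfrak p}\Big)^6\Big(1+\frac{6}{\mathrm N\mathfrak p}+\frac{1}{\mathrm N\mathfrak p^2}\Big)\cdot\omega_\infty,$$ with $\mathfrak p$ running over all nonzero prime ideals of $\mathcal O_K$, and $$\omega_\infty=\frac{12}{\pi}\int_{\max\{\|z_0z_2^2\|,\|z_1z_2^2\|,\|z_2^3\|,\|z_0z_1z_2\|,\|z_0z_1(z_0+z_1)\|\}\le 1}\mathrm dz_0\,\mathrm dz_1\,\mathrm dz_2 .$$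
   Context: $\mathcal O_K$ is the ring of integers of $K$, $\Delta_K$ its discriminant, $h_K$ its class number, $\omega_K=|\mathcal O_K^\times|$, and $\mathrm N$ the absolute norm of (fractional) ideals. For $z\in\mathbb C$, $\|z\|:=|z|^2$ (square of the usual complex absolute value). The height on $\mathbb P^4_K(K)$ is $H(x_0:\dots:x_4)=\max\{\|x_0\|,\dots,\|x_4\|\}/\mathrm N(x_0\mathcal O_K+\dots+x_4\mathcal O_K)$, and $N_{U,H}(B)=|\{x\in U(K): H(x)\le B\}|$. In $\omega_\infty$, $z_0,z_1,z_2$ are complex variables and $\mathrm dz_i$ is Lebesgue measure on $\mathbb C\cong\mathbb R^2$. The implied constant in the $O$-term may depend on $K$. *)

(* Defs.v *)
From HB Require Import structures.
From mathcomp Require Import all_boot all_order all_algebra all_field.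
From mathcomp Require Import finmap.
From mathcomp Require Import all_classical all_reals all_analysis.
From mathcomp Require Import complex.

Set Implicit Arguments.
Unset Strict Implicit.
Unset Printing Implicit Defensive.

Import Order.TTheory GRing.Theory Num.Theory.
Import numFieldNormedType.Exports.

Local Open Scope classical_set_scope.
Local Open Scope ring_scope.

(* All the sets counted below are finite; [ncard] is 0 on infinite sets. *)
Definition ncard (T : choiceType) (A : set T) : nat := #|` fset_set A|%fset.

Section NumberField.
Variable K : fieldExtType rat.

Definition ringOfIntegers : set K :=
  [set x | integralOver (intr : int -> K) x].
Local Notation OK := ringOfIntegers.

Definition OK_submodule (I : set K) :=
  [/\ I 0, forall x y, I x -> I y -> I (x + y)
    & forall a x, OK a -> I x -> I (a * x)].

Definition integral_ideal (I : set K) := OK_submodule I /\ I `<=` OK.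

Definition scale_ideal (c : K) (I : set K) : set K := [set c * x | x in I].

Definition denominator (I : set K) (d : K) :=
  [/\ d != 0, OK d & scale_ideal d I `<=` OK].

Definition fractional_ideal (I : set K) :=
  [/\ OK_submodule I, exists2 x, I x & x != 0
    & exists d, denominator I d].

Definition nonzero_prime_ideal (P : set K) :=
  [/\ integral_ideal P, exists2 x, P x & x != 0, ~ P 1
    & forall x y, OK x -> OK y -> P (x * y) -> P x \/ P y].

Definition coset_ideal (I : set K) (x : K) : set K := [set x + y | y in I].

(* |O_K / I|, for an integral ideal I *)
Definition absNorm (I : set K) : nat := ncard [set coset_ideal I x | x in OK].

(* N(I) = N(d I) / N(d O_K) for any d as in [denominator]; the quotient does
   not depend on the choice of d. *)
Definition fracNorm (I : set K) : rat :=
  let d := xget 1 (denominator I) in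
  (absNorm (scale_ideal d I))%:R / (absNorm (scale_ideal d OK))%:R.

Definition ideal_class (I : set K) : set (set K) :=
  [set scale_ideal c I | c in [set c : K | c != 0]].

Definition classNumber : nat :=
  ncard [set ideal_class I | I in fractional_ideal].

Definition unitCount : nat := ncard [set u : K | [/\ u != 0, OK u & OK u^-1]].

Definition integral_basis (w : 'I_(\dim {:K}) -> K) :=
  (forall i, OK (w i)) /\
  forall x, OK x ->
    exists! a : {ffun 'I_(\dim {:K}) -> int}, x = \sum_i w i *~ a i.

(* the trace of multiplication by x on the rat-vector space K *)
Definition traceQ (x : K) : rat :=
  let e := vbasis {:K} in \sum_i coord e i (x * e`_i).

Definition is_discriminant (D : rat) :=
  exists2 w, integral_basis w & D = \det (\matrix_(i, j) traceQ (w i * w j)).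

(* The discriminant does not depend on the integral basis. *)
Definition discriminant : rat := xget 0 is_discriminant.

End NumberField.

Section Surface.
Variable K : fieldType.

Definition onSurface (x : 'rV[K]_5) : Prop :=
  let X (i : nat) : K := x 0 (inord i) in
  X 0%N * X 1%N - X 2%N * X 3%N = 0 /\
  X 0%N * X 3%N + X 1%N * X 3%N + X 2%N * X 4%N = 0.

(* A linear subvariety of P^4 is the corresponding vector subspace of K^5:
   its points are the subspaces of dimension 1, its lines those of
   dimension 2. *)
Definition pointOnS (P : {vspace 'rV[K]_5}) :=
  \dim P = 1%N /\ forall x, x \in P -> onSurface x.

(* For K infinite, S contains exactly five lines over any extension of K, all
   defined over the prime field: x0=x3=x4=0, x1=x3=x4=0, x0=x1=x2=0,
   x0=x2=x3=0 and x1=x2=x3=0. So lines over K are the geometric lines. *)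
Definition lineOnS (L : {vspace 'rV[K]_5}) :=
  \dim L = 2%N /\ forall x, x \in L -> onSurface x.

Definition pointOnU (P : {vspace 'rV[K]_5}) :=
  pointOnS P /\ forall L, lineOnS L -> ~~ (P <= L)%VS.

End Surface.

Section Counting.
Variables (R : realType) (K : fieldExtType rat) (iota : {rmorphism K -> R[i]}).

Definition imaginary_quadratic :=
  \dim {:K} = 2%N /\ exists x : K, complex.Im (iota x) != 0.

Definition sqnorm (z : R[i]) : R := ComplexField.Normc.normc z ^+ 2.

Definition coord_ideal (x : 'rV[K]_5) : set K :=
  [set \sum_i a i * x 0 i
    | a in [set a : 'I_5 -> K | forall i, ringOfIntegers (a i)]].

Definition height_vec (x : 'rV[K]_5) : R :=
  (\big[Num.max/0]_(i < 5) sqnorm (iota (x 0 i)))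
    / ratr (fracNorm (coord_ideal x)).

(* [vpick P] is a nonzero vector of P; [height_vec] is invariant under
   scaling by nonzero elements of K. *)
Definition height (P : {vspace 'rV[K]_5}) : R := height_vec (vpick P).

Definition countU (B : R) : nat :=
  ncard [set P : {vspace 'rV[K]_5} | pointOnU P /\ height P <= B].

End Counting.

Section Constant.
Variables (R : realType) (K : fieldExtType rat).

Definition euler_factor (P : set K) : R :=
  let q : R := (absNorm P)%:R in
  (1 - q^-1) ^+ 6 * (1 + 6 / q + (q ^+ 2)^-1).

(* The product converges absolutely, so the order is irrelevant. *)
Definition euler_product : R :=
  limn (fun n : nat =>
    \big[*%R/1]_(P \in [set P : set K | nonzero_prime_ideal P /\
                                       (absNorm P <= n)%N]) euler_factor P).

(* (x0, y0, x1, y1, x2, y2) in R^6 stands for (z0, z1, z2) in C^3 with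
   z_j = x_j + i y_j. *)
Definition omega_domain : set (R * R * R * R * R * R) :=
  [set p | let: (x0, y0, x1, y1, x2, y2) := p in
    let z0 := (x0 +i* y0)%C in
    let z1 := (x1 +i* y1)%C in
    let z2 := (x2 +i* y2)%C in
    \big[Num.max/0]_(z <- [:: z0 * z2 ^+ 2; z1 * z2 ^+ 2; z2 ^+ 3;
                             z0 * z1 * z2; z0 * z1 * (z0 + z1)])
       sqnorm z <= 1].

Local Notation mu := (@lebesgue_measure R).

Definition omega_infty : R :=
  12 / pi * \int[(mu \x mu \x mu \x mu \x mu \x mu)%E]_(p in omega_domain) 1.

Definition leading_constant : R :=
  1 / 4320
  * ((2 * pi) ^+ 6 * (classNumber K)%:R ^+ 6
     / (ratr (discriminant K) ^+ 4 * (unitCount K)%:R ^+ 6))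
  * euler_product * omega_infty.

End Constant.

(* Main.v *)
Require Import Defs.
From HB Require Import structures.
From mathcomp Require Import all_boot all_order all_algebra all_field.
From mathcomp Require Import finmap.
From mathcomp Require Import all_classical all_reals all_analysis.
From mathcomp Require Import measurable_realfun.
From mathcomp Require Import complex.
From mathcomp Require Import zify ring lra.

Set Implicit Arguments.
Unset Strict Implicit.
Unset Printing Implicit Defensive.

Import Order.TTheory GRing.Theory Num.Theory.
Import numFieldNormedType.Exports.

Local Open Scope classical_set_scope.
Local Open Scope ring_scope.

(* A point of U is (u : v : 1 : uv : -uv(u+v)) with u, v in K^*.  Prime by prime, the valuations of u, v and u + v
   determine the exponents of six ideals eta_1, ..., eta_6 (the parameters of the universal torsor), and the height is
   M(u, v) N(eta_1^3 eta_2^2 eta_3 eta_4^2 eta_5 eta_6^2) with M = max(1, |u|^2, |v|^2, |uv|^2, |uv(u+v)|^2).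
   For fixed eta the pairs (u, v) form a lattice of rank 4 with sublattices removed.  If T = B / N(eta_1^3 ...) and the
   covolumes of its two rank-2 pieces lie in suitable logarithmic ranges, comparing fundamental domains with the
   region M <= T counts them asymptotically; the remaining eta are handled by a crude upper bound, and contribute
   O(B (log B)^4 log log B).  The swap (u, v) -> (v, u) allows one to assume N(eta_3) <= N(eta_5).
   The main terms are summed under the integral over (u, v): ideal counting in the form rho x + O(x^(1-c)) and Moebius
   inversion on supports show that the weighted sum over eta is a constant times the Euler product times
   (B / M) (log B)^5, and the integral of 1 / M over C^2 is a quarter of omega_infty, by z_0 = z_2 u, z_1 = z_2 v. *)

(** The obstacle is uniformity in eta. For fixed eta, v runs over an ideal of norm n and, for each
    v, u over a coset of an ideal of norm m; replacing the count by V(T) / (m n), up to a constant,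
    needs both m and n small. For n > T there is no point at all, since v is nonzero, yet the
    volumes of those eta add up to order B (log B)^5. The main term is therefore cut off at n <= 1
    and, for symmetry, at n' <= 1, with n' the value of n after the swap; the range 1 < n <= T is
    treated crudely. Since n n' <= 1, the cut-off is the full sum minus two partial sums, and in
    units of rho^6 / 4320 the coefficients are 3/2 - 1/4 - 1/4. Fourth roots occur because V(T) =
    O(T^(3/4)): the crude bound T^(3/4) / (m n) gains T^(1/4) over T / (m n), which controls the
    sums over large T. With exponent 3/4 also in the ideal counts, an error loses q^(-3/4) for each
    division by a prime of norm q, and two divisions already give a convergent product. The eta_i
    are ideals, not elements, so class group and units enter only through the density [rho] of
    ideals. *)

Section Manin.
Context (R : realType) (K : fieldExtType rat) (iota : {rmorphism K -> R[i]}).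
Hypothesis hK : imaginary_quadratic iota.
Ltac nneg := repeat first [assumption | exact: ler01 | exact: ler0n | exact: sqrtr_ge0 | exact: sqr_ge0
  | exact: normr_ge0 | by apply: ltW | apply: addr_ge0 | apply: mulr_ge0 | apply: exprn_ge0
  | rewrite invr_ge0 | apply: sumr_ge0].
(* lra is slow in large contexts: the common cases first. *)
Ltac qlra := first [assumption | apply: ltW; assumption | apply: lt_le_trans ltr01 _; assumption
  | apply: le_trans ler01 _; assumption | lra].

(** * Sums over integers *)
(** The natural scale of the error terms: the height region has volume O(T^(3/4)), and ideal counts
    are used with an error x^(3/4). *)
Definition r4 (x : R) : R := Num.sqrt (Num.sqrt x).
Lemma r4_ge0 x : 0 <= r4 x. Proof. exact: sqrtr_ge0. Qed.
Lemma r4_gt0 x : 0 < x -> 0 < r4 x. Proof. by move=> h; rewrite /r4 !sqrtr_gt0. Qed.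
Lemma r4K x : 0 <= x -> r4 x ^+ 4 = x.
Proof. by move=> x0; rewrite (exprM _ 2 2) /r4 !sqr_sqrtr ?sqrtr_ge0. Qed.
Lemma r4M x y : 0 <= x -> r4 (x * y) = r4 x * r4 y.
Proof. by move=> x0; rewrite /r4 sqrtrM // sqrtrM // sqrtr_ge0. Qed.
Lemma r4_le x y : x <= y -> r4 x <= r4 y.
Proof. by move=> h; rewrite /r4; do 2 apply: ler_wsqrtr. Qed.
Lemma r4_1 : r4 1 = 1. Proof. by rewrite /r4 !sqrtr1. Qed.
Lemma r4X4 x : 0 <= x -> r4 (x ^+ 4) = x.
Proof. by move=> x0; rewrite /r4 (exprM _ 2 2) sqrtr_sqr (ger0_norm (sqr_ge0 x)) sqrtr_sqr ger0_norm. Qed.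
Lemma r4_ge1 x : 1 <= x -> 1 <= r4 x. Proof. by move/r4_le; rewrite r4_1. Qed.
Lemma r4V x : 0 <= x -> r4 x^-1 = (r4 x)^-1. Proof. by move=> x0; rewrite /r4 !sqrtrV ?sqrtr_ge0. Qed.

Lemma ler_sum_in (T : eqType) (s : seq T) (F G : T -> R) : (forall x, x \in s -> F x <= G x) ->
  \sum_(x <- s) F x <= \sum_(x <- s) G x.
Proof. by move=> h; rewrite big_seq [leRHS]big_seq; apply: ler_sum. Qed.

Lemma ln_le_r4 x : 0 < x -> ln x <= 4 * r4 x.
Proof.
move=> x0; have r0 := r4_gt0 x0.
rewrite -{1}(r4K (ltW x0)) lnXn // -(mulr_natl (ln (r4 x)) 4) ler_pM2l //.
have h : ln (1 + (r4 x - 1)) <= r4 x - 1 by apply: le_ln1Dx; qlra.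
by rewrite addrC subrK in h; qlra.
Qed.

Lemma sum_abel (c g : nat -> R) (n : nat) :
  \sum_(i < n) (c i.+1 - c i) * g i = c n * g n - c 0%N * g 0%N + \sum_(i < n) c i.+1 * (g i - g i.+1).
Proof.
elim: n => [|n ih]; first by rewrite !big_ord0; ring.
by rewrite !big_ord_recr /= ih; ring.
Qed.

(** Summation by parts twice: first the differences fall on g, where monotonicity lets the error C
    sqrt i be inserted termwise; then they return to sqrt i, whose increments are at most 1 / sqrt
    (i + 1). *)
Lemma sum_compare (c g : nat -> R) (rho C : R) (n : nat) : 0 <= C ->
  (forall i, 0 <= g i) -> (forall i, g i.+1 <= g i) -> c 0%N = 0 ->
  (forall i, `|c i - rho * i%:R| <= C * Num.sqrt i%:R) ->
  `|\sum_(i < n) (c i.+1 - c i) * g i - rho * \sum_(i < n) g i| <= C * \sum_(i < n) g i / Num.sqrt i.+1%:R.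
Proof.
move=> C0 g0 gd c0 cP; pose d i := c i - rho * i%:R.
have -> : \sum_(i < n) (c i.+1 - c i) * g i - rho * \sum_(i < n) g i = \sum_(i < n) (d i.+1 - d i) * g i.
  by rewrite mulr_sumr -sumrB; apply: eq_bigr => i _; rewrite /d -[i.+1]addn1 natrD; ring.
have d0 : d 0%N = 0 by rewrite /d c0 mulr0 subrr.
rewrite sum_abel d0 mul0r subr0.
apply: (@le_trans _ _ (C * (Num.sqrt n%:R * g n + \sum_(i < n) Num.sqrt i.+1%:R * (g i - g i.+1)))).
  apply: le_trans (ler_normD _ _) _; rewrite mulrDr; apply: lerD.
    by rewrite normrM mulrA (ger0_norm (g0 n)) ler_wpM2r //; exact: cP.
  apply: le_trans (ler_norm_sum _ _ _) _; rewrite mulr_sumr; apply: ler_sum => i _.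
  have h : 0 <= g i - g i.+1 by rewrite subr_ge0.
  by rewrite normrM (ger0_norm h) mulrA ler_wpM2r //; exact: cP.
rewrite ler_wpM2l //.
have := sum_abel (fun i => Num.sqrt i%:R) g n; rewrite sqrtr0 mul0r subr0 => <-.
apply: ler_sum => i _; rewrite mulrC ler_wpM2l //.
have a0 : 0 <= i%:R :> R by rewrite ler0n.
have s1 : 0 < Num.sqrt i.+1%:R :> R by rewrite sqrtr_gt0 ltr0n.
have s0 : 0 <= Num.sqrt i%:R :> R by exact: sqrtr_ge0.
rewrite -[X in _ <= X]mul1r ler_pdivlMr // mulrBl -expr2 sqr_sqrtr ?ler0n //.
have : Num.sqrt i%:R <= Num.sqrt i.+1%:R :> R by rewrite ler_wsqrtr // ler_nat.
have := sqr_sqrtr a0; rewrite -[i.+1%:R]/(1 *+ i.+1) mulrS -[1 *+ i]/(i%:R); nra.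
Qed.

Lemma sum_telescope_le (f g : nat -> R) n : (forall i, (i < n)%N -> f i <= g i.+1 - g i) ->
  \sum_(i < n) f i <= g n - g 0%N.
Proof.
elim: n => [|n ih] H; first by rewrite big_ord0 subrr.
rewrite big_ord_recr /=; have := H n (ltnSn n).
by have := ih (fun i h => H i (ltnW h)); qlra.
Qed.
Lemma sum_telescope_ge (f g : nat -> R) n : (forall i, (i < n)%N -> g i.+1 - g i <= f i) ->
  g n - g 0%N <= \sum_(i < n) f i.
Proof.
elim: n => [|n ih] H; first by rewrite big_ord0 subrr.
rewrite big_ord_recr /=; have := H n (ltnSn n).
by have := ih (fun i h => H i (ltnW h)); qlra.
Qed.

Lemma ln_succ (n : nat) : (0 < n)%N -> n.+1%:R^-1 <= ln (n.+1%:R : R) - ln n%:R <= n%:R^-1.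
Proof.
move=> n0; have h0 : 0 < n%:R :> R by rewrite ltr0n.
have h1 : 0 < n.+1%:R :> R by rewrite ltr0n.
have E : n.+1%:R = n%:R + 1 :> R by rewrite -natr1.
apply/andP; split.
  have : ln (n%:R / n.+1%:R : R) <= - n.+1%:R^-1.
    rewrite (_ : n%:R / n.+1%:R = 1 + - n.+1%:R^-1); last first.
      by rewrite E; field; rewrite -E gt_eqF.
    by apply: le_ln1Dx; rewrite ltrN2 invf_lt1 // ltr1n ltnS.
  by rewrite ln_div ?posrE //; move: (ln _) (ln _) (n.+1%:R^-1) => a b c ?; qlra.
have : ln (n.+1%:R / n%:R : R) <= n%:R^-1.
  rewrite (_ : n.+1%:R / n%:R = 1 + n%:R^-1); last by rewrite E; field; rewrite gt_eqF.
  by apply: le_ln1Dx; apply: lt_le_trans (_ : 0 <= _); rewrite ?ltrN10 // invr_ge0 ler0n.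
by rewrite ln_div ?posrE.
Qed.

(** Stands in for the mean value theorem when powers of logarithms are telescoped. *)
Lemma powD_diff (a b : R) (k : nat) : 0 <= b -> b <= a ->
  (k.+1)%:R * b ^+ k * (a - b) <= a ^+ k.+1 - b ^+ k.+1 <= (k.+1)%:R * a ^+ k * (a - b).
Proof.
move=> b0 ba; have a0 : 0 <= a by qlra.
have d0 : 0 <= a - b by qlra.
elim: k => [|k /andP[h1 h2]]; first by rewrite !expr0 !expr1 !mulr1 !mul1r lexx.
have bk : b ^+ k.+1 <= a ^+ k.+1 by apply: lerXn2r; rewrite ?nnegrE.
have E : a ^+ k.+2 - b ^+ k.+2 = a * (a ^+ k.+1 - b ^+ k.+1) + b ^+ k.+1 * (a - b) by rewrite !(exprS _ k.+1); ring.
have E' : a ^+ k.+2 - b ^+ k.+2 = b * (a ^+ k.+1 - b ^+ k.+1) + a ^+ k.+1 * (a - b) by rewrite !(exprS _ k.+1); ring.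
apply/andP; split.
  rewrite E -[k.+2%:R]natr1 mulrDl mul1r [leLHS]mulrDl lerD2r.
  have := ler_wpM2l b0 h1; rewrite (_ : b * _ = k.+1%:R * b ^+ k.+1 * (a - b)); last by rewrite (exprS b k); ring.
  by move/le_trans; apply; apply: ler_wpM2r => //; rewrite subr_ge0.
rewrite E' -[k.+2%:R]natr1 mulrDl mul1r [leRHS]mulrDl lerD2r.
have := ler_wpM2l a0 h2; rewrite (_ : a * (k.+1%:R * _ * _) = k.+1%:R * a ^+ k.+1 * (a - b)); last by rewrite (exprS a k); ring.
by apply: le_trans; apply: ler_wpM2r => //; rewrite subr_ge0.
Qed.

Definition lnp (x : R) := Num.max 0 (ln x).
Lemma lnp_ge0 x : 0 <= lnp x. Proof. by rewrite /lnp le_max lexx. Qed.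
Lemma lnpE x : 1 <= x -> lnp x = ln x.
Proof. by move=> h; rewrite /lnp max_r // ln_ge0. Qed.
Lemma lnp_small x : x <= 1 -> lnp x = 0.
Proof. by move=> h; rewrite /lnp max_l // ln_le0. Qed.
Lemma lnp_le x y : 0 < x -> x <= y -> lnp x <= lnp y.
Proof.
move=> x0 xy; rewrite /lnp ge_max le_max lexx /= le_max ler_ln ?posrE ?xy ?orbT //.
exact: lt_le_trans xy.
Qed.

(* Comparison with the integral of ln^k(Z/t)/t. *)
Lemma sum_lnpX (Z : R) (k n : nat) : (0 < n)%N -> n%:R <= Z -> Z < n.+1%:R ->
  0 <= \sum_(i < n) lnp (Z / i.+1%:R) ^+ k / i.+1%:R - ln Z ^+ k.+1 / k.+1%:R <= ln Z ^+ k.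
Proof.
case: n => // n _ nZ Zn; have n1 : 1 <= n.+1%:R :> R by rewrite ler1n.
have Z0 : 0 < Z by qlra.
(* [g] samples a primitive of ln^k(Z/t)/t at t = i + 1. It vanishes at the end of the range, because
   Z lies below the next integer and [lnp] is 0 there. *)
pose A (i : nat) := lnp (Z / i.+1%:R); pose g i := - (A i ^+ k.+1 / k.+1%:R).
have k0 : 0 < k.+1%:R :> R by rewrite ltr0n.
have pos i : 0 < i.+1%:R :> R by rewrite ltr0n.
have A0 : A 0%N = ln Z by rewrite /A divr1 lnpE //; qlra.
have An : A n.+1 = 0 by rewrite /A lnp_small // ler_pdivrMr // mul1r ltW.
have AE i : (i <= n)%N -> A i = ln Z - ln i.+1%:R.
  move=> le; rewrite /A lnpE ?ln_div ?posrE //.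
  by rewrite ler_pdivlMr // mul1r (le_trans _ nZ) // ler_nat.
have Aup i : (i <= n)%N -> A i - A i.+1 <= i.+1%:R^-1.
  move=> le; have /andP[_ L2] := ln_succ (ltn0Sn i).
  move: le; rewrite leq_eqVlt => /orP[/eqP ->|lt]; last first.
    rewrite !AE ?(ltnW lt) //; move: L2.
    by move: (ln i.+2%:R : R) (ln i.+1%:R : R) ((i.+1%:R : R)^-1) => a b c; qlra.
  rewrite An AE // subr0; have /andP[_ L3] := ln_succ (ltn0Sn n).
  by apply: le_trans L3; rewrite lerD2r ler_ln ?posrE ?ltW.
have Adn i : (i < n)%N -> i.+2%:R^-1 <= A i - A i.+1.
  move=> lt; have /andP[L1 _] := ln_succ (ltn0Sn i); rewrite !AE ?(ltnW lt) //; move: L1.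
  by move: (ln i.+2%:R : R) (ln i.+1%:R : R) ((i.+2%:R : R)^-1) => a b c; qlra.
have Ad i : A i.+1 <= A i by apply: lnp_le; rewrite ?divr_gt0 // ler_pM2l // lef_pV2 ?posrE // ler_nat.
have Ap i : 0 <= A i by exact: lnp_ge0.
have P i := powD_diff k (Ap i.+1) (Ad i).
have gE i : g i.+1 - g i = (A i ^+ k.+1 - A i.+1 ^+ k.+1) / k.+1%:R by rewrite /g; ring.
have E0 : g 0%N = - (ln Z ^+ k.+1 / k.+1%:R) by rewrite /g A0.
have En : g n.+1 = 0 by rewrite /g An expr0n /= mul0r oppr0.
apply/andP; split.
  have := @sum_telescope_ge (fun i => A i ^+ k / i.+1%:R) g n.+1.
  rewrite En E0 sub0r opprK subr_ge0; apply => i le.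
  have /andP[_ h] := P i; rewrite gE ler_pdivrMr //; apply: le_trans h _.
  rewrite [leRHS]mulrC mulrA; apply: ler_wpM2l; last exact: Aup.
  by rewrite mulr_ge0 ?exprn_ge0 // ltW.
rewrite big_ord_recl /= -[lnp _]/(A 0%N) A0 divr1.
have := @sum_telescope_le (fun i => A i.+1 ^+ k / i.+2%:R) g n.
rewrite E0 => H; have gn : g n <= 0 by rewrite /g oppr_le0 divr_ge0 ?exprn_ge0 // ltW.
suff : \sum_(i < n) A i.+1 ^+ k / i.+2%:R <= g n - - (ln Z ^+ k.+1 / k.+1%:R).
  move=> h; rewrite (eq_bigr (fun i : 'I_n => A i.+1 ^+ k / i.+2%:R)) // lerBlDr lerD2l.
  by apply: le_trans h _; rewrite opprK gerDr.
apply: H => i lt; have /andP[h _] := P i; rewrite gE ler_pdivlMr //; apply: le_trans h.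
rewrite mulrC mulrA; apply: ler_wpM2l; last exact: Adn.
by rewrite mulr_ge0 ?exprn_ge0 // ltW.
Qed.

Lemma sum_inv32 n : \sum_(i < n) (i.+1%:R : R)^-1 / Num.sqrt i.+1%:R <= 3.
Proof.
(* The value 0 at i = 0 lets the first step absorb the term 1; from then on -2 / sqrt i is the usual
   primitive. *)
pose g (i : nat) : R := if i is 0%N then 0 else 3 - 2 / Num.sqrt i%:R.
apply: (@le_trans _ _ (g n - g 0%N)); last first.
  by rewrite subr0 /g; case: n => // n; rewrite lerBlDr lerDl divr_ge0 ?sqrtr_ge0.
apply: (@sum_telescope_le (fun i => i.+1%:R^-1 / Num.sqrt i.+1%:R) g) => -[|i] _; first by rewrite /g sqrtr1; qlra.
rewrite /g; have i1 : 0 < i.+1%:R :> R by rewrite ltr0n.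
have i2 : 0 < i.+2%:R :> R by rewrite ltr0n.
have E : i.+2%:R = i.+1%:R + 1 :> R by rewrite natr1.
have a0 : 0 < Num.sqrt i.+1%:R :> R by rewrite sqrtr_gt0.
have b0 : 0 < Num.sqrt i.+2%:R :> R by rewrite sqrtr_gt0.
have ab : Num.sqrt i.+1%:R <= Num.sqrt i.+2%:R :> R by rewrite ler_wsqrtr // ler_nat.
have aE := sqr_sqrtr (ltW i1); have bE := sqr_sqrtr (ltW i2).
rewrite -{1}bE; move: (Num.sqrt i.+1%:R : R) (Num.sqrt i.+2%:R : R) a0 b0 ab aE bE => a b a0 b0 ab aE bE.
have e1 : b ^+ 2 - a ^+ 2 = 1 by qlra.
rewrite (_ : _ - _ = 2 * (b - a) / (a * b)); last by field; rewrite !gt_eqF.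
rewrite -invfM ler_pdivlMr ?mulr_gt0 // mulrC ler_pdivrMr ?mulr_gt0 ?exprn_gt0 //.
have h : a * (a + b) <= 2 * b ^+ 2 by nra.
have : 0 <= (b - a) * (2 * b ^+ 2 - a * (a + b)) by apply: mulr_ge0; qlra.
have -> : a * b = a * b * (b ^+ 2 - a ^+ 2) by rewrite e1 mulr1.
by move=> h2; have : 0 <= b * ((b - a) * (2 * b ^+ 2 - a * (a + b))) by [rewrite mulr_ge0 // ltW]; nra.
Qed.

Lemma sum_r4 n : \sum_(i < n) (r4 i.+1%:R ^+ 3)^-1 <= 4 * r4 n%:R.
Proof.
apply: (@le_trans _ _ (4 * r4 n%:R - 4 * r4 0%:R)); last by rewrite lerBlDr lerDl mulr_ge0 ?r4_ge0.
apply: (@sum_telescope_le (fun i => (r4 i.+1%:R ^+ 3)^-1) (fun i => 4 * r4 i%:R)) => i _.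
have b0 : 0 < r4 i.+1%:R by rewrite r4_gt0 // ltr0n.
have a0 := r4_ge0 i%:R; have ab : r4 i%:R <= r4 i.+1%:R by rewrite r4_le // ler_nat.
have E : r4 i.+1%:R ^+ 4 - r4 i%:R ^+ 4 = 1 by rewrite !r4K ?ler0n // -natr1; ring.
move: (r4 i%:R) (r4 i.+1%:R) a0 b0 ab E => a b a0 b0 ab E.
rewrite -[_^-1]mul1r ler_pdivrMr ?exprn_gt0 // -mulrBr -mulrA.
have E2 : (b - a) * (b ^+ 3 + b ^+ 2 * a + b * a ^+ 2 + a ^+ 3) = 1 by rewrite -E; ring.
rewrite -[X in X <= _]E2 [leRHS]mulrCA; apply: ler_wpM2l; first qlra.
have h1 : a * b ^+ 2 <= b * b ^+ 2 by rewrite ler_wpM2r // sqr_ge0.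
have h2 : a ^+ 2 <= b ^+ 2 by apply: lerXn2r; rewrite ?nnegrE //; qlra.
have h3 : b * a ^+ 2 <= b * b ^+ 2 by rewrite ler_wpM2l //; qlra.
have h4 : a * a ^+ 2 <= b * b ^+ 2 by apply: ler_pM => //; rewrite sqr_ge0.
by rewrite !exprS !expr0 in h1 h2 h3 h4 *; qlra.
Qed.

(** * The field and its integers *)
Local Notation OO := (@ringOfIntegers K).
Definition re (x : K) : R := complex.Re (iota x).
Definition im (x : K) : R := complex.Im (iota x).
Definition sq (x : K) : R := sqnorm (iota x).

Lemma iotaE x : iota x = (re x +i* im x)%C.
Proof. by rewrite /re /im; case: (iota x). Qed.

Lemma sqE x : sq x = re x ^+ 2 + im x ^+ 2.
Proof.
rewrite /sq /sqnorm iotaE /= sqr_sqrtr //.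
by rewrite addr_ge0 // sqr_ge0.
Qed.

Lemma reD x y : re (x + y) = re x + re y.
Proof. by rewrite /re rmorphD; case: (iota x); case: (iota y). Qed.
Lemma imD x y : im (x + y) = im x + im y.
Proof. by rewrite /im rmorphD; case: (iota x); case: (iota y). Qed.
Lemma reN x : re (- x) = - re x.
Proof. by rewrite /re rmorphN; case: (iota x). Qed.
Lemma imN x : im (- x) = - im x.
Proof. by rewrite /im rmorphN; case: (iota x). Qed.
Lemma reM x y : re (x * y) = re x * re y - im x * im y.
Proof. by rewrite /re /im rmorphM; case: (iota x) => a b; case: (iota y) => c d. Qed.
Lemma imM x y : im (x * y) = re x * im y + im x * re y.
Proof. by rewrite /re /im rmorphM; case: (iota x) => a b; case: (iota y) => c d. Qed.
Definition rk : {rmorphism rat -> K} := GRing.in_alg K.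
Lemma iota_rk r : iota (rk r) = (ratr r)%:C%C.
Proof. by rewrite (fmorph_rat (real_complex R)) -(fmorph_eq_rat (iota \o rk : {rmorphism rat -> R[i]})). Qed.
Lemma re_rat r : re (rk r) = ratr r. Proof. by rewrite /re iota_rk. Qed.
Lemma im_rat r : im (rk r) = 0. Proof. by rewrite /im iota_rk. Qed.
Lemma re_int (m : int) : re m%:~R = m%:~R.
Proof. by rewrite -(rmorph_int rk) re_rat ratr_int. Qed.
Lemma im_int (m : int) : im m%:~R = 0.
Proof. by rewrite -(rmorph_int rk) im_rat. Qed.
Lemma re0 : re 0 = 0. Proof. by rewrite -[0]/(0%:~R : K) re_int. Qed.
Lemma im0 : im 0 = 0. Proof. by rewrite -[0]/(0%:~R : K) im_int. Qed.
Lemma re1 : re 1 = 1. Proof. by rewrite -[1]/(1%:~R : K) re_int. Qed.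
Lemma im1 : im 1 = 0. Proof. by rewrite -[1]/(1%:~R : K) im_int. Qed.

Lemma K_eq x y : re x = re y -> im x = im y -> x = y.
Proof. by move=> h1 h2; apply: (fmorph_inj iota); rewrite !iotaE h1 h2. Qed.

Lemma sqM x y : sq (x * y) = sq x * sq y.
Proof. by rewrite !sqE reM imM; ring. Qed.
Lemma sq1 : sq 1 = 1.
Proof. by rewrite sqE re1 im1; ring. Qed.
Lemma sq_ge0 x : 0 <= sq x.
Proof. by rewrite sqE addr_ge0 // sqr_ge0. Qed.
Lemma sq_eq0 x : (sq x == 0) = (x == 0).
Proof.
rewrite sqE paddr_eq0 ?sqr_ge0 // !sqrf_eq0.
apply/andP/eqP => [[/eqP h1 /eqP h2]|->]; last by rewrite re0 im0 eqxx.
by apply: K_eq; rewrite ?re0 ?im0.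
Qed.
Lemma sq_gt0 x : (0 < sq x) = (x != 0).
Proof. by rewrite lt_def sq_eq0 sq_ge0 andbT. Qed.
Lemma sqV x : sq x^-1 = (sq x)^-1.
Proof.
have [->|x0] := eqVneq x 0.
  by rewrite invr0 (eqP (_ : sq 0 == 0)) ?sq_eq0 // invr0.
apply: (@mulfI _ (sq x)); first by rewrite sq_eq0.
by rewrite -sqM !mulfV ?sq_eq0 // sq1.
Qed.
Lemma sq_int (m : int) : sq m%:~R = m%:~R ^+ 2.
Proof. by rewrite sqE re_int im_int; ring. Qed.

Lemma K_decomp : exists2 th, im th != 0 & forall x, exists a b : rat, x = rk a + rk b * th.
Proof.
case: hK => dK [th thP]; exists th => // x.
have fr : free [:: th; 1].
  rewrite free_cons span_seq1 seq1_free oner_neq0 andbT.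
  by apply/negP => /vlineP[k kE]; case/negP: thP; apply/eqP; rewrite -/(im th) kE -[k%:A]/(rk k) im_rat.

have : x \in <<[:: th; 1%R]>>%VS.
  have -> : <<[:: th; 1%R]>>%VS = fullv.
    by apply/eqP; rewrite eqEdim subvf dK /= (eqP fr).
  exact: memvf.
rewrite span_cons span_seq1 => /memv_addP[_ /vlineP[b ->] [_ /vlineP[a ->] ->]].
exists a, b; rewrite addrC; congr (_ + _).
by rewrite /rk /= mulr_algl.
Qed.

(** K is stable under complex conjugation: if th^2 = a + b th with a, b rational, imaginary parts
    give b = 2 Re th, so b - th is the conjugate of th. *)
Lemma conj_ex x : exists y, re y = re x /\ im y = - im x.
Proof.
have [th th0 D] := K_decomp.
have [p [q ->]] := D x; have [a [b]] := D (th * th).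
move=> /(congr1 im); rewrite imM imD im_rat imM im_rat re_rat => E.
have E2 : ratr b = 2 * re th.
  by apply: (mulIf th0); qlra.
exists (rk p + rk q * (rk b - th)).
by rewrite !(re_rat, im_rat, reD, imD, reM, imM, reN, imN) E2; split; ring.
Qed.

Definition cj x : K := xget 0 [set y | re y = re x /\ im y = - im x].
Lemma cjP x : re (cj x) = re x /\ im (cj x) = - im x.
Proof. have h := conj_ex x; exact: (xgetPex 0 h). Qed.
Lemma re_cj x : re (cj x) = re x. Proof. by case: (cjP x). Qed.
Lemma im_cj x : im (cj x) = - im x. Proof. by case: (cjP x). Qed.
Lemma cjK : involutive cj.
Proof. by move=> x; apply: K_eq; rewrite ?(re_cj, im_cj) ?opprK. Qed.
Lemma cjM x y : cj (x * y) = cj x * cj y.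
Proof. by apply: K_eq; rewrite !(reM, imM, re_cj, im_cj); ring. Qed.
Lemma cj_int (m : int) : cj m%:~R = m%:~R.
Proof. by apply: K_eq; rewrite !(re_cj, im_cj) ?re_int ?im_int ?oppr0. Qed.

Lemma real_rat x : im x = 0 -> exists r : rat, x = rk r.
Proof.
have [th th0 D] := K_decomp; have [a [b ->]] := D x.
rewrite imD im_rat imM im_rat re_rat mul0r addr0 add0r => /eqP.
rewrite mulf_eq0 (negPf th0) orbF fmorph_eq0 => /eqP b0; exists a.
by rewrite b0 rmorph0 mul0r addr0.
Qed.

Lemma OD x y : OO x -> OO y -> OO (x + y). Proof. exact: integral_add. Qed.
Lemma OM x y : OO x -> OO y -> OO (x * y). Proof. exact: integral_mul. Qed.
Lemma ON x : OO x -> OO (- x). Proof. exact: integral_opp. Qed.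
Lemma OB x y : OO x -> OO y -> OO (x - y). Proof. exact: integral_sub. Qed.
Lemma O_int (m : int) : OO m%:~R. Proof. exact: integral_id. Qed.
Lemma O_nat (m : nat) : OO m%:R. Proof. exact: integral_nat. Qed.
Lemma O0 : OO 0. Proof. exact: mxpoly.integral0. Qed.
Lemma O1 : OO 1. Proof. exact: integral1. Qed.
Lemma OX x n : OO x -> OO (x ^+ n).
Proof. by move=> h; elim: n => [|n ih]; [rewrite expr0; exact: O1|rewrite exprS; exact: OM]. Qed.

(** Transferred from [algC], where a rational algebraic integer is known to be an integer. *)
Lemma O_rat (r : rat) : OO (rk r) -> exists m : int, rk r = m%:~R :> K.
Proof.
case=> p pm pr.
have pr' : root (map_poly intr p) r.
  have E : map_poly (intr : int -> K) p = map_poly rk (map_poly intr p).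
    by rewrite -(map_poly_comp rk intr); apply: eq_map_poly => z; rewrite -[LHS](rmorph_int rk).
  by move: pr; rewrite E fmorph_root.
have : ratr r \in @Num.int algC.
  apply: (Cint_rat_Aint (z := ratr r : algC)); first by rewrite Crat_rat.
  apply: (root_monic_Aint (p := map_poly (intr : int -> algC) p)).
  - have -> : map_poly (intr : int -> algC) p = map_poly (@ratr algC) (map_poly intr p).
      by rewrite -(map_poly_comp (@ratr algC : {rmorphism rat -> algC}) intr); apply: eq_map_poly => z /=; rewrite ratr_int.
    by rewrite fmorph_root.
  - exact: monic_map.
  - by apply/polyOverP => i; rewrite coef_map /=; apply: rpred_int.
move=> /intrP[m mE]; exists m.
have -> : r = m%:~R.
  by apply: (fmorph_inj (@ratr algC : {rmorphism rat -> algC})); rewrite /= ratr_int.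
by rewrite rmorph_int.
Qed.

Lemma O_cj x : OO x -> OO (cj x).
Proof.
case=> p pm pr; exists p => //.
have E (z : K) : iota (map_poly intr p).[z] = (map_poly intr p).[iota z].
  rewrite -horner_map /= -map_poly_comp; congr (_.[_]).
  by apply: eq_map_poly => m /=; rewrite rmorph_int.
apply/eqP/(fmorph_inj iota); rewrite E rmorph0.
have -> : iota (cj x) = conjc (iota x) by rewrite !iotaE re_cj im_cj.
have -> : map_poly intr p = map_poly (@conjc R) (map_poly intr p).
  by rewrite -map_poly_comp; apply: eq_map_poly => m /=; rewrite rmorph_int.
by rewrite horner_map /= -E (eqP pr) rmorph0 conjc0.
Qed.

Lemma O_real x : OO x -> im x = 0 -> exists m : int, x = m%:~R.
Proof. by move=> ox /real_rat[r E]; move: ox; rewrite E => /O_rat. Qed.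

Lemma O_tr x : OO x -> exists m : int, x + cj x = m%:~R.
Proof. by move=> ox; apply: O_real; [exact/OD/O_cj|rewrite imD im_cj subrr]. Qed.
Lemma O_nm x : OO x -> exists n : nat, x * cj x = n%:R /\ sq x = n%:R.
Proof.
move=> ox; have [||m mE] := @O_real (x * cj x); first by apply: OM => //; exact: O_cj.
  by rewrite imM re_cj im_cj; ring.
have E : sq x = m%:~R by rewrite -re_int -mE reM re_cj im_cj sqE; ring.
have m0 : 0 <= m by rewrite -(ler0z R) -E sq_ge0.
by case: m m0 mE E => // n _ mE E; exists n.
Qed.
Lemma O_trnm x (m n : int) : x + cj x = m%:~R -> x * cj x = n%:~R -> OO x.
Proof.
move=> tE nE; exists ('X^2 - m%:P * 'X + n%:P).
  have s1 : leq (size (- (m%:P * 'X) + n%:P : {poly int})) 2.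
    rewrite (leq_trans (size_polyD _ _)) // geq_max size_polyN.
    by rewrite (leq_trans (size_polyC_leq1 _)) // mul_polyC (leq_trans (size_scale_leq _ _)) // size_polyX.
  by rewrite -addrA monicE lead_coefDl ?lead_coefXn // size_polyXn.
apply/rootP; rewrite rmorphD rmorphB (rmorphXn _ 2) rmorphM /= map_polyX !map_polyC /= !hornerE.
by rewrite -tE -nE; ring.
Qed.

(** The product of the denominators of trace and norm makes both integral after scaling. *)
Lemma O_scale x : exists2 N : nat, (0 < N)%N & OO (N%:R * x).
Proof.
have [|r rE] := @real_rat (x + cj x); first by rewrite imD im_cj subrr.
have [|s sE] := @real_rat (x * cj x); first by rewrite imM re_cj im_cj; ring.
have rZ : rk r * (denq r)%:~R = (numq r)%:~R :> K.
  by rewrite -[RHS](rmorph_int rk) numqE rmorphM rmorph_int.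
have sZ : rk s * (denq s)%:~R = (numq s)%:~R :> K.
  by rewrite -[RHS](rmorph_int rk) numqE rmorphM rmorph_int.
pose d := denq r * denq s.
have dE : (`|d|%N)%:R = (denq r)%:~R * (denq s)%:~R :> K.
  by rewrite -intrM -/d -[in RHS](gez0_abs (_ : 0 <= d)) ?mulr_ge0.
exists `|d|%N; first by rewrite absz_gt0 mulf_neq0.
apply: (@O_trnm _ (numq r * denq s) (numq s * denq s * denq r ^+ 2)); rewrite dE.
  rewrite cjM cjM !cj_int -mulrDr rE intrM -rZ; ring.
rewrite cjM cjM !cj_int expr2 !intrM -sZ -sE; ring.
Qed.

(** For an integer x the number (2 Im x)^2 = 4 N(x) - Tr(x)^2 is natural, so a smallest positive
    imaginary part exists. Division with remainder by it on imaginary parts leaves a real integer,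
    that is, a rational one. *)
Lemma w_exists : exists w, [/\ OO w, 0 < im w & forall x, OO x -> exists i j : int, x = i%:~R + j%:~R * w].
Proof.
pose P (n : nat) := exists x, [/\ OO x, 0 < im x & (2 * im x) ^+ 2 = n%:R].
have natP x : OO x -> exists n : nat, (2 * im x) ^+ 2 = n%:R.
  move=> ox; have [m mE] := O_tr ox; have [n [_ nE]] := O_nm ox.
  have m2 : m%:~R = 2 * re x by rewrite -re_int -mE reD re_cj; ring.
  have E : (2 * im x) ^+ 2 = (4 * n%:Z - m ^+ 2)%:~R.
    rewrite intrB intrM rmorphXn /= m2 -[n%:Z%:~R]/(n%:R) -nE sqE; ring.
  have : 0 <= 4 * n%:Z - m ^+ 2 by rewrite -(ler0z R) -E sqr_ge0.
  by case: (4 * n%:Z - m ^+ 2) E => // k E _; exists k.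
have ex : exists n, `[< P n >].
  have [th th0 _] := K_decomp; have [N N0 oN] := O_scale th.
  have N0' : im (N%:R * th) != 0.
    by rewrite imM -[N%:R]/(N%:Z%:~R) re_int im_int mul0r addr0 mulf_neq0 // intr_eq0; case: (N) N0.
  have [n nE] := natP _ oN; exists n; apply/asboolP.
  have [h|h|h] := ltrgtP (im (N%:R * th)) 0; last by rewrite h eqxx in N0'.
  - by exists (- (N%:R * th)); rewrite imN mulrN sqrrN oppr_gt0; split => //; exact: ON.
  - by exists (N%:R * th).
case: (ex_minnP ex) => n /asboolP[w [ow w0 wn]] nmin; exists w; split => // x ox.
pose j := Num.floor (im x / im w); pose y := x - j%:~R * w.
have oy : OO y by apply: OB => //; apply: OM => //; exact: O_int.
have imy : im y = im x - j%:~R * im w by rewrite imD imN imM re_int im_int; ring.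
have fl := floor_itv (im x / im w); move/andP: fl => [f1 f2].
have y0 : 0 <= im y.
  by rewrite imy subr_ge0 -ler_pdivlMr.
have y1 : im y < im w.
  by rewrite imy ltrBlDr -{1}[im w]mul1r -mulrDl -ltr_pdivrMr // addrC -(intrD _ j 1).
have [|i iE] := O_real oy; last by exists i, j; rewrite -iE subrK.
apply/eqP/negPn/negP => yn0.
have yp : 0 < im y by rewrite lt_def yn0.
have [k kE] := natP _ oy.
have : (n <= k)%N by apply: nmin; apply/asboolP; exists y.
rewrite leqNgt -(ltr_nat R) -kE -wn => /negP; apply.
by rewrite ltr_pXn2r ?nnegrE ?mulr_ge0 ?ltr_pM2l // ltW.
Qed.

Definition qw : K := xget 0 [set w | [/\ OO w, 0 < im w & forall x, OO x -> exists i j : int, x = i%:~R + j%:~R * w]].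
Lemma qwP : [/\ OO qw, 0 < im qw & forall x, OO x -> exists i j : int, x = i%:~R + j%:~R * qw].
Proof. have h := w_exists; exact: (xgetPex 0 h). Qed.
Lemma O_qw : OO qw. Proof. by case: qwP. Qed.
Lemma im_qw : 0 < im qw. Proof. by case: qwP. Qed.
Lemma O_qwE x : OO x -> exists i j : int, x = i%:~R + j%:~R * qw.
Proof. by case: qwP => _ _; apply. Qed.

(** * Valuations *)
Local Notation PI := (@nonzero_prime_ideal K).

(** An explicit list of N^2 representatives modulo N, on which the pigeonhole and finiteness
    arguments below rest. *)
Lemma O_mod (N : nat) x : (0 < N)%N -> OO x ->
  exists r : 'I_N * 'I_N, exists2 y, OO y & x = r.1%:R + r.2%:R * qw + N%:R * y.
Proof.
move=> N0 ox; have [i [j ->]] := O_qwE ox.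
have H (k : int) : exists r : 'I_N, k = r%:Z + N%:Z * (k %/ N)%Z.
  have kl : (`|(k %% N)%Z| < N)%N.
    by rewrite -ltz_nat gez0_abs ?modz_ge0 ?ltz_pmod // -lt0n.
  exists (Ordinal kl); rewrite /= gez0_abs ?modz_ge0 -?lt0n //.
  by rewrite {1}(divz_eq k N) addrC mulrC.
have [a aE] := H i; have [b bE] := H j; exists (a, b).
exists ((i %/ N)%Z%:~R + (j %/ N)%Z%:~R * qw).
  by apply: OD; [exact: O_int|apply: OM; [exact: O_int|exact: O_qw]].
by rewrite {1}aE {1}bE !intrD !intrM /=; ring.
Qed.

(** Applied to powers of one element: once to show that primes are maximal, once to show that
    valuations are finite. *)
Lemma pigeonhole (J : set K) (N : nat) (f : nat -> K) : OK_submodule J -> (0 < N)%N ->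
  J N%:R -> (forall k, OO (f k)) -> exists i j, (i < j)%N /\ J (f j - f i).
Proof.
move=> [J0 JD JM] N0 JN fO.
have [g gP] := choice (fun k => O_mod N0 (fO k)).
have : ~~ injectiveb (fun k : 'I_(N * N).+1 => g k).
  apply/negP => /injectiveP/leq_card; rewrite card_prod !card_ord; lia.
case/injectivePn => i [j ij E].
have H a b : g a = g b -> J (f b - f a).
  move=> gab; have [y yo yE] := gP a; have [z zo zE] := gP b.
  rewrite yE zE gab (_ : _ - _ = (z - y) * N%:R); last by ring.
  by apply: JM => //; exact: OB.
have [h|h|h] := ltngtP i j; last by rewrite (val_inj h) eqxx in ij.
  by exists i, j; split => //; exact: H.
by exists j, i; split => //; apply: H.
Qed.

(** * Localization at one prime and its valuation *)

Section PrimeIdeal.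
Variables (P : set K) (hP : PI P).

Lemma PI_sub x : P x -> OO x. Proof. by case: hP => -[_ h] _ _ _; apply: h. Qed.
Lemma PI_subm : OK_submodule P. Proof. by case: hP => -[]. Qed.
Lemma PI0 : P 0. Proof. by case: PI_subm. Qed.
Lemma PI_D x y : P x -> P y -> P (x + y). Proof. by case: PI_subm => _ h _; apply: h. Qed.
Lemma PI_M x y : OO x -> P y -> P (x * y). Proof. by case: PI_subm => _ _ h; apply: h. Qed.
Lemma PI1 : ~ P 1. Proof. by case: hP. Qed.
Lemma PI_prime x y : OO x -> OO y -> ~ P x -> ~ P y -> ~ P (x * y).
Proof. by move=> ox oy px py; case: hP => _ _ _ h /h -[]. Qed.
Lemma PI_primeX x n : OO x -> ~ P x -> ~ P (x ^+ n).
Proof.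
move=> ox px; elim: n => [|n ih]; first by rewrite expr0; exact: PI1.
by rewrite exprS; apply: PI_prime => //; exact: OX.
Qed.

Lemma PI_nat : exists2 N : nat, (0 < N)%N & P N%:R.
Proof.
case: hP => _ [x px x0] _ _; have [n [nE sE]] := O_nm (PI_sub px).
exists n; first by rewrite -(ltr_nat R) -sE sq_gt0.
by rewrite -nE mulrC; apply: PI_M => //; apply: O_cj; exact: PI_sub.
Qed.

(** By pigeonhole x^i (x^(j - i) - 1) lies in P for some i < j; primality removes x^i, so x^(j - i -
    1) inverts x modulo P. *)
Lemma PI_maximal x : OO x -> ~ P x -> exists2 y, OO y & P (x * y - 1).
Proof.
move=> ox px; have [N N0 PN] := PI_nat.
have [i [j [ij Pij]]] := pigeonhole PI_subm N0 PN (fun k => OX k ox).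
exists (x ^+ (j - i).-1); first exact: OX.
rewrite -exprS prednK ?subn_gt0 //; apply: contrapT => H.
apply: (PI_prime (OX i ox) _ (PI_primeX ox px) H); first exact/OB/O1/OX.
by rewrite mulrBr -exprD subnKC ?mulr1 // ltnW.
Qed.

(** The product of P with its complex conjugate, as an ideal. *)
Definition cjprod : set K := [set z | exists2 s : seq (K * K),
  (forall ab, ab \in s -> P ab.1 /\ P ab.2) & z = \sum_(ab <- s) ab.1 * cj ab.2].

Lemma cjprod1 x y : P x -> P y -> cjprod (x * cj y).
Proof.
move=> px py; exists [:: (x, y)]; last by rewrite big_seq1.
by move=> ab; rewrite inE => /eqP ->.
Qed.
Lemma cjprodD x y : cjprod x -> cjprod y -> cjprod (x + y).
Proof.
move=> [s sP ->] [t tP ->]; exists (s ++ t); last by rewrite big_cat.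
by move=> ab; rewrite mem_cat => /orP[/sP|/tP].
Qed.
Lemma cjprodM a x : OO a -> cjprod x -> cjprod (a * x).
Proof.
move=> oa [s sP ->]; exists [seq (a * ab.1, ab.2) | ab <- s].
  by move=> _ /mapP[ab /sP[h1 h2] ->]; split => //; exact: PI_M.
by rewrite big_map mulr_sumr; apply: eq_bigr => ab _; rewrite mulrA.
Qed.

Lemma PI_sum (s : seq (K * K)) (f : K * K -> K) : (forall ab, ab \in s -> P ab.1 /\ OO (f ab)) ->
  P (\sum_(ab <- s) ab.1 * f ab).
Proof.
elim: s => [|ab s ih] H; first by rewrite big_nil; exact: PI0.
rewrite big_cons; apply: PI_D; last by apply: ih => cd cds; apply: H; rewrite inE cds orbT.
by rewrite mulrC; have [h1 h2] := H ab (mem_head _ _); exact: PI_M.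
Qed.

(* Gauss's lemma for P times its conjugate: that product is n O_K. *)
Lemma cjprod_principal : exists n : nat, [/\ (0 < n)%N, cjprod n%:R &
  forall x y, P x -> P y -> OO (x * cj y / n%:R)].
Proof.
have nrm x : P x -> exists n : nat, [/\ sq x = n%:R, x * cj x = n%:R & cjprod n%:R].
  move=> px; have [n [nE sE]] := O_nm (PI_sub px); exists n; split => //.
  by rewrite -nE; exact: cjprod1.
have ex : exists n : nat, (0 < n)%N && `[< cjprod n%:R >].
  case: hP => _ [x px x0] _ _; have [n [sE _ cn]] := nrm _ px; exists n.
  by rewrite -(ltr_nat R) -sE sq_gt0 x0; exact/asboolP.
(* By minimality and division with remainder, every rational integer in the product ideal is a
   multiple of n. *)
case: (ex_minnP ex) => n /andP[n0 /asboolP cn] nmin; exists n.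
have dv (m : int) : cjprod m%:~R -> exists k : int, m = k * n%:Z.
  move=> cm; exists (m %/ n)%Z; rewrite {1}(divz_eq m n).
  suff -> : (m %% n)%Z = 0 by rewrite addr0.
  have r0 : 0 <= (m %% n)%Z by rewrite modz_ge0 // -lt0n.
  have rn : (m %% n)%Z < n%:Z by rewrite ltz_pmod.
  have cr : cjprod (m %% n)%Z%:~R.
    rewrite (_ : _%:~R = m%:~R + (- (m %/ n)%Z%:~R) * n%:R); last first.
      by have := congr1 (fun z : int => z%:~R : K) (divz_eq m n); rewrite intrD intrM => ->; ring.
    by apply: cjprodD => //; apply: cjprodM => //; apply: ON; exact: O_int.
  case: (m %% n)%Z r0 rn cr => // -[|k] // _ kn ck.
  have : (n <= k.+1)%N by apply: nmin; apply/asboolP.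
  by move=> h; exfalso; lia.
split => // x y px py.
have nK : n%:R != 0 :> K.
  by rewrite -sq_eq0 -[n%:R]/(n%:Z%:~R) sq_int sqrf_eq0 intr_eq0 -lt0n.
have [a [_ aE ca]] := nrm _ px; have [b [_ bE cb]] := nrm _ py.
have [a' aE'] := dv a ca; have [b' bE'] := dv b cb.
have cjn : cj (n%:R^-1) = n%:R^-1.
  apply: (mulfI nK); rewrite mulfV // -{1}[n%:R](cj_int n) -cjM mulfV //.
  exact: (cj_int 1).
have ztr : im (x * cj y + y * cj x) = 0.
  by rewrite imD !imM !re_cj !im_cj; ring.
have [t tE] : exists m : int, x * cj y + y * cj x = m%:~R.
  have ox := PI_sub px; have oy := PI_sub py.
  by apply: O_real => //; apply: OD; apply: OM => //; exact: O_cj.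
have [t' tE'] : exists k : int, t = k * n%:Z.
  by apply: dv; rewrite -tE; apply: cjprodD; exact: cjprod1.
have zc : cj (x * cj y / n%:R) = y * cj x / n%:R.
  by rewrite !cjM cjK cjn; ring.
(* Integrality of x cj y / n is read off from trace and norm: the norms of x and y and the sum x cj
   y + y cj x lie in the product ideal, hence are multiples of n. *)
apply: (@O_trnm _ t' (a' * b')); rewrite zc.
  by rewrite -mulrDl tE tE' intrM mulfK.
apply: (mulIf nK); apply: (mulIf nK).
have -> : x * cj y / n%:R * (y * cj x / n%:R) * n%:R * n%:R = (x * cj x) * (y * cj y).
  by move: (n%:R : K) nK => m m0; field.
rewrite aE bE -[a%:R]/(a%:Z%:~R) -[b%:R]/(b%:Z%:~R) aE' bE' !intrM /=; ring.
Qed.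

(** Provides the inverse of a local uniformizer. It is found among the cj y / n with y in P: if all
    of these were integral, writing n in the product ideal and dividing by n would put 1 into P. *)
Lemma tau_exists : exists t, [/\ forall y, P y -> OO (t * y), ~ OO t &
  exists2 z, P z & ~ P (t * z)].
Proof.
have [n [n0 [s sP nE] nP]] := cjprod_principal.
have nK : n%:R != 0 :> K.
  by rewrite -sq_eq0 -[n%:R]/(n%:Z%:~R) sq_int sqrf_eq0 intr_eq0 -lt0n.
have [y py yO] : exists2 y, P y & ~ OO (cj y / n%:R).
  apply: contrapT => H; apply: PI1.
  have -> : 1 = \sum_(ab <- s) ab.1 * (cj ab.2 / n%:R).
    transitivity (n%:R / n%:R : K); first by rewrite mulfV.
    rewrite {1}nE mulr_suml.
    by apply: eq_bigr => ab _; rewrite mulrA.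
  apply: PI_sum => ab abs; have [h1 h2] := sP _ abs; split => //.
  by apply: contrapT => h; apply: H; exists ab.2.
exists (cj y / n%:R); split => //.
  by move=> z pz; rewrite mulrC mulrA; exact: nP.
(* If t P were contained in P, then t, the sum of the (t a) cj b / n with a, b in P, would be
   integral by the choice of n. *)
apply: contrapT => H; apply: yO; set t := cj y / n%:R in H *; clearbody t.
have -> : t = \sum_(ab <- s) (t * ab.1) * cj ab.2 / n%:R.
  apply: (mulIf nK); rewrite -mulr_suml mulrAC -mulrA mulfV // mulr1 {1}nE mulr_sumr.
  by apply: eq_bigr => ab _; rewrite mulrA.
rewrite big_seq; elim/big_ind: _ => [|? ? ? ?|ab abs]; [exact: O0|exact: OD|].
have [h1 h2] := sP _ abs; apply: nP => //.
by apply: contrapT => h; apply: H; exists ab.1.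
Qed.

Definition tau : K := xget 0 [set t | [/\ forall y, P y -> OO (t * y), ~ OO t &
  exists2 z, P z & ~ P (t * z)]].
Lemma tauP : [/\ forall y, P y -> OO (tau * y), ~ OO tau & exists2 z, P z & ~ P (tau * z)].
Proof. have h := tau_exists; exact: (xgetPex 0 h). Qed.
Lemma tau_neq0 : tau != 0.
Proof. by apply/eqP => h; case: tauP => _ + _; rewrite h; apply; exact: O0. Qed.

(** The local ring of [OO] at P. *)
Definition locint : set K := [set x | exists s, [/\ OO s, ~ P s & OO (s * x)]].
Definition locunit x := [/\ x != 0, locint x & locint x^-1].

Lemma locint_O x : OO x -> locint x.
Proof. by move=> ox; exists 1; rewrite mul1r; split; [exact: O1|exact: PI1|]. Qed.
Lemma locintD x y : locint x -> locint y -> locint (x + y).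
Proof.
move=> [s [os ps ox]] [t [ot pt oy]]; exists (s * t); split; [exact: OM|exact: PI_prime|].
rewrite (_ : _ * _ = t * (s * x) + s * (t * y)); last by ring.
by apply: OD; exact: OM.
Qed.
Lemma locintM x y : locint x -> locint y -> locint (x * y).
Proof.
move=> [s [os ps ox]] [t [ot pt oy]]; exists (s * t); split; [exact: OM|exact: PI_prime|].
by rewrite mulrACA; exact: OM.
Qed.
Lemma locintX x n : locint x -> locint (x ^+ n).
Proof.
move=> h; elim: n => [|n ih]; first by rewrite expr0; apply: locint_O; exact: O1.
by rewrite exprS; exact: locintM.
Qed.
Lemma locunitM x y : locunit x -> locunit y -> locunit (x * y).
Proof.
move=> [x0 h1 h2] [y0 h3 h4]; split; first exact: mulf_neq0.
  exact: locintM.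
by rewrite invfM; exact: locintM.
Qed.
Lemma locunitV x : locunit x -> locunit x^-1.
Proof. by move=> [x0 h1 h2]; split; rewrite ?invrK ?invr_eq0. Qed.
Lemma locunit1 : locunit 1.
Proof. by split; rewrite ?invr1 ?oner_neq0 //; apply: locint_O; exact: O1. Qed.
Lemma locunit_notin x : OO x -> ~ P x -> locunit x.
Proof.
move=> ox px; have x0 : x != 0 by apply/eqP => h; apply: px; rewrite h; exact: PI0.
split => //; first exact: locint_O.
by exists x; split => //; rewrite mulfV //; exact: O1.
Qed.

Lemma locint_tauX m : ~ locint (tau ^+ m.+1).
Proof.
move=> [s [os ps ost]]; case: tauP => t1 _ [z pz ptz].
have : P (s * (tau * z) ^+ m.+1).
  by rewrite exprMn mulrA; apply: PI_M => //; rewrite exprS mulrC; apply: PI_M => //; apply/OX/PI_sub.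
by apply: PI_prime => //; [apply: OX; exact: t1|apply: PI_primeX => //; exact: t1].
Qed.
Lemma locint_tauV : locint tau^-1.
Proof.
case: tauP => t1 _ [z pz ptz].
have [z0 _ h] := locunit_notin (t1 _ pz) ptz.
rewrite (_ : tau^-1 = z * (tau * z)^-1); first by apply: locintM => //; apply/locint_O/PI_sub.
have z0' : z != 0 by apply: contraNneq z0 => ->; rewrite mulr0.
by field; rewrite z0' tau_neq0.
Qed.

(** If no x tau^k were a local unit, all of them would be integral. Two of them agree modulo the
    ideal of x, which gives tau^j - tau^i = a with a integral: a monic equation, although tau is not
    integral. *)
Lemma loc_exists_O x : OO x -> x != 0 -> exists k : nat, locunit (x * tau ^+ k).
Proof.
move=> ox x0; apply: contrapT => H.
have tk k : OO (x * tau ^+ k).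
  elim: k => [|k ih]; first by rewrite expr0 mulr1.
  have [p|p] := pselect (P (x * tau ^+ k)).
    by rewrite exprSr mulrA mulrC; case: tauP => h _ _; exact: h.
  by case: H; exists k; exact: locunit_notin.
pose J := [set y | exists2 a, OO a & y = a * x].
have sJ : OK_submodule J.
  split; first by exists 0; [exact: O0|rewrite mul0r].
    by move=> _ _ [a oa ->] [b ob ->]; exists (a + b); [exact: OD|rewrite mulrDl].
  by move=> b _ ob [a oa ->]; exists (b * a); [exact: OM|rewrite mulrA].
have [n [nE sE]] := O_nm ox.
have n0 : (0 < n)%N by rewrite -(ltr_nat R) -sE sq_gt0.
have Jn : J n%:R by exists (cj x); [exact: O_cj|rewrite -nE mulrC].
have [i [j [ij [a oa E]]]] := pigeonhole sJ n0 Jn tk.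
have E' : tau ^+ j - tau ^+ i = a by apply: (mulfI x0); rewrite mulrBr E mulrC.
case: tauP => _ + _; apply.
apply: (@integral_root_monic _ _ _ _ ('X^j - ('X^i + a%:P))).
- rewrite monicE lead_coefDl ?lead_coefXn // size_polyN size_polyXn ltnS.
  rewrite (leq_trans (size_polyD _ _)) // geq_max size_polyXn ij /=.
  by rewrite (leq_trans (size_polyC_leq1 _)) // (leq_trans _ ij).
- by apply/rootP; rewrite !hornerE /= opprD addrA E' subrr.
- apply/integral_poly => k; rewrite coefB coefD !coefXn coefC.
  apply: OB; first exact: O_nat.
  by apply: OD; [exact: O_nat|case: ifP => _; [|exact: O0]].
Qed.

Lemma loc_exists x : x != 0 -> exists k : int, locunit (x * tau ^ k).
Proof.
move=> x0; have [N N0 oN] := O_scale x.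
have NK : N%:R != 0 :> K.
  by rewrite -sq_eq0 -[N%:R]/(N%:Z%:~R) sq_int sqrf_eq0 intr_eq0 -lt0n.
have [k kP] := loc_exists_O oN (mulf_neq0 NK x0).
have [l lP] := loc_exists_O (O_nat N) NK.
exists (k%:Z - l%:Z).
have := locunitM kP (locunitV lP).
rewrite expfzDr ?tau_neq0 // -invr_expz invfM.
congr (locunit _); rewrite -!exprnP; field.
by rewrite NK expf_neq0 // tau_neq0.
Qed.

(** Since [tau] is an inverse uniformizer, the power of it that turns x into a local unit is the
    valuation, with the right sign. *)
Definition vp x : int := xget 0 [set k : int | locunit (x * tau ^ k)].
Lemma vpP x : x != 0 -> locunit (x * tau ^ vp x).
Proof. move=> x0; have h := loc_exists x0; exact: (xgetPex 0 h). Qed.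
Lemma vp_uniq x k : locunit (x * tau ^ k) -> vp x = k.
Proof.
move=> h; have x0 : x != 0 by case: h => /[!mulf_eq0] /norP[].
have H (i j : int) : i < j -> locunit (x * tau ^ i) -> locunit (x * tau ^ j) -> False.
  move=> ij hi hj; have [_ + _] := locunitM hj (locunitV hi).
  have -> : x * tau ^ j / (x * tau ^ i) = tau ^ (j - i).
    rewrite expfzDr ?tau_neq0 // -invr_expz; field.
    by rewrite x0 expfz_neq0 // tau_neq0.
  have : 0 < j - i by rewrite subr_gt0.
  by case: (j - i) => // -[//|m] _; exact: locint_tauX.
have h' := vpP x0; have [l|l|//] := ltrgtP (vp x) k.
  by case: (H _ _ l h' h).
by case: (H _ _ l h h').
Qed.

Lemma vpM x y : x != 0 -> y != 0 -> vp (x * y) = vp x + vp y.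
Proof.
move=> x0 y0; apply: vp_uniq; rewrite expfzDr ?tau_neq0 // mulrACA.
by apply: locunitM; exact: vpP.
Qed.
Lemma vp1 : vp 1 = 0.
Proof. by apply: vp_uniq; rewrite expr0z mulr1; exact: locunit1. Qed.
Lemma vp_unit x : locunit x -> vp x = 0.
Proof. by move=> h; apply: vp_uniq; rewrite expr0z mulr1. Qed.
Lemma vp_tau : vp tau = -1.
Proof. by apply: vp_uniq; rewrite mulfV ?tau_neq0 //; exact: locunit1. Qed.

Lemma vp_ge0 x : x != 0 -> (0 <= vp x) <-> locint x.
Proof.
move=> x0; have [_ h1 h2] := vpP x0; split.
  case: (vp x) h1 h2 => // n h1 h2 _.
  have -> : x = x * tau ^ n%:Z * tau^-1 ^+ n by rewrite -exprnP -mulrA -exprMn mulfV ?tau_neq0 // expr1n mulr1.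
  by apply: locintM => //; exact/locintX/locint_tauV.
move=> lx; case: (vp x) h1 h2 => // n h1 h2; exfalso; apply: (@locint_tauX n).
have -> : tau ^+ n.+1 = x * (x * tau ^ Negz n)^-1; last exact: locintM.
by rewrite NegzE -exprnN; field; rewrite x0 expf_neq0 // tau_neq0.
Qed.

Lemma vp_mem x : OO x -> x != 0 -> P x <-> 0 < vp x.
Proof.
move=> ox x0; split => [px|vx].
  have h : 0 <= vp (tau * x).
    by apply/vp_ge0; [rewrite mulf_neq0 ?tau_neq0|apply: locint_O; case: tauP => + _ _; apply].
  by rewrite vpM ?tau_neq0 // vp_tau in h; lia.
by apply: contrapT => /(locunit_notin ox)/vp_unit h; rewrite h in vx.
Qed.

Lemma vp_tauX (k : int) : vp (tau ^ k) = - k.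
Proof. by apply: vp_uniq; rewrite -expfzDr ?tau_neq0 // addrN expr0z; exact: locunit1. Qed.
Lemma vp_geP k x : x != 0 -> (k <= vp x) <-> locint (x * tau ^ k).
Proof.
move=> x0; have t0 : tau ^ k != 0 by rewrite expfz_neq0 // tau_neq0.
by rewrite -vp_ge0 ?mulf_neq0 // vpM // vp_tauX subr_ge0.
Qed.
Lemma vp_ultra k x y : x != 0 -> y != 0 -> x + y != 0 -> k <= vp x -> k <= vp y -> k <= vp (x + y).
Proof.
move=> x0 y0 xy0 /(vp_geP _ x0) h1 /(vp_geP _ y0) h2; apply/vp_geP => //.
by rewrite mulrDl; exact: locintD.
Qed.
Lemma vpN x : vp (- x) = vp x.
Proof.
have [->|x0] := eqVneq x 0; first by rewrite oppr0.
rewrite -mulN1r vpM ?oppr_eq0 ?oner_neq0 // vp_unit ?add0r //.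
have o : OO (-1) by apply: ON; exact: O1.
apply: locunit_notin => // /(PI_M o); rewrite mulrNN mulr1; exact: PI1.
Qed.
Lemma vpV x : x != 0 -> vp x^-1 = - vp x.
Proof.
move=> x0; have xV : x^-1 != 0 by rewrite invr_eq0.
by have := vpM xV x0; rewrite mulVf // vp1 => /esym/eqP; rewrite addr_eq0 => /eqP.
Qed.
End PrimeIdeal.

(** * Ideals as exponent vectors *)
Definition prm := {P : set K | `[< PI P >]}.
Implicit Types (p : prm) (e f : prm -> int).
Lemma prmP p : PI (sval p). Proof. by case: p => P /= /asboolP. Qed.
(** The value at 0 is a convention; wherever valuations decide membership in an ideal, 0 is treated
    apart. *)
Definition v p x : int := if x == 0 then 0 else vp (sval p) x.
Definition taup p : K := tau (sval p).

Lemma v0 p : v p 0 = 0. Proof. by rewrite /v eqxx. Qed.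
Lemma vE p x : x != 0 -> v p x = vp (sval p) x. Proof. by rewrite /v => /negPf ->. Qed.
Lemma vM p x y : x != 0 -> y != 0 -> v p (x * y) = v p x + v p y.
Proof. by move=> x0 y0; rewrite !vE ?mulf_neq0 //; apply: vpM => //; exact: prmP. Qed.
Lemma v1 p : v p 1 = 0. Proof. by rewrite vE ?oner_neq0 //; apply: vp1; exact: prmP. Qed.
Lemma vN p x : v p (- x) = v p x.
Proof. by rewrite /v oppr_eq0; case: ifP => // _; apply: vpN; exact: prmP. Qed.
Lemma vV p x : x != 0 -> v p x^-1 = - v p x.
Proof. by move=> x0; rewrite !vE ?invr_eq0 //; apply: vpV => //; exact: prmP. Qed.
Lemma vX p x n : x != 0 -> v p (x ^+ n) = v p x *+ n.
Proof.
move=> x0; elim: n => [|n ih]; first by rewrite expr0 v1 mulr0n.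
by rewrite exprS vM ?expf_neq0 // ih mulrS.
Qed.
Lemma v_ultra p k x y : x != 0 -> y != 0 -> x + y != 0 -> k <= v p x -> k <= v p y -> k <= v p (x + y).
Proof. by move=> x0 y0 xy0; rewrite !vE //; apply: vp_ultra => //; exact: prmP. Qed.
Lemma v_mem p x : OO x -> x != 0 -> sval p x <-> 0 < v p x.
Proof. by move=> ox x0; rewrite vE //; apply: vp_mem => //; exact: prmP. Qed.
Lemma v_O p x : OO x -> 0 <= v p x.
Proof.
move=> ox; have [->|x0] := eqVneq x 0; first by rewrite v0.
by rewrite vE //; apply/vp_ge0 => //; [exact: prmP|apply: locint_O => //; exact: prmP].
Qed.
Lemma v_loc p x y : x != 0 -> y != 0 -> v p x <= v p y -> exists s, [/\ OO s, ~ sval p s & OO (s * (y / x))].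
Proof.
move=> x0 y0; rewrite -subr_ge0 -vV // -vM ?invr_eq0 // vE ?mulf_neq0 ?invr_eq0 //.
by move/vp_ge0; apply; [exact: prmP|rewrite mulf_neq0 ?invr_eq0].
Qed.
Lemma taup_neq0 p : taup p != 0. Proof. by apply: tau_neq0; exact: prmP. Qed.
Lemma v_tau p : v p (taup p) = -1.
Proof. by rewrite vE ?taup_neq0 //; apply: vp_tau; exact: prmP. Qed.

Lemma prm_sub p q : sval p `<=` sval q -> p = q.
Proof.
move=> pq; apply/val_inj; apply/seteqP; split => //= x qx.
have hq := prmP q; have hp := prmP p; apply: contrapT => px.
have ox : OO x by apply: PI_sub hq _ qx.
have [y oy h] := PI_maximal hp ox px.
apply: (PI1 hq); rewrite (_ : 1 = y * x + (-1) * (x * y - 1)); last by ring.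
apply: (PI_D hq); first exact: PI_M.
by apply: (PI_M hq); [apply: ON; exact: O1|exact: pq].
Qed.

(** Take z in p but not in q: then tau_p z is integral, while z is a unit at q. *)
Lemma v_tau_other p q : p != q -> 0 <= v q (taup p).
Proof.
move=> pq; have [z pz qz] : exists2 z, sval p z & ~ sval q z.
  apply: contrapT => H; case/eqP: pq; apply: prm_sub => z pz.
  by apply: contrapT => qz; apply: H; exists z.
have hp := prmP p; have hq := prmP q.
have z0 : z != 0 by apply/eqP => h; apply: qz; rewrite h; exact: PI0.
have oz : OO z by apply: PI_sub hp _ pz.
have vz : v q z = 0.
  have := v_O q oz; rewrite le_eqVlt => /orP[/eqP <-//|h].
  by case: qz; apply/v_mem.
have : 0 <= v q (taup p * z) by apply: v_O; case: (tauP hp) => h _ _; exact: h.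
by rewrite vM ?taup_neq0 // vz addr0.
Qed.

Lemma prm_nat p : exists2 N : nat, (0 < N)%N & sval p N%:R.
Proof. exact: (PI_nat (prmP p)). Qed.

Lemma natK_neq0 (n : nat) : (0 < n)%N -> n%:R != 0 :> K.
Proof.
by move=> n0; rewrite -sq_eq0 -[n%:R]/(n%:Z%:~R) sq_int sqrf_eq0 intr_eq0 -lt0n.
Qed.

Lemma PI_mod p (N : nat) x : (0 < N)%N -> sval p N%:R -> OO x -> 
  exists2 r : 'I_N * 'I_N, (OO (r.1%:R + r.2%:R * qw)) & (sval p x <-> sval p (r.1%:R + r.2%:R * qw)).
Proof.
move=> N0 pN ox; have [r [y oy xE]] := O_mod N0 ox; exists r.
  by apply: OD; [exact: O_nat|apply: OM; [exact: O_nat|exact: O_qw]].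
have hp := prmP p; have h : sval p (N%:R * y) by rewrite mulrC; exact: PI_M.
rewrite xE; split => [h2|h2]; last exact: PI_D.
rewrite -[_ + _](addrK (N%:R * y)) -mulN1r; apply: (PI_D hp) => //.
by apply: (PI_M hp) => //; apply: ON; exact: O1.
Qed.

(** A prime containing N is determined by the residues modulo N that it contains. *)
Lemma finite_prm_nat (N : nat) : (0 < N)%N -> finite_set [set p : prm | sval p N%:R].
Proof.
move=> N0; set A := [set p | _].
have [->|/set0P[p0 _]] := eqVneq A set0; first exact: finite_set0.
pose F p := finset (fun r : 'I_N * 'I_N => `[< sval p (r.1%:R + r.2%:R * qw) >]).
pose g X := xget p0 [set p | A p /\ F p = X].
apply: (@sub_finite_set _ _ (g @` setT)); last exact/finite_image/finite_finset.
move=> p Ap; exists (F p) => //.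
have [Aq] : A (g (F p)) /\ F (g (F p)) = F p by exact: (xgetPex p0 (ex_intro (fun p' => A p' /\ F p' = F p) p (conj Ap erefl))).
set q := g (F p) in Aq * => qE.
have H p1 p2 : A p1 -> A p2 -> F p1 = F p2 -> sval p1 `<=` sval p2.
  move=> A1 A2 E x px; have ox : OO x by apply: PI_sub (prmP p1) _ px.
  have [r ro r1] := PI_mod N0 A1 ox.
  have /r1 h := px; have : r \in F p1 by rewrite inE; exact/asboolP.
  rewrite E inE => /asboolP h2.
  have [r' [y oy xE]] := O_mod N0 ox.
  have h3 : sval p1 (r'.1%:R + r'.2%:R * qw).
    rewrite (_ : _ + _ = x + (- y) * N%:R); last by rewrite xE; ring.
    by apply: (PI_D (prmP p1)) => //; apply: (PI_M (prmP p1)) => //; exact: ON.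
  have : r' \in F p1 by rewrite inE; exact/asboolP.
  rewrite E inE => /asboolP h4; rewrite xE; apply: (PI_D (prmP p2)) => //.
  by rewrite mulrC; apply: (PI_M (prmP p2)).
by apply: prm_sub; apply: H.
Qed.

Definition fs e := finite_set [set p | e p != 0].

Lemma fs_v x : fs (v ^~ x).
Proof.
have H y : OO y -> y != 0 -> fs (v ^~ y).
  move=> oy y0; have [n [nE sE]] := O_nm oy.
  have n0 : (0 < n)%N by rewrite -(ltr_nat R) -sE sq_gt0.
  apply: sub_finite_set (finite_prm_nat n0) => p /= vy.
  rewrite -nE mulrC; apply: (PI_M (prmP p)); first exact: O_cj.
  by apply/v_mem => //; rewrite lt_def vy v_O.
have [->|x0] := eqVneq x 0.
  by rewrite /fs; apply: sub_finite_set (finite_set0 _) => p /=; rewrite v0 eqxx.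
have [N N0 oN] := O_scale x; have N0' := natK_neq0 N0.
have h1 := H _ (O_nat N) N0'; have h2 := H _ oN (mulf_neq0 N0' x0).
apply: (@sub_finite_set _ _ ([set p | v p N%:R != 0] `|` [set p | v p (N%:R * x) != 0])).
  move=> p /=; rewrite vM // => vx.
  by have [h|h] := eqVneq (v p N%:R) 0; [right; rewrite h add0r|left].
by rewrite finite_setU.
Qed.

Lemma fsD e f : fs e -> fs f -> fs (e + f).
Proof.
move=> fe ff; apply: (@sub_finite_set _ _ ([set p | e p != 0] `|` [set p | f p != 0])).
  move=> p /=; rewrite !fctE => h.
  by have [h1|h1] := eqVneq (e p) 0; [right; rewrite h1 add0r in h|left].
by rewrite finite_setU.
Qed.
Lemma fsN e : fs e -> fs (- e).
Proof. by apply: sub_finite_set => p /=; rewrite !fctE oppr_eq0. Qed.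
Lemma fs0 : fs 0.
Proof. by rewrite /fs; apply: sub_finite_set (finite_set0 _) => p /eqP; case. Qed.
Lemma fs_sub e f g : fs e -> fs f -> (forall p, e p = 0 -> f p = 0 -> g p = 0) -> fs g.
Proof.
move=> fe ff H; apply: (@sub_finite_set _ _ ([set p | e p != 0] `|` [set p | f p != 0])).
  move=> p /= gp; have [h1|h1] := eqVneq (e p) 0; last by left.
  by right; apply: contraNneq gp => h2; rewrite H.
by rewrite finite_setU.
Qed.

(** The fractional ideal with exponents e at the primes, when e has finite support. *)
Definition ide e : set K := [set x | x = 0 \/ forall p, e p <= v p x].

Lemma ide_submod e : OK_submodule (ide e).
Proof.
split; first by left.
  move=> x y [->|hx] [->|hy]; rewrite ?addr0 ?add0r; try by [left|right].
  have [x0|x0] := eqVneq x 0; first by rewrite x0 add0r; right.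
  have [y0|y0] := eqVneq y 0; first by rewrite y0 addr0; right.
  have [xy|xy] := eqVneq (x + y) 0; first by left.
  by right => p; apply: v_ultra.
move=> a x oa [->|hx]; first by left; rewrite mulr0.
have [->|a0] := eqVneq a 0; first by left; rewrite mul0r.
have [->|x0] := eqVneq x 0; first by left; rewrite mulr0.
by right => p; rewrite vM // -[e p]add0r lerD // v_O.
Qed.

Lemma fracK x y : x != 0 -> exists2 a, OO a & exists2 n : nat, (0 < n)%N & n%:R * y = a * x.
Proof.
move=> x0; have [n n0 on] := O_scale (y / x); exists (n%:R * (y / x)) => //.
by exists n => //; rewrite -mulrA mulfVK.
Qed.

(** Ideals containing N are compared through the finite sets of residues modulo N that they contain.
    A proper ideal with the largest such set is prime: adjoining an element outside it produces
    1. *)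
Lemma proper_prime (A : set K) (N : nat) : integral_ideal A -> (0 < N)%N -> A N%:R -> ~ A 1 ->
  exists p, A `<=` sval p.
Proof.
move=> [sA AO] N0 AN A1.
pose F (B : set K) := finset (fun r : 'I_N * 'I_N => `[< B (r.1%:R + r.2%:R * qw) >]).
pose S (n : nat) := `[< exists B, [/\ integral_ideal B, A `<=` B, ~ B 1 & #|F B| = n] >].
have exS : exists n, S n by exists #|F A|; apply/asboolP; exists A; split => //; split.
have ubS n : S n -> (n <= #|{: 'I_N * 'I_N}|)%N.
  by move=> /asboolP[B [_ _ _ <-]]; exact: max_card.
case: (ex_maxnP exS ubS) => n /asboolP[B [[sB BO] AB B1 FB]] nmax.
have [B0 BD BM] := sB.
suff PB : PI B by exists (exist _ B (asboolT PB)).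
split => //; first by exists N%:R; [exact: AB|exact: natK_neq0].
move=> x y ox oy Bxy; have [Bx|Bx] := pselect (B x); [by left|right].
pose C := [set z | exists2 b, B b & exists2 a, OO a & z = b + a * x].
have sC : OK_submodule C.
  split; first by exists 0 => //; exists 0; [exact: O0|rewrite mul0r addr0].
    move=> _ _ [b Bb [a oa ->]] [c Bc [d od ->]]; exists (b + c); first exact: BD.
    by exists (a + d); [exact: OD|ring].
  move=> t _ ot [b Bb [a oa ->]]; exists (t * b); first exact: BM.
  by exists (t * a); [exact: OM|ring].
have BC : B `<=` C by move=> b Bb; exists b => //; exists 0; [exact: O0|rewrite mul0r addr0].
have CO : C `<=` OO by move=> _ [b Bb [a oa ->]]; apply: OD; [exact: BO|exact: OM].
have [C1|C1] := pselect (C 1).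
  case: C1 => b Bb [a oa E]; rewrite -[y]mul1r E mulrDl -mulrA; apply: BD; last exact: BM.
  by rewrite mulrC; exact: BM.
have Cx : C x by exists 0 => //; exists 1; [exact: O1|rewrite mul1r add0r].
have FE D r : (r \in F D) = `[< D (r.1%:R + r.2%:R * qw) >] by rewrite finset.in_set.
exfalso; have : (#|F C| <= n)%N.
  by apply: nmax; apply/asboolP; exists C; split => //; exact: subset_trans BC.
rewrite leqNgt -FB => /negP; apply; apply/proper_card/properP; split.
  by apply/fintype.subsetP => r; rewrite !FE => /asboolP h; apply/asboolP; exact: (BC _ h).
have [r [z oz xE]] := O_mod N0 ox; exists r; rewrite FE.
  apply/asboolP; rewrite (_ : _ + _ = x + (- z) * N%:R); last by rewrite xE; ring.
  by case: sC => _ CD CM; apply: CD => //; apply: CM; [exact: ON|exact: (BC _ (AB _ AN))].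
apply/asboolP => h; apply: Bx; rewrite xE; apply/BD => //.
by rewrite mulrC; apply: BM => //; exact: AB.
Qed.

(* A module is the intersection of its localisations. *)
Lemma local_global (J : set K) y : OK_submodule J -> (exists2 z, J z & z != 0) ->
  (forall p, exists2 z, J z & z != 0 /\ v p z <= v p y) -> J y.
Proof.
move=> [J0 JD JM] [z Jz z0] H; have [->|y0] := eqVneq y 0; first by [].
pose A := [set a | OO a /\ J (a * y)].
have [a oa [n n0 nE]] := fracK y z0.
have iA : integral_ideal A.
  split; last by move=> b [].
  split; first by split; [exact: O0|rewrite mul0r].
    by move=> b c [ob Jb] [oc Jc]; split; [exact: OD|rewrite mulrDl; exact: JD].
  by move=> b c ob [oc Jc]; split; [exact: OM|rewrite -mulrA; exact: JM].
have An : A n%:R by split; [exact: O_nat|rewrite nE; exact: JM].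
apply: contrapT => Jy.
have [|p Ap] := proper_prime iA n0 An; first by case=> _; rewrite mul1r.
have [u Ju [u0 vu]] := H p; have [s [os ps osu]] := v_loc u0 y0 vu.
apply: ps; apply: Ap; split => //.
by rewrite (_ : s * y = s * (y / u) * u); [exact: JM|rewrite -!mulrA mulVf // mulr1].
Qed.

(** * Norms *)
(** The exponent vector of the prime p itself. *)
Definition dl p : prm -> int := fun q => (q == p)%:R.
Lemma dlE p q : dl p q = (q == p)%:R. Proof. by []. Qed.
Lemma fs_dl p : fs (dl p).
Proof.
apply: (@sub_finite_set _ _ [set p]); last exact: finite_set1.
by move=> q /=; rewrite /dl; case: (q =P p) => // _; rewrite eqxx.
Qed.

Lemma fN e p : (- e) p = - e p. Proof. by []. Qed.
Lemma fD e f p : (e + f) p = e p + f p. Proof. by []. Qed.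
Lemma f0 p : (0 : prm -> int) p = 0. Proof. by []. Qed.

Lemma ide_bound e : fs e -> exists N : nat, [/\ (0 < N)%N & forall p, e p <= v p N%:R].
Proof.
move=> /finite_seqP[s sE].
have H (t : seq prm) : exists N : nat, (0 < N)%N /\ forall p, p \in t -> e p <= v p N%:R.
  elim: t => [|q t [N [N0 NP]]]; first by exists 1%N.
  have [M M0 qM] := prm_nat q.
  exists (M ^ `|e q| * N)%N; split; first by rewrite muln_gt0 expn_gt0 M0.
  move=> p; rewrite natrM natrX vM ?expf_neq0 ?natK_neq0 // vX ?natK_neq0 //.
  have vN0 := v_O p (O_nat N); have vM0 := v_O p (O_nat M).
  have : 0 <= v p M%:R *+ `|e q| by rewrite mulrn_wge0.
  rewrite inE => h /orP[/eqP pq|/NP]; last by lia.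
  subst q.
  have : 0 < v p M%:R by apply/v_mem; [exact: O_nat|exact: natK_neq0|].
  rewrite -(mulr_natr (v p M%:R)) natz => h1; have h2 : e p <= `|e p|%N%:Z by lia.
  have h3 : 0 <= (v p M%:R - 1) * `|e p|%N%:Z by apply: mulr_ge0; lia.
  move: h3 h2 vN0; rewrite mulrBl mul1r; clear; qlra.
have [N [N0 NP]] := H s; exists N; split => // p.
have [->|ep] := eqVneq (e p) 0; first exact/v_O/O_nat.
by apply: NP; have : [set p | e p != 0] p by []; rewrite sE.
Qed.

(** Start from an integer N with large valuations and multiply by tau_p^k with k = v_p(N) - e_p: the
    valuation at p drops to e_p and no other one decreases. *)
Lemma ide_exact e p : fs e -> exists x, [/\ x != 0, ide e x & v p x = e p].
Proof.
move=> fe; have [N [N0 NP]] := ide_bound fe; have N0' := natK_neq0 N0.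
have tp := taup_neq0 p.
have [k kE] : exists k : nat, k%:Z = v p N%:R - e p.
  by exists `|v p N%:R - e p|%N; rewrite gez0_abs // subr_ge0.
have vk q : v q (taup p ^+ k * N%:R) = v q (taup p) *+ k + v q N%:R.
  by rewrite vM ?expf_neq0 // vX.
exists (taup p ^+ k * N%:R); rewrite mulf_neq0 ?expf_neq0 //; split => //.
  right => q; rewrite vk; have [->|qp] := eqVneq q p.
    by rewrite v_tau mulNrn natz; lia.
  by have := NP q; have := mulrn_wge0 k (v_tau_other (p := p) (q := q) _); rewrite eq_sym qp => /(_ isT); lia.
by rewrite vk v_tau mulNrn natz; lia.
Qed.

Lemma ide_neq0 e : fs e -> exists2 x, ide e x & x != 0.
Proof.
move=> fe; have [N [N0 NP]] := ide_bound fe.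
by exists N%:R; [right|exact: natK_neq0].
Qed.

Lemma O_ide0 : OO = ide 0.
Proof.
apply/seteqP; split => x; first by move=> ox; right => p; exact: v_O.
case=> [->|hx]; first exact: O0.
apply: local_global; first by split; [exact: O0|exact: OD|exact: OM].
  by exists 1; [exact: O1|exact: oner_neq0].
by move=> p; exists 1; [exact: O1|rewrite oner_neq0 v1; split => //; exact: hx].
Qed.

Lemma ide_le e f : (forall p, e p <= f p) -> ide f `<=` ide e.
Proof. by move=> ef x [->|hx]; [left|right => p; exact: le_trans (hx p)]. Qed.


Lemma ide_fractional e : fs e -> fractional_ideal (ide e).
Proof.
move=> fe; split; [exact: ide_submod|by have [x h1 h2] := ide_neq0 fe; exists x|].
have [N [N0 NP]] := ide_bound (fsN fe).
exists N%:R; split; [exact: natK_neq0|exact: O_nat|].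
move=> _ [x [->|hx] <-]; first by rewrite mulr0; exact: O0.
have [->|x0] := eqVneq x 0; first by rewrite mulr0; exact: O0.
rewrite O_ide0; right => p; rewrite vM ?natK_neq0 //.
have := NP p; have := hx p; rewrite fN => h1 h2.
by change (0 <= v p N%:R + v p x); lia.
Qed.

Lemma ide_inj e f : fs e -> fs f -> ide e = ide f -> e = f.
Proof.
move=> fe ff E; apply/funext => p; apply/eqP; rewrite eq_le; apply/andP; split.
  have [x [x0 xf <-]] := ide_exact p ff; move: xf; rewrite -E => -[h|h]; last exact: h.
  by rewrite h eqxx in x0.
have [x [x0 xf <-]] := ide_exact p fe; move: xf; rewrite E => -[h|h]; last exact: h.
by rewrite h eqxx in x0.
Qed.

Lemma scale_ide e x : x != 0 -> scale_ideal x (ide e) = ide (e + v ^~ x).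
Proof.
move=> x0; apply/seteqP; split => y.
  case=> z [->|hz] <-; first by left; rewrite mulr0.
  have [->|z0] := eqVneq z 0; first by left; rewrite mulr0.
  by right => p; rewrite vM // fctE addrC lerD2l.
have [->|y0] := eqVneq y 0; first by move=> _; exists 0; [left|rewrite mulr0].
case=> [/eqP|hy]; first by rewrite (negPf y0).
exists (x^-1 * y); last by rewrite mulVKf.
right => p; rewrite vM ?invr_eq0 // vV //; have := hy p; rewrite fctE; lia.
Qed.

Lemma mono_min (T : Type) (A : set T) (g : T -> int) (b : int) : A !=set0 -> (forall x, A x -> b <= g x) ->
  exists2 x, A x & forall y, A y -> g x <= g y.
Proof.
move=> [x0 Ax0] gb.
pose S (n : nat) := `[< exists2 x, A x & g x = b + n%:Z >].
have SE x : A x -> exists2 n : nat, S n & g x = b + n%:Z.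
  move=> Ax; have nE : g x = b + `|g x - b|%N%:Z by rewrite gez0_abs ?subr_ge0 ?gb //; ring.
  by exists `|g x - b|%N => //; apply/asboolP; exists x.
have ex : exists n, S n by have [n Sn _] := SE _ Ax0; exists n.
case: (ex_minnP ex) => n /asboolP[x Ax xE] nmin; exists x => // y Ay.
have [m Sm mE] := SE _ Ay; have := nmin _ Sm; lia.
Qed.

(** The exponent at p is the smallest valuation of an element, attained because a common denominator
    bounds it from below; that these exponents determine the ideal is [local_global]. *)
Lemma frac_ide (J : set K) : fractional_ideal J -> exists2 e, fs e & J = ide e.
Proof.
move=> [sJ [z Jz z0] [d [d0 od dJ]]].
have lb p y : J y -> y != 0 -> - v p d <= v p y.
  move=> Jy y0; have : 0 <= v p (d * y) by apply: v_O; apply: dJ; exists y.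
  by rewrite vM //; lia.
have H p : exists2 x, J x /\ x != 0 & forall y, J y /\ y != 0 -> v p x <= v p y.
  by apply: (mono_min (b := - v p d)); [exists z|move=> x [] /lb; apply].
have /choice[g gP] : forall p, exists x, [/\ J x, x != 0 & forall y, J y -> y != 0 -> v p x <= v p y].
  by move=> p; have [x [Jx x0] hx] := H p; exists x; split => // y Jy y0; apply: hx.
exists (fun p => v p (g p)).
  apply: (fs_sub (fs_v d) (fs_v z)) => p h1 h2; have [j1 j2 j3] := gP p.
  by have := lb p _ j1 j2; have := j3 _ Jz z0; lia.
apply/seteqP; split => x.
  move=> Jx; have [->|x0] := eqVneq x 0; [by left|right => p].
  by have [_ _ h] := gP p; exact: h.
case=> [->|hx]; first by case: sJ.
apply: local_global => //; first by exists z.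
by move=> p; have [j1 j2 j3] := gP p; exists (g p).
Qed.

Definition qn p : nat := absNorm (sval p).

(* [reps I J s]: the list [s] represents I / J. *)
Definition reps (I J : set K) (s : seq K) := [/\ forall c, c \in s -> I c,
  uniq s, forall c d, c \in s -> d \in s -> J (c - d) -> c = d &
  forall x, I x -> exists2 c, c \in s & J (x - c)].

Lemma reps_absNorm J s : OK_submodule J -> reps OO J s -> absNorm J = size s.
Proof.
move=> [J0 JD JM] [sI us su sx].
have JN x : J x -> J (- x) by rewrite -mulN1r; apply: JM; apply: ON; exact: O1.
have cE x y : coset_ideal J x = coset_ideal J y <-> J (x - y).
  split=> [E|h].
    have : coset_ideal J x x by exists 0; rewrite ?addr0.
    by rewrite E => -[z Jz <-]; rewrite addrC addKr.
  apply/seteqP; split => _ [z Jz <-]; [exists (x - y + z)|exists (- (x - y) + z)]; try ring.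
    exact: JD.
  by apply: JD => //; exact: JN.
rewrite /absNorm.
have -> : [set coset_ideal J x | x in OO] = [set` [fset coset_ideal J x | x in s]%fset].
  apply/seteqP; split => [_ [x ox <-]|_ /imfsetP[x /= xs ->]].
    have [c cs Jc] := sx _ ox; apply/imfsetP; exists c => //; exact/cE.
  by exists x => //; exact: sI.
rewrite /ncard set_fsetK card_in_imfset /=; last first.
  by move=> x y /= xs ys /cE; exact: su.
by rewrite undup_id.
Qed.

Lemma reps_exists (I J : set K) (l : seq K) : OK_submodule J -> (forall c, c \in l -> I c) ->
  (forall x, I x -> exists2 c, c \in l & J (x - c)) -> exists s, reps I J s.
Proof.
move=> [J0 JD JM] lI lx.
have JN x : J x -> J (- x) by rewrite -mulN1r; apply: JM; apply: ON; exact: O1.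
have [s [s1 s2 s3 s4]] : exists s, [/\ forall c, c \in s -> I c, uniq s,
   forall c d, c \in s -> d \in s -> J (c - d) -> c = d & forall x, x \in l -> exists2 c, c \in s & J (x - c)].
  elim: l lI {lx} => [|a l ih] lI; first by exists [::].
  have [|s [s1 s2 s3 s4]] := ih; first by move=> c cl; apply: lI; rewrite inE cl orbT.
  have [[c cs Jc]|H] := pselect (exists2 c, c \in s & J (a - c)).
    by exists s; split => // x; rewrite inE => /orP[/eqP ->|/s4 //]; exists c.
  exists (a :: s); split.
  - by move=> c; rewrite inE => /orP[/eqP ->|/s1 //]; apply: lI; rewrite mem_head.
  - rewrite /= s2 andbT; apply/negP => as_; apply: H; exists a => //; by rewrite subrr.
  - move=> c d; rewrite !inE => /orP[/eqP ->|cs] /orP[/eqP ->|ds] // h.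
    + by case: H; exists d.
    + by case: H; exists c => //; rewrite -opprB; exact: JN.
    + exact: s3.
  - move=> x; rewrite inE => /orP[/eqP ->|/s4[c cs Jc]].
      by exists a; rewrite ?mem_head // subrr.
    by exists c => //; rewrite inE cs orbT.
exists s; split => // x Ix; have [c cl Jc] := lx _ Ix; have [d ds Jd] := s4 _ cl.
by exists d => //; rewrite (_ : x - d = (x - c) + (c - d)); [exact: JD|ring].
Qed.

Lemma reps_comp (I J L : set K) s t : OK_submodule I -> OK_submodule J -> OK_submodule L -> J `<=` I -> L `<=` J ->
  reps I J s -> reps J L t -> exists2 u, reps I L u & size u = (size s * size t)%N.
Proof.
move=> [I0 ID IM] [J0 JD JM] [L0 _ _] JI LJ [s1 s2 s3 s4] [t1 t2 t3 t4].
have JN x : J x -> J (- x) by rewrite -mulN1r; apply: JM; apply: ON; exact: O1.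
have key c d c' d' : c \in s -> c' \in s -> d \in t -> d' \in t -> L (c + d - (c' + d')) -> c = c' /\ d = d'.
  move=> cs cs' dt dt' h; have E : c = c'.
    apply: s3 => //; rewrite (_ : c - c' = (c + d - (c' + d')) + (d' - d)); last by ring.
    apply/JD; first exact: LJ.
    by apply/JD; [exact: t1|apply: JN; exact: t1].
  split => //; apply: t3 => //; move: h; rewrite E (_ : c' + d - _ = d - d') //; ring.
exists [seq c + d | c <- s, d <- t]; last by rewrite size_allpairs.
split.
- by move=> _ /allpairsP[[c d] [/= cs dt ->]]; apply: ID; [exact: s1|apply: JI; exact: t1].
- rewrite allpairs_uniq // => -[c d] [c' d'] /allpairsP[[a b] [/= as_ bt [-> ->]]] /allpairsP[[a' b'] [/= as' bt' [-> ->]]] /= E.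
  have [|-> ->//] := key a b a' b' as_ as' bt bt'.
  have : L (b - b).
    by rewrite subrr.
  by rewrite E !subrr.
- move=> _ _ /allpairsP[[c d] [/= cs dt ->]] /allpairsP[[c' d'] [/= cs' dt' ->]] h.
  by have [-> ->] := key _ _ _ _ cs cs' dt dt' h.
- move=> x Ix; have [c cs Jc] := s4 _ Ix; have [d dt Ld] := t4 _ Jc.
  exists (c + d); last by rewrite opprD addrA.
  by apply/allpairsP; exists (c, d).
Qed.

Lemma reps_prm p : exists2 s, reps OO (sval p) s & size s = qn p.
Proof.
have hp := prmP p; have [N N0 pN] := prm_nat p.
have [s sP] : exists s, reps OO (sval p) s.
  have H := @reps_exists OO (sval p) [seq i%:R + j%:R * qw | i <- seq.iota 0 N, j <- seq.iota 0 N] (PI_subm hp).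
  apply: H.
  - move=> _ /allpairsP[[i j] [/= _ _ ->]].
    by apply: OD; [exact: O_nat|apply: OM; [exact: O_nat|exact: O_qw]].
  - move=> x ox; have [r [y oy xE]] := O_mod N0 ox.
    exists (r.1%:R + r.2%:R * qw).
      by apply/allpairsP; exists (nat_of_ord r.1, nat_of_ord r.2); rewrite /= !mem_iota /= !ltn_ord.
    by rewrite xE addrC addKr mulrC; apply: (PI_M hp).
by exists s => //; rewrite /qn (reps_absNorm (PI_subm hp) sP).
Qed.

(** Multiplication by an x of exact valuation e_p at p identifies O_K / p with the quotient;
    surjectivity is checked prime by prime. *)
Lemma reps_dl e p : fs e -> exists2 s, reps (ide e) (ide (e + dl p)) s & size s = qn p.
Proof.
move=> fe; have [x [x0 xe vx]] := ide_exact p fe.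
have [s [s1 s2 s3 s4] <-] := reps_prm p.
have mem a : OO a -> ide (e + dl p) (a * x) <-> sval p a.
  move=> oa; have [->|a0] := eqVneq a 0.
    by rewrite mul0r; split => _; [exact: (PI0 (prmP p))|left].
  split.
    case=> [/eqP|/(_ p)]; first by rewrite mulf_eq0 (negPf a0) (negPf x0).
    by rewrite vM // fctE dlE eqxx vx => h; apply/v_mem => //; lia.
  move=> /(v_mem _ oa a0) va; right => q; rewrite fctE dlE vM //.
  have [->|_] := eqVneq q p; first by rewrite vx; lia.
  by rewrite addr0; case: xe => [/eqP|/(_ q)]; [rewrite (negPf x0)|have := v_O q oa; lia].
exists [seq c * x | c <- s]; last by rewrite size_map.
have [I0 ID IM] := ide_submod e; have [J0 JD JM] := ide_submod (e + dl p).
split.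
- by move=> _ /mapP[c cs ->]; apply: IM => //; exact: s1.
- by rewrite map_inj_uniq // => a b /(mulIf x0).
- move=> _ _ /mapP[c cs ->] /mapP[d ds ->]; rewrite -mulrBl => h; congr (_ * _).
  by apply: s3 => //; apply/mem => //; apply: OB; exact: s1.
- move=> y ye; have [y0|y0] := eqVneq y 0.
    have [c cs pc] := s4 _ O0; exists (c * x); first by apply/mapP; exists c.
    rewrite y0 sub0r -mulNr; apply/mem; first by apply: ON; exact: s1.
    by rewrite sub0r in pc.
  have [a oa [z ze yE]] : exists2 a, OO a & exists2 z, ide (e + dl p) z & y = a * x + z.
    pose S := [set y | exists2 a, OO a & exists2 z, ide (e + dl p) z & y = a * x + z].
    have Sx : S x by exists 1; [exact: O1|exists 0; rewrite ?mul1r ?addr0].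
    apply: (@local_global S).
    + split; first by exists 0; [exact: O0|exists 0; rewrite ?mul0r ?addr0].
        move=> _ _ [a oa [z zz ->]] [b ob [u uu ->]]; exists (a + b); first exact: OD.
        by exists (z + u); [exact: JD|ring].
      move=> b _ ob [a oa [z zz ->]]; exists (b * a); first exact: OM.
      by exists (b * z); [exact: JM|ring].
    + by exists x.
    + move=> q; have vy : e q <= v q y by case: ye => [/eqP|//]; rewrite (negPf y0).
      have [qp|qp] := eqVneq q p; first by exists x => //; rewrite qp vx -qp.
      have [z [z0 ze vz]] := ide_exact q (fsD fe (fs_dl p)).
      exists z; last by rewrite z0 vz fctE dlE (negPf qp) addr0.
      by exists 0; [exact: O0|exists z; rewrite ?mul0r ?add0r].
  have [c cs pc] := s4 _ oa; exists (c * x); first by apply/mapP; exists c.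
  rewrite yE (_ : _ - _ = (a - c) * x + z); last by ring.
  by apply: JD => //; apply/mem => //; apply: OB => //; exact: s1.
Qed.

(** Multiplicative by construction and meaningful for negative exponents as well; [absNorm_ide]
    identifies it with the index for integral ideals. *)
Definition nm e : R := \big[*%R/1]_(p \in [set p | e p != 0]) ((qn p)%:R : R) ^ e p.

Lemma nmE (s : seq prm) e : uniq s -> (forall p, e p != 0 -> p \in s) -> nm e = \prod_(p <- s) (qn p)%:R ^ e p.
Proof.
move=> us H; rewrite /nm (fsbig_widen [set p | e p != 0] [set` s]); last 2 first.
- by move=> p /= ep; exact: H.
- by move=> p /= [_ /negP/negPn/eqP ->].
by rewrite -fsbig_seq.
Qed.

Lemma fs_seq e : fs e -> exists2 s : seq prm, uniq s & forall p, e p != 0 -> p \in s.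
Proof.
move=> /finite_seqP[s sE]; exists (undup s); first exact: undup_uniq.
by move=> p ep; rewrite mem_undup; have : [set p | e p != 0] p by []; rewrite sE.
Qed.

Lemma fs_seq2 e f : fs e -> fs f -> exists2 s : seq prm, uniq s &
  (forall p, e p != 0 -> p \in s) /\ (forall p, f p != 0 -> p \in s).
Proof.
move=> fe ff; have [s us sP] := fs_seq fe; have [t ut tP] := fs_seq ff.
exists (undup (s ++ t)); first exact: undup_uniq.
by split => p h; rewrite mem_undup mem_cat; [rewrite sP|rewrite tP ?orbT].
Qed.

Lemma qn_gt1 p : (1 < qn p)%N.
Proof.
have [s [s1 s2 s3 s4] <-] := reps_prm p.
have [c cs pc] := s4 _ O0; have [d ds pd] := s4 _ O1.
have cd : c != d.
  apply/eqP => E; apply: (PI1 (prmP p)).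
  rewrite (_ : 1 = (1 - d) + (-1) * (0 - c)); last by rewrite E; ring.
  by apply: (PI_D (prmP p)) => //; apply: (PI_M (prmP p)) => //; apply: ON; exact: O1.
have : (size [:: c; d] <= size s)%N.
  apply: uniq_leq_size; first by rewrite /= inE cd.
  by move=> x; rewrite !inE => /orP[/eqP ->|/eqP ->].
by [].
Qed.
Lemma qn_gt0 p : 0 < (qn p)%:R :> R.
Proof. by rewrite ltr0n (ltn_trans _ (qn_gt1 p)). Qed.
Lemma qn_neq0 p : (qn p)%:R != 0 :> R. Proof. by rewrite gt_eqF // qn_gt0. Qed.
Lemma qn_ge1 p : 1 <= (qn p)%:R :> R.
Proof. by rewrite ler1n (ltn_trans _ (qn_gt1 p)). Qed.
Lemma qn_ge2 p : 2 <= (qn p)%:R :> R.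
Proof. by rewrite (ler_nat _ 2) qn_gt1. Qed.

Lemma nm_gt0 e : fs e -> 0 < nm e.
Proof.
move=> fe; have [s us sP] := fs_seq fe; rewrite (nmE us sP).
by apply: prodr_gt0 => p _; rewrite exprz_gt0 // qn_gt0.
Qed.
Lemma nm_neq0 e : fs e -> nm e != 0. Proof. by move=> fe; rewrite gt_eqF // nm_gt0. Qed.
Lemma nm0 : nm 0 = 1.
Proof. by rewrite (@nmE [::]) // ?big_nil // => p; rewrite f0 eqxx. Qed.
Lemma nmD e f : fs e -> fs f -> nm (e + f) = nm e * nm f.
Proof.
move=> fe ff; have [s us [s1 s2]] := fs_seq2 fe ff.
rewrite !(@nmE s) // -?big_split /=.
  by apply: eq_bigr => p _; rewrite fD expfzDr // qn_neq0.
move=> p; rewrite fD => h; have [h1|h1] := eqVneq (e p) 0; last exact: s1.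
by apply: s2; rewrite h1 add0r in h.
Qed.
Lemma nmN e : fs e -> nm (- e) = (nm e)^-1.
Proof.
move=> fe; apply: (mulfI (nm_neq0 fe)); rewrite -nmD //; last exact: fsN.
by rewrite subrr nm0 mulfV // nm_neq0.
Qed.
Lemma nmB e f : fs e -> fs f -> nm (e - f) = nm e / nm f.
Proof. by move=> fe ff; rewrite nmD ?nmN //; exact: fsN. Qed.
Lemma nm_dl p : nm (dl p) = (qn p)%:R.
Proof.
rewrite (@nmE [:: p]) //; first by rewrite big_seq1 dlE eqxx.
by move=> q; rewrite dlE inE; case: (q == p).
Qed.
Lemma nm_ge1 e : fs e -> (forall p, 0 <= e p) -> 1 <= nm e.
Proof.
move=> fe e0; have [s us sP] := fs_seq fe; rewrite (nmE us sP).
by elim/big_ind: _ => // [x y x1 y1|p _]; [rewrite mulr_ege1|by case: (e p) (e0 p) => // n _; rewrite -exprnP exprn_ege1 ?qn_ge1].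
Qed.
Lemma nm_le e f : fs e -> fs f -> (forall p, e p <= f p) -> nm e <= nm f.
Proof.
move=> fe ff ef; rewrite -[f](subrK e) nmD //; last by apply: fsD => //; exact: fsN.
rewrite ler_peMl ?(ltW (nm_gt0 _)) // nm_ge1 //; first by apply: fsD => //; exact: fsN.
by move=> p; rewrite fD fN subr_ge0.
Qed.

Lemma fsMn e n : fs e -> fs (e *+ n).
Proof. by move=> fe; elim: n => [|n ih]; [rewrite mulr0n; exact: fs0|rewrite mulrS; exact: fsD]. Qed.

Lemma fs_ind (Q : (prm -> int) -> Prop) : Q 0 ->
  (forall e p, fs e -> (forall q, 0 <= e q) -> Q e -> Q (e + dl p)) ->
  forall e, fs e -> (forall q, 0 <= e q) -> Q e.
Proof.
move=> Q0 QS e fe; have [s us sP] := fs_seq fe.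
have [n] := ubnP (\sum_(p <- s) `|e p|)%N; elim: n e fe sP => // n ih e fe sP.
rewrite ltnS => le e0; have [->//|/eqP] := pselect (e = 0).
move=> /eqP eN; have [p ep] : exists p, e p != 0.
  by apply: contrapT => H; apply: eN; apply/funext => p; apply/eqP/negPn/negP => h; apply: H; exists p.
have ps := sP _ ep; have ep0 := e0 p.
have fd : fs (e - dl p) by apply: fsD => //; apply: fsN; exact: fs_dl.
have d0 q : 0 <= (e - dl p) q.
  rewrite fD fN dlE; have := e0 q; case: eqVneq => [->|_]; last by lia.
  by move: ep ep0; lia.
rewrite -[e](subrK (dl p)); apply: QS => //; apply: ih => //.
  move=> q; rewrite fD fN dlE; case: (q =P p) => [->|_]; [by rewrite ps|rewrite subr0; exact: sP].
apply: leq_trans le; rewrite (bigD1_seq p) //= [X in (_ < X)%N](bigD1_seq p) //=.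
rewrite fD fN dlE eqxx -addSn leq_add //; first by move: ep ep0; lia.
apply: leq_sum => q qp; rewrite fD fN dlE (negPf qp) subr0 //.
Qed.

Lemma reps_ide e : fs e -> (forall p, 0 <= e p) -> exists2 s, reps OO (ide e) s & (size s)%:R = nm e.
Proof.
move: e; apply: fs_ind.
  exists [:: 0]; last by rewrite nm0.
  split => //; first by move=> c; rewrite inE => /eqP ->; exact: O0.
    by move=> c d; rewrite !inE => /eqP -> /eqP ->.
  by move=> x ox; exists 0; rewrite ?mem_head // subr0 -O_ide0.
move=> e p fe e0 [s sP sE]; have [t tP tE] := reps_dl p fe.
have [|||||u uP uE] := reps_comp _ _ _ _ _ sP tP.
- by split; [exact: O0|exact: OD|exact: OM].
- exact: ide_submod.
- exact: ide_submod.
- by rewrite O_ide0; exact: ide_le.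
- by apply: ide_le => q; rewrite fD dlE lerDl.
by exists u => //; rewrite uE natrM sE tE nmD ?nm_dl //; exact: fs_dl.
Qed.

Lemma absNorm_ide e : fs e -> (forall p, 0 <= e p) -> (absNorm (ide e))%:R = nm e.
Proof.
move=> fe e0; have [s sP <-] := reps_ide fe e0.
by rewrite (reps_absNorm (ide_submod _) sP).
Qed.

(** * Fundamental domains *)
Local Notation mu := (@lebesgue_measure R).
Local Notation m2 := (mu \x mu)%E.

(** Turns a scaled preimage into a measure, so that scaling laws follow from the uniqueness of
    Lebesgue and product measures. *)
Lemma pushforward_scaled d1 d2 (T1 : measurableType d1) (T2 : measurableType d2)
  (m : {measure set T1 -> \bar R}) (f : T1 -> T2) (c : R) : measurable_fun setT f -> 0 <= c ->
  exists m' : {measure set T2 -> \bar R}, forall A, m' A = (c%:E * m (f @^-1` A))%E.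
Proof.
move=> mf c0.
pose m1 : {measure set T2 -> \bar R} := @measure_function_pushforward__canonical__measure_function_Measure _ _ _ _ _ m f mf.
by exists (mscale (NngNum c0) m1).
Qed.

Lemma mu_affine (c b : R) (A : set R) : 0 < c -> measurable A ->
  mu A = (c%:E * mu ((fun x => c * x + b)%R @^-1` A))%E.
Proof.
move=> c0 mA; have mf : measurable_fun [set: measurableTypeR R] (fun x : R => c * x + b : measurableTypeR R).
  by apply: measurable_funD => //; exact: measurable_funM.
have [m' m'E] := pushforward_scaled mu mf (ltW c0).
rewrite -m'E; apply: lebesgue_measure_unique => //= _ [[a d]] _ <-.
rewrite m'E /=.
have -> : (fun x : R => c * x + b) @^-1` `]a, d] = `](a - b) / c, (d - b) / c]%classic.
  apply/seteqP; split => x /=; rewrite !in_itv /= ltr_pdivrMr // ler_pdivlMr //;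
  by move=> /andP[h1 h2]; apply/andP; split; qlra.
rewrite !lebesgue_measure_itv /= !lte_fin ltr_pdivrMr // mulfVK ?gt_eqF // ltrD2r.
case: ifP => _; last by rewrite mule0.
by rewrite -!EFinD -EFinM; congr (_%:E); field; rewrite gt_eqF.
Qed.

Section ProductScaling.
Context d1 d2 (T1 : measurableType d1) (T2 : measurableType d2).
Variables (n1 : {sigma_finite_measure set T1 -> \bar R}) (n2 : {sigma_finite_measure set T2 -> \bar R}).

Lemma product_scaling (f : T1 -> T1) (g : T2 -> T2) (c d : R) (A : set (T1 * T2)) :
  measurable_fun setT f -> measurable_fun setT g -> 0 < c -> 0 < d ->
  (forall B, measurable B -> n1 B = (c%:E * n1 (f @^-1` B))%E) ->
  (forall B, measurable B -> n2 B = (d%:E * n2 (g @^-1` B))%E) -> measurable A ->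
  (n1 \x n2)%E A = ((c * d)%:E * (n1 \x n2)%E ((fun z => (f z.1, g z.2)) @^-1` A))%E.
Proof.
move=> mf mg c0 d0 h1 h2 mA.
have mh : measurable_fun setT (fun z : T1 * T2 => (f z.1, g z.2)).
  by apply: measurable_fun_pair; apply: measurableT_comp.
have cd0 : 0 <= c * d by rewrite mulr_ge0 // ltW.
have [m' m'E] := pushforward_scaled (n1 \x n2)%E mh cd0.
rewrite -m'E; apply: product_measure_unique => // B C mB mC; rewrite m'E /=.
have -> : (fun z : T1 * T2 => (f z.1, g z.2)) @^-1` (B `*` C) = (f @^-1` B) `*` (g @^-1` C) by [].
rewrite product_measure1E; last 2 first.
- by rewrite -[X in measurable X]setTI; exact: mf.
- by rewrite -[X in measurable X]setTI; exact: mg.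
by rewrite (h1 _ mB) (h2 _ mC) EFinM muleACA.
Qed.
End ProductScaling.

Lemma tiles_measure d (T : measurableType d) (m : {measure set T -> \bar R}) (I : choiceType) (s : seq I)
  (F : I -> set T) (a : R) : uniq s -> (forall i, i \in s -> measurable (F i)) ->
  (forall i, i \in s -> m (F i) = a%:E) ->
  (forall i j, i \in s -> j \in s -> (F i `&` F j) !=set0 -> i = j) ->
  measurable (\bigcup_(i in [set` s]) F i) /\ m (\bigcup_(i in [set` s]) F i) = ((size s)%:R * a)%:E.
Proof.
move=> us mF aF dF; split; first by apply: fin_bigcup_measurable => //; exact: finite_seq.
rewrite measure_fin_bigcup //.
rewrite -fsbig_seq // (eq_big_seq (fun=> a%:E)) //.
by rewrite sumEFin; congr (_%:E); rewrite big_const_seq count_predT iter_addr_0 mulr_natl.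
Qed.

Definition pt (x : K) : R * R := (re x, im x).
Lemma ptD x y : pt (x + y) = pt x + pt y. Proof. by rewrite /pt reD imD. Qed.
Lemma ptN x : pt (- x) = - pt x. Proof. by rewrite /pt reN imN. Qed.
Definition n2 (z : R * R) : R := z.1 ^+ 2 + z.2 ^+ 2.
Lemma n2_pt x : n2 (pt x) = sq x. Proof. by rewrite sqE. Qed.
Lemma n2_ge0 z : 0 <= n2 z. Proof. by rewrite addr_ge0 // sqr_ge0. Qed.

Lemma n2D (z w : R * R) (a b : R) : 0 <= a -> 0 <= b -> n2 z <= a ^+ 2 -> n2 w <= b ^+ 2 ->
  n2 (z + w) <= (a + b) ^+ 2.
Proof.
case: z w => x y [u t] a0 b0; rewrite /n2 /= => h1 h2.
have h3 : x * u + y * t <= a * b.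
  rewrite -[leRHS](ger0_norm) ?mulr_ge0 // -sqrtr_sqr; apply: le_trans (ler_norm _) _.
  rewrite -sqrtr_sqr ler_wsqrtr // exprMn.
  have : (x * u + y * t) ^+ 2 <= (x ^+ 2 + y ^+ 2) * (u ^+ 2 + t ^+ 2).
    by rewrite -subr_ge0 (_ : _ - _ = (x * t - y * u) ^+ 2) ?sqr_ge0 //; ring.
  by move/le_trans; apply; apply: ler_pM => //; rewrite addr_ge0 // sqr_ge0.
rewrite (_ : _ + _ = (x ^+ 2 + y ^+ 2) + (u ^+ 2 + t ^+ 2) + 2 * (x * u + y * t)); last by ring.
rewrite (_ : (a + b) ^+ 2 = a ^+ 2 + b ^+ 2 + 2 * (a * b)); last by ring.
by qlra.
Qed.
Lemma n2B (z w : R * R) (a b : R) : 0 <= a -> 0 <= b -> n2 z <= a ^+ 2 -> n2 w <= b ^+ 2 ->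
  n2 (z - w) <= (a + b) ^+ 2.
Proof. by move=> a0 b0 h1 h2; apply: n2D => //; rewrite /n2 /= !sqrrN. Qed.

Definition disc (t : R) : set (R * R) := [set z | n2 z <= t].

Lemma measurable_n2 : measurable_fun setT (n2 : R * R -> R).
Proof. by apply: measurable_funD; apply: measurable_funX; [exact: measurable_fst|exact: measurable_snd]. Qed.
Lemma measurable_disc t : measurable (disc t).
Proof.
rewrite -[disc t]setTI; apply: measurable_fun_le => //; exact: measurable_n2.
Qed.

(** The area of the unit disc. Its value pi matters only for the final constant and is established
    in [c1_pi]. *)
Definition c1 : R := fine (m2 (disc 1)).

Lemma m2_translate (a : R * R) (A : set (R * R)) : measurable A ->
  m2 ((fun z => z - a) @^-1` A) = m2 A.
Proof.
move=> mA; have H (b : R) B : measurable B -> mu B = (1%:E * mu ((fun x => x - b)%R @^-1` B))%E.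
  move=> mB; rewrite (@mu_affine 1 (- b) B) //; congr (_ * mu _)%E.
  by apply/seteqP; split => x /=; rewrite mul1r.
rewrite [RHS](@product_scaling _ _ _ _ mu mu (fun x => x - a.1)%R (fun x => x - a.2)%R 1 1) //.
- by rewrite mul1r mul1e.
- exact: measurable_funB.
- exact: measurable_funB.
- exact: H.
- exact: H.
Qed.

Lemma m2_scale (c : R) (A : set (R * R)) : 0 < c -> measurable A ->
  m2 A = ((c ^+ 2)%:E * m2 ((fun z : R * R => (c * z.1, c * z.2)%R) @^-1` A))%E.
Proof.
move=> c0 mA; have H B : measurable B -> mu B = (c%:E * mu ((fun x => c * x)%R @^-1` B))%E.
  move=> mB; rewrite (@mu_affine c 0 B) //; congr (_ * mu _)%E.
  by apply/seteqP; split => x /=; rewrite addr0.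
rewrite [LHS](@product_scaling _ _ _ _ mu mu (fun x => c * x)%R (fun x => c * x)%R c c) //; exact: measurable_funM.
Qed.

Lemma m2_rect (a b c d : R) : a <= b -> c <= d -> m2 (`[a, b[ `*` `[c, d[) = ((b - a) * (d - c))%:E.
Proof.
have H (x y : R) : x <= y -> mu `[x, y[ = (y - x)%:E.
  rewrite lebesgue_measure_itv /= lte_fin le_eqVlt => /orP[/eqP ->|->]; last by rewrite EFinB.
  by rewrite ltxx subrr.
move=> ab cd; transitivity (mu `[a, b[ * mu `[c, d[)%E; first exact: product_measure1E.
by rewrite !H // EFinM.
Qed.

Lemma disc1_bounds : (m2 (disc 1) <= 16%:E)%E /\ (1%:E <= m2 (disc 1))%E.
Proof.
split.
  have -> : 16%:E = m2 (`[-2, 2[ `*` `[-2, 2[) :> \bar R.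
    by rewrite m2_rect; [congr (_%:E); ring| |]; qlra.
  apply: le_measure; rewrite ?inE; [exact: measurable_disc|exact: measurableX|].
  by move=> [x y]; rewrite /disc /n2 /= !in_itv /= => h; split; apply/andP; split; nra.
apply: (@le_trans _ _ (m2 (`[-(1/2), (1/2)[ `*` `[-(1/2), (1/2)[))).
  by rewrite m2_rect; [rewrite lee_fin| |]; qlra.
apply: le_measure; rewrite ?inE; [exact: measurableX|exact: measurable_disc|].
by move=> [x y]; rewrite /disc /n2 /= !in_itv /= => -[/andP[h1 h2] /andP[h3 h4]]; nra.
Qed.

Lemma c1_gt0 : 0 < c1.
Proof.
have [h1 h2] := disc1_bounds; have f : m2 (disc 1) \is a fin_num.
  by rewrite ge0_fin_numE ?(le_lt_trans h1) ?ltry.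
by rewrite /c1; move: h2; rewrite -{1}(fineK f) lee_fin; qlra.
Qed.

Lemma m2_disc t : 0 <= t -> m2 (disc t) = (c1 * t)%:E.
Proof.
have [h1 h2] := disc1_bounds; have f : m2 (disc 1) \is a fin_num.
  by rewrite ge0_fin_numE ?(le_lt_trans h1) ?ltry.
have H s : 0 < s -> m2 (disc s) = (c1 * s)%:E.
  move=> s0; rewrite (@m2_scale (Num.sqrt s)) ?sqrtr_gt0 //; last exact: measurable_disc.
  have -> : (fun z => (Num.sqrt s * z.1, Num.sqrt s * z.2)) @^-1` disc s = disc 1.
    apply/seteqP; split => -[x y]; rewrite /disc /n2 /= !exprMn sqr_sqrtr ?(ltW s0) // -mulrDr;
    by rewrite -{2}[s]mulr1 ler_pM2l.
  by rewrite -[m2 _]fineK // -EFinM sqr_sqrtr ?(ltW s0) // mulrC.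
rewrite le_eqVlt => /orP[/eqP <-|/H //]; rewrite mulr0.
apply/eqP; rewrite eq_le measure_ge0 andbT; apply/lee_addgt0Pr => e e0; rewrite add0e.
have h : 0 < e / c1 by rewrite divr_gt0 // c1_gt0.
have -> : e%:E = m2 (disc (e / c1)) by rewrite H // mulrC mulfVK // gt_eqF // c1_gt0.
apply: le_measure; rewrite ?inE; [exact: measurable_disc|exact: measurable_disc|].
by move=> z; rewrite /disc /= => /le_trans; apply; exact: ltW.
Qed.

Definition trl (F : set (R * R)) (x : K) : set (R * R) := (fun z => z - pt x) @^-1` F.
Lemma measurable_trl F x : measurable F -> measurable (trl F x).
Proof.
move=> mF; rewrite -[trl F x]setTI.
have : measurable_fun setT (fun z : R * R => z - pt x).
  have -> : (fun z : R * R => z - pt x) = (fun z => (z.1 - re x, z.2 - im x)) by apply/funext => -[].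
  by apply: measurable_fun_pair; apply: measurable_funB.
by move=> h; apply: h.
Qed.
Lemma m2_trl F x : measurable F -> m2 (trl F x) = m2 F.
Proof. by move=> mF; rewrite /trl m2_translate. Qed.

(* [F] is a fundamental domain, of radius [r] and area [a], for the translations by [I]. *)
Definition tile (I : set K) (F : set (R * R)) (r a : R) :=
  [/\ measurable F, 0 <= r, (forall z, F z -> n2 z <= r ^+ 2), m2 F = a%:E &
      (forall z, exists2 x, I x & trl F x z) /\
      (forall x y z, I x -> I y -> trl F x z -> trl F y z -> x = y)].

(** The translates by the lattice points of the disc of radius t lie in the disc of radius t + r and
    cover the disc of radius t - r. *)
Lemma tile_disc I F r a (s : seq K) (t : R) : tile I F r a -> uniq s -> 0 <= t ->
  (forall x, (x \in s) = `[< I x /\ sq x <= t ^+ 2 >]) ->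
  a * (size s)%:R <= c1 * (t + r) ^+ 2 /\ (r <= t -> c1 * (t - r) ^+ 2 <= a * (size s)%:R).
Proof.
move=> [mF r0 rF aF [F1 F2]] us t0 sE.
have sP x : x \in s -> I x /\ sq x <= t ^+ 2 by rewrite sE => /asboolP.
have [mU UE] := @tiles_measure _ _ m2 _ s (trl F) a us (fun x _ => measurable_trl x mF)
  (fun x _ => etrans (m2_trl x mF) aF) (fun x y xs ys '(ex_intro z (conj h1 h2)) => F2 x y z (proj1 (sP x xs)) (proj1 (sP y ys)) h1 h2).
rewrite [a * _]mulrC; split => [|rt]; rewrite -lee_fin -UE -m2_disc ?sqr_ge0 //;
  apply: le_measure; rewrite ?inE //; try exact: measurable_disc.
  move=> z [x /= xs zx]; rewrite /disc /= -[z](subrK (pt x)) addrC.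
  by apply: n2D => //; [rewrite n2_pt; case: (sP _ xs)|exact: rF].
move=> z zr; have [x Ix zx] := F1 z; exists x => //=; rewrite sE; apply/asboolP; split => //.
rewrite -n2_pt (_ : pt x = z - (z - pt x)); last by rewrite opprB addrCA subrr addr0.
by rewrite -[t](subrK r); apply: n2B => //; [rewrite subr_ge0|exact: rF].
Qed.

(** Extracts an inequality of leading coefficients from one that holds for all large radii. *)
Lemma quad_le0 (d b c r0 : R) : (forall r, r0 <= r -> d * r ^+ 2 <= b * r + c) -> d <= 0.
Proof.
move=> H; rewrite leNgt; apply/negP => d0.
pose r := `|r0| + (`|b| + `|c|) / d + 1.
have r1 : 1 <= r by rewrite lerDr addr_ge0 // divr_ge0 ?addr_ge0 // ltW.
have rr0 : r0 <= r by rewrite /r; have := ler_norm r0; have : 0 <= (`|b| + `|c|) / d by [rewrite divr_ge0 ?addr_ge0 // ltW]; qlra.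
have dr : `|b| + `|c| < d * r.
  rewrite /r !mulrDr mulrCA mulfV ?gt_eqF // mulr1 mulr1.
  by have : 0 <= d * `|r0| by [rewrite mulr_ge0 // ltW]; qlra.
have := H r rr0; rewrite leNgt => /negP; apply.
have h1 : b * r <= `|b| * r by rewrite ler_wpM2r ?ler_norm //; qlra.
have h2 : c <= `|c| * r by apply: le_trans (ler_norm c) _; rewrite ler_peMr.
have h3 : (`|b| + `|c|) * r < d * r * r by rewrite ltr_pM2r //; qlra.
by rewrite expr2 mulrA; qlra.
Qed.

Lemma ltn_int_bound (x : R) (i : int) : `|i%:~R| <= x -> (`|i|%N <= Num.trunc x)%N.
Proof.
move=> h; have x0 : 0 <= x by exact: le_trans h.
rewrite truncn_ge_nat //; suff -> : (absz i)%:R = `|i%:~R| :> R by [].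
by rewrite -intr_norm -abszE.
Qed.

Lemma finite_O t : finite_set [set x | OO x /\ sq x <= t].
Proof.
pose b := Num.trunc (Num.sqrt t / im qw); pose c := Num.trunc (Num.sqrt t + b%:R * `|re qw|).
pose f (r : 'I_(c + c).+1 * 'I_(b + b).+1) : K := (r.1%:Z - c%:Z)%:~R + (r.2%:Z - b%:Z)%:~R * qw.
apply: (@sub_finite_set _ _ (f @` setT)); last exact/finite_image/finite_finset.
move=> x [ox xt]; have [i [j xE]] := O_qwE ox; have w0 := im_qw.
have ix : im x = j%:~R * im qw by rewrite xE imD imM re_int !im_int; ring.
have rx : re x = i%:~R + j%:~R * re qw by rewrite xE reD reM !re_int im_int; ring.
have st : 0 <= Num.sqrt t by exact: sqrtr_ge0.
have t0 : 0 <= t by exact: le_trans (sq_ge0 x) xt.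
have ab (y : R) : y ^+ 2 <= sq x -> `|y| <= Num.sqrt t.
  by move=> h; rewrite -sqrtr_sqr ler_wsqrtr // (le_trans h).
have jb : (`|j|%N <= b)%N.
  apply: ltn_int_bound; rewrite ler_pdivlMr // -[im qw]gtr0_norm // -normrM -ix.
  by apply: ab; rewrite sqE lerDr sqr_ge0.
have ib : (`|i|%N <= c)%N.
  apply: ltn_int_bound; rewrite (_ : i%:~R = re x - j%:~R * re qw); last by rewrite rx addrK.
  apply: le_trans (ler_normB _ _) _; apply: lerD; first by apply: ab; rewrite sqE lerDl sqr_ge0.
  rewrite normrM ler_wpM2r // -intr_norm -abszE -[_%:~R]/((absz j)%:R) ler_nat //.
have h1 : (absz (i + c%:Z)%R < (c + c).+1)%N by lia.
have h2 : (absz (j + b%:Z)%R < (b + b).+1)%N by lia.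
exists (Ordinal h1, Ordinal h2) => //; rewrite /f /= xE; congr (_%:~R + _%:~R * _); lia.
Qed.

Lemma finite_ide e t : fs e -> finite_set [set x | ide e x /\ sq x <= t].
Proof.
move=> fe; have [N [N0 NP]] := ide_bound (fsN fe); have N0' := natK_neq0 N0.
apply: (@sub_finite_set _ _ ((fun x => x / N%:R) @` [set x | OO x /\ sq x <= t * sq N%:R])); last exact/finite_image/finite_O.
move=> x [xe xt]; exists (x * N%:R); last by rewrite mulfK.
split; last by rewrite sqM ler_wpM2r // sq_ge0.
have [->|x0] := eqVneq x 0; first by rewrite mul0r; exact: O0.
rewrite O_ide0; right => p; rewrite vM //; case: xe => [/eqP|/(_ p) h]; first by rewrite (negPf x0).
have := NP p; rewrite fN => h1; change (0 <= v p x + v p N%:R); lia.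
Qed.

Definition pts e (t : R) : seq K := enum_fset (fset_set [set x | ide e x /\ sq x <= t]).
Lemma pts_uniq e t : uniq (pts e t). Proof. exact: fset_uniq. Qed.
Lemma ptsE e t x : fs e -> (x \in pts e t) = `[< ide e x /\ sq x <= t >].
Proof.
move=> fe; rewrite /pts -[LHS]/(x \in fset_set _) in_fset_set; last exact: finite_ide.
by apply/idP/asboolP; rewrite inE.
Qed.

Lemma pts_scale e g t : fs e -> g != 0 ->
  size (pts (e + v ^~ g) (t * sq g)) = size (pts e t).
Proof.
move=> fe g0; have fg := fs_v g; have feg := fsD fe fg.
rewrite -(size_map (fun x => g * x) (pts e t)); apply/perm_size/uniq_perm; first exact: pts_uniq.
  by rewrite map_inj_uniq ?pts_uniq // => x y /(mulfI g0).
move=> x; rewrite ptsE // -scale_ide //; apply/asboolP/mapP.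
  move=> [[y ye <-]]; rewrite sqM mulrC ler_pM2r ?sq_gt0 // => h.
  by exists y => //; rewrite ptsE //; exact/asboolP.
move=> [y]; rewrite ptsE // => /asboolP[ye yt] ->; split; first by exists y.
by rewrite sqM mulrC ler_pM2r ?sq_gt0.
Qed.

Lemma tile_pts e F r a t : fs e -> tile (ide e) F r a -> 0 <= t ->
  a * (size (pts e (t ^+ 2)))%:R <= c1 * (t + r) ^+ 2 /\
  (r <= t -> c1 * (t - r) ^+ 2 <= a * (size (pts e (t ^+ 2)))%:R).
Proof. by move=> fe te t0; apply: (tile_disc te (pts_uniq _ _) t0) => x; rewrite ptsE. Qed.

Lemma tile_gt0 e F r a : fs e -> tile (ide e) F r a -> 0 < a.
Proof.
move=> fe te; have r0 : 0 <= r by case: te.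
have [_ h] := tile_pts fe te (t := r + 1) (addr_ge0 r0 ler01).
have h1 : c1 * (r + 1 - r) ^+ 2 <= a * (size (pts e ((r + 1) ^+ 2)))%:R by apply: h; qlra.
have := c1_gt0; rewrite (_ : r + 1 - r = 1) in h1; last by ring.
rewrite expr1n mulr1 in h1; move=> c0; rewrite ltNge; apply/negP => a0.
by have : a * (size (pts e ((r + 1) ^+ 2)))%:R <= 0 by [rewrite mulr_le0_ge0]; qlra.
Qed.

(* Two fundamental domains are compared by counting lattice points in large discs. *)
Lemma tile_cmp e g F r a F' r' a' : fs e -> g != 0 -> tile (ide e) F r a ->
  tile (ide (e + v ^~ g)) F' r' a' -> a' <= sq g * a.
Proof.
move=> fe g0 te te'; have fg := fs_v g; have feg := fsD fe fg.
have [a0 a0'] := (tile_gt0 fe te, tile_gt0 feg te').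
have [r0 r0'] : 0 <= r /\ 0 <= r' by case: te; case: te'.
pose s := Num.sqrt (sq g); have s0 : 0 < s by rewrite sqrtr_gt0 sq_gt0.
have sE : s ^+ 2 = sq g by rewrite sqr_sqrtr // sq_ge0.
have c0 := c1_gt0.
rewrite -subr_le0; apply: (@quad_le0 _ (2 * a * s ^+ 1 * r' + 2 * a' * r + (a' - a * s ^+ 2) * 0 + 2 * a * s * r' *+ 0 + a * 0) (a * r' ^+ 2) r) => t rt.
have t0 : 0 <= t by qlra.
have [_ h1] := tile_pts fe te t0; have [h2 _] := tile_pts feg te' (mulr_ge0 t0 (ltW s0)).
have h3 := h1 rt; rewrite exprMn sE pts_scale // in h2.
move: h2 h3; set n := (size _)%:R => h2 h3.
have h4 : c1 * (a' * (t - r) ^+ 2) <= c1 * (a * (t * s + r') ^+ 2).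
  apply: (@le_trans _ _ (a' * (a * n))).
    by rewrite mulrCA ler_wpM2l // ltW.
  by rewrite mulrCA [leRHS]mulrCA ler_wpM2l // ltW.
rewrite ler_pM2l // in h4.
have h5 : 0 <= a' * r ^+ 2 by rewrite mulr_ge0 ?sqr_ge0 // ltW.
rewrite -sE; nra.
Qed.

(** A rectangle replaces the parallelogram on 1 and [qw]: multiples of [qw] first reduce the
    imaginary part, then integers reduce the real part. *)
Lemma tile_O : exists F r, tile (ide 0) F r (im qw).
Proof.
have w0 := im_qw.
exists (`[0, 1[ `*` `[0, im qw[), (1 + im qw); split.
- exact: measurableX.
- qlra.
- move=> [x y] /= []; rewrite !in_itv /n2 /= => /andP[a0 a1] /andP[b0 b1].
  have h1 : x ^+ 2 <= 1 by rewrite expr_le1 // ltW.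
  have h2 : y ^+ 2 <= im qw ^+ 2 by rewrite ler_pXn2r ?nnegrE // ltW.
  by rewrite (_ : (1 + im qw) ^+ 2 = 1 + 2 * im qw + im qw ^+ 2); [qlra|ring].
- by rewrite m2_rect; [congr (_%:E); ring| |]; qlra.
split.
  move=> [x y].
  pose j := Num.floor (y / im qw); pose i := Num.floor (x - j%:~R * re qw).
  have /andP[j1 j2] := floor_itv (y / im qw); have /andP[i1 i2] := floor_itv (x - j%:~R * re qw).
  exists (i%:~R + j%:~R * qw).
    by rewrite -O_ide0; apply: OD; [exact: O_int|apply: OM; [exact: O_int|exact: O_qw]].
  rewrite /trl /= !(imD, reD, imM, reM, re_int, im_int) !in_itv /=.
  rewrite ler_pdivlMr // in j1; rewrite ltr_pdivrMr // in j2.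
  move: i1 i2 j1 j2; rewrite -/i -/j !intrD; clear.
  by move: (i%:~R : R) (j%:~R : R) => I J *; split; apply/andP; split; qlra.
move=> x y [z1 z2]; rewrite -O_ide0 => ox oy.
have [k [l dE]] := O_qwE (OB ox oy).
rewrite /trl /= !in_itv /= => -[/andP[h1 h2] /andP[h3 h4]] [/andP[h5 h6] /andP[h7 h8]].
have e1 : re x - re y = k%:~R + l%:~R * re qw.
  by rewrite -reN -reD dE reD reM !re_int im_int; ring.
have e2 : im x - im y = l%:~R * im qw.
  by rewrite -imN -imD dE imD imM re_int !im_int; ring.
have H (m : int) (b : R) : 0 < b -> m%:~R * b < b -> - b < m%:~R * b -> m = 0.
  move=> b0; rewrite -ltr_pdivlMr // mulfV ?gt_eqF // -mulN1r ltr_pM2r // => m1 m2.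
  have n1 : (m < 1)%R by rewrite -(ltr_int R).
  have n2 : (-1 < m)%R by rewrite -(ltr_int R) intrN.
  by move: n1 n2; clear; lia.
have l0 : l = 0 by apply: (H l (im qw)) => //; rewrite -e2; move: h3 h4 h7 h8; clear; qlra.
have k0 : k = 0.
  by apply: (H k 1) => //; rewrite mulr1; move: e1; rewrite l0 mul0r addr0 => <-; move: h1 h2 h5 h6; clear; qlra.
by apply/eqP; rewrite -subr_eq0 dE l0 k0 mul0r addr0.
Qed.

Lemma bounded_pts (s : seq K) : exists2 b : R, 0 <= b & forall x, x \in s -> sq x <= b ^+ 2.
Proof.
elim: s => [|x s [b b0 bP]]; first by exists 0.
exists (Num.sqrt (sq x) + b); first by rewrite addr_ge0 ?sqrtr_ge0.
have s0 := sqrtr_ge0 (sq x); have sE := sqr_sqrtr (sq_ge0 x).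
move=> y; rewrite inE => /orP[/eqP ->|/bP h]; nra.
Qed.

(** The union of the translates of a tile by coset representatives is a tile for the sublattice. *)
Lemma tile_reps (I J : set K) (s : seq K) F r a : OK_submodule I -> OK_submodule J -> J `<=` I ->
  reps I J s -> tile I F r a -> exists F' r', tile J F' r' ((size s)%:R * a).
Proof.
move=> [I0 ID IM] [J0 JD JM] JI [s1 s2 s3 s4] [mF r0 rF aF [F1 F2]].
have [b b0 bP] := bounded_pts s.
have [mU UE] := @tiles_measure _ _ m2 _ s (trl F) a s2 (fun x _ => measurable_trl x mF)
  (fun x _ => etrans (m2_trl x mF) aF) (fun x y xs ys '(ex_intro z (conj h1 h2)) => F2 x y z (s1 x xs) (s1 y ys) h1 h2).
exists (\bigcup_(x in [set` s]) trl F x), (r + b); split => //; first qlra.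
  move=> z [x /= xs zx]; rewrite -[z](subrK (pt x)); apply: n2D => //; first exact: rF.
  by rewrite n2_pt; exact: bP.
split.
  move=> z; have [x Ix zx] := F1 z; have [c cs Jc] := s4 _ Ix; exists (x - c) => //.
  by exists c => //; rewrite /trl /= -addrA -opprD -ptD subrK.
move=> x y z Jx Jy [c /= cs h1] [d /= ds h2].
have E : x + c = y + d.
  apply: (F2 _ _ z); [by apply/ID/s1 => //; exact: JI|by apply/ID/s1 => //; exact: JI| |].
    by move: h1; rewrite /trl /= ptD opprD addrA.
  by move: h2; rewrite /trl /= ptD opprD addrA.
have cd : c = d.
  apply: s3 => //; rewrite (_ : c - d = y + (-1) * x); last by rewrite -[c](addKr x) E; ring.
  by apply: JD => //; apply: JM => //; apply: ON; exact: O1.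
by move: E; rewrite cd => /addIr.
Qed.

(** Multiplication by g includes a rotation. The area of the image is not obtained by a change of
    variables but from [tile_cmp], applied with g and with its inverse. *)
Lemma tile_scale e g F r a : fs e -> g != 0 -> tile (ide e) F r a ->
  exists F', exists2 a', tile (ide (e + v ^~ g)) F' (r * Num.sqrt (sq g)) a' & a' = sq g * a.
Proof.
move=> fe g0 te; have [mF r0 rF aF [F1 F2]] := te.
pose h (z : R * R) : R * R := (re g^-1 * z.1 - im g^-1 * z.2, re g^-1 * z.2 + im g^-1 * z.1).
have mh : measurable_fun setT h.
  apply: measurable_fun_pair; [apply: measurable_funB|apply: measurable_funD];
  by apply: measurable_funM => //; (exact: measurable_fst || exact: measurable_snd).
have hB z w : h (z - w) = h z - h w by rewrite /h; congr (_, _); rewrite /=; ring.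
have hpt x : h (pt (g * x)) = pt x.
  rewrite /pt -{3 4}(mulKf g0 x) /h /=; move: (g * x) (g^-1) => y z.
  by rewrite reM imM; congr (_, _); ring.
have n2h z : n2 z = sq g * n2 (h z).
  have -> : n2 (h z) = sq g^-1 * n2 z by rewrite sqE /h /n2 /=; ring.
  by rewrite mulrA -sqM mulfV // sq1 mul1r.
pose F' := h @^-1` F.
have mF' : measurable F' by rewrite -[F']setTI; exact: mh.
have r' : forall z, F' z -> n2 z <= (r * Num.sqrt (sq g)) ^+ 2.
  by move=> z /rF hz; rewrite n2h exprMn sqr_sqrtr ?sq_ge0 // [leRHS]mulrC ler_wpM2l ?sq_ge0.
have fin : m2 F' \is a fin_num.
  rewrite ge0_fin_numE ?measure_ge0 //; apply: (@le_lt_trans _ _ (m2 (disc ((r * Num.sqrt (sq g)) ^+ 2)))).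
    by apply: le_measure; rewrite ?inE; [exact: mF'|exact: measurable_disc|exact: r'].
  by rewrite m2_disc ?sqr_ge0 // ltry.
have te' : tile (ide (e + v ^~ g)) F' (r * Num.sqrt (sq g)) (fine (m2 F')).
  split => //; first by rewrite mulr_ge0 // sqrtr_ge0.
    by rewrite fineK.
  rewrite -scale_ide //; split.
    move=> z; have [x Ix zx] := F1 (h z); exists (g * x); first by exists x.
    by rewrite /trl /F' /= hB hpt.
  move=> _ _ z [x Ix <-] [y Iy <-]; rewrite /trl /F' /= !hB !hpt => z1 z2.
  by rewrite (F2 x y (h z)).
exists F', (fine (m2 F')) => //; apply/eqP; rewrite eq_le (tile_cmp fe g0 te te') /=.
have fg := fs_v g; have gV : g^-1 != 0 by rewrite invr_eq0.
have := @tile_cmp (e + v ^~ g) g^-1 _ _ _ F r a (fsD fe fg) gV te'.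
have -> : e + v ^~ g + v ^~ g^-1 = e by apply/funext => p; rewrite !fD vV // addrK.
move=> /(_ te); rewrite sqV => H.
by rewrite mulrC -ler_pdivlMr ?sq_gt0 // mulrC.
Qed.

Lemma tile_uniq e F r a F' r' a' : fs e -> tile (ide e) F r a -> tile (ide e) F' r' a' -> a = a'.
Proof.
have E0 : e + v ^~ 1 = e by apply/funext => p; rewrite fD v1 addr0.
move=> fe t1 t2; apply/eqP; rewrite eq_le; apply/andP; split.
  by have := @tile_cmp e 1 F' r' a' F r a fe (oner_neq0 _) t2; rewrite E0 sq1 mul1r; apply.
by have := @tile_cmp e 1 F r a F' r' a' fe (oner_neq0 _) t1; rewrite E0 sq1 mul1r; apply.
Qed.

Lemma tile_integral e : fs e -> (forall p, 0 <= e p) -> exists F r, tile (ide e) F r (nm e * im qw).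
Proof.
move=> fe e0; have [s sP <-] := reps_ide fe e0; have [F [r tO]] := tile_O.
rewrite O_ide0 in sP; apply: (tile_reps _ _ _ sP tO); [exact: ide_submod|exact: ide_submod|exact: ide_le].
Qed.

(** The principal ideal of an integer has two tiles, one scaled from O_K and one built from the
    index; their areas agree. A general x is first multiplied by a denominator. *)
Lemma nm_v x : x != 0 -> nm (v ^~ x) = sq x.
Proof.
have H y : OO y -> y != 0 -> nm (v ^~ y) = sq y.
  move=> oy y0; have [F [r tO]] := tile_O; have [F' [a' t1 E]] := tile_scale fs0 y0 tO.
  have [|F2 [r2 t2]] := @tile_integral (v ^~ y) (fs_v y); first by move=> p; exact: v_O.
  rewrite add0r E in t1; have := tile_uniq (fs_v y) t1 t2.
  by move/mulIf => -> //; rewrite gt_eqF // im_qw.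
move=> x0; have [N N0 oN] := O_scale x; have N0' := natK_neq0 N0.
apply: (mulfI (nm_neq0 (fs_v N%:R))); rewrite -nmD; [|exact: fs_v|exact: fs_v].
rewrite (H N%:R (O_nat N) N0') -sqM -H ?mulf_neq0 //.
by congr nm; apply/funext => p; rewrite fD vM.
Qed.

(** * Ideal classes *)
Lemma fracNorm_ide e : fs e -> ratr (fracNorm (ide e)) = nm e.
Proof.
move=> fe; rewrite /fracNorm.
have [_ _ [d dP]] := ide_fractional fe.
have : denominator (ide e) (xget 1 (denominator (ide e))).
  exact: (xgetPex 1 (ex_intro _ d dP)).
set c := xget _ _ => -[c0 oc ce].
rewrite rmorphM fmorphV /= !ratr_nat.
have fc := fs_v c.
have H f : fs f -> scale_ideal c (ide f) `<=` OO -> (absNorm (scale_ideal c (ide f)))%:R = nm f * nm (v ^~ c) :> R.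
  move=> ff cf; rewrite scale_ide // absNorm_ide ?nmD //; first exact: fsD.
  move=> p; have [x [x0 xf vx]] := ide_exact p ff.
  have : 0 <= v p (c * x) by apply: v_O; apply: cf; exists x.
  by rewrite vM // vx fD addrC.
have O' : scale_ideal c (ide 0) `<=` OO.
  by move=> _ [x + <-]; rewrite -O_ide0 => ox; exact: OM.
rewrite O_ide0 !H //; last exact: fs0.
by rewrite nm0 mul1r mulfK // nm_neq0.
Qed.

(* Pigeonhole on the points i + j w with 0 <= i, j <= sqrt n, modulo an ideal of index n. *)
Lemma short_vector : exists2 C : R, 0 < C & forall e, fs e -> exists x, [/\ x != 0, ide e x & sq x <= C * nm e].
Proof.
pose C0 : R := 2 * (1 + sq qw).
have q0 := sq_ge0 qw.
have H e : fs e -> (forall p, 0 <= e p) -> exists x, [/\ x != 0, ide e x & sq x <= C0 * nm e].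
  move=> fe e0; have [s [s1 s2 s3 s4] sE] := reps_ide fe e0; have n0 := ltW (nm_gt0 fe).
  pose m := Num.trunc (Num.sqrt (nm e)).
  have mle : m%:R ^+ 2 <= nm e.
    rewrite -[leRHS]sqr_sqrtr // ler_pXn2r ?nnegrE ?ler0n ?sqrtr_ge0 //.
    by rewrite /m truncn_le sqrtr_ge0.
  have sz : (size s < m.+1 * m.+1)%N.
    have h := truncnS_gt (Num.sqrt (nm e)).
    rewrite -(ltr_nat R) sE natrM -[nm e]sqr_sqrtr // expr2.
    by rewrite ltr_pM // sqrtr_ge0.
  pose P (r : 'I_m.+1 * 'I_m.+1) : K := r.1%:R + r.2%:R * qw.
  have oP r : OO (P r) by apply: OD; [exact: O_nat|apply: OM; [exact: O_nat|exact: O_qw]].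
  have /choice[g gP] : forall r, exists c, c \in s /\ ide e (P r - c).
    by move=> r; have [c cs ce] := s4 _ (oP r); exists c.
  have : ~~ injectiveb g.
    apply/negP => /injectiveP gi.
    have : (size (map g (enum {: 'I_m.+1 * 'I_m.+1})) <= size s)%N.
      apply: uniq_leq_size; first by rewrite map_inj_uniq // enum_uniq.
      by move=> _ /mapP[r _ ->]; case: (gP r).
    by rewrite size_map -cardE card_prod !card_ord leqNgt sz.
  case/injectivePn => r [r' rr' gE].
  have [_ h1] := gP r; have [_ h2] := gP r'; have [I0 ID IM] := ide_submod e.
  pose i := r.1%:Z - r'.1%:Z; pose j := r.2%:Z - r'.2%:Z.
  have xE : P r - P r' = i%:~R + j%:~R * qw.
    by rewrite /P /i /j !intrD !rmorphN /= -!pmulrn; ring.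
  have [li lj] : `|i| <= m%:Z /\ `|j| <= m%:Z.
    by have := ltn_ord r.1; have := ltn_ord r.2; have := ltn_ord r'.1; have := ltn_ord r'.2; rewrite /i /j; lia.
  exists (P r - P r'); split.
  - apply/eqP => E; case/eqP: rr'; rewrite E in xE.
    have : im 0 = im (i%:~R + j%:~R * qw) by rewrite -xE.
    have : re 0 = re (i%:~R + j%:~R * qw) by rewrite -xE.
    rewrite reD imD reM imM !re_int !im_int re0 im0 => e1 e2.
    have j0 : j = 0.
      apply/eqP; rewrite -(intr_eq0 R); have w0 := im_qw.
      by apply/eqP; apply: (mulIf (lt0r_neq0 w0)); qlra.
    have i0 : i = 0 by apply/eqP; rewrite -(intr_eq0 R); apply/eqP; move: e1; rewrite j0; qlra.
    by rewrite [r]surjective_pairing [r']surjective_pairing; congr (_, _); apply/val_inj => /=; apply/eqP;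
      [move/eqP: i0|move/eqP: j0]; rewrite subr_eq0 eqz_nat.
  - rewrite (_ : _ - _ = (P r - g r) + (-1) * (P r' - g r')); last by rewrite gE; ring.
    by apply: ID => //; apply: IM => //; apply: ON; exact: O1.
  - rewrite xE sqE reD imD reM imM !re_int !im_int.
    have a1 : (i%:~R : R) ^+ 2 <= m%:R ^+ 2.
      by rewrite -real_normK ?num_real // ler_pXn2r ?nnegrE // -intr_norm -[m%:R]/(m%:Z%:~R) ler_int.
    have b1 : (j%:~R : R) ^+ 2 <= m%:R ^+ 2.
      by rewrite -real_normK ?num_real // ler_pXn2r ?nnegrE // -intr_norm -[m%:R]/(m%:Z%:~R) ler_int.
    apply: (@le_trans _ _ (C0 * m%:R ^+ 2)); last by rewrite ler_wpM2l // /C0; qlra.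
    have b2 : j%:~R ^+ 2 * sq qw <= m%:R ^+ 2 * sq qw by rewrite ler_wpM2r.
    rewrite sqE in b2 q0 *; rewrite /C0 sqE.
    have := sqr_ge0 (i%:~R - j%:~R * re qw : R); have := sqr_ge0 (j%:~R * im qw : R); nra.
exists C0; first by rewrite /C0; qlra.
move=> e fe; have [N [N0 NP]] := ide_bound (fsN fe); have N0' := natK_neq0 N0.
have fN' := fs_v N%:R; have [|x [x0 xe xs]] := H (e + v ^~ N%:R) (fsD fe fN').
  by move=> p; have := NP p; rewrite fN fD; lia.
rewrite -scale_ide // in xe; case: xe xs x0 => y ye <-; rewrite sqM nmD // nm_v //.
rewrite mulrA mulrC ler_pM2r ?sq_gt0 // => ys; rewrite mulf_eq0 negb_or => /andP[_ y0].
by exists y.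
Qed.

Definition integral e := fs e /\ forall p, 0 <= e p.
Lemma integralD e f : integral e -> integral f -> integral (e + f).
Proof. by move=> [fe e0] [ff f0']; split; [exact: fsD|move=> p; rewrite fD addr_ge0]. Qed.
Lemma integral_dl p : integral (dl p).
Proof. by split; [exact: fs_dl|move=> q; rewrite dlE]. Qed.
Lemma integral0' : integral 0.
Proof. by split => //; exact: fs0. Qed.

(** If N p <= n, two of the integers 0, ..., n agree modulo p, so p contains their difference and
    hence n!. *)
Lemma finite_prm (n : nat) : finite_set [set p : prm | (qn p <= n)%N].
Proof.
apply: (@sub_finite_set _ _ [set p : prm | sval p (n`!)%:R]); last first.
  by apply: finite_prm_nat; exact: fact_gt0.
move=> p /= pn; have [s [s1 s2 s3 s4] sE] := reps_prm p.
have /choice[g gP] : forall i : nat, exists c, c \in s /\ sval p (i%:R - c).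
  by move=> i; have [c cs ce] := s4 _ (O_nat i); exists c.
have : ~~ injectiveb (fun i : 'I_n.+1 => g i).
  apply/negP => /injectiveP gi.
  have : (size (map (fun i : 'I_n.+1 => g i) (enum 'I_n.+1)) <= size s)%N.
    apply: uniq_leq_size; first by rewrite map_inj_uniq // enum_uniq.
    by move=> _ /mapP[r _ ->]; case: (gP r).
  by rewrite size_map -cardE card_ord sE ltnNge pn.
case/injectivePn => i [j ij gE].
have hp := prmP p; have oN : OO (-1) by apply: ON; exact: O1.
have key (a b : nat) : (a < b <= n)%N -> g a = g b -> sval p (n`!)%:R.
  move=> /andP[ab bn] E; have d0 : (0 < b - a)%N by rewrite subn_gt0.
  have pd : sval p (b - a)%:R.
    rewrite natrB ?(ltnW ab) // (_ : _ - _ = (b%:R - g b) + (-1) * (a%:R - g a)); last by rewrite E; ring.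
    by apply: (PI_D hp); [case: (gP b)|apply: (PI_M hp) => //; case: (gP a)].
  have /dvdnP[k ->] : (b - a %| n`!)%N by apply: dvdn_fact; rewrite d0 (leq_trans (leq_subr _ _)).
  by rewrite natrM; apply: (PI_M hp) => //; exact: O_nat.
have [h|h|h] := ltngtP i j; last by rewrite (val_inj h) eqxx in ij.
  by apply: (key i j) => //; rewrite h -ltnS ltn_ord.
by apply: (key j i) => //; rewrite h -ltnS ltn_ord.
Qed.

Definition ples (n : nat) : seq prm := enum_fset (fset_set [set p : prm | (qn p <= n)%N]).
Lemma ples_uniq n : uniq (ples n). Proof. exact: fset_uniq. Qed.
Lemma plesE n p : (p \in ples n) = (qn p <= n)%N.
Proof.
rewrite /ples -[LHS]/(p \in fset_set _) in_fset_set; last exact: finite_prm.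
by apply/idP/idP; rewrite inE.
Qed.

Lemma nm_ge_pow e p : integral e -> (2 ^ `|e p|)%:R <= nm e.
Proof.
move=> [fe e0]; pose f q : int := if q == p then e p else 0.
have ff : fs f by apply: (fs_sub fe fs0) => q; rewrite /f; case: eqP => [->|].
apply: (@le_trans _ _ (nm f)); last first.
  by apply: nm_le => // q; rewrite /f; case: eqP => [->|_] //.
rewrite (@nmE [:: p]) //; last by move=> q; rewrite /f inE; case: (q == p) => //; rewrite eqxx.
rewrite big_seq1 /f eqxx; case: (e p) (e0 p) => // n _; rewrite absz_nat -exprnP natrX.
by apply: lerXn2r; rewrite ?nnegrE ?ler0n //; exact: qn_ge2.
Qed.
Lemma nm_ge_qn e p : integral e -> e p != 0 -> (qn p)%:R <= nm e.
Proof.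
move=> [fe e0] ep; rewrite -nm_dl; apply: nm_le => //; first exact: fs_dl.
by move=> q; rewrite dlE; case: eqP => [->|_] //; have := e0 p; move: ep; lia.
Qed.

Lemma finite_ideals (x : R) : finite_set [set e | integral e /\ nm e <= x].
Proof.
pose n := Num.trunc x; pose s := ples n.
pose F (f : {ffun seq_sub s -> 'I_n.+1}) : prm -> int :=
  fun p => if insub p is Some u then (f u)%:Z else 0.
apply: (@sub_finite_set _ _ (F @` setT)); last exact/finite_image/finite_finset.
move=> e [ie ex]; have x1 : 0 <= x by apply: le_trans ex; apply/ltW/nm_gt0; case: ie.
have eb p : (`|e p| < n.+1)%N.
  rewrite ltnS truncn_ge_nat //; apply: le_trans ex; apply: le_trans (nm_ge_pow p ie).
  by rewrite ler_nat ltnW // ltn_expl.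
exists [ffun u : seq_sub s => Ordinal (eb (ssval u))] => //; apply/funext => p; rewrite /F.
have e0 : 0 <= e p by case: ie.
case: insubP => [u us uE|ps]; first by rewrite ffunE /= uE gez0_abs.
apply/eqP; rewrite eq_sym; apply/negPn/negP => ep; case/negP: ps; rewrite plesE truncn_ge_nat //.
exact: le_trans (nm_ge_qn ie ep) ex.
Qed.

Definition idl (x : R) : seq (prm -> int) := enum_fset (fset_set [set e | integral e /\ nm e <= x]).
Lemma idl_uniq x : uniq (idl x). Proof. exact: fset_uniq. Qed.
Lemma idlE x e : (e \in idl x) = `[< integral e /\ nm e <= x >].
Proof.
rewrite /idl -[LHS]/(e \in fset_set _) in_fset_set; last exact: finite_ideals.
by apply/idP/asboolP; rewrite inE.
Qed.
Lemma idlP x e : e \in idl x -> integral e /\ nm e <= x.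
Proof. by rewrite idlE => /asboolP. Qed.

(** A short nonzero x in the ideal e makes x / e integral of norm at most C. So every class is
    represented by the inverse of one of finitely many ideals, and duplicates are removed. *)
Lemma class_reps : exists2 s : seq (prm -> int), (forall f, f \in s -> fs f) /\ uniq s &
  [/\ size s = classNumber K,
      forall e, fs e -> exists2 f, f \in s & exists2 g, g != 0 & e = f + v ^~ g &
      forall f f' g, f \in s -> f' \in s -> g != 0 -> f = f' + v ^~ g -> f = f'].
Proof.
have [C C0 CP] := short_vector.
have [s0 s0P] : exists s0 : seq (prm -> int), forall f, f \in s0 <-> integral f /\ nm f <= C.
  by exists (idl C) => f; rewrite idlE; split => [/asboolP|h]; last exact/asboolP.
pose E (f f' : prm -> int) := `[< exists2 g, g != 0 & f = f' + v ^~ g >].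
have Er f : E f f by apply/asboolP; exists 1; [exact: oner_neq0|apply/funext => p; rewrite fD v1 addr0].
have Es f f' : E f f' -> E f' f.
  move=> /asboolP[g g0 ->]; apply/asboolP; exists g^-1; first by rewrite invr_eq0.
  by apply/funext => p; rewrite !fD vV // addrK.
have Et f1 f2 f3 : E f1 f2 -> E f2 f3 -> E f1 f3.
  move=> /asboolP[g g0 ->] /asboolP[h h0 ->]; apply/asboolP; exists (h * g); first exact: mulf_neq0.
  by apply/funext => p; rewrite !fD vM // addrA.
have [s [sf us sE sU]] : exists s : seq (prm -> int), [/\ forall f, f \in s -> fs f, uniq s,
    forall f, f \in [seq - f | f <- s0] -> exists2 f', f' \in s & E f f' &
    forall f f', f \in s -> f' \in s -> E f f' -> f = f'].
  have : forall f, f \in [seq - f | f <- s0] -> fs f.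
    by move=> _ /mapP[f /s0P[[ff _] _] ->]; exact: fsN.
  elim: [seq - f | f <- s0] => [|f t ih] tf; first by exists [::].
  have [|s [sf us sE sU]] := ih; first by move=> f' h; apply: tf; rewrite inE h orbT.
  have [[f' f's ff']|H] := pselect (exists2 f', f' \in s & E f f').
    by exists s; split => // h; rewrite inE => /orP[/eqP ->|/sE //]; exists f'.
  exists (f :: s); split.
  - by move=> h; rewrite inE => /orP[/eqP ->|/sf //]; apply: tf; rewrite mem_head.
  - by rewrite /= us andbT; apply/negP => fs'; apply: H; exists f.
  - move=> h; rewrite inE => /orP[/eqP ->|/sE[h' h1 h2]]; first by exists f; rewrite ?mem_head.
    by exists h' => //; rewrite inE h1 orbT.
  - move=> h h'; rewrite !inE => /orP[/eqP ->|hs] /orP[/eqP ->|hs'] // e.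
    + by case: H; exists h' => //; apply/asboolP.
    + by case: H; exists h => //; apply/Es/asboolP.
    + by apply: sU => //; apply/asboolP.
have all e : fs e -> exists2 f, f \in s & E e f.
  move=> fe; have [x [x0 xe xC]] := CP _ fe.
  have fi : integral (v ^~ x - e).
    split; first by apply: fsD; [exact: fs_v|exact: fsN].
    by move=> p; rewrite fD fN subr_ge0; case: xe => // /eqP; rewrite (negPf x0).
  have [|f fs' Ef] := sE (- (v ^~ x - e)).
    apply/mapP; exists (v ^~ x - e) => //; apply/s0P; split => //.
    by rewrite nmB ?nm_v ?ler_pdivrMr ?nm_gt0 //; exact: fs_v.
  exists f => //; apply: Et Ef; apply/asboolP; exists x => //.
  by apply/funext => p; rewrite !(fD, fN) opprB subrK.
exists s => //; split; last first.
- by move=> f f' g h1 h2 g0 h; apply: sU => //; apply/asboolP; exists g.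
- by move=> e /all[f fs' /asboolP[g g0 ->]]; exists f => //; exists g.
pose cl f := ideal_class (ide f).
have clE f f' : fs f -> fs f' -> cl f = cl f' <-> E f f'.
  move=> ff ff'; split => [h|/asboolP[g g0 ->]].
    have : cl f (ide f).
      exists 1; rewrite /= ?oner_neq0 // scale_ide ?oner_neq0 //.
      by congr ide; apply/funext => p; rewrite fD v1 addr0.
    rewrite h => -[g /= g0]; rewrite scale_ide // => e; apply/asboolP; exists g => //.
    by apply: ide_inj => //; apply: fsD => //; exact: fs_v.
  apply/seteqP; split => _ [c /= c0 <-].
    exists (g * c); rewrite /= ?mulf_neq0 // !scale_ide ?mulf_neq0 //.
    by congr ide; apply/funext => p; rewrite !fD vM // addrA.
  exists (c / g); rewrite /= ?mulf_neq0 ?invr_eq0 // !scale_ide ?mulf_neq0 ?invr_eq0 //.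
  by congr ide; apply/funext => p; rewrite !fD vM ?invr_eq0 // vV //; ring.
rewrite /classNumber.
have -> : [set ideal_class I | I in @fractional_ideal K] = [set` [fset cl f | f in s]%fset].
  apply/seteqP; split => [_ [I /frac_ide[e fe ->] <-]|_ /imfsetP[f /= fs' ->]].
    have [f fs' Ef] := all _ fe; apply/imfsetP; exists f => //; apply/clE => //; exact: sf.
  by exists (ide f) => //; apply: ide_fractional; exact: sf.
rewrite /ncard set_fsetK card_in_imfset /=; last first.
  by move=> f f' /= h1 h2 /clE h; apply: sU => //; apply: h; exact: sf.
by rewrite undup_id.
Qed.

Definition units : seq K := enum_fset (fset_set [set u : K | [/\ u != 0, OO u & OO u^-1]]).
Lemma unitsP u : (u \in units) = `[< u != 0 /\ v ^~ u = 0 >].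
Proof.
have fin : finite_set [set u : K | [/\ u != 0, OO u & OO u^-1]].
  apply: sub_finite_set (finite_O 1) => {}u [u0 ou ouV]; split => //.
  have [n [_ nE]] := O_nm ou; have [m [_ mE]] := O_nm ouV.
  have : (n * m)%N = 1%N by apply/eqP; rewrite -(eqr_nat R) natrM -nE -mE -sqM mulfV // sq1.
  by move/eqP; rewrite muln_eq1 => /andP[/eqP n1 _]; rewrite nE n1.
rewrite /units -[LHS]/(u \in fset_set _) in_fset_set //.
apply/idP/asboolP; rewrite inE.
  move=> [u0 ou ouV]; split => //; apply/funext => p; apply/eqP; rewrite eq_le v_O // andbT.
  by have := v_O p ouV; rewrite vV // oppr_ge0.
move=> [u0 uv]; have h p : v p u = 0 by have := congr1 (fun f => f p) uv.
split => //; rewrite O_ide0; right => p; rewrite ?vV // h //.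
Qed.
Lemma unitCountE : unitCount K = size units. Proof. by []. Qed.
Lemma unitCount_gt0 : (0 < unitCount K)%N.
Proof.
rewrite unitCountE; have : 1 \in units.
  by rewrite unitsP; apply/asboolP; split; [exact: oner_neq0|apply/funext => p; rewrite v1].
by case: units.
Qed.

(* Uniform in the ideal: reduce to finitely many ideal classes by scaling. *)
Lemma tile_ide : exists2 C : R, 0 < C & forall e, fs e -> exists F, tile (ide e) F (C * Num.sqrt (nm e)) (nm e * im qw).
Proof.
have [s [sf us] [_ sE _]] := class_reps.
have T f : fs f -> exists2 b, 0 < b & exists F, tile (ide f) F (b * Num.sqrt (nm f)) (nm f * im qw).
  move=> ff; have n0 := nm_gt0 ff.
  have [F [r t]] : exists F r, tile (ide f) F r (nm f * im qw).
    have [N [N0 NP]] := ide_bound (fsN ff); have N0' := natK_neq0 N0; have fN' := fs_v N%:R.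
    have [|F [r t]] := @tile_integral (f + v ^~ N%:R) (fsD ff fN').
      by move=> p; have := NP p; rewrite fN fD; lia.
    have gV : N%:R^-1 != 0 :> K by rewrite invr_eq0.
    have [F' [a' t' aE]] := tile_scale (fsD ff fN') gV t.
    have E : f + v ^~ N%:R + v ^~ N%:R^-1 = f by apply/funext => p; rewrite !fD vV // addrK.
    rewrite E in t'; exists F', (r * Num.sqrt (sq N%:R^-1)).
    suff <- : a' = nm f * im qw by [].
    by rewrite aE nmD // nm_v // sqV; field; rewrite sq_eq0.
  have [mF r0 rF aF FU] := t.
  exists ((r + 1) / Num.sqrt (nm f)); first by rewrite divr_gt0 ?sqrtr_gt0 //; qlra.
  exists F; rewrite mulfVK ?gt_eqF ?sqrtr_gt0 //; split => //; first qlra.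
  by move=> z /rF h; apply: le_trans h _; rewrite ler_pXn2r ?nnegrE //; qlra.
have [C C0 CP] : exists2 C, 0 < C & forall f, f \in s -> exists2 b, b <= C & exists F, tile (ide f) F (b * Num.sqrt (nm f)) (nm f * im qw).
  elim: s sf {us sE} => [|f s ih] sf; first by exists 1.
  have [|C C0 CP] := ih; first by move=> h hs; apply: sf; rewrite inE hs orbT.
  have [b b0 bP] := T f (sf f (mem_head _ _)).
  exists (C + b); first qlra.
  move=> h; rewrite inE => /orP[/eqP ->|/CP[b' b1 b2]]; first by exists b => //; qlra.
  by exists b' => //; qlra.
exists C => // e fe; have [f fs' [g g0 E]] := sE _ fe; have [b bC [F t]] := CP _ fs'.
have ff := sf _ fs'; have [F' [a' t' aE]] := tile_scale ff g0 t; rewrite -E in t'.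
have nE : nm e = nm f * sq g by rewrite E nmD ?nm_v //; exact: fs_v.
have [mF r0 rF aF FU] := t'.
have nS : Num.sqrt (nm e) = Num.sqrt (nm f) * Num.sqrt (sq g) by rewrite nE sqrtrM // ltW // nm_gt0.
exists F'; split => //.
- by rewrite mulr_ge0 // ?sqrtr_ge0 // ltW.
- move=> z /rF h; apply: le_trans h _; rewrite nS mulrA; apply: lerXn2r; rewrite ?nnegrE //.
    by rewrite !mulr_ge0 ?sqrtr_ge0 // ltW.
  by do 2 (apply: ler_wpM2r; first exact: sqrtr_ge0).
- by rewrite aF aE nE; congr (_%:E); ring.
Qed.

(** * Counting ideals *)
Lemma pts_asym f : fs f -> exists2 C, 0 <= C & forall t, 0 <= t ->
  `|(size (pts f (t ^+ 2)))%:R - c1 * t ^+ 2 / (nm f * im qw)| <= C * (t + 1).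
Proof.
move=> ff; have [C C0 CP] := tile_ide; have [F tF] := CP _ ff.
set r := C * _ in tF; set a := nm f * _ in tF *.
have a0 : 0 < a by rewrite mulr_gt0 ?nm_gt0 // im_qw.
have r0 : 0 <= r by rewrite mulr_ge0 ?sqrtr_ge0 // ltW.
have c0 := c1_gt0.
exists ((c1 * (2 * r + r ^+ 2 + r ^+ 2)) / a).
  by rewrite divr_ge0 ?(ltW a0) // mulr_ge0 ?(ltW c0) // !addr_ge0 ?sqr_ge0 //; qlra.
move=> t t0; have [h1 h2] := tile_pts ff tF t0.
set n := (size _)%:R in h1 h2 *.
rewrite -(ler_pM2l a0) -[X in X * `|_|](ger0_norm (ltW a0)) -normrM mulrBr.
have an0 : a != 0 by rewrite gt_eqF.
have -> : a * (c1 * t ^+ 2 / a) = c1 * t ^+ 2 by field.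
have -> : a * (c1 * (2 * r + r ^+ 2 + r ^+ 2) / a * (t + 1)) = c1 * (2 * r + r ^+ 2 + r ^+ 2) * (t + 1) by field.
rewrite ler_norml; apply/andP; split; last first.
  have h : 0 <= c1 * (2 * r + 2 * r ^+ 2 * t + r ^+ 2).
    by nneg.
  by nra.
have an : 0 <= a * n by rewrite mulr_ge0 ?ler0n // ltW.
case: (leP r t) => [/h2 h|tr].
  have h' : 0 <= c1 * (2 * r + 2 * r ^+ 2 * t + 3 * r ^+ 2).
    by nneg.
  by nra.
have h3 : c1 * t ^+ 2 <= c1 * r ^+ 2 by rewrite ler_wpM2l ?(ltW c0) //; apply: lerXn2r; rewrite ?nnegrE // ltW.
have h4 : 0 <= c1 * (2 * r * t + 2 * r + 2 * r ^+ 2 * t + r ^+ 2).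
  by nneg.
by nra.
Qed.

(** The density of ideals, that is, the residue of the Dedekind zeta function at 1: [c1] is pi and
    [im qw] is half the square root of the absolute discriminant. *)
Definition rho : R := locked ((classNumber K)%:R * c1 / ((unitCount K)%:R * im qw)).
Lemma rhoE : rho = (classNumber K)%:R * c1 / ((unitCount K)%:R * im qw). Proof. by rewrite /rho -lock. Qed.

Lemma idl_small x : x < 1 -> idl x = [::].
Proof.
move=> x1; case E : (idl x) => [//|e t]; have H : e \in idl x by rewrite E mem_head.
by exfalso; move/idlP: H => [[fe e0] ex]; have := nm_ge1 fe e0; qlra.
Qed.

Definition same_class f e : bool := `[< exists2 g, g != 0 & e = f + v ^~ g >].
Local Notation cl := same_class.
(** The integral ideals in the class of f are f times (g) with g nonzero in the inverse of f, and
    each arises from as many g as there are units. The successor accounts for g = 0. *)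
Lemma fs_class_fiber f (x : R) : fs f -> 0 <= x ->
  (unitCount K * count (cl f) (idl x)).+1%N = size (pts (- f) (x / nm f)).
Proof.
move=> ff x0; have fN' := fsN ff; have n0 := nm_gt0 ff.
pose s := [seq g <- pts (- f) (x / nm f) | g != 0].
have -> : size (pts (- f) (x / nm f)) = (size s).+1.
  have z : 0 \in pts (- f) (x / nm f).
    by rewrite ptsE //; apply/asboolP; split; [left|rewrite (eqP (_ : sq 0 == 0)) ?sq_eq0 // divr_ge0 // ltW].
  by rewrite /s size_filter -(count_predC (pred1 0)) -/(count_mem 0 _) count_uniq_mem ?pts_uniq // z add1n.
congr _.+1.
have im_e g : g \in s -> f + v ^~ g \in idl x.
  rewrite mem_filter ptsE // => /andP[g0 /asboolP[gf gx]]; rewrite idlE; apply/asboolP; split.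
    split; first by apply: fsD => //; exact: fs_v.
    move=> p; rewrite fD; case: gf => [/eqP|/(_ p)]; first by rewrite (negPf g0).
    by rewrite fN; lia.
  by rewrite nmD ?nm_v //; [rewrite mulrC -ler_pdivlMr|exact: fs_v].
pose F g : prm -> int := f + v ^~ g.
transitivity (\sum_(e <- idl x | cl f e) count (fun g => F g == e) s)%N; last first.
  transitivity (\sum_(g <- s) \sum_(e <- idl x | cl f e) (F g == e))%N.
    rewrite [RHS]exchange_big /=; apply: eq_bigr => e _; rewrite -sum1_count big_mkcond /=.
    by apply: eq_bigr => g _; case: (_ == _).
  rewrite -sum1_size; apply: eq_big_seq => g gs.
  have g0 : g != 0 by move: gs; rewrite mem_filter => /andP[].
  have cg : cl f (F g) by apply/asboolP; exists g.
  rewrite big_mkcond (bigD1_seq (F g)) /= ?im_e ?idl_uniq // cg eqxx big1 ?addn0 // => e.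
  by rewrite eq_sym => /negPf ->; case: ifP.
rewrite -sum1_count big_distrr /= -big_filter -[RHS]big_filter; apply: eq_big_seq => e.
rewrite mem_filter => /andP[/asboolP[g g0 E] ex]; rewrite muln1.
have fg := fs_v g.
rewrite unitCountE -size_filter -(size_map (fun u => g * u)); apply/perm_size/uniq_perm.
- by rewrite map_inj_uniq ?fset_uniq // => a b /(mulfI g0).
- by rewrite !filter_uniq // pts_uniq.
move=> y; rewrite !mem_filter; apply/mapP/andP.
  move=> [u]; rewrite unitsP => /asboolP[u0 uv] ->.
  have vE : v ^~ (g * u) = v ^~ g.
    by apply/funext => p; rewrite vM //; have := congr1 (fun h => h p) uv => /= ->; rewrite f0 addr0.
  rewrite /F vE -E eqxx; split => //; rewrite mulf_neq0 //= ptsE //; apply/asboolP.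
  have [ie ne] := idlP ex; split.
    right => p; rewrite fN; have := congr1 (fun h => h p) vE => /= ->.
    by have := ie.2 p; rewrite E fD; lia.
  by rewrite -nm_v ?mulf_neq0 // vE ler_pdivlMr // mulrC -nmD // -E.
rewrite E => -[/eqP h /andP[y0 _]]; exists (y / g); last by rewrite mulrC mulfVK.
rewrite unitsP; apply/asboolP; split; first by rewrite mulf_neq0 ?invr_eq0.
apply/funext => p; rewrite vM ?invr_eq0 // vV //.
by have := congr1 (fun h => h p) h; rewrite !fD => /addrI ->; rewrite subrr.
Qed.

(** Every class contributes a lattice point count with the same main term, whatever its
    representative; this is how the class number becomes a factor of [rho]. *)
Lemma ideal_count : exists2 C, 0 <= C & forall x, 0 <= x -> `|(size (idl x))%:R - rho * x| <= C * Num.sqrt x.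
Proof.
have [s [sf us] [sz sE sU]] := class_reps.
have w0 := im_qw; have c0 := c1_gt0; have u0 : 0 < (unitCount K)%:R :> R by rewrite ltr0n unitCount_gt0.
have H f : fs f -> exists2 C, 0 <= C & forall x, 1 <= x ->
   `|(count (cl f) (idl x))%:R - c1 / ((unitCount K)%:R * im qw) * x| <= C * Num.sqrt x.
  move=> ff; have [C C0 CP] := pts_asym (fsN ff); have n0 := nm_gt0 ff.
  have q0 : 0 <= Num.sqrt (nm f)^-1 by exact: sqrtr_ge0.
  exists ((C * (Num.sqrt (nm f)^-1 + 1) + 1) / (unitCount K)%:R).
    by rewrite divr_ge0 ?ler0n // addr_ge0 // mulr_ge0 // addr_ge0.
  move=> x x1; have x0 : 0 <= x by qlra.
  have xf : 0 <= x / nm f by rewrite divr_ge0 // ltW.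
  have := CP _ (sqrtr_ge0 (x / nm f)); rewrite sqr_sqrtr // -fs_class_fiber //.
  rewrite -[_.+1%:R]natr1 natrM -/(cl f) nmN //.
  rewrite (_ : c1 * (x / nm f) / ((nm f)^-1 * im qw) = c1 * x / im qw); last by field; rewrite !gt_eqF.
  have s1 : 1 <= Num.sqrt x by rewrite -sqrtr1 ler_wsqrtr.
  rewrite sqrtrM // => h.
  rewrite -(ler_pM2l u0) -[X in X * `|_|](ger0_norm (ltW u0)) -normrM mulrBr.
  rewrite (_ : _ * (c1 / _ * x) = c1 * x / im qw); last by field; rewrite !gt_eqF.
  rewrite mulrA [_ * (_ / _)]mulrC mulfVK ?gt_eqF //.
  move: h; set a := _ * (count _ _)%:R; set b := c1 * x / im qw; set q := Num.sqrt (nm f)^-1 in q0 *; set y := Num.sqrt x in s1 *.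
  move=> h; have : C * (y * q + 1) <= C * (q + 1) * y by rewrite -mulrA ler_wpM2l //; nra.
  move: h; rewrite !ler_norml => /andP[h1 h2] h3; apply/andP; split; nra.
have [C C0 CP] : exists2 C, 0 <= C & forall x, 1 <= x -> `|(\sum_(f <- s) count (cl f) (idl x))%:R - (size s)%:R * (c1 / ((unitCount K)%:R * im qw)) * x| <= C * Num.sqrt x.
  elim: s sf {us sz sE sU} => [|f s ih] sf.
    by exists 0 => // x _; rewrite big_nil !mul0r subrr normr0.
  have [|C C0 CP] := ih; first by move=> h hs; apply: sf; rewrite inE hs orbT.
  have [D D0 DP] := H f (sf f (mem_head _ _)).
  exists (C + D); first exact: addr_ge0.
  move=> x x1; rewrite big_cons natrD /= -[(size s).+1]add1n natrD.
  have h2 := CP x x1; have h1 := DP x x1.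
  rewrite (_ : _ - _ = ((count (cl f) (idl x))%:R - c1 / ((unitCount K)%:R * im qw) * x) + ((\sum_(j <- s) count (cl j) (idl x))%:R - (size s)%:R * (c1 / ((unitCount K)%:R * im qw)) * x)); last by ring.
  by apply: le_trans (ler_normD _ _) _; rewrite mulrDl [leRHS]addrC; apply: lerD.
have rE : rho = (size s)%:R * (c1 / ((unitCount K)%:R * im qw)) by rewrite rhoE sz mulrA.
have r0 : 0 <= rho by rewrite rE mulr_ge0 ?ler0n // divr_ge0 ?mulr_ge0 // ltW.
exists (C + rho); first exact: addr_ge0.
move=> x x0; case: (leP 1 x) => [x1|x1].
  have := CP x x1; rewrite -rE.
  have -> : (\sum_(f <- s) count (cl f) (idl x))%N = size (idl x).
    transitivity (\sum_(e <- idl x) \sum_(f <- s) cl f e)%N.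
      rewrite [RHS]exchange_big /=; apply: eq_bigr => f _; rewrite -sum1_count big_mkcond /=.
      by apply: eq_bigr => e _; case: (cl f e).
    rewrite -sum1_size; apply: eq_big_seq => e ex; have [[fe e0] _] := idlP ex.
    have [f fs' fE] := sE _ fe; rewrite (bigD1_seq f) //= (_ : cl f e = true); last exact/asboolP.
    rewrite big1_seq ?addn0 // => f' /andP[ff' fs'']; apply/eqP; rewrite eqb0.
    apply/asboolP => -[g' g0' E']; case/eqP: ff'; case: fE => g g0 E.
    apply: (sU _ _ (g / g')) => //; first by rewrite mulf_neq0 ?invr_eq0.
    apply/funext => p; rewrite fD vM ?invr_eq0 // vV //.
    move: (congr1 (fun h => h p) E') (congr1 (fun h => h p) E); rewrite /= !fD => -> /=.
    by move: (f p) (f' p) (v p g) (v p g') => z1 z2 z3 z4; clear; lia.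
  by move/le_trans; apply; rewrite mulrDl lerDl mulr_ge0 // sqrtr_ge0.
rewrite idl_small // (_ : (size [::])%:R = 0) // sub0r normrN ger0_norm; last by rewrite mulr_ge0.
rewrite [leRHS]mulrDl.
have sx : x <= Num.sqrt x.
  have q0 := sqrtr_ge0 x; have qE := sqr_sqrtr x0.
  have : Num.sqrt x <= 1 by rewrite -sqrtr1 ler_wsqrtr // ltW.
  by nra.
have : rho * x <= rho * Num.sqrt x by rewrite ler_wpM2l.
by have : 0 <= C * Num.sqrt x by [rewrite mulr_ge0 // sqrtr_ge0]; qlra.
Qed.

Lemma rho_gt0 : 0 < rho.
Proof.
have [s [sf us] [sz sE sU]] := class_reps.
have h : (0 < classNumber K)%N by rewrite -sz; have [f] := sE _ fs0; case: (s).
by rewrite rhoE divr_gt0 ?mulr_gt0 ?ltr0n ?unitCount_gt0 ?c1_gt0 ?im_qw.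
Qed.

Lemma nm_nat e : integral e -> exists2 n : nat, (0 < n)%N & nm e = n%:R.
Proof.
move=> [fe e0]; exists (absNorm (ide e)); last by rewrite absNorm_ide.
by rewrite -(ltr_nat R) absNorm_ide // nm_gt0.
Qed.

Lemma idl_trunc x : 0 <= x -> idl x = idl (Num.trunc x)%:R.
Proof.
move=> x0; rewrite /idl; congr (enum_fset (fset_set _)); apply/seteqP; split => e [ie h]; split => //;
have [n n0 nE] := nm_nat ie; move: h; rewrite nE ler_nat truncn_ge_nat //.
Qed.

Lemma sum_idl (G : R -> R) (n : nat) :
  \sum_(e <- idl n%:R) G (nm e) = \sum_(i < n) ((size (idl i.+1%:R))%:R - (size (idl i%:R))%:R) * G i.+1%:R.
Proof.
elim: n => [|n ih].
  rewrite big_ord0 big_seq big1 // => e /idlP[[fe e0] h].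
  by have := nm_ge1 fe e0; qlra.
rewrite big_ord_recr /= -ih.
have P : perm_eq (idl n.+1%:R) (idl n%:R ++ [seq e <- idl n.+1%:R | nm e == n.+1%:R]).
  apply: uniq_perm; first exact: idl_uniq.
    rewrite cat_uniq !idl_uniq filter_uniq ?idl_uniq // andbT /=.
    apply/hasPn => e; rewrite mem_filter => /andP[/eqP E _]; apply/negP => /idlP[_].
    by rewrite E ler_nat ltnn.
  move=> e; rewrite mem_cat mem_filter !idlE.
  apply/asboolP/orP => [[ie h]|[/asboolP[ie h]|/andP[_ /asboolP//]]].
    have [m m0 mE] := nm_nat ie; have hm : (m <= n.+1)%N by move: h; rewrite mE ler_nat.
    move: hm; rewrite leq_eqVlt => /orP[/eqP E|lt].
      by right; rewrite mE E eqxx /=; apply/asboolP; split => //; rewrite mE E.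
    by left; apply/asboolP; rewrite mE ler_nat.
  by split => //; apply: le_trans h _; rewrite ler_nat.
rewrite (perm_big _ P) big_cat /=; congr (_ + _).
rewrite (perm_size P) size_cat natrD addrC addKr big_filter.
rewrite (eq_bigr (fun=> G n.+1%:R)); last by move=> e /eqP ->.
by rewrite size_filter -big_filter big_const_seq count_predT size_filter iter_addr_0 mulr_natl.
Qed.

Lemma sum_idl_compare : exists2 C, 0 <= C & forall (g : nat -> R) n, (forall i, 0 <= g i) -> (forall i, g i.+1 <= g i) ->
  forall G, (forall i, G i.+1%:R = g i) ->
  `|\sum_(e <- idl n%:R) G (nm e) - rho * \sum_(i < n) g i| <= C * \sum_(i < n) g i / Num.sqrt i.+1%:R.
Proof.
have [C C0 CP] := ideal_count; exists C => // g n g0 gd G GE.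
rewrite sum_idl; under eq_bigr do rewrite GE.
apply: (@sum_compare (fun i => (size (idl i%:R))%:R)) => //; last by move=> i; exact: CP.
by rewrite idl_small.
Qed.

(** The error in [sum_idl_compare] carries an additional 1 / sqrt i, so it sums to O(ln^k Z), one
    logarithm below the main term. *)
Lemma sum_idl_inv_lnX k : exists2 C, 0 <= C & forall Z, 1 <= Z ->
  `|\sum_(e <- idl Z) (nm e)^-1 * lnp (Z / nm e) ^+ k - rho * ln Z ^+ k.+1 / k.+1%:R| <= C * ln Z ^+ k.
Proof.
have [C C0 CP] := sum_idl_compare; have r0 := ltW rho_gt0.
exists (rho + C * 3); first by rewrite addr_ge0 // mulr_ge0.
move=> Z Z1; have Z0 : 0 <= Z by qlra.
have l0 : 0 <= ln Z by exact: ln_ge0.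
set n := Num.trunc Z; have /andP[n1 n2] := truncn_itv Z0; rewrite -/n in n1 n2.
have n0 : (0 < n)%N by rewrite truncn_gt0.
pose G (x : R) := x^-1 * lnp (Z / x) ^+ k; pose g i := G i.+1%:R.
have pos i : 0 < i.+1%:R :> R by rewrite ltr0n.
have lp i : 0 <= lnp (Z / i.+1%:R) ^+ k by rewrite exprn_ge0 // lnp_ge0.
have g0 i : 0 <= g i by rewrite /g /G mulr_ge0 // invr_ge0 ltW.
have gd i : g i.+1 <= g i.
  rewrite /g /G; apply: ler_pM => //; rewrite ?invr_ge0 ?(ltW (pos _)) //.
    by rewrite lef_pV2 ?posrE // ler_nat.
  apply: lerXn2r; rewrite ?nnegrE ?lnp_ge0 //; apply: lnp_le; first by rewrite divr_gt0 //; qlra.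
  by rewrite ler_wpM2l // lef_pV2 ?posrE // ler_nat.
have := CP g n g0 gd G (fun i => erefl); rewrite /n -idl_trunc // -/n => h.
have /andP[h1 h2] := sum_lnpX k n0 n1 n2.
have gE : \sum_(i < n) g i = \sum_(i < n) lnp (Z / i.+1%:R) ^+ k / i.+1%:R.
  by apply: eq_bigr => i _; rewrite /g /G mulrC.
have h3 : C * \sum_(i < n) g i / Num.sqrt i.+1%:R <= C * 3 * ln Z ^+ k.
  rewrite -mulrA ler_wpM2l //; apply: (@le_trans _ _ (\sum_(i < n) i.+1%:R^-1 / Num.sqrt i.+1%:R * ln Z ^+ k)).
    apply: ler_sum => i _; rewrite /g /G mulrAC; apply: ler_wpM2l.
      by rewrite mulr_ge0 // invr_ge0 ?sqrtr_ge0 // ltW.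
    apply: lerXn2r; rewrite ?nnegrE ?lnp_ge0 // -lnpE //; apply: lnp_le; first by rewrite divr_gt0 //; qlra.
    by rewrite ler_pdivrMr // ler_peMr // ler1n.
  by rewrite -mulr_suml ler_wpM2r ?exprn_ge0 // sum_inv32.
rewrite -gE in h1 h2.
have h4 : `|rho * (\sum_(i < n) g i - ln Z ^+ k.+1 / k.+1%:R)| <= rho * ln Z ^+ k.
  by rewrite normrM (ger0_norm r0) (ger0_norm h1) ler_wpM2l.
rewrite (_ : _ - _ = (\sum_(e <- idl Z) G (nm e) - rho * \sum_(i < n) g i) + rho * (\sum_(i < n) g i - ln Z ^+ k.+1 / k.+1%:R)); last by rewrite /G; ring.
apply: le_trans (ler_normD _ _) _; rewrite mulrDl addrC; apply: lerD => //.
exact: le_trans h h3.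
Qed.

Lemma sum_idl_inv : exists2 C, 0 <= C & forall x, 1 <= x -> \sum_(e <- idl x) (nm e)^-1 <= C * (1 + ln x).
Proof.
have [C C0 CP] := sum_idl_inv_lnX 0; have r0 := ltW rho_gt0.
exists (rho + C); first exact: addr_ge0.
move=> x x1; have := CP x x1; rewrite expr0 expr1 mulr1 divr1 ler_norml => /andP[_ h].
have l0 := ln_ge0 x1; have E : \sum_(e <- idl x) (nm e)^-1 * lnp (x / nm e) ^+ 0 = \sum_(e <- idl x) (nm e)^-1.
  by apply: eq_bigr => e _; rewrite expr0 mulr1.
by rewrite E in h; nra.
Qed.

Lemma nm_idl_gt0 x e : e \in idl x -> 0 < nm e.
Proof. by move/idlP => [[fe _] _]; exact: nm_gt0. Qed.
Lemma nm_idl_ge1 x e : e \in idl x -> 1 <= nm e.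
Proof. by move/idlP => [[fe e0] _]; exact: nm_ge1. Qed.


Lemma ler_sum_sub (T : eqType) (s t : seq T) (f : T -> R) : uniq s -> uniq t -> {subset s <= t} ->
  (forall x, x \in t -> 0 <= f x) -> \sum_(x <- s) f x <= \sum_(x <- t) f x.
Proof.
move=> us ut st f0; have P : perm_eq t (s ++ [seq x <- t | x \notin s]).
  apply: uniq_perm => //.
    by rewrite cat_uniq us filter_uniq // andbT; apply/hasPn => x; rewrite mem_filter => /andP[].
  move=> x; rewrite mem_cat mem_filter; case: (boolP (x \in s)) => //=; exact: st.
rewrite (perm_big _ P) big_cat /= lerDl big_filter big_seq_cond.
by apply: sumr_ge0 => x /andP[/f0].
Qed.

(** The logarithms of a b and a / 2 differ by O(1 + ln b), so the position a drops out. Subtracting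
    the sum up to a / 2, not a, keeps the ideals of norm exactly a. *)
Lemma sum_idl_window : exists2 C, 0 <= C & forall B a b, 0 < a -> 1 <= b ->
  \sum_(e <- idl B | a <= nm e <= a * b) (nm e)^-1 <= C * (1 + ln b).
Proof.
have [C C0 CP] := sum_idl_inv_lnX 0; have r0 := ltW rho_gt0.
exists (2 * C + rho); first by rewrite addr_ge0 // mulr_ge0.
have H x : 1 <= x -> `|\sum_(e <- idl x) (nm e)^-1 - rho * ln x| <= C.
  move=> x1; have := CP x x1; rewrite expr0 expr1 mulr1 divr1.
  by under eq_bigr do rewrite expr0 mulr1.
move=> B a b a0 b1; have lb := ln_ge0 b1.
have l2 : ln 2 <= 1 :> R by have := @le_ln1Dx R 1; rewrite (_ : 1 + 1 = 2) //; apply.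
have i0 x e : e \in idl x -> 0 <= (nm e)^-1 by move/nm_idl_gt0 => h; rewrite invr_ge0 ltW.
pose w := [seq e <- idl B | a <= nm e <= a * b]; rewrite -big_filter -/w.
have uw : uniq w by rewrite filter_uniq // idl_uniq.
have wE e : e \in w -> [/\ integral e, a <= nm e & nm e <= a * b].
  by rewrite mem_filter => /andP[/andP[h1 h2] /idlP[]].
have sw : {subset w <= idl (a * b)} by move=> e /wE[h1 h2 h3]; rewrite idlE; apply/asboolP.
have ab : a <= a * b by rewrite ler_peMr // ltW.
have lnab : 1 <= a -> ln (a * b) = ln a + ln b by move=> a1; rewrite lnM ?posrE //; qlra.
have step := ler_sum_sub uw (idl_uniq _) sw (@i0 _).
have rl : 0 <= rho * ln b by rewrite mulr_ge0.
case: (ltP (a * b) 1) => [ab1|ab1].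
  apply: le_trans step _; rewrite idl_small // big_nil; nra.
have := H _ ab1; rewrite ler_norml => /andP[_ h].
case: (ltP a 2) => [a2|a2].
  apply: le_trans step _; apply: (@le_trans _ _ (rho * ln (a * b) + C)); first by qlra.
  have : ln (a * b) <= ln 2 + ln b.
    have b0 : 0 < b by qlra.
    by rewrite -lnM ?posrE // ler_ln ?posrE ?mulr_gt0 // ler_wpM2r // ltW.
  by move=> h3; have : rho * ln (a * b) <= rho * (1 + ln b) by [rewrite ler_wpM2l //; qlra]; nra.
have h2 : 1 <= a / 2 by qlra.
have := H _ h2; rewrite ler_norml => /andP[h3 _].
have L : \sum_(e <- w ++ idl (a / 2)) (nm e)^-1 <= \sum_(e <- idl (a * b)) (nm e)^-1.
  apply: ler_sum_sub; [|exact: idl_uniq| |exact: i0].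
    rewrite cat_uniq uw idl_uniq andbT /=; apply/hasPn => e /idlP[_ h4]; apply/negP => /wE[_ h5 _]; qlra.
  move=> e; rewrite mem_cat => /orP[/sw//|/idlP[h4 h5]]; rewrite idlE; apply/asboolP; split => //; qlra.
rewrite big_cat /= in L.
have E : ln (a * b) = ln 2 + ln (a / 2) + ln b.
  have b0 : 0 < b by qlra.
  rewrite -[LHS]/(ln (a * b)) -lnM ?posrE //; last qlra.
  by rewrite -lnM ?posrE //; [congr ln; field|qlra].
rewrite E in h; move: L h h3; set x := \sum_(i <- w) _; set y := \sum_(e <- idl (a / 2)) _; set z := \sum_(e <- _) _ => L h h3.
have : rho * ln 2 <= rho by rewrite ler_piMr.
by nra.
Qed.

Lemma sum_idl_r43 : exists2 C, 0 <= C & forall x, 0 <= x -> \sum_(e <- idl x) (r4 (nm e) ^+ 3)^-1 <= C * r4 x.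
Proof.
have [C C0 CP] := sum_idl_compare; have r0 := ltW rho_gt0.
exists ((rho + C) * 4); first by rewrite mulr_ge0 // addr_ge0.
move=> x x0; rewrite idl_trunc //; set n := Num.trunc x.
pose g i := (r4 i.+1%:R ^+ 3)^-1.
have g0 i : 0 <= g i by rewrite invr_ge0 exprn_ge0 // r4_ge0.
have gd i : g i.+1 <= g i.
  have h j : 0 < r4 j.+1%:R ^+ 3 by rewrite exprn_gt0 // r4_gt0 // ltr0n.
  rewrite lef_pV2 ?posrE //; apply: lerXn2r; rewrite ?nnegrE ?r4_ge0 //.
  by apply: r4_le; rewrite ler_nat.
have := CP g n g0 gd (fun y => (r4 y ^+ 3)^-1) (fun i => erefl); rewrite ler_norml => /andP[_ h].
have h1 : \sum_(i < n) g i / Num.sqrt i.+1%:R <= \sum_(i < n) g i.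
  apply: ler_sum => i _; rewrite ler_pdivrMr ?sqrtr_gt0 ?ltr0n // ler_peMr //.
  by rewrite -[leLHS]sqrtr1 ler_wsqrtr // ler1n.
have h2 := sum_r4 n; have h3 : r4 n%:R <= r4 x by apply: r4_le; have /andP[] := truncn_itv x0.
move: h h1 h2; set c := \sum_(i < n) (g i / _); set b := \sum_(i < n) g i; rewrite -/(g _) => h h1 h2.
have {}h : \sum_(e <- idl n%:R) (r4 (nm e) ^+ 3)^-1 - rho * b <= C * c by [].
have {}h2 : b <= 4 * r4 n%:R by [].
move: h h1 h2; move: (\sum_(e <- _) _) b c => a b c h h1 h2.
have h4 : rho * b <= rho * (4 * r4 x) by rewrite ler_wpM2l //; qlra.
have h5 : C * c <= C * (4 * r4 x) by rewrite ler_wpM2l //; qlra.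
by qlra.
Qed.

(** * Moebius inversion on supports *)
Fixpoint tups (T : Type) (l : seq T) n : seq (seq T) :=
  if n is m.+1 then [seq a :: s | a <- l, s <- tups l m] else [:: [::]].

Lemma tupsE (T : eqType) (l : seq T) n s : (s \in tups l n) = (size s == n) && all (mem l) s.
Proof.
elim: n s => [|n ih] [|c s] //=; first by apply/allpairsP => -[[a b] [_ _]].
rewrite eqSS andbCA -ih; apply/allpairsP/andP => [[[a b] /= [h1 h2 [-> ->]]]|[h1 h2]] //.
by exists (c, s).
Qed.
Lemma tups_uniq (T : eqType) (l : seq T) n : uniq l -> uniq (tups l n).
Proof. by move=> ul; elim: n => //= n ih; apply: allpairs_uniq => // -[a b] [c d] _ _ [-> ->]. Qed.
Lemma sum_tupsS (T : Type) (l : seq T) n (G : seq T -> R) :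
  \sum_(s <- tups l n.+1) G s = \sum_(c <- l) \sum_(s <- tups l n) G (c :: s).
Proof. by rewrite /= big_allpairs_dep. Qed.
Lemma sum_tups0 (T : Type) (l : seq T) (G : seq T -> R) : \sum_(s <- tups l 0) G s = G [::].
Proof. by rewrite big_seq1. Qed.

Local Notation bits := (tups [:: false; true]).
Lemma sum_bitsS n (G : seq bool -> R) :
  \sum_(b <- bits n.+1) G b = \sum_(b <- bits n) G (false :: b) + \sum_(b <- bits n) G (true :: b).
Proof. by rewrite sum_tupsS !big_cons big_nil addr0. Qed.

(* Moebius inversion on the lattice of subsets: h = sum of [mob h] over smaller subsets. *)
Fixpoint mob (h : seq bool -> R) (b : seq bool) : R :=
  if b is c :: b' then
    (if c then mob (fun s => h (true :: s)) b' - mob (fun s => h (false :: s)) b' else mob (fun s => h (false :: s)) b')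
  else h [::].
Lemma mobB h h' b : mob (fun s => h s - h' s) b = mob h b - mob h' b.
Proof. by elim: b h h' => [//|[] b ih] h h' /=; rewrite !ih //; ring. Qed.

(** If n coordinates are set independently with probability x, the right side is the mean of h
    sorted by the exact pattern, the left side the same mean expanded over the events that all
    coordinates in b are set. With x = 1/q this gives the Euler factor. *)
Lemma mob_sum n h (x : R) : \sum_(b <- bits n) mob h b * x ^+ count id b =
  \sum_(b <- bits n) h b * (x ^+ count id b * (1 - x) ^+ (n - count id b)).
Proof.
elim: n h => [|n ih] h; first by rewrite !sum_tups0 /= expr0 !mulr1.
rewrite !sum_bitsS /= -[RHS]addrC.
have -> : \sum_(b <- bits n) h (false :: b) * (x ^+ (0 + count id b) * (1 - x) ^+ (n.+1 - (0 + count id b))) =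
   (1 - x) * \sum_(b <- bits n) h (false :: b) * (x ^+ count id b * (1 - x) ^+ (n - count id b)).
  rewrite mulr_sumr; apply: eq_big_seq => b; rewrite tupsE add0n => /andP[/eqP bn _].
  by rewrite subSn ?exprS; [ring|rewrite -bn count_size].
have -> : \sum_(b <- bits n) h (true :: b) * (x ^+ (1 + count id b) * (1 - x) ^+ (n.+1 - (1 + count id b))) =
   x * \sum_(b <- bits n) h (true :: b) * (x ^+ count id b * (1 - x) ^+ (n - count id b)).
  by rewrite mulr_sumr; apply: eq_bigr => b _; rewrite !add1n subSS exprS; ring.
rewrite -!ih; under [X in _ + X]eq_bigr do rewrite add1n exprS mulrBl.
rewrite sumrB mulrBl mul1r.
have H g : \sum_(b <- bits n) mob g b * (x * x ^+ count id b) = x * \sum_(b <- bits n) mob g b * x ^+ count id b.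
  by rewrite mulr_sumr; apply: eq_bigr => b _; ring.
by rewrite !H; ring.
Qed.

Lemma mob_le h b : (forall s, `|h s| <= 1) -> `|mob h b| <= 2 ^+ size b.
Proof.
elim: b h => [|c b ih] h h1; first by rewrite expr0; exact: h1.
have [h2 h3] : `|mob (fun s => h (true :: s)) b| <= 2 ^+ size b /\ `|mob (fun s => h (false :: s)) b| <= 2 ^+ size b by split; exact: ih.
have p0 : 0 <= 2 ^+ size b :> R by rewrite exprn_ge0.
rewrite /= exprS; case: c; last by qlra.
by apply: le_trans (ler_normB _ _) _; qlra.
Qed.

Definition supp p (s : seq (prm -> int)) : seq bool := [seq e p != 0 | e <- s].
Definition shift p (b : seq bool) (s : seq (prm -> int)) :=
  [seq if x.1 then x.2 + dl p else x.2 | x <- zip b s].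

(** An ideal divisible by p is p times an ideal; the truncation at X does no harm because f vanishes
    beyond it. *)
Lemma sum_idl_dvd X p (f : (prm -> int) -> R) : (forall e, integral e -> X < nm e -> f e = 0) ->
  \sum_(e <- idl X) (e p != 0)%:R * f e = \sum_(e <- idl X) f (e + dl p).
Proof.
move=> H; rewrite [RHS](bigID (fun e => nm (e + dl p) <= X)) /= [X in _ = _ + X]big1_seq ?addr0; last first.
  move=> e /andP[h /idlP[ie _]]; apply: H; first by apply: integralD => //; exact: integral_dl.
  by rewrite ltNge.
rewrite (bigID (fun e => e p != 0)) /= [X in _ + X]big1 ?addr0; last by move=> e /negPf ->; rewrite mul0r.
under eq_bigr => e h do rewrite h mul1r.
have injD : injective (fun e : prm -> int => e + dl p) by move=> a b /addIr.
rewrite -[RHS]big_filter -[LHS]big_filter -[RHS](big_map (fun e => e + dl p) predT f); apply: perm_big.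
apply: uniq_perm; [by rewrite filter_uniq // idl_uniq|by rewrite map_inj_uniq // filter_uniq // idl_uniq|].
move=> e; rewrite mem_filter; apply/andP/mapP.
  move=> [ep /idlP[[fe e0] h]].
  exists (e - dl p); last by rewrite subrK.
  rewrite mem_filter subrK h idlE; apply/asboolP.
  have fe' : fs (e - dl p) by apply: fsD => //; exact/fsN/fs_dl.
  split; first split => //.
    by move=> r; rewrite fD fN dlE; case: eqP => [->|_]; have := e0 r; have := e0 p; move: ep; lia.
  apply: le_trans h; apply: nm_le => // r; rewrite fD fN dlE; case: eqP => _; lia.
move=> [f']; rewrite mem_filter => /andP[h /idlP[[ff' f0'] _]] ->; rewrite fD dlE eqxx; split.
  by have := f0' p; lia.
rewrite idlE; apply/asboolP; split => //; apply: integralD => //; exact: integral_dl.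
Qed.

Lemma integral_tups X n s : s \in tups (idl X) n -> forall e, e \in s -> integral e.
Proof. by rewrite tupsE => /andP[_ /allP h] e /h /idlP[]. Qed.

Lemma size_shift p b s : size b = size s -> size (shift p b s) = size s.
Proof. by move=> h; rewrite size_map size_zip h minnn. Qed.
Lemma integral_shift p b s : (forall e, e \in s -> integral e) -> forall e, e \in shift p b s -> integral e.
Proof.
elim: s b => [|e s ih] [|c b] //= h f.
have is' : forall e', e' \in s -> integral e' by move=> e' he; apply: h; rewrite inE he orbT.
rewrite inE => /orP[/eqP ->|/ih]; last by apply.
by case: c; rewrite ?[integral _]/(integral _) /=; [apply: integralD; [apply: h; rewrite mem_head|exact: integral_dl]|apply: h; rewrite mem_head].
Qed.

(** Makes the finite range [idl X] behave like the set of all ideals when the arguments are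
    multiplied by primes. *)
Definition vanishes X n (f : seq (prm -> int) -> R) := forall s, size s = n ->
  (forall e, e \in s -> integral e) -> (exists2 e, e \in s & X < nm e) -> f s = 0.

Lemma mobius_step X n p (f : seq (prm -> int) -> R) h : vanishes X n f ->
  \sum_(s <- tups (idl X) n) f s * h (supp p s) =
  \sum_(b <- bits n) mob h b * \sum_(s <- tups (idl X) n) f (shift p b s).
Proof.
elim: n f h => [|n ih] f h H; first by rewrite !sum_tups0 /= mulrC.
have He e : integral e -> vanishes X n (fun s => f (e :: s)).
  move=> ie s sn si [e' h1 h2]; apply: H; first by rewrite /= sn.
    by move=> e''; rewrite inE => /orP[/eqP ->//|]; exact: si.
  by exists e' => //; rewrite inE h1 orbT.
pose h1 s := h (true :: s) - h (false :: s).
pose g (k : seq bool -> R) e := \sum_(b <- bits n) mob k b * \sum_(s <- tups (idl X) n) f (e :: shift p b s).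
transitivity (\sum_(e <- idl X) (g (fun s => h (false :: s)) e + (e p != 0)%:R * g h1 e)).
  rewrite sum_tupsS; apply: eq_big_seq => e /idlP[ie _].
  have Eg k : g k e = \sum_(s <- tups (idl X) n) f (e :: s) * k (supp p s) by rewrite (ih _ k (He _ ie)).
  rewrite !Eg mulr_sumr -big_split; apply: eq_bigr => s _ /=.
  by rewrite /h1; case: (e p != 0); rewrite ?mul1r ?mul0r; ring.
rewrite big_split /= sum_idl_dvd; last first.
  move=> e ie hX; rewrite /g big_seq big1 // => b; rewrite tupsE => /andP[/eqP bn _].
  rewrite big_seq big1 ?mulr0 // => s hs; apply: (H).
  - by move: hs; rewrite tupsE => /andP[/eqP sn _]; rewrite /= size_shift sn.
  - move=> e'; rewrite inE => /orP[/eqP ->//|]; apply: integral_shift; exact: integral_tups hs.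
  - by exists e; rewrite ?mem_head.
rewrite sum_bitsS; congr (_ + _); rewrite /g exchange_big /=; apply: eq_bigr => b _.
  by rewrite sum_tupsS mulr_sumr.
by rewrite mobB sum_tupsS mulr_sumr.
Qed.

Definition theta (h : R -> seq bool -> R) (P : seq prm) s : R := \prod_(p <- P) h (qn p)%:R (supp p s).
Definition vals (lam : seq R) (s : seq (prm -> int)) : seq R := [seq x.1 * nm x.2 | x <- zip lam s].
Definition ppow (q : R) (b : seq bool) (lam : seq R) : seq R := [seq (if x.1 then q else 1) * x.2 | x <- zip b lam].
(** The factor by which the error is required to decrease under a dilation by lambda: lambda^(-3/4)
    in each coordinate, against 1 / lambda in the main term. *)
Definition wt (lam : seq R) : R := \prod_(x <- lam) (r4 x ^+ 3)^-1.

Lemma vals_shift p b lam s : size b = size s -> size lam = size s -> (forall e, e \in s -> integral e) ->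
  vals lam (shift p b s) = vals (ppow (qn p)%:R b lam) s.
Proof.
elim: s b lam => [|e s ih] [|c b] [|x lam] //= [bs] [ls] h.
congr (_ :: _); last by apply: ih => // e' he; apply: h; rewrite inE he orbT.
have [fe _] := h e (mem_head _ _).
by case: c => /=; rewrite ?nmD ?nm_dl ?mul1r //; [ring|exact: fs_dl].
Qed.

Lemma theta_shift h P p b s : p \notin P -> size b = size s -> theta h P (shift p b s) = theta h P s.
Proof.
move=> pP bs; apply: eq_big_seq => r rP; congr (h _ _).
have rp : r != p by apply: contraNneq pP => <-.
elim: s b bs => [|e s ih] [|c b] //= [bs]; congr (_ :: _); last exact: ih.
by case: c => //; rewrite fD dlE (negPf rp) addr0.
Qed.

Lemma wt_ppow q b lam : 1 <= q -> size b = size lam -> wt (ppow q b lam) = (r4 q ^+ 3)^-1 ^+ count id b * wt lam.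
Proof.
move=> q1; have q0 : 0 <= q by qlra.
elim: b lam => [|c b ih] [|x lam] //=; first by rewrite /wt !big_nil expr0 mulr1.
move=> [bs]; rewrite /wt /= !big_cons -!/(wt _) ih //; case: c => /=; last by rewrite mul1r add0n mulrCA.
by rewrite r4M // exprMn invfM add1n [_ ^+ (count id b).+1]exprS; ring.
Qed.
Lemma prod_ppow q b lam : size b = size lam ->
  (\prod_(x <- ppow q b lam) x)^-1 = q^-1 ^+ count id b * (\prod_(x <- lam) x)^-1.
Proof.
elim: b lam => [|c b ih] [|x lam] //=; first by rewrite !big_nil expr0 mul1r.
move=> [bs]; rewrite /= !big_cons !invfM ih //; case: c => /=; last by rewrite invr1 mul1r add0n mulrCA.
by rewrite add1n exprS; ring.
Qed.
Lemma size_ppow q b lam : size b = size lam -> size (ppow q b lam) = size lam.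
Proof. by move=> h; rewrite size_map size_zip h minnn. Qed.
Lemma ppow_ge1 q b lam : 1 <= q -> (forall x, x \in lam -> 1 <= x) -> forall x, x \in ppow q b lam -> 1 <= x.
Proof.
move=> q1; elim: b lam => [|c b ih] [|x lam] //= h y.
have h' z : z \in lam -> 1 <= z by move=> hz; apply: h; rewrite inE hz orbT.
rewrite inE => /orP[/eqP ->|]; last exact: ih.
have x1 := h x (mem_head _ _); case: c => /=; rewrite ?mul1r //; nra.
Qed.

(** Inserting the weights at one prime of norm q multiplies the main term by [euler_loc] and the
    error bound by [euler_err]; a division by the prime counts 1/q in the former, but only q^(-3/4)
    in the latter. *)
Definition euler_loc n (h : R -> seq bool -> R) q : R := \sum_(b <- bits n) mob (h q) b * q^-1 ^+ count id b.
Definition euler_err n (h : R -> seq bool -> R) q : R := \sum_(b <- bits n) `|mob (h q) b| * (r4 q ^+ 3)^-1 ^+ count id b.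

(* Once the sum of F(lambda eta) is known for every dilation lambda, the local weights h can be
   inserted one prime at a time. *)
Lemma prime_induction X n (F : seq R -> R) (A E : R) (h : R -> seq bool -> R) :
  (forall lam, size lam = n -> (forall x, x \in lam -> 1 <= x) -> vanishes X n (fun s => F (vals lam s))) ->
  (forall lam, size lam = n -> (forall x, x \in lam -> 1 <= x) ->
    `|\sum_(s <- tups (idl X) n) F (vals lam s) - A * (\prod_(x <- lam) x)^-1| <= E * wt lam) ->
  forall P, uniq P -> forall lam, size lam = n -> (forall x, x \in lam -> 1 <= x) ->
    `|\sum_(s <- tups (idl X) n) F (vals lam s) * theta h P s
       - A * \prod_(p <- P) euler_loc n h (qn p)%:R * (\prod_(x <- lam) x)^-1|
      <= E * \prod_(p <- P) euler_err n h (qn p)%:R * wt lam.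
Proof.
move=> van base; elim=> [|p P ih] /= => [_ lam ln l1|/andP[pP uP] lam ln l1].
  rewrite !big_nil !mulr1; under eq_bigr do rewrite /theta big_nil mulr1.
  exact: base.
have q1 := qn_ge1 p; set q := (qn p)%:R in q1 *.
have step : \sum_(s <- tups (idl X) n) F (vals lam s) * theta h (p :: P) s =
  \sum_(b <- bits n) mob (h q) b * \sum_(s <- tups (idl X) n) F (vals (ppow q b lam) s) * theta h P s.
  transitivity (\sum_(s <- tups (idl X) n) (F (vals lam s) * theta h P s) * h q (supp p s)).
    by apply: eq_bigr => s _; rewrite /theta big_cons /=; ring.
  rewrite mobius_step; last by move=> s sn si sX; rewrite (van lam) ?mul0r.
  apply: eq_big_seq => b; rewrite tupsE => /andP[/eqP bn _]; congr (_ * _); apply: eq_big_seq => s sT.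
  have si := integral_tups sT; move: sT; rewrite tupsE => /andP[/eqP sn _].
  by rewrite vals_shift ?bn ?sn // theta_shift ?bn ?sn.
rewrite step !big_cons -/q {1}/euler_loc.
have -> : A * ((\sum_(b <- bits n) mob (h q) b * q^-1 ^+ count id b) * \prod_(j <- P) euler_loc n h (qn j)%:R) * (\prod_(x <- lam) x)^-1
  = \sum_(b <- bits n) mob (h q) b * (A * \prod_(j <- P) euler_loc n h (qn j)%:R * (\prod_(x <- ppow q b lam) x)^-1).
  rewrite mulr_suml mulr_sumr mulr_suml; apply: eq_big_seq => b; rewrite tupsE => /andP[/eqP bn _].
  by rewrite prod_ppow ?bn ?ln //; ring.
rewrite -sumrB; apply: le_trans (ler_norm_sum _ _ _) _.
rewrite {1}/euler_err mulr_suml mulr_sumr mulr_suml; apply: ler_sum_in => b.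
rewrite tupsE => /andP[/eqP bn _]; rewrite -mulrBr normrM.
have -> : E * (`|mob (h q) b| * (r4 q ^+ 3)^-1 ^+ count id b * \prod_(j <- P) euler_err n h (qn j)%:R) * wt lam =
  `|mob (h q) b| * (E * \prod_(j <- P) euler_err n h (qn j)%:R * wt (ppow q b lam)).
  by rewrite wt_ppow ?bn ?ln //; ring.
rewrite ler_wpM2l //; apply: ih => //; first by rewrite size_ppow ?bn ?ln.
exact: ppow_ge1.
Qed.

(** * Ideal counts and logarithmic sums over several ideals *)

Definition ic (b : bool) : R := b%:R.
Lemma icT (b : bool) : b -> ic b = 1. Proof. by move=> ->. Qed.
Lemma icF (b : bool) : ~~ b -> ic b = 0. Proof. by move=> /negPf ->. Qed.
Lemma ic_ge0 b : 0 <= ic b. Proof. exact: ler0n. Qed.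
Lemma ic_le1 b : ic b <= 1. Proof. by case: b. Qed.

Lemma sum_idl_cond X Y (f : (prm -> int) -> R) : Y <= X ->
  \sum_(e <- idl X | nm e <= Y) f e = \sum_(e <- idl Y) f e.
Proof.
move=> YX; rewrite -big_filter; apply: perm_big; apply: uniq_perm; rewrite ?filter_uniq ?idl_uniq // => e.
rewrite mem_filter !idlE; apply/andP/asboolP => [[h /asboolP[ie _]] //|[ie h]].
by split => //; apply/asboolP; split => //; exact: le_trans h YX.
Qed.
Lemma sum_idl_ind X Y (f : (prm -> int) -> R) : Y <= X ->
  \sum_(e <- idl X) ic (nm e <= Y) * f e = \sum_(e <- idl Y) f e.
Proof.
move=> YX; rewrite -(sum_idl_cond f YX) [RHS]big_mkcond /=; apply: eq_bigr => e _.
by rewrite /ic; case: ifP => _; rewrite ?mul1r ?mul0r.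
Qed.

Lemma size_idl_le : exists2 C, 0 <= C & forall x, 0 <= x -> (size (idl x))%:R <= C * x.
Proof.
have [C C0 CP] := ideal_count; have r0 := ltW rho_gt0.
exists (rho + C); first exact: addr_ge0.
move=> x x0; case: (ltP x 1) => x1.
  by rewrite idl_small // (_ : (size [::])%:R = 0) // mulr_ge0 // addr_ge0.
have := CP x x0; rewrite ler_norml => /andP[_ h].
have : Num.sqrt x <= x by have := sqr_sqrtr x0; have := sqrtr_ge0 x; have : 1 <= Num.sqrt x by [rewrite -sqrtr1 ler_wsqrtr]; nra.
by move=> h2; have : C * Num.sqrt x <= C * x by [rewrite ler_wpM2l]; qlra.
Qed.

(** The square root of [ideal_count] is weakened to the power 3/4 below, and for small arguments the
    main term itself is absorbed. A square root error would lose only q^(-1/2) per division, and two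
    divisions would not give a convergent Euler product. *)
Lemma cnt_idl : exists2 C, 0 <= C & forall B Z lam, 0 <= Z -> Z <= B -> 1 <= lam ->
  `|\sum_(e <- idl B) ic (lam * nm e <= Z) - rho * (Z / lam)| <= C * r4 (Z / lam) ^+ 3.
Proof.
have [C C0 CP] := ideal_count; have r0 := ltW rho_gt0.
exists (rho + C); first exact: addr_ge0.
move=> B Z lam Z0 ZB l1; have l0 : 0 < lam by qlra.
have y0 : 0 <= Z / lam by rewrite divr_ge0 // ltW.
have yB : Z / lam <= B by rewrite ler_pdivrMr //; nra.
have -> : \sum_(e <- idl B) ic (lam * nm e <= Z) = (size (idl (Z / lam)))%:R :> R.
  rewrite -[size _]count_predT -sum1_count natr_sum -(sum_idl_ind _ yB).
  by apply: eq_bigr => e _; rewrite mulr1 ler_pdivlMr // mulrC.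
move: (Z / lam) y0 {yB} => y y0; have q0 := r4_ge0 y; have q4 := r4K y0.
case: (ltP y 1) => y1.
  rewrite idl_small // (_ : (size [::])%:R = 0) // sub0r normrN ger0_norm; last by rewrite mulr_ge0.
  rewrite [leRHS]mulrDl.
  apply: (@le_trans _ _ (rho * r4 y ^+ 3)); last by rewrite lerDl mulr_ge0 // exprn_ge0.
  rewrite ler_wpM2l // -[leLHS]q4 exprS ler_piMl ?exprn_ge0 //.
  by rewrite -r4_1 r4_le // ltW.
apply: le_trans (CP y y0) _; rewrite mulrDl.
apply: (@le_trans _ _ (C * r4 y ^+ 3)); last by rewrite lerDr mulr_ge0 // exprn_ge0.
rewrite ler_wpM2l // (_ : Num.sqrt y = r4 y ^+ 2); last by rewrite /r4 sqr_sqrtr // sqrtr_ge0.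
by rewrite [leRHS]exprS ler_peMl ?exprn_ge0 // r4_ge1.
Qed.

(* The sum of 1/(N e1 ... N ek) over the tuples of ideals with N e1^a1 ... N ek^ak <= Z. *)
Fixpoint GG (B : R) (a : seq nat) (Z : R) : R :=
  if a is k :: a' then \sum_(e <- idl B) (nm e)^-1 * GG B a' (Z / nm e ^+ k) else ic (1 <= Z).

Lemma GG_lt1 B a Z : 0 < Z -> Z < 1 -> GG B a Z = 0.
Proof.
elim: a Z => [|k a ih] Z Z0 Z1 /=; first by rewrite leNgt Z1.
rewrite big_seq big1 // => e eB; have n1 : 1 <= nm e ^+ k by rewrite exprn_ege1 // (nm_idl_ge1 eB).
rewrite ih ?mulr0 // ?divr_gt0 //; first by qlra.
rewrite ltr_pdivrMr; [qlra|qlra].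
Qed.

(** Induction on the list. With Y = Z^(1/k) the first ideal runs up to norm Y, and ln (Z / N^k) = k
    ln (Y / N), so summing the n-th power of this logarithm gives the factor rho / (k (n + 1)). The
    clause on the empty list is there because [.-1] cannot lower the exponent 0: in the first step
    the previous error must vanish exactly. *)
Lemma GG_main a : all (fun k => (0 < k)%N) a -> exists2 C, 0 <= C /\ (a = [::] -> C = 0) &
  forall B Z, 1 <= Z -> Z <= B ->
  `|GG B a Z - rho ^+ size a * ln Z ^+ size a / ((size a)`! * \prod_(k <- a) k)%:R| <= C * (1 + ln Z) ^+ (size a).-1.
Proof.
have r0 := ltW rho_gt0.
elim: a => [_|k a ih /= /andP[k0 a0]].
  exists 0; first by [].
  by move=> B Z Z1 _; rewrite /= Z1 big_nil !expr0 fact0 !mul1r invr1 subrr normr0 mul0r.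
have [C [C0 Cn] CP] := ih a0; set n := size a in CP *.
have [C1 C10 C1P] := sum_idl_inv; have [C2 C20 C2P] := sum_idl_inv_lnX n.
set D := (n`! * \prod_(j <- a) j)%N in CP; have DE : (n`! * \prod_(j <- a) j)%N = D by [].
have D0 : (0 < D)%N.
  rewrite -DE muln_gt0 fact_gt0 /=; elim: (a) a0 => [|j t iht] /=; first by rewrite big_nil.
  by move=> /andP[j0 /iht h]; rewrite big_cons muln_gt0 j0.
clearbody D; have D0' : 0 < D%:R :> R by rewrite ltr0n.
have kR : 0 < k%:R :> R by rewrite ltr0n.
pose c := rho ^+ n / D%:R; have c0 : 0 <= c by rewrite divr_ge0 ?exprn_ge0 // ltW.
exists (C * C1 + c * k%:R ^+ n * C2).
  split=> //; nneg; exact: ltW.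
move=> B Z Z1 ZB; have Z0 : 0 < Z by qlra.
have l0 : 0 <= ln Z by exact: ln_ge0.
pose Y := expR (ln Z / k%:R).
have Y0 : 0 < Y by exact: expR_gt0.
have YK : Y ^+ k = Z by rewrite /Y -expRM_natl [k%:R * _]mulrC mulfVK ?gt_eqF // lnK // posrE.
have lY : ln Y = ln Z / k%:R by rewrite expRK.
have lkZ : ln Z / k%:R <= ln Z by rewrite ler_pdivrMr // ler_peMr // ler1n.
have Y1 : 1 <= Y by rewrite -expR0 ler_expR divr_ge0 // ltW.
have YZ : Y <= Z by rewrite -[leRHS]lnK ?posrE // ler_expR.
have -> : \sum_(e <- idl B) (nm e)^-1 * GG B a (Z / nm e ^+ k) = \sum_(e <- idl Y) (nm e)^-1 * GG B a (Z / nm e ^+ k).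
  rewrite -(sum_idl_cond _ (le_trans YZ ZB)) [RHS]big_mkcond /=; apply: eq_big_seq => e eB.
  case: ifP => // /negbT; rewrite -ltNge => eY; rewrite GG_lt1 ?mulr0 //.
    by rewrite divr_gt0 // exprn_gt0 // (nm_idl_gt0 eB).
  have h : Y ^+ k < nm e ^+ k by rewrite ltr_pXn2r ?nnegrE ?ltW // (nm_idl_gt0 eB).
  by rewrite ltr_pdivrMr ?mul1r ?exprn_gt0 ?(nm_idl_gt0 eB) // -YK.
have lE e : e \in idl Y -> [/\ 1 <= Z / nm e ^+ k, Z / nm e ^+ k <= Z & ln (Z / nm e ^+ k) = k%:R * lnp (Y / nm e)].
  move=> eY; have [n0 n1] := (nm_idl_gt0 eY, nm_idl_ge1 eY); have [_ h] := idlP eY.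
  have nk : 0 < nm e ^+ k by rewrite exprn_gt0.
  split.
  - by rewrite ler_pdivlMr // mul1r -YK; apply: lerXn2r; rewrite ?nnegrE // ltW.
  - by rewrite ler_pdivrMr // ler_peMr ?(ltW Z0) // exprn_ege1.
  - rewrite lnpE ?ler_pdivlMr ?mul1r // -YK -expr_div_n lnXn ?divr_gt0 //.
    by rewrite mulr_natl.
have -> : rho ^+ n.+1 * ln Z ^+ n.+1 / (n.+1`! * \prod_(j <- k :: a) j)%:R =
   c * k%:R ^+ n * (rho * ln Y ^+ n.+1 / n.+1%:R).
  rewrite big_cons factS lY mulnACA DE.
  rewrite !natrM /c !exprS (expr_div_n (ln Z)).
  have n1 : n.+1%:R != 0 :> R by rewrite pnatr_eq0.
  have k1 : k%:R != 0 :> R by rewrite gt_eqF.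
  have kn : k%:R ^+ n != 0 :> R by rewrite expf_neq0.
  have D1 : D%:R != 0 :> R by rewrite gt_eqF.
  by move: (n.+1%:R : R) (k%:R ^+ n) (ln Z ^+ n) (rho ^+ n) n1 kn => N a1 a2 a3 n1 kn; field; rewrite n1 kn k1 D1.
have main := C2P Y Y1.
set S2 := \sum_(e <- idl Y) _ in main.
have E1 : `|\sum_(e <- idl Y) (nm e)^-1 * GG B a (Z / nm e ^+ k) - c * k%:R ^+ n * S2| <= C * C1 * (1 + ln Z) ^+ n.
  rewrite /S2 mulr_sumr -sumrB; apply: le_trans (ler_norm_sum _ _ _) _.
  apply: (@le_trans _ _ (\sum_(e <- idl Y) (nm e)^-1 * (C * (1 + ln Z) ^+ n.-1))).
    apply: ler_sum_in => e eY; have [h1 h2 h3] := lE e eY; have n0 := nm_idl_gt0 eY.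
    have i0 : 0 <= (nm e)^-1 by rewrite invr_ge0 ltW.
    have := CP B _ h1 (le_trans h2 ZB); rewrite h3 -/n => h.
    rewrite (_ : _ - _ = (nm e)^-1 * (GG B a (Z / nm e ^+ k) - rho ^+ n * (k%:R * lnp (Y / nm e)) ^+ n / D%:R)); last first.
      rewrite /c [(k%:R * _) ^+ n]exprMn; move: (k%:R ^+ n) (lnp _ ^+ n) (rho ^+ n) (GG _ _ _) => u1 u2 u3 u4; ring.
    rewrite normrM (ger0_norm i0) ler_wpM2l //; apply: le_trans h _; rewrite ler_wpM2l //.
    have l1 : 0 <= k%:R * lnp (Y / nm e) by rewrite mulr_ge0 ?ler0n // lnp_ge0.
    apply: lerXn2r; rewrite ?nnegrE ?addr_ge0 // lerD2l -h3 ler_ln ?posrE //; qlra.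
  rewrite -mulr_suml; case: (eqVneq n 0%N) => [n0|n0].
    by rewrite (Cn (size0nil n0)) !mul0r mulr0.
  have := C1P Y Y1; set s := \sum_(e <- _) _ => hs.
  have L0 : 0 <= 1 + ln Z by qlra.
  have hs2 : s <= C1 * (1 + ln Z) by apply: le_trans hs _; rewrite ler_wpM2l // lerD2l lY.
  rewrite -[in leRHS](prednK (_ : (0 < n)%N)) ?lt0n // exprS.
  rewrite (_ : C * C1 * _ = C1 * (1 + ln Z) * (C * (1 + ln Z) ^+ n.-1)); last by ring.
  by rewrite ler_wpM2r // mulr_ge0 // exprn_ge0.
have E2 : `|c * k%:R ^+ n * (S2 - rho * ln Y ^+ n.+1 / n.+1%:R)| <= c * k%:R ^+ n * C2 * (1 + ln Z) ^+ n.
  have ck : 0 <= c * k%:R ^+ n by rewrite mulr_ge0 // exprn_ge0 // ltW.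
  rewrite normrM (ger0_norm ck) -[leRHS]mulrA; apply: ler_wpM2l => //; apply: le_trans main _; apply: ler_wpM2l => //.
  have [yy0 yy1] : 0 <= ln Y /\ ln Y <= 1 + ln Z by rewrite lY; split; [rewrite divr_ge0 // ltW|qlra].
  by apply: lerXn2r; rewrite ?nnegrE //; qlra.
rewrite -[X in `|X|](subrKA (c * k%:R ^+ n * S2)) -mulrBr; apply: le_trans (ler_normD _ _) _.
by rewrite [leRHS]mulrDl lerD.
Qed.

(** * The sum over 6-tuples of ideals *)
(* A 6-tuple of norms is listed in the order y1, y2, y4, y6, y3, y5. *)
Definition Jf (y : seq R) : R :=
  if y is [:: y1; y2; y4; y6; y3; y5] then y1 ^+ 3 * y2 ^+ 2 * y4 ^+ 2 * y6 ^+ 2 * y3 * y5 else 0.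
(** With m = y3 / (y1 y4 y5) and n = y5 / (y1 y2 y6 y3), the norms of the two ideals in which u (for
    fixed v) and v vary, [wf] is 1 / (m n), and [nf] is the denominator of n. *)
Definition wf (y : seq R) : R := if y is [:: y1; y2; y4; y6; y3; y5] then y1 ^+ 2 * y2 * y4 * y6 else 0.
Definition nf (y : seq R) : R := if y is [:: y1; y2; y4; y6; y3; y5] then y1 * y2 * y6 * y3 else 0.
(** With b = true only the tuples with n > 1 are kept. *)
Definition FQ (b : bool) (X : R) (y : seq R) : R :=
  ic ((Jf y <= X) && (b ==> (nf y < nth 0 y 5))) * wf y.
(** The exponents of y1, y2, y4, y6, y3 once y5 is summed out: J <= X is solvable with y5 >= 1 if
    y1^3 y2^2 y4^2 y6^2 y3 <= X, and with y5 > [nf] only if that product times [nf] is at most X. *)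
Definition expo (b : bool) : seq nat := if b then [:: 4; 3; 2; 3; 2]%N else [:: 3; 2; 2; 2; 1]%N.

Lemma inv_le_r4 x : 1 <= x -> x^-1 <= (r4 x ^+ 3)^-1.
Proof.
move=> x1; have x0 : 0 < x by qlra.
rewrite lef_pV2 ?posrE ?exprn_gt0 ?r4_gt0 // -[leRHS](r4K (ltW x0)) [leRHS]exprS ler_peMl ?exprn_ge0 ?r4_ge0 //.
exact: r4_ge1.
Qed.

(** For b = true the ideals with D < y5 are a difference of two counts; the part up to D is not kept
    in the main term but charged to the error, as D / l5. *)
Lemma sum_y5 : exists2 C, 0 <= C & forall b B X P D l5, 1 <= P -> 1 <= D -> 0 < X -> X <= B -> 1 <= l5 ->
  `|\sum_(e <- idl B) ic ((P * (l5 * nm e) <= X) && (b ==> (D < l5 * nm e)))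
    - ic ((if b then P * D else P) <= X) * (rho * (X / P / l5))|
  <= ic ((if b then P * D else P) <= X) * (C * r4 (X / P / l5) ^+ 3 + b%:R * (C * D / l5)).
Proof.
have [C C0 CP] := cnt_idl; have r0 := ltW rho_gt0.
exists (2 * C + rho); first by rewrite addr_ge0 // mulr_ge0.
move=> b B X P D l5 P1 D1 X0 XB l51.
have P0 : 0 < P by qlra.
have l50 : 0 < l5 by qlra.
have Z0 : 0 < X / P by rewrite divr_gt0.
have ZB : X / P <= B by apply: le_trans XB; rewrite ler_pdivrMr // ler_peMr // ltW.
have iE e : (P * (l5 * nm e) <= X) = (l5 * nm e <= X / P) by rewrite [RHS]ler_pdivlMr // mulrC.
have ge e : e \in idl B -> 1 <= l5 * nm e by move/nm_idl_ge1 => h; nra.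
move: (CP B (X / P) l5 (ltW Z0) ZB l51); set Z := X / P in Z0 ZB iE *.
have q0 : 0 <= r4 (Z / l5) by exact: r4_ge0.
case: b; last first.
  rewrite mul0r addr0 => h; under eq_bigr do rewrite iE andbT.
  have -> : (P <= X) = (1 <= Z) by rewrite /Z ler_pdivlMr // mul1r.
  rewrite /ic; case: (leP 1 Z) => Z1.
    rewrite !mul1r; apply: le_trans h _; rewrite ler_wpM2r ?exprn_ge0 //; qlra.
  rewrite !mul0r subr0 big_seq big1 ?normr0 // => e /ge h2.
  by rewrite leNgt (lt_le_trans Z1 h2).
move=> h; rewrite mul1r (_ : (P * D <= X) = (D <= Z)); last by rewrite /Z ler_pdivlMr // mulrC.
under eq_bigr do rewrite iE /=.
rewrite {2 3}/ic; case: (leP D Z) => DZ; last first.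
  rewrite !mul0r subr0 big_seq big1 ?normr0 // => e _.
  by rewrite /ic; case: leP => //= h1; case: ltP => // h2; qlra.
have D0 : 0 <= D by qlra.
have h2 := CP B D l5 D0 (le_trans DZ ZB) l51.
have -> : \sum_(e <- idl B) ic ((l5 * nm e <= Z) && (D < l5 * nm e)) =
  \sum_(e <- idl B) ic (l5 * nm e <= Z) - \sum_(e <- idl B) ic (l5 * nm e <= D).
  rewrite -sumrB; apply: eq_bigr => e _; rewrite /ic.
  by case: (leP (l5 * nm e) D) => h3; rewrite ?andbF ?andbT ?subr0 // (le_trans h3 DZ) subrr.
have h3 : r4 (D / l5) ^+ 3 <= r4 (Z / l5) ^+ 3.
  by apply: lerXn2r; rewrite ?nnegrE ?r4_ge0 // r4_le // ler_wpM2r // invr_ge0 ltW.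
have h4 : C * r4 (D / l5) ^+ 3 <= C * r4 (Z / l5) ^+ 3 by rewrite ler_wpM2l.
have h5 : 0 <= D / l5 by rewrite divr_ge0 // ltW.
have h6 : 0 <= rho * r4 (Z / l5) ^+ 3 by nneg.
have h7 : 0 <= C * (D / l5) by nneg.
rewrite !mul1r -[_ * D / l5]mulrA.
move: h h2 h4 h6 h7; move: h5; set a := \sum_(e <- _) _; set c := \sum_(e <- _) _.
set q := r4 (Z / l5) ^+ 3; set q' := r4 _ ^+ 3; set z := Z / l5; set d := D / l5 => h5.
by rewrite !ler_norml => /andP[h21 h22] /andP[h31 h32] h4 h6 h7; apply/andP; split; nra.
Qed.

(** The first error of [sum_y5] is summed over y3 up to X / p with weight y3^(-3/4), the second over
    y3 <= [W], a bound that n > 1 enforces. Both sums are O(X / (y1 y2 y4 y6)), without a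
    logarithm. *)
Lemma sum_y35 : exists2 C, 0 <= C & forall b B X y1 y2 y4 y6 l3 l5,
  1 <= y1 -> 1 <= y2 -> 1 <= y4 -> 1 <= y6 -> 1 <= l3 -> 1 <= l5 -> 1 <= X -> X <= B ->
  `|\sum_(e <- idl B) \sum_(f <- idl B) FQ b X [:: y1; y2; y4; y6; l3 * nm e; l5 * nm f]
    - \sum_(e <- idl B) ic ((if b then y1 ^+ 4 * y2 ^+ 3 * y4 ^+ 2 * y6 ^+ 3 * (l3 * nm e) ^+ 2
         else y1 ^+ 3 * y2 ^+ 2 * y4 ^+ 2 * y6 ^+ 2 * (l3 * nm e)) <= X)
         * (rho * X / (y1 * y2 * y4 * y6 * (l3 * nm e) * l5))|
  <= C * (X / (y1 * y2 * y4 * y6)) * wt [:: l3; l5].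
Proof.
have [C C0 CP] := sum_y5; have [C1 C10 C1P] := sum_idl_r43; have [C2 C20 C2P] := size_idl_le.
exists (C * C1 + C * C2); first by nneg.
move=> b B X y1 y2 y4 y6 l3 l5 y11 y21 y41 y61 l31 l51 X1' XB.
have X0 : 0 < X by qlra.
have [y10 y20 y40 y60] : [/\ 0 < y1, 0 < y2, 0 < y4 & 0 < y6] by split; apply: lt_le_trans ltr01 _.
have [l30 l50] : 0 < l3 /\ 0 < l5 by split; apply: lt_le_trans ltr01 _.
pose p := y1 ^+ 3 * y2 ^+ 2 * y4 ^+ 2 * y6 ^+ 2; pose g := y1 ^+ 2 * y2 * y4 * y6; pose d := y1 * y2 * y6.
have p1 : 1 <= p by rewrite /p !mulr_ege1 // exprn_ege1.
have d1 : 1 <= d by rewrite /d !mulr_ege1.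
have g0 : 0 <= g by rewrite /g; nneg; qlra.
have p0 : 0 < p by qlra.
have d0 : 0 < d by qlra.
have gp : g / p = (y1 * y2 * y4 * y6)^-1 by rewrite /g /p; field; rewrite !gt_eqF.
rewrite -sumrB; apply: le_trans (ler_norm_sum _ _ _) _.
pose W := Num.sqrt (X / (p * d)).
have W0 : 0 <= W by exact: sqrtr_ge0.
have WE : W ^+ 2 = X / (p * d) by rewrite sqr_sqrtr // divr_ge0 ?mulr_ge0 // ltW.
have q5 : 0 < r4 l5 by rewrite r4_gt0.
have q3 : 0 < r4 l3 by rewrite r4_gt0.
have X1 : 0 <= X / p by rewrite divr_ge0 // ltW.
pose T1 e := (nm e <= X / p / l3)%R; pose T2 e := (nm e <= W / l3)%R.
apply: (@le_trans _ _ (\sum_(e <- idl B) (g * C * r4 (X / p) ^+ 3 / r4 l5 ^+ 3 / r4 l3 ^+ 3 * (ic (T1 e) * (r4 (nm e) ^+ 3)^-1)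
    + g * C * d / l5 * W * (ic (T2 e) * 1)))).
  apply: ler_sum_in => e eB; have [n0 n1] := (nm_idl_gt0 eB, nm_idl_ge1 eB).
  set y3 := l3 * nm e; have y31 : 1 <= y3 by rewrite /y3 mulr_ege1.
  have y30 : 0 < y3 by qlra.
  have P1 : 1 <= p * y3 by rewrite mulr_ege1.
  have D1 : 1 <= d * y3 by rewrite mulr_ege1.
  have := CP b B X (p * y3) (d * y3) l5 P1 D1 X0 XB l51.
  set S := \sum_(f <- _) _; set c := ic _; set M := X / (p * y3) / l5 => h.
  have -> : \sum_(f <- idl B) FQ b X [:: y1; y2; y4; y6; y3; l5 * nm f] = g * S.
    by rewrite /S mulr_sumr; apply: eq_bigr => f _; rewrite /FQ mulrC.
  have cE : ic ((if b then y1 ^+ 4 * y2 ^+ 3 * y4 ^+ 2 * y6 ^+ 3 * y3 ^+ 2 else y1 ^+ 3 * y2 ^+ 2 * y4 ^+ 2 * y6 ^+ 2 * y3) <= X) = c.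
    by rewrite /c; congr (ic (_ <= _)); case: (b) => //; rewrite /p /d; ring.
  rewrite cE.
  have -> : c * (rho * X / (y1 * y2 * y4 * y6 * y3 * l5)) = g * (c * (rho * M)).
    rewrite /M (_ : _ / (y1 * y2 * y4 * y6 * y3 * l5) = (y1 * y2 * y4 * y6)^-1 * (rho * X / y3 / l5)); last by field; rewrite !gt_eqF.
    by rewrite -gp; field; rewrite !gt_eqF.
  rewrite -mulrBr normrM (ger0_norm g0).
  apply: (@le_trans _ _ (g * (c * (C * r4 M ^+ 3 + b%:R * (C * (d * y3) / l5))))); first by rewrite ler_wpM2l.
  have c0 : 0 <= c by exact: ic_ge0.
  rewrite mulrDr mulrDr; apply: lerD.
    have ME : M = X / p * (l5^-1 * (l3^-1 * (nm e)^-1)) by rewrite /M /y3; field; rewrite !gt_eqF.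
    have rE : r4 M ^+ 3 = r4 (X / p) ^+ 3 / r4 l5 ^+ 3 / r4 l3 ^+ 3 / r4 (nm e) ^+ 3.
      have [i5 i3] : 0 <= l5^-1 /\ 0 <= l3^-1 by rewrite !invr_ge0 !ltW.
      by rewrite ME (r4M _ X1) (r4M _ i5) (r4M _ i3) (r4V (ltW l50)) (r4V (ltW l30)) (r4V (ltW n0)) !exprMn !exprVn !mulrA.
    rewrite rE (_ : g * (c * _) = c * (g * C * r4 (X / p) ^+ 3 / r4 l5 ^+ 3 / r4 l3 ^+ 3 / r4 (nm e) ^+ 3)); last by ring.
    rewrite [leRHS]mulrCA ler_wpM2r //; first by nneg; try exact: r4_ge0; exact: ltW.
    rewrite /c /ic; case E : (_ <= X); last by rewrite ler0n.
    rewrite (_ : T1 e) //; rewrite /T1 ler_pdivlMr // ler_pdivlMr //.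
    have h1 : p * y3 <= X by case: (b) E => // h1; apply: le_trans h1; rewrite ler_peMr // (le_trans ler01 P1).
    by move: h1; rewrite /y3 mulrC (mulrC l3).
  case: (b) @c {cE h S} c0 => [|] c c0; last by rewrite !mul0r !mulr0; nneg; try exact: ic_ge0; qlra.
  rewrite mul1r mulr1 (_ : g * _ = g * C * d / l5 * (c * y3)); last by ring.
  rewrite -[leRHS]mulrA; apply: ler_wpM2l; first by nneg; exact: ltW.
  rewrite /c /ic; case: (leP (p * y3 * (d * y3)) X) => h1; last by rewrite mul0r mulr_ge0 // ler0n.
  have h2 : y3 ^+ 2 <= W ^+ 2.
    rewrite WE ler_pdivlMr ?mulr_gt0 //; apply: le_trans h1; rewrite le_eqVlt; apply/orP; left; apply/eqP; ring.
  have h3 : y3 <= W by rewrite -(ler_sqr (_ : y3 \is Num.nneg)) ?nnegrE // ltW.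
  by rewrite (_ : T2 e) ?mul1r ?mulr1 // /T2 ler_pdivlMr // mulrC.
rewrite big_split -!mulr_sumr /=.
have XB' : X / p / l3 <= B.
  by apply: le_trans XB; rewrite !ler_pdivrMr // -mulrA ler_peMr ?(ltW X0) // mulr_ege1.
have W1 : W / l3 <= B.
  rewrite ler_pdivrMr //; apply: (@le_trans _ _ X); last by rewrite -[X in X <= _]mulr1; apply: ler_pM => //; exact: ltW.
  rewrite -(ler_sqr (_ : W \is Num.nneg)) ?nnegrE ?(ltW X0) // WE ler_pdivrMr ?mulr_gt0 //.
  have pd1 : 1 <= p * d by rewrite mulr_ege1.
  by nra.
rewrite (sum_idl_ind (fun e => (r4 (nm e) ^+ 3)^-1) XB') (sum_idl_ind (fun=> 1) W1).
have x0 : 0 <= r4 (X / p) by exact: r4_ge0.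
have h1 : \sum_(e <- idl (X / p / l3)) (r4 (nm e) ^+ 3)^-1 <= C1 * r4 (X / p).
  apply: le_trans (C1P _ _) _; first by rewrite divr_ge0 // ltW.
  by rewrite ler_wpM2l // r4_le // ler_pdivrMr // ler_peMr.
have h2 : \sum_(e <- idl (W / l3)) 1 <= C2 * (W / l3) :> R.
  have := C2P (W / l3); rewrite -[size _]count_predT -sum1_count natr_sum; apply.
  by rewrite divr_ge0 // ltW.
have w5 : l5^-1 <= (r4 l5 ^+ 3)^-1 by exact: inv_le_r4.
have w3 : l3^-1 <= (r4 l3 ^+ 3)^-1 by exact: inv_le_r4.
have wE : wt [:: l3; l5] = (r4 l3 ^+ 3)^-1 * (r4 l5 ^+ 3)^-1 by rewrite /wt !big_cons big_nil mulr1.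
rewrite wE -gp mulrDl mulrDl; apply: lerD.
  apply: (@le_trans _ _ (g * C * r4 (X / p) ^+ 3 / r4 l5 ^+ 3 / r4 l3 ^+ 3 * (C1 * r4 (X / p)))).
    by apply: ler_wpM2l => //; nneg.
  rewrite (_ : X * (g / p) = g * (X / p)); last by rewrite mulrCA mulrA.
  by rewrite -[in leRHS](r4K X1) le_eqVlt; apply/orP; left; apply/eqP; ring.
apply: (@le_trans _ _ (g * C * d / l5 * W * (C2 * (W / l3)))).
  by apply: ler_wpM2l => //; nneg.
rewrite (_ : _ * (C2 * (W / l3)) = C * C2 * (g * d * W ^+ 2) * (l3^-1 * l5^-1)); last by ring.
rewrite WE (_ : g * d * _ = X * (g / p)); last by field; rewrite !gt_eqF.
apply: ler_wpM2l; first by nneg; exact: ltW.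
by apply: ler_pM => //; rewrite invr_ge0 ltW.
Qed.

Lemma vals6 l1 l2 l4 l6 l3 l5 e1 e2 e4 e6 e3 e5 :
  vals [:: l1; l2; l4; l6; l3; l5] [:: e1; e2; e4; e6; e3; e5] =
  [:: l1 * nm e1; l2 * nm e2; l4 * nm e4; l6 * nm e6; l3 * nm e3; l5 * nm e5].
Proof. by []. Qed.

Lemma sum_tups6 (l : seq (prm -> int)) (G : seq (prm -> int) -> R) : \sum_(s <- tups l 6) G s =
  \sum_(e1 <- l) \sum_(e2 <- l) \sum_(e4 <- l) \sum_(e6 <- l) \sum_(e3 <- l) \sum_(e5 <- l) G [:: e1; e2; e4; e6; e3; e5].
Proof. by rewrite sum_tupsS; do 5!(apply: eq_bigr => ? _; rewrite sum_tupsS); apply: eq_bigr => ? _; rewrite sum_tups0. Qed.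

Definition k0 : R := locked 4320.
Lemma k0E : k0 = 4320. Proof. by rewrite /k0 -lock. Qed.
Lemma k0_gt0 : 0 < k0. Proof. by rewrite k0E ltr0n. Qed.
(** The denominators are 5! times the products of the exponents [expo]: 120 * 24 = 2880, which is
    2/3 of 4320, and 120 * 144 = 17280, which is 4 times 4320. *)
Definition bmain (b : bool) : R := rho ^+ 6 / (if b then 4 * k0 else 2 / 3 * k0).

Definition Lf (b : bool) (lam : seq R) : R := if lam is [:: x1; x2; x4; x6; x3; x5] then
  if b then x1 ^+ 4 * (x2 ^+ 3 * (x4 ^+ 2 * (x6 ^+ 3 * x3 ^+ 2))) else x1 ^+ 3 * (x2 ^+ 2 * (x4 ^+ 2 * (x6 ^+ 2 * x3))) else 0.

(** Replacing ln (X / L) by ln X costs a factor 1 + ln L. Since ln x <= 4 x^(1/4), this is paid for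
    by weakening 1 / lambda to lambda^(-3/4), which is the purpose of [wt]. *)
Lemma lam_cut b : exists2 C, 0 <= C & forall B X lam, 1 <= X -> X <= B -> size lam = 6 -> (forall x, x \in lam -> 1 <= x) ->
  `|rho * X * (\prod_(x <- lam) x)^-1 * GG B (expo b) (X / Lf b lam) - bmain b * (X * ln X ^+ 5) * (\prod_(x <- lam) x)^-1|
   <= C * (X * (1 + ln B) ^+ 4) * wt lam.
Proof.
have a0 : all (fun k => (0 < k)%N) (expo b) by case: b.
have [C [C0 _] CP] := GG_main a0; have r0 := ltW rho_gt0.
have sz : size (expo b) = 5 by case: (b).
have bE : bmain b = rho * (rho ^+ 5 / (5`! * \prod_(k <- expo b) k)%:R).
  rewrite /bmain mulrA -exprS; congr (_ / _); rewrite k0E /expo.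
  case: (b); rewrite !big_cons big_nil; first by rewrite -natrM; congr (_%:R).
  by rewrite mulrAC -natrM (_ : (2 * 4320)%N = 2880 * 3)%N // natrM mulfK ?pnatr_eq0 //; congr (_%:R).
set c := rho ^+ 5 / _ in bE; have c0 : 0 <= c by rewrite divr_ge0 ?exprn_ge0.
exists (rho * (C + c * 5) * 100); first by nneg.
move=> B X lam X1 XB sl l1.
case: lam sl l1 => [|x1 [|x2 [|x4 [|x6 [|x3 [|x5 [|? ?]]]]]]] // _ l1 /=.
have [h1 h2 h4 [h6 h3 h5]] : [/\ 1 <= x1, 1 <= x2, 1 <= x4 & [/\ 1 <= x6, 1 <= x3 & 1 <= x5]].
  by do ![split]; apply: l1; rewrite !inE eqxx ?orbT.
set P := \prod_(x <- _) x; set L := (X in GG _ _ (_ / X)).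
have PE : P = x1 * (x2 * (x4 * (x6 * (x3 * x5)))) by rewrite /P !big_cons big_nil mulr1.
have P1 : 1 <= P by rewrite PE !mulr_ege1.
have LE : L = if b then x1 ^+ 4 * (x2 ^+ 3 * (x4 ^+ 2 * (x6 ^+ 3 * x3 ^+ 2))) else x1 ^+ 3 * (x2 ^+ 2 * (x4 ^+ 2 * (x6 ^+ 2 * x3))) by [].
have L1 : 1 <= L by rewrite LE; case: (b); rewrite !mulr_ege1 ?exprn_ege1.
have X0 : 0 < X by qlra.
have L0 : 0 < L by qlra.
have lX : 0 <= ln X by exact: ln_ge0.
have lL : 0 <= ln L by exact: ln_ge0.
have lB : ln X <= ln B by rewrite ler_ln ?posrE // (lt_le_trans X0 XB).
have P0 : 0 < P by exact: lt_le_trans ltr01 P1.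
have q k x : 1 <= x -> 0 <= ln x /\ ln (x ^+ k) <= k%:R * (4 * r4 x).
  move=> hx; have x0 : 0 < x by qlra.
  split; first exact: ln_ge0.
  by rewrite lnXn // -[leLHS]mulr_natl ler_wpM2l // ln_le_r4.
have key : (1 + ln L) / P <= 100 * wt [:: x1; x2; x4; x6; x3; x5].
  have wE : wt [:: x1; x2; x4; x6; x3; x5] = (r4 x1 * (r4 x2 * (r4 x4 * (r4 x6 * (r4 x3 * r4 x5))))) / P.
    rewrite PE /wt !big_cons big_nil mulr1.
    have e x : 1 <= x -> (r4 x ^+ 3)^-1 = r4 x / x.
      move=> hx; have hq : r4 x != 0 by rewrite gt_eqF // r4_gt0 //; qlra.
      have xE : r4 x ^+ 4 = x by rewrite r4K //; qlra.
      by rewrite -[X in _ = _ / X]xE; field.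
    by rewrite !e // !invfM; ring.
  rewrite wE mulrA ler_wpM2r ?invr_ge0 ?(ltW P0) //.
  have r1 x : 1 <= x -> 1 <= r4 x by exact: r4_ge1.
  have [t1 t2 t3] := And3 (r1 _ h1) (r1 _ h2) (r1 _ h4); have [t4 t5 t6] := And3 (r1 _ h6) (r1 _ h3) (r1 _ h5).
  have sub : ln L <= 4 * 4 * (r4 x1 + r4 x2 + r4 x4 + r4 x6 + r4 x3).
    have q4 k (x : R) : (k <= 4)%N -> 1 <= x -> ln (x ^+ k) <= 4 * 4 * r4 x.
      move=> k4 hx; have [_ hq] := q k x hx; apply: le_trans hq _; rewrite -[leRHS]mulrA ler_wpM2r ?ler_nat //.
      by rewrite mulr_ge0 // r4_ge0.
    have lnm (y1 y2 y3 y4 y5 : R) : 1 <= y1 -> 1 <= y2 -> 1 <= y3 -> 1 <= y4 -> 1 <= y5 ->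
        ln (y1 * (y2 * (y3 * (y4 * y5)))) = ln y1 + (ln y2 + (ln y3 + (ln y4 + ln y5))).
      have pos (x : R) : 1 <= x -> 0 < x by move=> hx; qlra.
      by move=> /pos ? /pos ? /pos ? /pos ? /pos ?; rewrite !lnM ?posrE ?mulr_gt0.
    rewrite LE; case: (b).
      rewrite lnm ?exprn_ege1 //; move: (q4 4%N _ isT h1) (q4 3%N _ isT h2) (q4 2%N _ isT h4) (q4 3%N _ isT h6) (q4 2%N _ isT h3).
      by move: (ln _) (ln _) (ln _) (ln _) (ln _); clear -hK; move=> *; lra.
    rewrite lnm ?exprn_ege1 //; move: (q4 3%N _ isT h1) (q4 2%N _ isT h2) (q4 2%N _ isT h4) (q4 2%N _ isT h6) (q4 1%N _ isT h3).
    by rewrite expr1; move: (ln _) (ln _) (ln _) (ln _) (ln _); clear -hK; move=> *; lra.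
  have m (x y : R) : 1 <= x -> 1 <= y -> [/\ x <= x * y, y <= x * y & 1 <= x * y].
    by move=> hx hy; have [x0 y0] := (le_trans ler01 hx, le_trans ler01 hy); rewrite ler_peMr ?ler_peMl ?mulr_ege1.
  have [m1 m2 m3] := m _ _ t5 t6; have [m4 m5 m6] := m _ _ t4 m3; have [m7 m8 m9] := m _ _ t3 m6.
  have [m10 m11 m12] := m _ _ t2 m9; have [m13 m14 m15] := m _ _ t1 m12.
  move: m1 m2 m4 m5 m7 m8 m10 m11 m13 m14 m15 sub; set z1 := r4 x3 * r4 x5; set z2 := r4 x6 * z1; set z3 := r4 x4 * z2.
  set z4 := r4 x2 * z3; set z5 := r4 x1 * z4; move: (ln L) (r4 x1) (r4 x2) (r4 x4) (r4 x6) (r4 x3) z1 z2 z3 z4 z5.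
  by clear; move=> *; qlra.
have lq1 : 1 <= 1 + ln B by qlra.
move: key; set w := wt _; clearbody w => key; clear q h1 h2 h4 h6 h3 h5 l1 LE PE; clearbody L P.
have goal : `|GG B (expo b) (X / L) - c * ln X ^+ 5| <= (C + c * 5) * (1 + ln B) ^+ 4 * (1 + ln L).
  have l4 : ln X ^+ 4 <= (1 + ln B) ^+ 4 by apply: lerXn2r; rewrite ?nnegrE //; qlra.
  have q0 : 0 <= (1 + ln B) ^+ 4 by rewrite exprn_ge0 //; qlra.
  have X4 : 0 <= ln X ^+ 4 by rewrite exprn_ge0.
  (* Here the sum is empty, and ln X <= ln L shows that the main term has the size of the error. *)
  case: (ltP (X / L) 1) => hXL.
    rewrite GG_lt1 ?divr_gt0 // sub0r normrN ger0_norm ?mulr_ge0 ?exprn_ge0 //.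
    have h : ln X <= ln L by rewrite ler_ln ?posrE // -[leRHS]mul1r -ler_pdivrMr // ltW.
    rewrite exprSr mulrDl mulrDl.
    have h7 : c * (ln X ^+ 4 * ln X) <= c * ((1 + ln B) ^+ 4 * (1 + ln L)).
      by rewrite ler_wpM2l // ler_pM //; qlra.
    by have : 0 <= C * (1 + ln B) ^+ 4 * (1 + ln L) /\ 0 <= c * ((1 + ln B) ^+ 4 * (1 + ln L)) by [split; nneg; qlra]; qlra.
  have hB : X / L <= B by apply: le_trans XB; rewrite ler_pdivrMr // ler_peMr // ltW.
  have := CP B (X / L) hXL hB; rewrite sz /= -/c; set z := ln (X / L) => h.
  have zE : z = ln X - ln L by rewrite /z ln_div ?posrE.
  have z0 : 0 <= z by exact: ln_ge0.
  have zX : z <= ln X by rewrite zE gerBl.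
  have hp : ln X ^+ 5 - z ^+ 5 <= 5%:R * ln X ^+ 4 * (ln X - z) by have /andP[_ ?] := powD_diff 4 z0 zX.
  have zp : z ^+ 5 <= ln X ^+ 5 by apply: lerXn2r; rewrite ?nnegrE //; qlra.
  have z4 : C * (1 + z) ^+ 4 <= C * (1 + ln B) ^+ 4 by rewrite ler_wpM2l //; apply: lerXn2r; rewrite ?nnegrE; move: z0 zX lB lq1; clear -hK; move=> *; lra.
  rewrite (_ : _ - _ = (GG B (expo b) (X / L) - rho ^+ 5 * z ^+ 5 / (5`! * \prod_(k <- expo b) k)%:R) + (- (c * (ln X ^+ 5 - z ^+ 5)))); last by rewrite /c; ring.
  apply: le_trans (ler_normD _ _) _; rewrite normrN mulrDl mulrDl; apply: lerD.
    apply: le_trans h _; apply: le_trans z4 _; rewrite ler_peMr //; first by nneg.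
    by qlra.
  rewrite ger0_norm; last by rewrite mulr_ge0 // subr_ge0.
  rewrite -[leRHS]mulrA -[leRHS]mulrA; apply: ler_wpM2l => //; apply: le_trans hp _.
  rewrite zE opprB addrCA subrr addr0 -mulrA; apply: ler_wpM2l => //; apply: ler_pM => //; qlra.
rewrite bE (_ : _ - _ = rho * X / P * (GG B (expo b) (X / L) - c * ln X ^+ 5)); last by ring.
have rP : 0 <= rho * X / P by nneg; exact: ltW.
rewrite normrM (ger0_norm rP); apply: le_trans (ler_wpM2l rP goal) _.
have Y0 : 0 <= X * (1 + ln B) ^+ 4 by exact: mulr_ge0 (ltW X0) (exprn_ge0 4 (le_trans ler01 lq1)).
rewrite (_ : rho * X / P * _ = rho * (C + c * 5) * (X * (1 + ln B) ^+ 4) * ((1 + ln L) / P)); last by ring.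
rewrite (_ : rho * (C + c * 5) * 100 * _ * _ = rho * (C + c * 5) * (X * (1 + ln B) ^+ 4) * (100 * w)); last by ring.
by apply: ler_wpM2l => //; nneg; qlra.
Qed.

Lemma FQ_vanishes b B X lam : X <= B -> size lam = 6 -> (forall x, x \in lam -> 1 <= x) ->
  vanishes B 6 (fun s => FQ b X (vals lam s)).
Proof.
move=> XB; case: lam => [|l1 [|l2 [|l4 [|l6 [|l3 [|l5 [|? ?]]]]]]] // _ hl.
have [h1 h2 h4 [h6 h3 h5]] : [/\ 1 <= l1, 1 <= l2, 1 <= l4 & [/\ 1 <= l6, 1 <= l3 & 1 <= l5]].
  by do ![split]; apply: hl; rewrite !inE eqxx ?orbT.
case=> [|e1 [|e2 [|e4 [|e6 [|e3 [|e5 [|? ?]]]]]]] // _ ie [e eE eX].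
have n1 f l : f \in [:: e1; e2; e4; e6; e3; e5] -> 1 <= l -> 1 <= l * nm f /\ nm f <= l * nm f.
  by move=> /ie[ff f0] hl1; have := nm_ge1 ff f0; split; nra.
have [[a1 b1] [a2 b2] [a4 b4]] : [/\ 1 <= l1 * nm e1 /\ nm e1 <= l1 * nm e1, 1 <= l2 * nm e2 /\ nm e2 <= l2 * nm e2 & 1 <= l4 * nm e4 /\ nm e4 <= l4 * nm e4].
  by split; apply: n1 => //; rewrite !inE eqxx ?orbT.
have [[a6 b6] [a3 b3] [a5 b5]] : [/\ 1 <= l6 * nm e6 /\ nm e6 <= l6 * nm e6, 1 <= l3 * nm e3 /\ nm e3 <= l3 * nm e3 & 1 <= l5 * nm e5 /\ nm e5 <= l5 * nm e5].
  by split; apply: n1 => //; rewrite !inE eqxx ?orbT.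
rewrite /FQ vals6 icF ?mul0r //; apply/negP => /andP[+ _]; apply/negP; rewrite -ltNge.
apply: le_lt_trans XB _; apply: lt_le_trans eX _; rewrite /Jf.
have m (x y : R) : 1 <= x -> 1 <= y -> [/\ x <= x * y, y <= x * y & 1 <= x * y].
    by move=> hx hy; have [x0 y0] := (le_trans ler01 hx, le_trans ler01 hy); rewrite ler_peMr ?ler_peMl ?mulr_ege1.
have p (x : R) k : 1 <= x -> x <= x ^+ k.+1 /\ 1 <= x ^+ k.+1 by move=> hx; rewrite exprn_ege1 // exprS ler_peMr ?exprn_ege1 //; qlra.
have [[p1 q1] [p2 q2] [p4 q4] [p6 q6]] := And4 (p _ 2%N a1) (p _ 1%N a2) (p _ 1%N a4) (p _ 1%N a6).
have [m1 m2 m3] := m _ _ q1 q2; have [m4 m5 m6] := m _ _ m3 q4; have [m7 m8 m9] := m _ _ m6 q6.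
have [m10 m11 m12] := m _ _ m9 a3; have [m13 m14 m15] := m _ _ m12 a5.
have u3 := le_trans m10 m13; have u2 := le_trans m7 u3; have u1 := le_trans m4 u2.
move: eE; rewrite !inE => /or4P[||| /or3P[]] /eqP -> {ie n1 hl}.
- exact: le_trans b1 (le_trans p1 (le_trans m1 u1)).
- exact: le_trans b2 (le_trans p2 (le_trans m2 u1)).
- exact: le_trans b4 (le_trans p4 (le_trans m5 u2)).
- exact: le_trans b6 (le_trans p6 (le_trans m8 u3)).
- exact: le_trans b3 (le_trans m11 m13).
exact: le_trans b5 m14.
Qed.

(** After [sum_y35] the error still has to be summed over the four ideals e1, e2, e4, e6, each
    costing one factor 1 + ln B. *)
Lemma base_sum b : exists2 C, 0 <= C & forall B X lam, 1 <= X -> X <= B -> size lam = 6 -> (forall x, x \in lam -> 1 <= x) ->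
  `|\sum_(s <- tups (idl B) 6) FQ b X (vals lam s) - bmain b * (X * ln X ^+ 5) * (\prod_(x <- lam) x)^-1|
   <= C * (X * (1 + ln B) ^+ 4) * wt lam.
Proof.
have [C C0 CP] := sum_y35; have [C1 C10 C1P] := lam_cut b; have [C2 C20 C2P] := sum_idl_inv.
exists (C * C2 ^+ 4 + C1); first by rewrite addr_ge0 // mulr_ge0 // exprn_ge0.
move=> B X lam X1 XB sl hl; have := C1P B X lam X1 XB sl hl.
case: lam sl hl => [|l1 [|l2 [|l4 [|l6 [|l3 [|l5 [|? ?]]]]]]] // _ hl.
have [h1 h2 h4 [h6 h3 h5]] : [/\ 1 <= l1, 1 <= l2, 1 <= l4 & [/\ 1 <= l6, 1 <= l3 & 1 <= l5]].
  by do ![split]; apply: hl; rewrite !inE eqxx ?orbT.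
set P := \prod_(x <- _) x; set L := Lf _ _; set w := wt _ => hcut.
have X0 : 0 < X by qlra.
have PE : P = l1 * (l2 * (l4 * (l6 * (l3 * l5)))) by rewrite /P !big_cons big_nil mulr1.
set main := rho * X * P^-1 * GG B (expo b) (X / L) in hcut.
suff H : `|\sum_(s <- tups (idl B) 6) FQ b X (vals [:: l1; l2; l4; l6; l3; l5] s) - main| <= C * C2 ^+ 4 * (X * (1 + ln B) ^+ 4) * w.
  rewrite -[X in `|X|](subrKA main); apply: le_trans (ler_normD _ _) _; rewrite !mulrDl; exact: lerD.
pose T e1 e2 e4 e6 e3 := let y1 := l1 * nm e1 in let y2 := l2 * nm e2 in let y4 := l4 * nm e4 in let y6 := l6 * nm e6 in
  ic ((if b then y1 ^+ 4 * y2 ^+ 3 * y4 ^+ 2 * y6 ^+ 3 * (l3 * nm e3) ^+ 2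
         else y1 ^+ 3 * y2 ^+ 2 * y4 ^+ 2 * y6 ^+ 2 * (l3 * nm e3)) <= X)
         * (rho * X / (y1 * y2 * y4 * y6 * (l3 * nm e3) * l5)).
have mE : main = \sum_(e1 <- idl B) \sum_(e2 <- idl B) \sum_(e4 <- idl B) \sum_(e6 <- idl B) \sum_(e3 <- idl B) T e1 e2 e4 e6 e3.
  have gE : GG B (expo b) (X / L) = \sum_(e1 <- idl B) \sum_(e2 <- idl B) \sum_(e4 <- idl B) \sum_(e6 <- idl B) \sum_(e3 <- idl B)
     (nm e1)^-1 * ((nm e2)^-1 * ((nm e4)^-1 * ((nm e6)^-1 * ((nm e3)^-1 * GG B [::] (if b then X / L / nm e1 ^+ 4 / nm e2 ^+ 3 / nm e4 ^+ 2 / nm e6 ^+ 3 / nm e3 ^+ 2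
       else X / L / nm e1 ^+ 3 / nm e2 ^+ 2 / nm e4 ^+ 2 / nm e6 ^+ 2 / nm e3 ^+ 1))))).
    by rewrite /expo; case: (b); rewrite [LHS]/=; do 4!(apply: eq_bigr => ? _; rewrite !mulr_sumr); apply: eq_bigr => ? _.
  rewrite /main gE; rewrite mulr_sumr; apply: eq_big_seq => e1 /nm_idl_gt0 p1; rewrite mulr_sumr; apply: eq_big_seq => e2 /nm_idl_gt0 p2.
  rewrite mulr_sumr; apply: eq_big_seq => e4 /nm_idl_gt0 p4; rewrite mulr_sumr; apply: eq_big_seq => e6 /nm_idl_gt0 p6.
  rewrite mulr_sumr; apply: eq_big_seq => e3 /nm_idl_gt0 p3; rewrite /T /GG /L /Lf PE.
  move: (nm e1) (nm e2) (nm e4) (nm e6) (nm e3) p1 p2 p4 p6 p3 => n1 n2 n4 n6 n3 p1 p2 p4 p6 p3.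
  have [l10 l20 l40 [l60 l30 l50]] : [/\ 0 < l1, 0 < l2, 0 < l4 & [/\ 0 < l6, 0 < l3 & 0 < l5]] by do ![split]; apply: lt_le_trans ltr01 _.
  rewrite (_ : (1 <= _) = ((if b then (l1 * n1) ^+ 4 * (l2 * n2) ^+ 3 * (l4 * n4) ^+ 2 * (l6 * n6) ^+ 3 * (l3 * n3) ^+ 2
     else (l1 * n1) ^+ 3 * (l2 * n2) ^+ 2 * (l4 * n4) ^+ 2 * (l6 * n6) ^+ 2 * (l3 * n3)) <= X)); last first.
    by case: (b); rewrite !ler_pdivlMr ?exprn_gt0 ?mulr_gt0 ?exprn_gt0 //; congr (_ <= X); ring.
  by move: (ic _) => c; field; rewrite !gt_eqF.
rewrite sum_tups6 mE; pose S := \sum_(e <- idl B) (nm e)^-1; pose Q := C * (X / (l1 * l2 * l4 * l6)) * wt [:: l3; l5].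
have [l10 l20 l40 l60] : [/\ 0 < l1, 0 < l2, 0 < l4 & 0 < l6] by split; apply: lt_le_trans ltr01 _.
have lB : 0 <= ln B by apply: ln_ge0; exact: le_trans X1 XB.
have S0 : 0 <= S by rewrite /S big_seq; apply: sumr_ge0 => e /nm_idl_gt0 h; rewrite invr_ge0 ltW.
have wE : w = (r4 l1 ^+ 3)^-1 * ((r4 l2 ^+ 3)^-1 * ((r4 l4 ^+ 3)^-1 * ((r4 l6 ^+ 3)^-1 * wt [:: l3; l5]))).
  by rewrite /w /wt !big_cons !big_nil.
have w0 : 0 <= wt [:: l3; l5] by rewrite /wt; apply: prodr_ge0 => x _; rewrite invr_ge0 exprn_ge0 // r4_ge0.
apply: (@le_trans _ _ (Q * S ^+ 4)).
  have -> : Q * S ^+ 4 = \sum_(e1 <- idl B) \sum_(e2 <- idl B) \sum_(e4 <- idl B) \sum_(e6 <- idl B)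
     (nm e1)^-1 * ((nm e2)^-1 * ((nm e4)^-1 * ((nm e6)^-1 * Q))).
    rewrite (_ : _ * _ = S * (S * (S * (S * Q)))); last by ring.
    by rewrite {1}/S mulr_suml; do 3!(apply: eq_bigr => ? _; rewrite {1}/S mulr_suml !mulr_sumr); apply: eq_bigr.
  do 4!(rewrite -sumrB; apply: le_trans (ler_norm_sum _ _ _) _; apply: ler_sum_in => ? /[dup] /nm_idl_gt0 ? /nm_idl_ge1 ?).
  apply: le_trans (CP b B X _ _ _ _ l3 l5 _ _ _ _ h3 h5 X1 XB) _; [by rewrite mulr_ege1|by rewrite mulr_ege1|by rewrite mulr_ege1|by rewrite mulr_ege1|].
  by rewrite le_eqVlt; apply/orP; left; apply/eqP; rewrite /Q /=; move: (wt _) => W'; field; rewrite !gt_eqF.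
have S1 : S <= C2 * (1 + ln B) by apply: C2P; exact: le_trans X1 XB.
have S4 : S ^+ 4 <= C2 ^+ 4 * (1 + ln B) ^+ 4 by rewrite -exprMn; apply: lerXn2r; rewrite ?nnegrE // mulr_ge0 // addr_ge0.
have QE : Q <= C * X * w.
  rewrite /Q wE -(mulrA C) -(mulrA C); apply: ler_wpM2l => //; rewrite -(mulrA X); apply: ler_wpM2l; first exact: ltW.
  rewrite (_ : (l1 * l2 * l4 * l6)^-1 = l1^-1 * (l2^-1 * (l4^-1 * l6^-1))); last by rewrite -!invfM -!mulrA.
  rewrite -!(mulrA _ _ (wt _)); do 4!(apply: ler_pM; [by rewrite invr_ge0 ltW|by nneg; exact: ltW|exact: inv_le_r4|]).
  exact: lexx.
have Q0 : 0 <= Q by rewrite /Q; nneg; exact: ltW.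
apply: le_trans (ler_wpM2l Q0 S4) _; rewrite (_ : C * C2 ^+ 4 * _ * w = C * X * w * (C2 ^+ 4 * (1 + ln B) ^+ 4)); last by ring.
by apply: ler_wpM2r => //; rewrite mulr_ge0 ?exprn_ge0 // addr_ge0.
Qed.

(* The density at p of the pairs (u, v) whose parameters eta_i are divisible by p exactly for i in
   the given subset, relative to the lattice defined by eta. *)
Definition hloc (q : R) (b : seq bool) : R :=
  if b is [:: b1; b2; b4; b6; b3; b5] then
    if [|| b1 && (b3 || b5), b2 && [|| b4, b5 | b6], b3 && [|| b4, b5 | b6], b4 && b6 | b5 && b6] then 0 else
    (if [|| b1, b2, b3, b4 | b6] then 1 - q^-1 else 1)
    * (1 - (ic ([|| b1, b2, b4 | b5] && ~~ b6) + ic [&& b1, ~~ b2 & ~~ b4]) * q^-1)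
  else 0.

(** * The Euler product *)

Definition eul (q : R) : R := (1 - q^-1) ^+ 6 * (1 + 6 / q + (q ^+ 2)^-1).

(** The origin of the Euler factor in the theorem: by [mob_sum] it is the mean of [hloc] over the 64
    divisibility patterns, an explicit polynomial in 1/q. *)
Lemma euler_locE q : euler_loc 6 hloc q = eul q.
Proof.
rewrite /euler_loc mob_sum !sum_bitsS !sum_tups0 /= /eul -exprVn; move: (q^-1) => x.
by rewrite /ic /= ?mul0r ?add0r ?addr0 ?subn0 /subn /=; ring.
Qed.

Lemma hloc_bounds q b : 2 <= q -> 0 <= hloc q b <= 1.
Proof.
move=> q2; have x0 : 0 < q^-1 by rewrite invr_gt0; qlra.
have x2 : q^-1 <= 2^-1 by rewrite lef_pV2 ?posrE //; qlra.
case: b => [|b1 [|b2 [|b4 [|b6 [|b3 [|b5 [|? ?]]]]]]] /=; rewrite ?lexx ?ler01 //.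
case: ifP => _; rewrite ?lexx ?ler01 //.
have h (b : bool) : 0 <= (if b then 1 - q^-1 else 1) <= 1 by case: b; qlra.
have := h [|| b1, b2, b3, b4 | b6]; move: (if _ then _ else _) => t /andP[t0 t1].
have [k0 k2] : 0 <= ic ([|| b1, b2, b4 | b5] && ~~ b6) + ic [&& b1, ~~ b2 & ~~ b4] /\
   ic ([|| b1, b2, b4 | b5] && ~~ b6) + ic [&& b1, ~~ b2 & ~~ b4] <= 2.
  by rewrite /ic; split; case: (_ && _); case: (_ && _); rewrite /=; qlra.
move: (ic _ + ic _) k0 k2 => k k0 k2.
have kx0 : 0 <= k * q^-1 by rewrite mulr_ge0 // ltW.
have kx1 : k * q^-1 <= 2 * 2^-1 by apply: ler_pM => //; exact: ltW.
have [u0 u1] : 0 <= 1 - k * q^-1 /\ 1 - k * q^-1 <= 1 by split; qlra.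
by rewrite mulr_ge0 // mulr_ile1.
Qed.

(** Patterns with two or more divisibilities carry at least (q^(-3/4))^2, with coefficient at most
    2^6 = 64; for a single divisibility the coefficient is itself O(1/q). So every pattern except
    the empty one contributes O(q^(-3/2)). *)
Lemma mob_hloc q b : 2 <= q -> size b = 6 ->
  `|mob (hloc q) b| * (r4 q ^+ 3)^-1 ^+ count id b <= ic (count id b == 0)%N + 64 * (r4 q ^+ 6)^-1.
Proof.
move=> q2 sb; have q1 : 1 <= q by qlra.
have yE : (r4 q ^+ 6)^-1 = (r4 q ^+ 3)^-1 ^+ 2 by rewrite exprVn -exprM.
have qy := inv_le_r4 q1; have qi : 0 <= q^-1 by rewrite invr_ge0; qlra.
have r1 : 1 <= r4 q ^+ 3 by rewrite exprn_ege1 // r4_ge1.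
rewrite yE; set y := (r4 q ^+ 3)^-1 in qy *.
have y0 : 0 <= y by rewrite invr_ge0; qlra.
have y1 : y <= 1 by rewrite invf_le1 //; qlra.
have yy : 0 <= y ^+ 2 by rewrite exprn_ge0.
have [k2|] := leqP 2 (count id b).
  have mb : `|mob (hloc q) b| <= 64.
    apply: le_trans (mob_le b _) _; last by rewrite sb -natrX ler_nat.
    by move=> s; have /andP[h0 h1] := hloc_bounds s q2; rewrite ger0_norm.
  have yk : y ^+ count id b <= y ^+ 2 by apply: ler_wiXn2l.
  have ym : `|mob (hloc q) b| * y ^+ count id b <= 64 * y ^+ 2 by apply: ler_pM => //; rewrite exprn_ge0.
  by apply: le_trans ym _; rewrite lerDr ic_ge0.
case: b sb => [|b1 [|b2 [|b4 [|b6 [|b3 [|b5 [|? ?]]]]]]] // _.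
have qy2 : q^-1 * y <= y ^+ 2 by rewrite expr2 ler_wpM2r.
have fin (m : R) : `|m| <= 3 * q^-1 -> `|m| * y <= 0 + 64 * y ^+ 2.
  move=> h; apply: (@le_trans _ _ (3 * q^-1 * y)); first by rewrite ler_wpM2r.
  by rewrite -mulrA add0r; qlra.
case: b1; case: b2; case: b4; case: b6; case: b3; case: b5 => // _; rewrite /= /ic /= ?expr1 ?expr0;
  try (apply: fin; rewrite ler_norml; apply/andP; split; nra).
by rewrite addr0 mul0r subr0 !mulr1 normr1; qlra.
Qed.

Lemma euler_err_le q : 2 <= q -> euler_err 6 hloc q <= 1 + 64 * 64 * (r4 q ^+ 6)^-1.
Proof.
move=> q2; apply: (@le_trans _ _ (\sum_(b <- bits 6) (ic (count id b == 0)%N + 64 * (r4 q ^+ 6)^-1))).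
  by apply: ler_sum_in => b; rewrite tupsE => /andP[/eqP sb _]; exact: mob_hloc.
by rewrite !sum_bitsS !sum_tups0 /ic /=; qlra.
Qed.

Lemma sum_idl_r46 : exists2 C, 0 <= C & forall x, 0 <= x -> \sum_(e <- idl x) (r4 (nm e) ^+ 6)^-1 <= C.
Proof.
have [C C0 CP] := sum_idl_compare; have r0 := ltW rho_gt0.
exists ((rho + C) * 3); first by rewrite mulr_ge0 // addr_ge0.
move=> x x0; rewrite idl_trunc //; set n := Num.trunc x.
pose g i := (r4 i.+1%:R ^+ 6)^-1.
have gE i : g i = i.+1%:R^-1 / Num.sqrt i.+1%:R.
  rewrite /g -invfM; congr (_^-1); rewrite (exprD _ 4 2) r4K ?ler0n //.
  by rewrite /r4 sqr_sqrtr // sqrtr_ge0.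
have g0 i : 0 <= g i by rewrite invr_ge0 exprn_ge0 // r4_ge0.
have gd i : g i.+1 <= g i.
  have h j : 0 < r4 j.+1%:R ^+ 6 by rewrite exprn_gt0 // r4_gt0 // ltr0n.
  rewrite lef_pV2 ?posrE //; apply: lerXn2r; rewrite ?nnegrE ?r4_ge0 //.
  by apply: r4_le; rewrite ler_nat.
have := CP g n g0 gd (fun y => (r4 y ^+ 6)^-1) (fun i => erefl); rewrite ler_norml => /andP[_ h].
have h1 : \sum_(i < n) g i / Num.sqrt i.+1%:R <= \sum_(i < n) g i.
  apply: ler_sum => i _; rewrite ler_pdivrMr ?sqrtr_gt0 ?ltr0n // ler_peMr //.
  by rewrite -[leLHS]sqrtr1 ler_wsqrtr // ler1n.
have h2 : \sum_(i < n) g i <= 3 by under eq_bigr do rewrite gE; exact: sum_inv32.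
move: h h1 h2; set c := \sum_(i < n) (g i / _); set b := \sum_(i < n) g i => h h1 h2.
have h4 : rho * b <= rho * 3 by rewrite ler_wpM2l.
have h5 : C * c <= C * 3 by rewrite ler_wpM2l //; qlra.
by move: h; set a := \sum_(e <- _) _; qlra.
Qed.

Lemma sum_ples_r46 : exists2 C, 0 <= C & forall n, \sum_(p <- ples n) (r4 (qn p)%:R ^+ 6)^-1 <= C.
Proof.
have [C C0 CP] := sum_idl_r46; exists C => // n.
have -> : \sum_(p <- ples n) (r4 (qn p)%:R ^+ 6)^-1 = \sum_(e <- [seq dl p | p <- ples n]) (r4 (nm e) ^+ 6)^-1.
  by rewrite big_map; apply: eq_bigr => p _; rewrite nm_dl.
apply: le_trans (CP n%:R _) => //; apply: ler_sum_sub; last by move=> e _; rewrite invr_ge0 exprn_ge0 // r4_ge0.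
- rewrite map_inj_uniq ?ples_uniq // => p r E.
  by have := congr1 (fun f : prm -> int => f p) E; rewrite /= !dlE eqxx; case: eqP.
- exact: idl_uniq.
move=> e /mapP[p]; rewrite plesE => pn ->; rewrite idlE; apply/asboolP.
by split; [exact: integral_dl|rewrite nm_dl ler_nat].
Qed.

Lemma prod_le_expR (T : eqType) (s : seq T) (f g : T -> R) : (forall x, x \in s -> 0 <= f x <= 1 + g x) ->
  \prod_(x <- s) f x <= expR (\sum_(x <- s) g x).
Proof.
elim: s => [|a s ih] h; first by rewrite !big_nil expR0.
have /andP[f0 fg] := h a (mem_head _ _).
have h' x : x \in s -> 0 <= f x <= 1 + g x by move=> xs; apply: h; rewrite inE xs orbT.
rewrite !big_cons expRD; apply: ler_pM => //; last exact: ih.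
- by rewrite big_seq; apply: prodr_ge0 => x /h' /andP[].
- by apply: le_trans fg _; exact: expR_ge1Dx.
Qed.

Lemma prod_err : exists2 C, 0 <= C & forall n, \prod_(p <- ples n) euler_err 6 hloc (qn p)%:R <= C.
Proof.
have [C C0 CP] := sum_ples_r46; exists (expR (64 * 64 * C)); first exact: expR_ge0.
move=> n; apply: le_trans (@prod_le_expR _ _ _ (fun p => 64 * 64 * (r4 (qn p)%:R ^+ 6)^-1) _) _.
  move=> p _; rewrite euler_err_le ?qn_ge2 // andbT /euler_err; apply: sumr_ge0 => b _.
  by rewrite mulr_ge0 // exprn_ge0 // invr_ge0 exprn_ge0 // r4_ge0.
rewrite ler_expR -mulr_sumr; apply: ler_wpM2l (CP n).
by apply: mulr_ge0; exact: ler0n.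
Qed.

Lemma eul_bounds q : 2 <= q -> 0 <= eul q <= 1 /\ 1 - eul q <= 20 * (q ^+ 2)^-1.
Proof.
move=> q2; rewrite /eul -exprVn.
have x0 : 0 <= q^-1 by rewrite invr_ge0; qlra.
have x2 : q^-1 <= 2^-1 by rewrite lef_pV2 ?posrE //; qlra.
move: (q^-1) x0 x2 => x x0 x2.
have E : 1 - (1 - x) ^+ 6 * (1 + 6 * x + x ^+ 2) = x ^+ 2 * (20 * (1 - x) ^+ 4 + x * (16 * (1 - x) ^+ 2 + 2 * x - x ^+ 5)) by ring.
have x1 : x <= 1 by qlra.
have a5 : x ^+ 5 <= x by rewrite -[leRHS]expr1; apply: ler_wiXn2l.
have s2 : 0 <= (1 - x) ^+ 2 by exact: sqr_ge0.
have h1 : 0 <= 16 * (1 - x) ^+ 2 + 2 * x - x ^+ 5 by qlra.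
have h2 : 0 <= 20 * (1 - x) ^+ 4 + x * (16 * (1 - x) ^+ 2 + 2 * x - x ^+ 5).
  by apply: addr_ge0; apply: mulr_ge0 => //; apply: exprn_ge0; qlra.
have h3 : 20 * (1 - x) ^+ 4 + x * (16 * (1 - x) ^+ 2 + 2 * x - x ^+ 5) <= 20.
  rewrite (_ : _ + _ = 20 - (x * (64 - 90 * x + 64 * x ^+ 2 - 20 * x ^+ 3) + x ^+ 6)); last by ring.
  have x6 : 0 <= x ^+ 6 by rewrite exprn_ge0.
  have x3 : 0 <= x ^+ 3 by rewrite exprn_ge0.
  have x3' : x ^+ 3 <= x by rewrite -[leRHS]expr1; apply: ler_wiXn2l.
  have : 0 <= x * (64 - 90 * x + 64 * x ^+ 2 - 20 * x ^+ 3).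
    by apply: mulr_ge0 => //; have := sqr_ge0 x; qlra.
  by qlra.
split; last first.
  by rewrite E mulrC ler_wpM2r ?exprn_ge0.
have p0 : 0 <= (1 - x) ^+ 6 * (1 + 6 * x + x ^+ 2).
  by apply: mulr_ge0; [rewrite exprn_ge0 //; qlra|have := sqr_ge0 x; qlra].
by rewrite p0 -subr_ge0 E mulr_ge0 ?exprn_ge0.
Qed.

Definition euler_part (n : nat) : R := \prod_(p <- ples n) eul (qn p)%:R.

Lemma prod_diff (T : eqType) (s : seq T) (f : T -> R) : (forall x, x \in s -> 0 <= f x <= 1) ->
  0 <= \prod_(x <- s) f x <= 1 /\ 1 - \prod_(x <- s) f x <= \sum_(x <- s) (1 - f x).
Proof.
elim: s => [|a s ih] h; first by rewrite !big_nil; split; qlra.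
have /andP[f0 fg] := h a (mem_head _ _).
have [|/andP[p0 p1] p2] := ih; first by move=> x xs; apply: h; rewrite inE xs orbT.
rewrite !big_cons; move: (\prod_(x <- s) _) (\sum_(x <- s) _) (f a) p0 p1 p2 f0 fg => u w t p0 p1 p2 f0 fg.
by split; nra.
Qed.

(** For q > n the deviation 20 / q^2 of a factor from 1 is at most 20 q^(-3/2) / sqrt (n + 1), and
    the sum of q^(-3/2) over primes converges. *)
Lemma euler_part_diff : exists2 C, 0 <= C & forall n m, (n <= m)%N ->
  0 <= euler_part m <= euler_part n /\ euler_part n - euler_part m <= C / Num.sqrt n.+1%:R.
Proof.
have [C C0 CP] := sum_ples_r46; exists (20 * C); first by rewrite mulr_ge0.
have eb p : 0 <= eul (qn p)%:R <= 1 /\ 1 - eul (qn p)%:R <= 20 * ((qn p)%:R ^+ 2)^-1 by apply: eul_bounds; exact: qn_ge2.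
move=> n m nm'; set t := [seq p <- ples m | (n < qn p)%N].
have P : perm_eq (ples m) (ples n ++ t).
  apply: uniq_perm; first exact: ples_uniq.
    rewrite cat_uniq !ples_uniq filter_uniq ?ples_uniq // andbT; apply/hasPn => p.
    by rewrite mem_filter => /andP[h _]; rewrite plesE -ltnNge.
  move=> p; rewrite mem_cat mem_filter !plesE; case: leqP => //= h.
  exact: leq_trans h nm'.
have E : euler_part m = euler_part n * \prod_(p <- t) eul (qn p)%:R by rewrite /euler_part (perm_big _ P) big_cat.
have [/andP[t0 t1] t2] := @prod_diff _ t (fun p => eul (qn p)%:R) (fun p _ => (eb p).1).
have [/andP[n0 n1] _] := @prod_diff _ (ples n) (fun p => eul (qn p)%:R) (fun p _ => (eb p).1).
rewrite -/(euler_part n) in n0 n1.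
have s0 : 0 < Num.sqrt n.+1%:R :> R by rewrite sqrtr_gt0 ltr0n.
have t3 : \sum_(p <- t) (1 - eul (qn p)%:R) <= 20 * C / Num.sqrt n.+1%:R.
  apply: (@le_trans _ _ (\sum_(p <- t) 20 / Num.sqrt n.+1%:R * (r4 (qn p)%:R ^+ 6)^-1)).
    apply: ler_sum_in => p; rewrite mem_filter => /andP[np _].
    apply: le_trans (eb p).2 _; rewrite -mulrA ler_wpM2l // -invfM lef_pV2 ?posrE ?exprn_gt0 ?mulr_gt0 ?exprn_gt0 ?r4_gt0 ?qn_gt0 //.
    rewrite -[in leRHS](r4K (ltW (qn_gt0 p))) -exprM (exprD _ 2 6) ler_wpM2r ?exprn_ge0 ?r4_ge0 //.
    by rewrite /r4 sqr_sqrtr ?sqrtr_ge0 // ler_wsqrtr // ler_nat.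
  rewrite -mulr_sumr mulrAC -mulrA [leRHS]mulrAC -[leRHS]mulrA; apply: ler_wpM2l => //.
  rewrite [leRHS]mulrC ler_wpM2r ?invr_ge0 ?(ltW s0) //.
  apply: le_trans (CP m); apply: ler_sum_sub.
  - by rewrite filter_uniq // ples_uniq.
  - exact: ples_uniq.
  - by move=> p; rewrite mem_filter => /andP[].
  - by move=> p _; rewrite invr_ge0 exprn_ge0 // r4_ge0.
by rewrite E; move: (\prod_(p <- t) _) (\sum_(p <- t) _) (euler_part n) t0 t1 t2 t3 n0 n1 => u w e t0 t1 t2 t3 n0 n1; split; nra.
Qed.

Lemma euler_productE : euler_product R K = limn euler_part.
Proof.
rewrite /euler_product; congr (lim (_ @ \oo)); apply/funext => n; rewrite /euler_part.
have -> : [set P : set K | nonzero_prime_ideal P /\ (absNorm P <= n)%N] = [set` [seq sval p | p <- ples n]].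
  apply/seteqP; split => P /=.
    move=> [hP Pn]; have h : `[< PI P >] by apply/asboolP.
    by apply/mapP; exists (exist _ P h) => //; rewrite plesE.
  by move=> /mapP[p]; rewrite plesE => pn ->; split => //; exact: prmP.
rewrite -fsbig_seq ?big_map //; rewrite map_inj_uniq ?ples_uniq //; exact: val_inj.
Qed.

Lemma euler_conv : exists2 C, 0 <= C & forall n, `|euler_part n - euler_product R K| <= C / Num.sqrt n.+1%:R.
Proof.
have [C C0 CP] := euler_part_diff; exists C => // n; rewrite euler_productE.
have dec : nonincreasing_seq euler_part by move=> i j ij; have [/andP[]] := CP _ _ ij.
have cv : cvgn euler_part.
  apply: nonincreasing_is_cvgn => //; exists 0 => _ [i _ <-].
  by have [/andP[]] := CP _ _ (leqnn i).
have l1 : limn euler_part <= euler_part n.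
  apply: limr_le => //; exists n => // m /= nm'; exact: dec.
have l2 : euler_part n - C / Num.sqrt n.+1%:R <= limn euler_part.
  apply: limr_ge => //; exists n => // m /= nm'; have [_] := CP _ _ nm'; qlra.
by rewrite ler_norml; apply/andP; split; qlra.
Qed.

(** The effect of (u, v) -> (v, u) on the parameters: eta_2 is exchanged with eta_4, and eta_3 with
    eta_5. *)
Definition swl (T : Type) (s : seq T) : seq T :=
  if s is [:: a1; a2; a4; a6; a3; a5] then [:: a1; a4; a2; a6; a5; a3] else s.
Lemma swlK T : involutive (@swl T).
Proof. by case=> [|a1 [|a2 [|a4 [|a6 [|a3 [|a5 [|? ?]]]]]]]. Qed.
Lemma map_swl T U (f : T -> U) s : map f (swl s) = swl (map f s).
Proof. by case: s => [|a1 [|a2 [|a4 [|a6 [|a3 [|a5 [|? ?]]]]]]]. Qed.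
Lemma perm_swl (T : eqType) (s : seq T) : perm_eq (swl s) s.
Proof.
case: s => [|a1 [|a2 [|a4 [|a6 [|a3 [|a5 [|? ?]]]]]]] //=; apply/permP => P /=; lia.
Qed.
Lemma sum_tups_swl (l : seq (prm -> int)) (G : seq (prm -> int) -> R) : uniq l ->
  \sum_(s <- tups l 6) G (swl s) = \sum_(s <- tups l 6) G s.
Proof.
move=> ul; rewrite -(big_map (@swl _) predT G); apply: perm_big; apply: uniq_perm.
- by rewrite map_inj_uniq ?tups_uniq //; exact: inv_inj (@swlK _).
- exact: tups_uniq.
have H s : s \in tups l 6 -> swl s \in tups l 6.
  by rewrite !tupsE (perm_size (perm_swl s)) (eq_all_r (perm_mem (perm_swl s))).
move=> s; apply/mapP/idP => [[s' /H h ->//]|h]; exists (swl s); rewrite ?swlK //; exact: H.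
Qed.

Lemma theta_swl P s : theta hloc P (swl s) = theta hloc P s.
Proof.
apply: eq_bigr => p _; rewrite /supp map_swl.
case: (map _ s) => [|a1 [|a2 [|a4 [|a6 [|a3 [|a5 [|? ?]]]]]]] //=.
by case: a1; case: a2; case: a4; case: a6; case: a3; case: a5; rewrite /ic /=; ring.
Qed.

(** * The weighted sum over all tuples *)

Definition nms (s : seq (prm -> int)) : seq R := map nm s.
Definition Theta (B : R) s : R := theta hloc (ples (Num.trunc B)) s.
(** Total weight of the tuples with J <= X, n <= 1 and n' <= 1, where n' is n after the swap; this
    cut-off is written as one indicator minus two, see [FQ_ic]. *)
Definition Qsum B X : R := \sum_(s <- tups (idl B) 6)
  (FQ false X (nms s) - FQ true X (nms s) - FQ true X (swl (nms s))) * Theta B s.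

(** The values in [bmain] combine to 3/2 - 2 * 1/4 = 1. The primes entering the weight are those of
    norm at most B, so the full Euler product is approximated by a partial one. *)
Lemma Qsum_main : exists2 C, 0 <= C & forall B X, 1 <= X -> X <= B ->
  `|Qsum B X - rho ^+ 6 / k0 * euler_product R K * (X * ln X ^+ 5)| <= C * (X * (1 + ln B) ^+ 4).
Proof.
have [D D0 DP] := prod_err; have [E E0 EP] := euler_conv; have r0 := ltW rho_gt0; have kp := k0_gt0.
have H b : exists2 C, 0 <= C & forall B X, 1 <= X -> X <= B ->
   `|\sum_(s <- tups (idl B) 6) FQ b X (nms s) * Theta B s - bmain b * (X * ln X ^+ 5) * euler_part (Num.trunc B)|
    <= C * (X * (1 + ln B) ^+ 4).
  have [C C0 CP] := base_sum b; exists (C * D); first by rewrite mulr_ge0.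
  move=> B X X1 XB; have l0 : 0 <= ln B by apply: ln_ge0; qlra.
  have := @prime_induction B 6 (FQ b X) (bmain b * (X * ln X ^+ 5)) (C * (X * (1 + ln B) ^+ 4)) hloc
    (fun lam => @FQ_vanishes b B X lam XB) (fun lam => CP B X lam X1 XB) _ (ples_uniq (Num.trunc B)) (nseq 6 1) erefl.
  have -> : (\prod_(x <- nseq 6 1) x)^-1 = 1 :> R by rewrite big_nseq /= !mulr1 invr1.
  have -> : wt (nseq 6 1) = 1 by rewrite /wt big_nseq /= r4_1 expr1n invr1 !mulr1.
  rewrite !mulr1 => h; have {}h := h _.
  have -> : \sum_(s <- tups (idl B) 6) FQ b X (nms s) * Theta B s =
     \sum_(s <- tups (idl B) 6) FQ b X (vals (nseq 6 1) s) * theta hloc (ples (Num.trunc B)) s.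
    apply: eq_big_seq => s; rewrite tupsE => /andP[/eqP + _].
    by case: s => [|a1 [|a2 [|a4 [|a6 [|a3 [|a5 [|? ?]]]]]]] // _; rewrite /vals /nms /= !mul1r.
  have -> : euler_part (Num.trunc B) = \prod_(p <- ples (Num.trunc B)) euler_loc 6 hloc (qn p)%:R.
    by apply: eq_bigr => p _; rewrite euler_locE.
  apply: le_trans (h _) _; first by move=> x /nseqP[-> _].
  rewrite [leRHS]mulrAC ler_wpM2l //; nneg; qlra.
have [C1 C10 H1] := H false; have [C2 C20 H2] := H true.
exists (C1 + 2 * C2 + rho ^+ 6 / k0 * E * 4); first by nneg.
move=> B X X1 XB; have := H1 B X X1 XB; have := H2 B X X1 XB.
set T := Theta B; set S2 := \sum_(s <- _) _; set S1 := \sum_(s <- _) _ => h2 h1.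
have -> : Qsum B X = S1 - S2 - S2.
  transitivity (S1 - S2 - \sum_(s <- tups (idl B) 6) FQ true X (swl (nms s)) * T s).
    by rewrite /Qsum /S1 /S2 -!sumrB; apply: eq_bigr => s _; rewrite /T; ring.
  congr (_ - _); rewrite /S2 -(sum_tups_swl _ (idl_uniq B)); apply: eq_bigr => s _.
  by rewrite /T /Theta theta_swl /nms map_swl swlK.
have := EP (Num.trunc B); set e := euler_part _ in h1 h2 *; set el := euler_product R K => he.
have B1 : 1 <= B by qlra.
have X0 : 0 < X by qlra.
have [lX lB] : 0 <= ln X /\ 0 <= ln B by split; apply: ln_ge0.
have lXB : ln X <= ln B by rewrite ler_ln ?posrE //; qlra.
have s0 : 0 < Num.sqrt (Num.trunc B).+1%:R :> R by rewrite sqrtr_gt0 ltr0n.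
(* The tail of the Euler product is O(B^(-1/2)), which absorbs one of the five logarithms. *)
have k1 : ln X <= 4 * Num.sqrt (Num.trunc B).+1%:R.
  have B0 : 0 < B by qlra.
  apply: le_trans lXB _; apply: le_trans (ln_le_r4 B0) _; rewrite ler_wpM2l //.
  have sB : Num.sqrt B <= Num.sqrt (Num.trunc B).+1%:R by rewrite ler_wsqrtr // ltW //; have /andP[] := truncn_itv (ltW B0).
  apply: le_trans sB; rewrite /r4 -[leRHS](sqr_sqrtr (sqrtr_ge0 B)) expr2 ler_peMr ?sqrtr_ge0 //.
  by rewrite -sqrtr1 ler_wsqrtr // -sqrtr1 ler_wsqrtr.
have l4 : ln X ^+ 4 <= (1 + ln B) ^+ 4 by apply: lerXn2r; rewrite ?nnegrE //; qlra.
have X4 : 0 <= ln X ^+ 4 by rewrite exprn_ge0.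
have hE : `|(e - el) * ln X ^+ 5| <= E * 4 * (1 + ln B) ^+ 4.
  rewrite normrM (ger0_norm (exprn_ge0 5 lX)) (exprS _ 4).
  apply: (@le_trans _ _ (E / Num.sqrt (Num.trunc B).+1%:R * (4 * Num.sqrt (Num.trunc B).+1%:R * (1 + ln B) ^+ 4))).
    apply: ler_pM => //; first by rewrite mulr_ge0.
    by apply: ler_pM.
  by rewrite le_eqVlt; apply/orP; left; apply/eqP; field; rewrite gt_eqF.
rewrite (_ : _ - _ = (S1 - bmain false * (X * ln X ^+ 5) * e) - 2 * (S2 - bmain true * (X * ln X ^+ 5) * e)
   + rho ^+ 6 / k0 * X * ((e - el) * ln X ^+ 5)); last by rewrite /bmain; field; rewrite gt_eqF // k0_gt0.
have c0 : 0 <= rho ^+ 6 / k0 * X by nneg; exact: ltW.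
apply: le_trans (ler_normD _ _) _; rewrite [X in _ + X]normrM (ger0_norm c0).
have := ler_wpM2l c0 hE.
have h3 := ler_wpM2l c0 hE.
have h4 := ler_normB (S1 - bmain false * (X * ln X ^+ 5) * e) (2 * (S2 - bmain true * (X * ln X ^+ 5) * e)).
have h5 : `|2 * (S2 - bmain true * (X * ln X ^+ 5) * e)| = 2 * `|S2 - bmain true * (X * ln X ^+ 5) * e| by rewrite normrM normr_nat.
rewrite h5 in h4; clear -h1 h2 h3 h4; set a1 := `|_ - _ - 2 * _| in h4 *; set a4 := `|_ * ln X ^+ 5| in h3 *.
set a2 := `|S1 - _| in h1 h4 *; set a3 := `|S2 - _| in h2 h4 *; set Y := X * (1 + ln B) ^+ 4 in h1 h2 *.
have E' : rho ^+ 6 / k0 * X * (E * 4 * (1 + ln B) ^+ 4) = rho ^+ 6 / k0 * E * 4 * Y by rewrite /Y; ring.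
rewrite E' {E'} in h3; move: h1 h2 h3 h4; clearbody Y a4 a1 a2 a3; move: a1 a2 a3 (_ * X * a4) Y (rho ^+ 6 / k0 * E * 4) => ? ? ? ? ? ? *; qlra.
Qed.

(** * Lattice points in the height region *)
Section ProductSigmaFinite.
Context d1 d2 (T1 : measurableType d1) (T2 : measurableType d2).
Variables (n1 : {sigma_finite_measure set T1 -> \bar R}) (n2 : {sigma_finite_measure set T2 -> \bar R}).
(** A named copy of the product measure carrying a sigma-finite structure, so that it can itself be
    a factor of a product. *)
Definition sfprod : set (T1 * T2)%type -> \bar R := (n1 \x n2)%E.
HB.instance Definition _ := Measure.copy sfprod (n1 \x n2)%E.
Lemma sfprod_sigma_finite : sigma_finite setT sfprod.
Proof. by case: (lebesgue_integral_fubini.measure_function_Measure_isSigmaFinite__to__measure_function_isSigmaFinite n1 n2). Qed.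
HB.instance Definition _ := Measure_isSigmaFinite.Build _ _ _ sfprod sfprod_sigma_finite.
End ProductSigmaFinite.
Definition mC : set (measurableTypeR R * measurableTypeR R)%type -> \bar R := (mu \x mu)%E.
HB.instance Definition _ := Measure.copy mC (mu \x mu)%E.
Lemma mC_sigma_finite : sigma_finite setT mC.
Proof. exact: (sfprod_sigma_finite mu mu). Qed.
HB.instance Definition _ := Measure_isSigmaFinite.Build _ _ _ mC mC_sigma_finite.
Lemma mCE (A : set (R * R)) : mC A = m2 A. Proof. by []. Qed.
Local Notation m4 := (mC \x mC)%E.
Definition pm (z w : R * R) : R * R := (z.1 * w.1 - z.2 * w.2, z.1 * w.2 + z.2 * w.1).
Lemma n2M z w : n2 (pm z w) = n2 z * n2 w.
Proof. by case: z w => a b [c d]; rewrite /n2 /=; ring. Qed.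

Definition Rg (T : R) : set ((R * R) * (R * R)) := [set x | [/\ n2 x.1 <= T, n2 x.2 <= T,
  n2 x.1 * n2 x.2 <= T & n2 x.1 * n2 x.2 * n2 (x.1 + x.2) <= T]].

Lemma n2_D3 z w (a b c : R) : 0 <= a -> 0 <= b -> a + b <= c -> n2 z <= a ^+ 2 -> n2 w <= b ^+ 2 -> n2 (z + w) <= c ^+ 2.
Proof.
move=> a0 b0 ab h1 h2; apply: le_trans (n2D a0 b0 h1 h2) _.
by apply: lerXn2r; rewrite ?nnegrE; qlra.
Qed.
Lemma n2_M2 z w (a b : R) : 0 <= a -> 0 <= b -> n2 z <= a ^+ 2 -> n2 w <= b ^+ 2 -> n2 (pm z w) <= (a * b) ^+ 2.
Proof. by move=> a0 b0 h1 h2; rewrite n2M exprMn; apply: ler_pM => //; exact: n2_ge0. Qed.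

(* Moving a point of the region by at most d enlarges the region by the amount 14 t^2 d. *)
Lemma Rg_move t s d (x y : (R * R) * (R * R)) : 1 <= t -> 0 <= s -> s <= t -> 0 <= d -> d <= t ->
  Rg (s ^+ 2) x -> n2 y.1 <= d ^+ 2 -> n2 y.2 <= d ^+ 2 -> Rg ((s + 14 * t ^+ 2 * d) ^+ 2) (x.1 + y.1, x.2 + y.2).
Proof.
case: x y => u v [e f] /= t1 s0 st d0 dt [hu hv huv huvw] he hf.
have t0 : 0 <= t by qlra.
have td : d <= t ^+ 2 * d by rewrite ler_peMl // exprn_ege1.
have ttd : t * d <= t ^+ 2 * d by rewrite ler_wpM2r // expr2 ler_peMl.
have t2d : 0 <= t ^+ 2 * d by rewrite mulr_ge0 // exprn_ge0.
have dd : d * d <= t * d by rewrite ler_wpM2r.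
have tdd : t * (d * d) <= t ^+ 2 * d by rewrite expr2 -mulrA ler_wpM2l // ler_wpM2r.
have ddd : d * (d * d) <= t ^+ 2 * d by apply: le_trans tdd; rewrite ler_wpM2r // mulr_ge0.
have S0 : 0 <= s + 14 * t ^+ 2 * d by qlra.
have hu' : n2 u <= t ^+ 2 by apply: le_trans hu _; apply: lerXn2r.
have hv' : n2 v <= t ^+ 2 by apply: le_trans hv _; apply: lerXn2r.
rewrite -n2M in huv; rewrite -!n2M in huvw.
have huv' : n2 (pm u v) <= t ^+ 2 by apply: le_trans huv _; apply: lerXn2r.
have q1 : n2 (u + e) <= (s + d) ^+ 2 by exact: n2D.
have q2 : n2 (v + f) <= (s + d) ^+ 2 by exact: n2D.
have k1 : n2 (pm u f + pm e v + pm e f) <= (2 * (t * d) + d * d) ^+ 2.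
  have p0 : 0 <= t * d by rewrite mulr_ge0.
  apply: (@n2_D3 _ _ (t * d + t * d) (d * d)); rewrite ?addr_ge0 ?mulr_ge0 //; first qlra; last exact: n2_M2.
  by apply: n2D => //; [exact: n2_M2|rewrite mulrC; exact: n2_M2].
have E1 : pm (u + e) (v + f) = pm u v + (pm u f + pm e v + pm e f).
  by case: (u) (v) (e) (f) => ? ? [? ?] [? ?] [? ?]; rewrite /pm /=; congr (_, _); rewrite /=; ring.
have q3 : n2 (pm (u + e) (v + f)) <= (s + (2 * (t * d) + d * d)) ^+ 2.
  by rewrite E1; apply: n2D => //; rewrite addr_ge0 ?mulr_ge0 ?mulr_ge0.
split => /=.
- by apply: le_trans q1 _; apply: lerXn2r; rewrite ?nnegrE; move: s0 d0 td t2d; clear -hK; move=> *; lra.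
- by apply: le_trans q2 _; apply: lerXn2r; rewrite ?nnegrE; move: s0 d0 td t2d; clear -hK; move=> *; lra.
- by rewrite -n2M; apply: le_trans q3 _; apply: lerXn2r; rewrite ?nnegrE; move: (mulr_ge0 d0 d0) (mulr_ge0 t0 d0) s0 ttd dd t2d; clear -hK; move=> *; lra.
rewrite -!n2M; have E2 : pm (pm (u + e) (v + f)) (u + e + (v + f)) =
    pm (pm u v) (u + v) + (pm (pm u v) (e + f) + pm (pm u f + pm e v + pm e f) (u + e + (v + f))).
  by case: (u) (v) (e) (f) => ? ? [? ?] [? ?] [? ?]; rewrite /pm /=; congr (_, _); rewrite /=; ring.
rewrite E2; have p0 : 0 <= t * d by rewrite mulr_ge0.
have p1 : 0 <= d * d by rewrite mulr_ge0.
apply: (@n2_D3 _ _ s (t * (d + d) + (2 * (t * d) + d * d) * ((t + d) + (t + d)))) => //.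
- by rewrite addr_ge0 // mulr_ge0 //; qlra.
- by rewrite expr2 in tdd ddd ttd *; qlra.
have tt : 0 <= t + d + (t + d) by rewrite !addr_ge0.
have q4 : n2 (u + e + (v + f)) <= (t + d + (t + d)) ^+ 2 by apply: n2D; rewrite ?addr_ge0 //; exact: n2D.
have tdd2 : 0 <= 2 * (t * d) + d * d by rewrite addr_ge0 // mulr_ge0.
apply: n2D; [by rewrite mulr_ge0 // addr_ge0|by rewrite mulr_ge0| |].
  by apply: n2_M2 => //; [rewrite addr_ge0|exact: n2D].
exact: n2_M2 k1 q4.
Qed.

Lemma measurable_n2D : measurable_fun setT (fun x : (R * R) * (R * R) => n2 (x.1 + x.2)).
Proof.
rewrite /n2 /=; apply: measurable_funD; apply: measurable_funX; apply: measurable_funD.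
- exact: (measurableT_comp measurable_fst measurable_fst).
- exact: (measurableT_comp measurable_fst measurable_snd).
- exact: (measurableT_comp measurable_snd measurable_fst).
- exact: (measurableT_comp measurable_snd measurable_snd).
Qed.
Lemma measurable_Rg T : measurable (Rg T).
Proof.
have mn : measurable_fun setT (n2 : R * R -> R) by exact: measurable_n2.
have m1 : measurable_fun setT (fun x : (R * R) * (R * R) => n2 x.1) by exact: measurableT_comp.
have m2' : measurable_fun setT (fun x : (R * R) * (R * R) => n2 x.2) by exact: measurableT_comp.
have m3 := measurable_n2D.
have mle (f : (R * R) * (R * R) -> R) : measurable_fun setT f -> measurable [set x | f x <= T].
  by move=> mf; rewrite -[X in measurable X]setTI; apply: measurable_fun_le => //; exact: measurable_cst.
have m12 : measurable_fun setT (fun x : (R * R) * (R * R) => n2 x.1 * n2 x.2) by exact: measurable_funM.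
rewrite (_ : Rg T = [set x | n2 x.1 <= T] `&` [set x | n2 x.2 <= T] `&` [set x | n2 x.1 * n2 x.2 <= T]
  `&` [set x | n2 x.1 * n2 x.2 * n2 (x.1 + x.2) <= T]).
  by do 3?apply: measurableI; apply: mle => //; exact: measurable_funM.
by apply/seteqP; split => x [] //; move=> [[]].
Qed.

Definition Vol (T : R) : R := locked (fine (m4 (Rg T))).

Lemma Rg_sub S T : S <= T -> Rg S `<=` Rg T.
Proof. by move=> h x [h1 h2 h3 h4]; split; exact: le_trans h. Qed.

Lemma Vol_fin T : 0 <= T -> (m4 (Rg T) <= ((c1 * T) ^+ 2)%:E)%E.
Proof.
move=> T0; have -> : ((c1 * T) ^+ 2)%:E = m4 (disc T `*` disc T).
  transitivity (mC (disc T) * mC (disc T))%E; first by rewrite mCE !m2_disc // -EFinM expr2.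
  by apply/esym; apply: product_measure1E; exact: measurable_disc.
apply: le_measure; rewrite ?inE; first exact: measurable_Rg.
  by apply: measurableX; exact: measurable_disc.
by move=> x [h1 h2 _ _].
Qed.
Lemma VolE T : 0 <= T -> m4 (Rg T) = (Vol T)%:E.
Proof.
move=> T0; rewrite /Vol -lock fineK // ge0_fin_numE; last exact: measure_ge0.
by apply: le_lt_trans (Vol_fin T0) _; rewrite ltry.
Qed.
Lemma Vol_ge0 T : 0 <= Vol T. Proof. by rewrite /Vol -lock; apply: fine_ge0; exact: measure_ge0. Qed.

(** After scaling u and v by c >= 1 the left sides of the four conditions grow by c^2, c^2, c^4 and
    c^6, each at least c^2, so the scaled-down region lies in Rg T, while real dimension 4 gives the
    factor c^4. *)
Lemma Vol_scale c T : 1 <= c -> 0 <= T -> Vol (c ^+ 2 * T) <= c ^+ 4 * Vol T.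
Proof.
move=> c1' T0; have c0 : 0 < c by exact: lt_le_trans c1'.
have cc : 0 < c ^+ 2 by rewrite exprn_gt0.
have cT0 : 0 <= c ^+ 2 * T by rewrite mulr_ge0 // ltW.
suff : (m4 (Rg (c ^+ 2 * T)) <= (c ^+ 4)%:E * m4 (Rg T))%E by rewrite (VolE cT0) (VolE T0) -EFinM lee_fin.
have mf : measurable_fun setT (fun z : R * R => (c * z.1, c * z.2)).
  by apply: measurable_fun_pair; apply: measurable_funM.
have H (B : set (R * R)) : measurable B -> mC B = ((c ^+ 2)%:E * mC ((fun z : R * R => (c * z.1, c * z.2)%R) @^-1` B))%E.
  by move=> mB; exact: m2_scale.
have E0 := @product_scaling _ _ _ _ mC mC _ _ _ _ _ mf mf cc cc H H (measurable_Rg (c ^+ 2 * T)).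
rewrite E0 {E0 H}.
rewrite -exprD; apply: lee_wpmul2l; first by rewrite lee_fin exprn_ge0 // ltW.
apply: le_measure; rewrite ?inE; [|exact: measurable_Rg|].
  rewrite -[X in measurable X]setTI.
  have : measurable_fun setT (fun z : (R * R) * (R * R) => ((c * z.1.1, c * z.1.2), (c * z.2.1, c * z.2.2))).
    by apply: measurable_fun_pair; [exact: (measurableT_comp mf measurable_fst)|exact: (measurableT_comp mf measurable_snd)].
  by apply => //; exact: measurable_Rg.
have E z : n2 (c * z.1, c * z.2) = c ^+ 2 * n2 z by rewrite /n2 /=; ring.
have E' (z w : R * R) : n2 ((c * z.1, c * z.2) + (c * w.1, c * w.2)) = c ^+ 2 * n2 (z + w) by rewrite /n2 /=; ring.
have c21 : 1 <= c ^+ 2 by rewrite exprn_ege1.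
move=> [z w] []; rewrite /= E' !E !(ler_pM2l cc) => h1 h2 h3 h4; split => //=.
  have zw : 0 <= n2 z * n2 w by rewrite mulr_ge0 ?n2_ge0.
  rewrite (_ : _ * n2 z * _ = c ^+ 2 * (c ^+ 2 * (n2 z * n2 w))) in h3; last by ring.
  by move: h3; rewrite ler_pM2l // => h3; apply: le_trans h3; rewrite ler_peMl.
have zw : 0 <= n2 z * n2 w * n2 (z + w) by rewrite !mulr_ge0 ?n2_ge0.
rewrite (_ : _ * n2 z * _ * _ = c ^+ 2 * (c ^+ 4 * (n2 z * n2 w * n2 (z + w)))) in h4; last by ring.
by move: h4; rewrite ler_pM2l // => h4; apply: le_trans h4; rewrite ler_peMl // exprn_ege1.
Qed.

Definition emax e f : prm -> int := fun p => Num.max (e p) (f p).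
Definition emin e f : prm -> int := fun p => Num.min (e p) (f p).
Lemma fs_emax e f : fs e -> fs f -> fs (emax e f).
Proof. by move=> fe ff; apply: (fs_sub fe ff) => p h1 h2; rewrite /emax h1 h2 maxxx. Qed.
Lemma fs_emin e f : fs e -> fs f -> fs (emin e f).
Proof. by move=> fe ff; apply: (fs_sub fe ff) => p h1 h2; rewrite /emin h1 h2 minxx. Qed.

Definition Lam x y z (a : K * K) : Prop := [/\ ide x a.1, ide y a.2 & ide z (a.1 + a.2)].
(** The exponents of Y ∩ (X + Z), the image of [Lam] under projection to v. The kernel of this
    projection is X ∩ Z, with exponents [emax x z]. *)
Definition proj x y z := emax y (emin x z).

Lemma ide_emax e f x : ide (emax e f) x <-> ide e x /\ ide f x.
Proof.
split=> [[->|h]|[[->|h1] h2]]; try by split; left.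
- by split; right => p; have := h p; rewrite ge_max => /andP[].
- by left.
by case: h2 => [->|h2]; [left|right => p; rewrite ge_max h1 h2].
Qed.
Lemma ideN e x : ide e x -> ide e (- x).
Proof. by move=> h; rewrite -mulN1r; have [_ _ M] := ide_submod e; apply: M => //; apply/ON/O1. Qed.
Lemma ideB e x y : ide e x -> ide e y -> ide e (x - y).
Proof. by move=> hx hy; have [_ D _] := ide_submod e; apply: D => //; exact: ideN. Qed.

(** The sum of two fractional ideals has the minimum of the exponents: at each prime an element of
    one of the two attains it, and [local_global] puts these together. *)
Lemma ide_emin e f y : fs e -> fs f -> ide (emin e f) y -> exists2 a, ide e a & ide f (a + y).
Proof.
move=> fe ff hy; have [->|y0] := eqVneq y 0; first by exists 0; rewrite ?addr0; left.
pose J := [set w | exists2 a, ide e a & ide f (a + w)].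
have [e0 eD eM] := ide_submod e; have [g0 gD gM] := ide_submod f.
apply: (@local_global J).
- split; first by exists 0; rewrite ?add0r.
    move=> a b [c hc hca] [d hd hdb]; exists (c + d); first exact: eD.
    by rewrite addrACA; exact: gD.
  move=> a b oa [c hc hcb]; exists (a * c); first exact: eM.
  by rewrite -mulrDr; exact: gM.
- by have [w w1 w0] := ide_neq0 ff; exists w => //; exists 0; rewrite ?add0r.
move=> p; case: hy => [h|/(_ p)]; first by rewrite h eqxx in y0.
rewrite /emin minEle; case: ifP => _ h.
  have [a [a0 ae va]] := ide_exact p fe; exists a; last by rewrite va.
  by exists (- a); [exact: ideN|rewrite addNr].
have [a [a0 ae va]] := ide_exact p ff; exists a; last by rewrite va.
by exists 0; rewrite ?add0r.
Qed.

Lemma fs_proj x y z : fs x -> fs y -> fs z -> fs (proj x y z).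
Proof. by move=> fx fy fz; apply: fs_emax => //; exact: fs_emin. Qed.

Lemma Lam_proj x y z a : Lam x y z a -> ide (proj x y z) a.2.
Proof.
move=> [h1 h2 h3]; apply/ide_emax; split => //.
have s1 : ide (emin x z) a.1 by apply: (ide_le _ h1) => p; rewrite ge_min lexx.
have s2 : ide (emin x z) (a.1 + a.2) by apply: (ide_le _ h3) => p; rewrite ge_min lexx orbT.
by have := ideB s2 s1; rewrite addrC addKr.
Qed.
Lemma Lam_surj x y z b : fs x -> fs z -> ide (proj x y z) b -> exists a, Lam x y z (a, b).
Proof. by move=> fx fz /ide_emax[h1 /(ide_emin fx fz)[a h2 h3]]; exists a. Qed.
Lemma Lam_ker x y z a b c : Lam x y z (a, c) -> Lam x y z (b, c) <-> ide (emax x z) (b - a).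
Proof.
move=> [h1 h2 h3]; rewrite ide_emax; split => [[h4 _ h5]|[h4 h5]].
  split; first exact: ideB.
  by have := ideB h5 h3; rewrite /= opprD addrACA subrr addr0.
have [_ xD _] := ide_submod x; have [_ zD _] := ide_submod z.
split => //=; first by rewrite -(subrK a b); exact: xD.
by rewrite (_ : b + c = b - a + (a + c)); [exact: zD|rewrite addrA subrK].
Qed.

Definition lampts x y z (T : R) : seq (K * K) := [seq a <- [seq (u, w) | u <- pts x T, w <- pts y T] |
  [&& `[< ide z (a.1 + a.2) >], sq a.1 * sq a.2 <= T & sq a.1 * sq a.2 * sq (a.1 + a.2) <= T]].
Definition pt2 (a : K * K) := (pt a.1, pt a.2).

Lemma lampts_uniq x y z T : uniq (lampts x y z T).
Proof. by rewrite filter_uniq //; apply: allpairs_uniq; rewrite ?pts_uniq // => -[? ?] [? ?] _ _ [-> ->]. Qed.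
Lemma lamptsE x y z T a : fs x -> fs y -> (a \in lampts x y z T) = `[< Lam x y z a /\ Rg T (pt2 a) >].
Proof.
move=> fx fy; rewrite mem_filter; apply/andP/asboolP => [[+ /allpairsP[[u w] /= [hu hw E]]]|[[h1 h2 h3] []]].
  move: hu hw; rewrite !ptsE // E => /asboolP[hu hu'] /asboolP[hw hw'] /= /and3P[/asboolP h1 h2 h3].
  have h4 : n2 (pt u + pt w) = sq (u + w) by rewrite -ptD n2_pt.
  split; first by split; [exact: hu|exact: hw|exact: h1].
  by split; [change (n2 (pt u) <= T)|change (n2 (pt w) <= T)|change (n2 (pt u) * n2 (pt w) <= T)|
    change (n2 (pt u) * n2 (pt w) * n2 (pt u + pt w) <= T)]; rewrite ?h4 !n2_pt.
by rewrite /pt2 /= -ptD !n2_pt => h4 h5 h6 h7; rewrite h6 h7; split; [rewrite !andbT; exact/asboolP|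
   apply/allpairsP; exists a; rewrite !ptsE //; split; [exact/asboolP|exact/asboolP|case: (a)]].
Qed.

Definition tile2 (F G : set (R * R)) (a : K * K) : set ((R * R) * (R * R)) := trl F a.1 `*` trl G a.2.

Lemma measurable_tile2 (F G : set (R * R)) b : measurable F -> measurable G -> measurable (tile2 F G b).
Proof. by move=> mF mG; apply: measurableX; exact: measurable_trl. Qed.
Lemma m4_tile2 F G b (c d : R) : measurable F -> measurable G -> m2 F = c%:E -> m2 G = d%:E ->
  m4 (tile2 F G b) = (c * d)%:E.
Proof.
move=> mF mG cF dG; transitivity (mC (trl F b.1) * mC (trl G b.2))%E.
  by apply: product_measure1E; exact: measurable_trl.
by rewrite !mCE (m2_trl _ mF) (m2_trl _ mG) cF dG -EFinM.
Qed.

(** The lattice is an extension of its projection by the kernel: reduce the second coordinate by the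
    projection, lift, then reduce the first coordinate by the kernel. *)
Lemma lam_tiles x y z F G r r' c c' : fs x -> fs z -> tile (ide (emax x z)) F r c -> tile (ide (proj x y z)) G r' c' ->
  (forall w, exists2 a, Lam x y z a & tile2 F G a w) /\
  (forall a b w, Lam x y z a -> Lam x y z b -> tile2 F G a w -> tile2 F G b w -> a = b).
Proof.
move=> fx fz [_ _ _ _ [F1 F2]] [_ _ _ _ [G1 G2]].
have sh a b w : trl F (a + b) w = trl F a (w - pt b) by rewrite /trl /= ptD opprD addrCA addrC addrAC.
split.
  move=> [w1 w2]; have [b hb gb] := G1 w2; have [a ha] := Lam_surj fx fz hb.
  have [u hu fu] := F1 (w1 - pt a); exists (u + a, b); last by split => //=; rewrite sh.
  by apply/(Lam_ker _ ha); rewrite addrK.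
move=> [a b] [a' b'] [w1 w2] h h' [/= t1 t2] [/= t1' t2'].
have E : b = b' by apply: G2 t2 t2'; [exact: Lam_proj h|exact: Lam_proj h'].
rewrite -E in h' *; congr (_, _).
have h0 : ide (emax x z) (a' - a) by apply/(Lam_ker _ h).
have z0 : ide (emax x z) 0 by left.
have := F2 _ _ (w1 - pt a) h0 z0; rewrite -!sh subrK add0r => /(_ t1' t1) /eqP.
by rewrite subr_eq0 => /eqP ->.
Qed.

(** Only differences of the points have to lie in the ideal: the tiles around them are still
    disjoint, and the centre of the disc is arbitrary. *)
Lemma coset_count : exists2 C, 0 <= C & forall e z0 r s, fs e -> 0 <= r -> uniq s ->
  (forall a b, a \in s -> b \in s -> ide e (a - b)) -> (forall a, a \in s -> n2 (pt a - z0) <= r ^+ 2) ->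
  (size s)%:R <= C * (r ^+ 2 / nm e + 1).
Proof.
have [D D0 DP] := tile_ide; have w0 := im_qw; have c0 := c1_gt0.
exists (2 * c1 * (1 + D ^+ 2) / im qw); first by nneg.
move=> e z0 r s fe r0 us hs hr; have n0 := nm_gt0 fe; have [F tF] := DP e fe.
have [mF d0 rF aF [F1 F2]] := tF; set d := D * Num.sqrt (nm e) in d0 rF.
have dE : d ^+ 2 = D ^+ 2 * nm e by rewrite exprMn sqr_sqrtr // ltW.
have dis a b : a \in s -> b \in s -> (trl F a `&` trl F b) !=set0 -> a = b.
  move=> ha hb [w [h1 h2]]; have z1 : ide e 0 by left.
  have := F2 _ _ (w - pt b) (hs _ _ ha hb) z1; rewrite /trl /= !ptD ptN [pt 0](_ : _ = 0); last by rewrite /pt re0 im0.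
  rewrite subr0 opprD opprK addrACA [- pt b + pt b]addNr addr0 => /(_ h1 h2) /eqP.
  by rewrite subr_eq0 => /eqP.
have [mU UE] := @tiles_measure _ _ m2 _ s (trl F) _ us (fun a _ => measurable_trl a mF) (fun a _ => etrans (m2_trl a mF) aF) dis.
have md : measurable ((fun w => w - z0) @^-1` disc ((r + d) ^+ 2)).
  rewrite -[X in measurable X]setTI.
  have : measurable_fun setT (fun w : R * R => w - z0).
    have -> : (fun w : R * R => w - z0) = (fun w => (w.1 - z0.1, w.2 - z0.2)) by apply/funext => -[].
    by apply: measurable_fun_pair; apply: measurable_funB.
  by apply => //; exact: measurable_disc.
have : (((size s)%:R * (nm e * im qw))%:E <= (c1 * (r + d) ^+ 2)%:E)%E.
  rewrite -UE -m2_disc ?sqr_ge0 // -(m2_translate z0); last exact: measurable_disc.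
  apply: le_measure; rewrite ?inE // => w [a /= ha wa]; rewrite /disc /=.
  rewrite (_ : w - z0 = (pt a - z0) + (w - pt a)); last by rewrite [RHS]addrC addrA subrK.
  by apply: n2D => //; [exact: hr|exact: rF].
rewrite lee_fin => h.
have h2 : c1 * (r + d) ^+ 2 <= c1 * (2 * (1 + D ^+ 2) * (r ^+ 2 + nm e)).
  apply: ler_wpM2l; first exact: ltW.
  have := sqr_ge0 (r - d); have := mulr_ge0 (sqr_ge0 D) (sqr_ge0 r); have := sqr_ge0 r.
  by move: dE; rewrite !expr2; nra.
have nw : 0 < nm e * im qw by rewrite mulr_gt0.
rewrite -(ler_pM2r nw); apply: le_trans h _; apply: le_trans h2 _.
by rewrite le_eqVlt; apply/orP; left; apply/eqP; field; rewrite !gt_eqF.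
Qed.

Lemma pts_le : exists2 C, 0 <= C & forall e T, fs e -> 0 <= T -> (size (pts e T))%:R <= C * (T / nm e + 1).
Proof.
have [C C0 CP] := coset_count; exists C => // e T fe T0.
have := CP e 0 (Num.sqrt T) (pts e T) fe (sqrtr_ge0 _) (pts_uniq _ _); rewrite sqr_sqrtr //; apply.
  by move=> a b; rewrite !ptsE // => /asboolP[ha _] /asboolP[hb _]; exact: ideB.
by move=> a; rewrite ptsE // subr0 n2_pt => /asboolP[].
Qed.
Lemma nm_le_sq e a : fs e -> ide e a -> a != 0 -> nm e <= sq a.
Proof.
move=> fe [/eqP|h a0]; first by move=> h /negP; rewrite h.
by rewrite -nm_v //; apply: nm_le => //; exact: fs_v.
Qed.

Lemma size_by_snd (s : seq (K * K)) (t : seq K) : uniq t -> (forall a, a \in s -> a.2 \in t) ->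
  (size s)%:R = \sum_(b <- t) (size [seq a <- s | a.2 == b])%:R :> R.
Proof.
move=> ut h; rewrite -natr_sum; congr (_%:R).
rewrite -(big_map _ predT (fun n => n)) /= -sum1_size big_map.
transitivity (\sum_(a <- s) \sum_(b <- t) (a.2 == b))%N.
  apply: eq_big_seq => a /h at2; rewrite (bigD1_seq a.2) //= eqxx big1 ?addn0 // => b.
  by rewrite eq_sym => /negPf ->.
rewrite exchange_big /=; apply: eq_bigr => b _; rewrite size_filter -sum1_count [RHS]big_mkcond /=.
by apply: eq_bigr => a _; case: (_ == _).
Qed.

Lemma pts_coset x y z T a b : fs x -> fs y -> fs z ->
  let us := [seq c.1 | c <- lampts x y z T & c.2 == b] in
  uniq us /\ (a \in us -> forall c, c \in us -> ide (emax x z) (a - c)).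
Proof.
move=> fx fy fz us; split.
  rewrite map_inj_in_uniq; first by apply: filter_uniq; exact: lampts_uniq.
  move=> -[c1' c2'] [d1 d2].
  by rewrite !mem_filter /= => /andP[/eqP -> _] /andP[/eqP -> _] ->.
have H c : c \in us -> Lam x y z (c, b).
  move=> /mapP[[c1' c2']]; rewrite mem_filter /= => /andP[/eqP -> hc] ->.
  by move: hc; rewrite lamptsE // => /asboolP[].
by move=> /H ha c /H hc; apply/(Lam_ker a hc).
Qed.

Lemma lampts_le : exists2 C, 0 <= C & forall x y z T, fs x -> fs y -> fs z -> 0 <= T ->
  (size (lampts x y z T))%:R <= C * (T / nm (emax x z) + 1) * (T / nm (proj x y z) + 1).
Proof.
have [C C0 CP] := coset_count; have [D D0 DP] := pts_le.
exists (C * D); first by rewrite mulr_ge0.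
move=> x y z T fx fy fz T0; have fW := fs_emax fx fz; have fP := fs_proj fx fy fz.
have m0 := nm_gt0 fW; have n0 := nm_gt0 fP.
rewrite (@size_by_snd _ (pts (proj x y z) T)) ?pts_uniq //; last first.
  move=> a; rewrite lamptsE // => /asboolP[hL [_ h2 _ _]]; rewrite ptsE //; apply/asboolP.
  by split; [exact: Lam_proj hL|rewrite -n2_pt].
have q0 : 0 <= C * (T / nm (emax x z) + 1) by rewrite mulr_ge0 // addr_ge0 // divr_ge0 // ltW.
apply: (@le_trans _ _ (\sum_(b <- pts (proj x y z) T) C * (T / nm (emax x z) + 1))).
  apply: ler_sum_in => b _; have [u1 _] := pts_coset T 0 b fx fy fz.
  rewrite -(size_map fst); have := CP (emax x z) 0 (Num.sqrt T) _ fW (sqrtr_ge0 _) u1; rewrite sqr_sqrtr //; apply.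
    by move=> a c ha hc; have [_ h] := pts_coset T a b fx fy fz; exact: h.
  move=> a /mapP[c]; rewrite mem_filter => /andP[_]; rewrite lamptsE // => /asboolP[_ [h1 _ _ _]] ->.
  by rewrite subr0.
rewrite big_const_seq count_predT iter_addr_0 -mulr_natr.
rewrite (_ : C * D * _ * _ = C * (T / nm (emax x z) + 1) * (D * (T / nm (proj x y z) + 1))); last by ring.
by apply: ler_wpM2l => //; exact: DP.
Qed.

(** The tiles around the lattice points of the region stay inside a slightly larger region and cover
    a slightly smaller one, both by [Rg_move]. *)
Lemma lampts_sandwich x y z t d F G r r' c c' : fs x -> fs y -> fs z -> 1 <= t -> 0 <= d -> d <= t ->
  tile (ide (emax x z)) F r c -> tile (ide (proj x y z)) G r' c' -> r <= d -> r' <= d ->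
  let N := (size (lampts x y z (t ^+ 2)))%:R in
  N * (c * c') <= Vol ((t + 14 * t ^+ 2 * d) ^+ 2) /\
  forall s, 0 <= s -> s + 14 * t ^+ 2 * d <= t -> Vol (s ^+ 2) <= N * (c * c').
Proof.
move=> fx fy fz t1 d0 dt tF tG rd r'd N.
have t0 : 0 <= t by exact: le_trans t1.
have td0 : 0 <= 14 * t ^+ 2 * d by rewrite mulr_ge0 // mulr_ge0 // sqr_ge0.
have [tiles_cov tiles_dis] := lam_tiles fx fz tF tG.
have [mF rF0 rF aF _] := tF; have [mG rG0 rG aG _] := tG.
have rd1 w : F w -> n2 w <= d ^+ 2 by move=> /rF h; apply: le_trans h _; apply: lerXn2r.
have rd2 w : G w -> n2 w <= d ^+ 2 by move=> /rG h; apply: le_trans h _; apply: lerXn2r.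
pose L := lampts x y z (t ^+ 2).
have mL b : b \in L -> measurable (tile2 F G b) by move=> _; exact: measurable_tile2 mF mG.
have aL b : b \in L -> m4 (tile2 F G b) = (c * c')%:E by move=> _; exact: m4_tile2 mF mG aF aG.
have dL b b' : b \in L -> b' \in L -> (tile2 F G b `&` tile2 F G b') !=set0 -> b = b'.
  by rewrite !lamptsE // => /asboolP[h _] /asboolP[h' _] [w [h1 h2]]; exact: tiles_dis h1 h2.
have [mU UE] := @tiles_measure _ _ m4 _ _ (tile2 F G) (c * c') (lampts_uniq x y z (t ^+ 2)) mL aL dL.
split.
  have h0 : 0 <= (t + 14 * t ^+ 2 * d) ^+ 2 by exact: sqr_ge0.
  suff : (m4 (\bigcup_(i in [set` L]) tile2 F G i) <= m4 (Rg ((t + 14 * t ^+ 2 * d) ^+ 2)))%E by rewrite UE (VolE h0) lee_fin.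
  apply: le_measure; rewrite ?inE; [by []|exact: measurable_Rg|].
  move=> w [b /=]; rewrite lamptsE // => /asboolP[_ hb] [h1 h2].
  have := @Rg_move t t d (pt2 b) (w.1 - pt b.1, w.2 - pt b.2) t1 t0 (lexx t) d0 dt hb (rd1 _ h1) (rd2 _ h2).
  by rewrite /= !(addrC (pt _)) !subrK -surjective_pairing.
move=> s s0 sd.
suff : (m4 (Rg (s ^+ 2)) <= m4 (\bigcup_(i in [set` L]) tile2 F G i))%E by rewrite UE (VolE (sqr_ge0 s)) lee_fin.
apply: le_measure; rewrite ?inE; [exact: measurable_Rg|by []|].
move=> w hw; have [b hb wb] := tiles_cov w; exists b => //=; rewrite lamptsE //; apply/asboolP; split => //.
have [h1 h2] := wb; have n2N v' : n2 (- v') = n2 v' by case: v' => ? ?; rewrite /n2 /= !sqrrN.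
have st : s <= t by apply: le_trans sd; rewrite lerDl.
have := @Rg_move t s d w (pt b.1 - w.1, pt b.2 - w.2) t1 s0 st d0 dt hw.
rewrite /= -!(opprB _ (pt _)) !n2N => /(_ (rd1 _ h1) (rd2 _ h2)).
rewrite !opprB !(addrC w.1) !(addrC w.2) !subrK => h; apply: Rg_sub h.
by apply: lerXn2r; rewrite ?nnegrE // addr_ge0.
Qed.

(* The sandwich in the form |N a - V| <= V O(u + u^4), u = 14 t d. *)
Lemma sandwich_bound (t d N : R) (V : R -> R) : 1 <= t -> 0 <= d -> 0 <= N -> 0 <= V (t ^+ 2) ->
  (forall k S, 1 <= k -> 0 <= S -> V (k ^+ 2 * S) <= k ^+ 4 * V S) ->
  N <= V ((t + 14 * t ^+ 2 * d) ^+ 2) -> (forall s, 0 <= s -> s + 14 * t ^+ 2 * d <= t -> V (s ^+ 2) <= N) ->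
  `|N - V (t ^+ 2)| <= 15 * (14 * t * d + (14 * t * d) ^+ 4) * V (t ^+ 2).
Proof.
move=> t1 d0 N0 V0 sc up lo; have t0 : 0 < t by qlra.
pose u := 14 * t * d; have u0 : 0 <= u by rewrite mulr_ge0 // mulr_ge0 // ltW.
have td : 14 * t ^+ 2 * d = t * u by rewrite /u; ring.
rewrite -/u; clearbody u; rewrite !td in up lo; clear td d d0.
have up' : N <= (1 + u) ^+ 4 * V (t ^+ 2).
  have cu : 1 <= 1 + u by qlra.
  by apply: le_trans (sc _ _ cu (sqr_ge0 t)); apply: le_trans up _; rewrite -exprMn mulrDl mul1r mulrC (mulrC u).
have lo' : (1 - 4 * u) * V (t ^+ 2) <= N.
  have [u1|u1] := leP 1 u; first by nra.
  have u2 : 0 < 1 - u by qlra.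
  have k1 : 1 <= (1 - u)^-1 by rewrite invf_ge1 //; qlra.
  have sT : V ((t * (1 - u)) ^+ 2) <= N.
    by apply: lo; [apply: mulr_ge0; qlra|rewrite -mulrDr subrK mulr1].
  have := sc _ _ k1 (sqr_ge0 (t * (1 - u))); rewrite -exprMn (_ : (1 - u)^-1 * (t * (1 - u)) = t); last first.
    by field; rewrite gt_eqF.
  rewrite exprVn mulrC ler_pdivlMr ?exprn_gt0 // => h.
  have h3 : 1 - 4 * u <= (1 - u) ^+ 4.
    rewrite (_ : (1 - u) ^+ 4 = 1 - 4 * u + u ^+ 2 * ((2 - u) ^+ 2 + 2)); last by ring.
    by rewrite lerDl mulr_ge0 ?sqr_ge0 // addr_ge0 ?sqr_ge0.
  by have := ler_wpM2r V0 h3; qlra.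
have u4 : (1 + u) ^+ 4 <= 1 + 15 * (u + u ^+ 4).
  rewrite (_ : (1 + u) ^+ 4 = 1 + 4 * u + 6 * u ^+ 2 + 4 * u ^+ 3 + u ^+ 4); last by ring.
  have h1 : 0 <= u ^+ 2 * (u - 1) ^+ 2 by apply: mulr_ge0; exact: sqr_ge0.
  have h2 : 0 <= u * (u - 1) ^+ 2 by apply: mulr_ge0 => //; exact: sqr_ge0.
  have h3 := exprn_ge0 4 u0; rewrite !exprS expr0 in h1 h2 h3 *; qlra.
have e4 := exprn_ge0 4 u0.
have h1 := ler_wpM2r V0 u4.
have h2 : 4 * u * V (t ^+ 2) <= 15 * (u + u ^+ 4) * V (t ^+ 2) by apply: ler_wpM2r => //; qlra.
by move: (V _) h1 h2 up' lo' => v h1 h2 up' lo'; rewrite ler_norml; apply/andP; split; qlra.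
Qed.

Lemma lampts_asym : exists2 C, 0 <= C & forall x y z T, fs x -> fs y -> fs z -> 1 <= T ->
  nm (emax x z) <= 1 -> nm (proj x y z) <= 1 ->
  `|(size (lampts x y z T))%:R * (nm (emax x z) * nm (proj x y z) * im qw ^+ 2) - Vol T|
    <= C * T ^+ 4 * (Num.sqrt (nm (emax x z)) + Num.sqrt (nm (proj x y z))).
Proof.
have [D D0 DP] := tile_ide; have [E E0 EP] := lampts_le; have w0 := im_qw; have c0 := c1_gt0.
pose C1 := (4 * E * im qw ^+ 2 + c1 ^+ 2) * D.
pose C2 := c1 ^+ 2 * 15 * (14 * D) * (1 + (28 * D) ^+ 3).
have C10 : 0 <= C1 by rewrite /C1; nneg; exact: ltW.
have C20 : 0 <= C2 by rewrite /C2; nneg; exact: ltW.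
exists (C1 + C2); first exact: addr_ge0.
move=> x y z T fx fy fz; have [T0|T0] := ltP T 0; first by qlra.
have [t t0 <-] : exists2 t, 0 <= t & t ^+ 2 = T by exists (Num.sqrt T); rewrite ?sqr_sqrtr ?sqrtr_ge0.
move=> T1; have fW := fs_emax fx fz; have fP := fs_proj fx fy fz; clear T0 T.
have t1 : 1 <= t by rewrite -(ler_sqr (_ : 1 \is Num.nneg)) ?nnegrE // expr1n.
set T := t ^+ 2 in T1 *; have T0 : 0 <= T by exact: le_trans T1.
have := Vol_ge0 T; have V2 : Vol T <= (c1 * T) ^+ 2 by rewrite -lee_fin -(VolE T0); exact: Vol_fin.
have m0 := nm_gt0 fW; have n0 := nm_gt0 fP; have [F tF] := DP _ fW; have [G tG] := DP _ fP.
have sw d (d0 : 0 <= d) (dt : d <= t) := lampts_sandwich fx fy fz t1 d0 dt tF tG; rewrite -/T in sw.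
have sc := Vol_scale; have hle := EP x y z T fx fy fz T0.
clear DP EP tF tG F G fW fP fx fy fz.
move: (nm (proj x y z)) (nm (emax x z)) ((size (lampts x y z T))%:R : R) (ler0n R (size (lampts x y z T))) m0 n0 hle sw V2.
move=> n m N N0 m0 n0 hle sw V2 V0 m1 n1; clear x y z.
set s1 := Num.sqrt m; set s2 := Num.sqrt n.
have [s10 s20] : 0 <= s1 /\ 0 <= s2 by rewrite !sqrtr_ge0.
have [s11 s21] : s1 <= 1 /\ s2 <= 1 by rewrite -sqrtr1 !ler_wsqrtr.
have tE : t ^+ 2 = T by [].
have ss0 : 0 <= s1 + s2 by rewrite addr_ge0.
pose d := D * (s1 + s2); have d0 : 0 <= d by apply: mulr_ge0 => //; exact: ltW.
have a0 : 0 < m * n * im qw ^+ 2 by rewrite !mulr_gt0 // exprn_gt0.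
have aE : m * im qw * (n * im qw) = m * n * im qw ^+ 2 by ring.
have T24 : T ^+ 2 <= T ^+ 4 by apply: ler_weXn2l.
have T40 : 0 <= T ^+ 4 by exact: exprn_ge0.
have [P1 P2] : 0 <= C1 * T ^+ 4 * (s1 + s2) /\ 0 <= C2 * T ^+ 4 * (s1 + s2).
  by split; apply: mulr_ge0 => //; exact: mulr_ge0.
rewrite (mulrDl C1 C2) mulrDl.
(* If the tiles are small against t the sandwich applies. Otherwise D (sqrt m + sqrt n) exceeds 1,
   and the count and the volume, each O(T^2) after normalization, are already smaller than the
   claimed error. *)
have [dt|dt] := leP d t.
  apply: (@le_trans _ _ (C2 * T ^+ 4 * (s1 + s2))); last by rewrite lerDr.
  have dm : D * s1 <= d by rewrite /d ler_pM2l // lerDl.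
  have dn : D * s2 <= d by rewrite /d ler_pM2l // lerDr.
  have [up lo] := sw d d0 dt dm dn; rewrite aE -tE in up lo; clear sw hle.
  have Na : 0 <= N * (m * n * im qw ^+ 2) by apply: mulr_ge0 => //; exact: ltW.
  have V0' : 0 <= Vol (t ^+ 2) by rewrite tE.
  have := sandwich_bound t1 d0 Na V0' sc up lo; rewrite tE => h; apply: le_trans h _.
  clear up lo sc Na V0' a0 aE m0 n0 m1 n1 N0 w0 E0 dm dn dt C10 P1 P2.
  pose u := 14 * t * d; have uE : u = t * (14 * D * (s1 + s2)) by rewrite /u /d; ring.
  rewrite -/u; clearbody T.
  have k0 : 0 <= 14 * D * (s1 + s2) by apply: mulr_ge0 => //; apply: mulr_ge0 => //; exact: ltW.
  have u0 : 0 <= u by rewrite uE mulr_ge0.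
  have tt4 : t <= t ^+ 4 by rewrite -[leLHS]expr1 ler_weXn2l.
  have k28 : 14 * D * (s1 + s2) <= 28 * D by nra.
  have u28 : u <= t * (28 * D) by rewrite uE ler_wpM2l.
  have u3 : u ^+ 3 <= t ^+ 3 * (28 * D) ^+ 3 by rewrite -exprMn; apply: lerXn2r; rewrite ?nnegrE //; apply: le_trans u28.
  have e1 : u <= t ^+ 4 * (14 * D * (s1 + s2)) by rewrite uE ler_wpM2r.
  have e2 : u ^+ 4 <= t ^+ 3 * (28 * D) ^+ 3 * u by rewrite exprSr ler_wpM2r.
  have ub : u + u ^+ 4 <= t ^+ 4 * ((14 * D) * (1 + (28 * D) ^+ 3)) * (s1 + s2).
    apply: le_trans (lerD e1 e2) _; rewrite uE (exprS t 3) le_eqVlt; apply/orP; left; apply/eqP; ring.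
  have Vt : Vol T <= c1 ^+ 2 * t ^+ 4 by rewrite (exprM t 2 2) tE -exprMn.
  have T8 : T ^+ 4 = t ^+ 4 * t ^+ 4 by rewrite -tE -exprM -exprD.
  have uu0 : 0 <= 15 * (u + u ^+ 4) by rewrite mulr_ge0 // addr_ge0 // exprn_ge0.
  apply: (@le_trans _ _ (15 * (t ^+ 4 * ((14 * D) * (1 + (28 * D) ^+ 3)) * (s1 + s2)) * (c1 ^+ 2 * t ^+ 4))).
    by apply: ler_pM => //; rewrite ler_wpM2l.
  by rewrite le_eqVlt; apply/orP; left; apply/eqP; rewrite /C2 T8; ring.
apply: (@le_trans _ _ (C1 * T ^+ 4 * (s1 + s2))); last by rewrite lerDl.
have D1 : 1 <= D * (s1 + s2) by apply/ltW; exact: le_lt_trans dt.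
clear sw sc dt; have hN : N * (m * n * im qw ^+ 2) <= 4 * E * im qw ^+ 2 * T ^+ 2.
  have ge1 k : 0 < k -> k <= 1 -> T / k + 1 <= 2 * T / k by move=> k0' k1'; rewrite -lerBrDl -mulrBl ler_pdivlMr //; qlra.
  have h3 : N <= E * (2 * T / m) * (2 * T / n).
    apply: le_trans hle _; rewrite -(mulrA E) -(mulrA E); apply: ler_wpM2l => //.
    by apply: ler_pM; rewrite ?ge1 //; apply: addr_ge0 => //; apply: divr_ge0 => //; exact: ltW.
  apply: le_trans (ler_wpM2r (ltW a0) h3) _.
  by rewrite le_eqVlt; apply/orP; left; apply/eqP; field; rewrite !gt_eqF.
apply: (@le_trans _ _ ((4 * E * im qw ^+ 2 + c1 ^+ 2) * T ^+ 2)).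
  rewrite exprMn in V2; have h4 : 0 <= N * (m * n * im qw ^+ 2) by apply: mulr_ge0 => //; exact: ltW.
  by move: (Vol T) (N * _) V0 V2 hN h4 => v k V0 V2 hN h4; rewrite ler_norml; apply/andP; split; qlra.
rewrite /C1 (_ : _ * D * T ^+ 4 * _ = (4 * E * im qw ^+ 2 + c1 ^+ 2) * (T ^+ 4 * (D * (s1 + s2)))); last by ring.
apply: ler_wpM2l; first by nneg; exact: ltW.
by apply: le_trans T24 _; rewrite ler_peMr.
Qed.

(** * Upper bounds for lattice points *)
(** The axes u = 0 and v = 0 carry no points of U and are left out of the counts. *)
Definition lamnz x y z T := [seq a <- lampts x y z T | (a.1 != 0) && (a.2 != 0)].

Lemma size_le_map (T U : eqType) (f : T -> U) (s : seq T) (t : seq U) : uniq s -> {in s &, injective f} ->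
  (forall a, a \in s -> f a \in t) -> (size s <= size t)%N.
Proof.
move=> us fi h; rewrite -(size_map f); apply: uniq_leq_size; first by rewrite map_inj_in_uniq.
by move=> _ /mapP[a /h ? ->].
Qed.

Lemma zero_pts : exists2 C, 0 <= C & forall x y z T, fs x -> fs y -> fs z -> 0 <= T ->
  (size (lampts x y z T))%:R <= (size (lamnz x y z T))%:R + C * (T / nm (emax x z) + T / nm (proj x y z) + 2).
Proof.
have [C C0 CP] := coset_count; have [D D0 DP] := pts_le.
exists (C + D); first exact: addr_ge0.
move=> x y z T fx fy fz T0; have fW := fs_emax fx fz; have fP := fs_proj fx fy fz.
have m0 := nm_gt0 fW; have n0 := nm_gt0 fP.
set L := lampts x y z T; pose A := [seq a <- L | a.1 == 0]; pose B := [seq a <- L | a.2 == 0].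
have uL : uniq L by exact: lampts_uniq.
have hs : (size L <= size (lamnz x y z T) + (size A + size B))%N.
  have H (l : seq (K * K)) : (size l <= size [seq a <- l | (a.1 != 0%R) && (a.2 != 0%R)] +
      (size [seq a <- l | a.1 == 0%R] + size [seq a <- l | a.2 == 0%R]))%N.
    rewrite !size_filter; elim: l => [//|a l] /=; move: (size l) (count _ l) (count _ l) (count _ l) => n1 n2' n3 n4.
    by case: (a.1 == 0); case: (a.2 == 0) => /=; clear; lia.
  exact: H.
have LE a : a \in L -> [/\ Lam x y z a, sq a.1 <= T & sq a.2 <= T].
  by rewrite lamptsE // => /asboolP[h [h1 h2 _ _]]; split => //; rewrite -n2_pt.
have hA : (size A)%:R <= D * (T / nm (proj x y z) + 1).
  apply: le_trans (DP _ T fP T0); rewrite ler_nat; apply: (@size_le_map _ _ snd).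
  - exact: filter_uniq.
  - by move=> [a1 a2] [b1 b2]; rewrite !mem_filter /= => /andP[/eqP -> _] /andP[/eqP -> _] ->.
  move=> a; rewrite mem_filter => /andP[_ /LE[h1 _ h2]]; rewrite ptsE //; apply/asboolP.
  by split => //; exact: Lam_proj h1.
have hB : (size B)%:R <= C * (T / nm (emax x z) + 1).
  have [u1 _] := pts_coset T 0 0 fx fy fz.
  rewrite -(size_map fst); have := CP (emax x z) 0 (Num.sqrt T) _ fW (sqrtr_ge0 _) u1; rewrite sqr_sqrtr //; apply.
    by move=> a c ha hc; have [_ h] := pts_coset T a 0 fx fy fz; exact: h.
  by move=> a /mapP[c]; rewrite mem_filter => /andP[_ /LE[_ h _]] ->; rewrite subr0 n2_pt.
have : (size L)%:R <= (size (lamnz x y z T))%:R + ((size A)%:R + (size B)%:R) :> R by rewrite -!natrD ler_nat.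
have q1 : 0 <= C * (T / nm (proj x y z) + 1) by apply: mulr_ge0 => //; apply: addr_ge0 => //; apply: divr_ge0 => //; exact: ltW.
have q2 : 0 <= D * (T / nm (emax x z) + 1) by apply: mulr_ge0 => //; apply: addr_ge0 => //; apply: divr_ge0 => //; exact: ltW.
move: hA hB q1 q2; move: (T / nm (emax x z)) (T / nm (proj x y z)) (size A)%:R (size B)%:R (size (lamnz x y z T))%:R (size L)%:R.
by clear; move=> m n a b c l; qlra.
Qed.

Lemma pts_main : exists2 C, 0 <= C & forall x y z T m n, fs x -> fs y -> fs z -> 1 <= T ->
  nm (emax x z) = m -> nm (proj x y z) = n ->
  `|(size (lamnz x y z T))%:R - Vol T / (m * n * im qw ^+ 2)|
    <= C * T ^+ 4 * (1 + m^-1 + n^-1 + (Num.sqrt m + Num.sqrt n) / (m * n)).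
Proof.
have [C C0 CP] := lampts_asym; have [D D0 DP] := zero_pts; have [E E0 EP] := lampts_le.
have w0 := im_qw; have c0 := ltW c1_gt0; have i0 : 0 <= (im qw ^+ 2)^-1 by rewrite invr_ge0 sqr_ge0.
exists (C / im qw ^+ 2 + 2 * D + 2 * E + c1 ^+ 2 / im qw ^+ 2); first by nneg.
move=> x y z T m n fx fy fz T1 mE nE; have T0 : 0 <= T by exact: (le_trans ler01 T1).
have := nm_gt0 (fs_emax fx fz); have := nm_gt0 (fs_proj fx fy fz); rewrite mE nE => n0 m0.
have := CP x y z T fx fy fz T1; have := DP x y z T fx fy fz T0; have := EP x y z T fx fy fz T0; rewrite mE nE.
have zs : (size (lamnz x y z T) <= size (lampts x y z T))%N by rewrite /lamnz size_filter count_size.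
have V2 : Vol T <= c1 ^+ 2 * T ^+ 2 by rewrite -exprMn -lee_fin -(VolE T0); exact: Vol_fin.
have V0 := Vol_ge0 T; have NN : (size (lamnz x y z T))%:R <= (size (lampts x y z T))%:R :> R by rewrite ler_nat.
have N0 : 0 <= (size (lamnz x y z T))%:R :> R by rewrite ler0n.
move: (size (lamnz x y z T))%:R (size (lampts x y z T))%:R (Vol T) V0 V2 NN N0 => N L V V0 V2 NN N0.
clear CP DP EP zs fx fy fz mE nE; clear x y z => hE hD hC.
have [T4 T24] : T <= T ^+ 4 /\ T ^+ 2 <= T ^+ 4 by split; [rewrite -[leLHS]expr1|]; apply: ler_weXn2l.
have T41 : 1 <= T ^+ 4 by exact: exprn_ege1.
have [mi ni] : 0 < m^-1 /\ 0 < n^-1 by rewrite !invr_gt0.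
have [sm sn] : 0 <= Num.sqrt m /\ 0 <= Num.sqrt n by rewrite !sqrtr_ge0.
have q0 : 0 <= (Num.sqrt m + Num.sqrt n) / (m * n) by apply: divr_ge0; [exact: addr_ge0|apply: mulr_ge0; exact: ltW].
set Q := 1 + m^-1 + n^-1 + _; have Q0 : 0 <= Q by apply: addr_ge0 q0; apply: addr_ge0 (ltW ni); exact: addr_ge0 ler01 (ltW mi).
have TQ0 : 0 <= T ^+ 4 * Q by apply: mulr_ge0 => //; qlra.
have TQ1 : T ^+ 4 * (1 + m^-1 + n^-1) <= T ^+ 4 * Q by apply: ler_wpM2l; [exact: le_trans ler01 T41|rewrite /Q lerDl].
have eQ : (C / im qw ^+ 2 + 2 * D + 2 * E + c1 ^+ 2 / im qw ^+ 2) * T ^+ 4 * Q = C / im qw ^+ 2 * (T ^+ 4 * Q) +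
  2 * D * (T ^+ 4 * Q) + 2 * E * (T ^+ 4 * Q) + c1 ^+ 2 / im qw ^+ 2 * (T ^+ 4 * Q) by rewrite -mulrA -!mulrDl.
rewrite eQ {eQ}; have [/andP[m1 n1]|] := boolP ((m <= 1) && (n <= 1)).
  have h1 : `|L - V / (m * n * im qw ^+ 2)| <= C / im qw ^+ 2 * (T ^+ 4 * Q).
    have a0 : 0 < m * n * im qw ^+ 2 by rewrite !mulr_gt0 // exprn_gt0.
    rewrite -(ler_pM2r a0) -[X in _ * X <= _](gtr0_norm a0) -normrM mulrBl mulfVK ?gt_eqF //.
    apply: le_trans (hC m1 n1) _.
    rewrite (_ : C / im qw ^+ 2 * _ * _ = C * T ^+ 4 * (Q * (m * n))); last by field; rewrite gt_eqF // exprn_gt0.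
    apply: ler_wpM2l; first by nneg.
    by rewrite -ler_pdivrMr ?mulr_gt0 // /Q lerDr !addr_ge0 // ltW.
  have h2 : L - N <= 2 * D * (T ^+ 4 * Q).
    have : T / m + T / n + 2 <= 2 * (T ^+ 4 * (1 + m^-1 + n^-1)).
      have u1 : T * m^-1 <= T ^+ 4 * m^-1 by rewrite ler_wpM2r // ltW.
      have u2 : T * n^-1 <= T ^+ 4 * n^-1 by rewrite ler_wpM2r // ltW.
      have u3 : 0 <= T ^+ 4 * m^-1 /\ 0 <= T ^+ 4 * n^-1 by split; apply: mulr_ge0; rewrite ?exprn_ge0 // ltW.
      by move: T41 u1 u2 u3; clear -hK => t41 u1 u2 [u3 u4]; lra.
    move=> h; have : D * (T / m + T / n + 2) <= D * (2 * (T ^+ 4 * Q)) by apply: ler_wpM2l => //; apply: (le_trans h); rewrite ler_pM2l.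
    by move: hD; clear -hK; move=> *; lra.
  have k1 : 0 <= 2 * E * (T ^+ 4 * Q) by rewrite !mulr_ge0.
  have k2 : 0 <= c1 ^+ 2 / im qw ^+ 2 * (T ^+ 4 * Q) by rewrite !mulr_ge0 // sqr_ge0.
  move: h1 h2 k1 k2; move: (V / _) (T ^+ 4 * Q) => v q; rewrite !ler_norml => /andP[h1 h1'] h2 k1 k2.
  by move: NN h1 h1' h2 k1 k2; clear -hK; move=> *; apply/andP; split; lra.
(* If m > 1 or n > 1, then 1 / (m n) <= 1/m + 1/n, so that both the count and the volume term are
   themselves of the size of the error. *)
move=> mn; have mn1 : (m * n)^-1 <= m^-1 + n^-1.
  rewrite invfM; case/nandP: mn; rewrite -ltNge => h.
    have h' : m^-1 <= 1 by rewrite invf_le1 // ltW.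
    by apply: (le_trans (ler_piMl (ltW ni) h')); rewrite lerDr ltW.
  have h' : n^-1 <= 1 by rewrite invf_le1 // ltW.
  by apply: (le_trans (ler_piMr (ltW mi) h')); rewrite lerDl ltW.
have hN : N <= 2 * E * (T ^+ 4 * Q).
  apply: le_trans NN _; apply: le_trans hE _; rewrite -mulrA.
  rewrite (_ : 2 * E * _ = E * (2 * (T ^+ 4 * Q))); last by ring.
  apply: ler_wpM2l => //; rewrite (_ : _ * _ = T ^+ 2 * (m * n)^-1 + T / m + T / n + 1); last by rewrite invfM; ring.
  have u1 : T * m^-1 <= T ^+ 4 * m^-1 by rewrite ler_wpM2r // ltW.
  have u2 : T * n^-1 <= T ^+ 4 * n^-1 by rewrite ler_wpM2r // ltW.
  have u3 : T ^+ 2 * (m * n)^-1 <= T ^+ 4 * (m^-1 + n^-1) by apply: ler_pM => //; rewrite ?sqr_ge0 // invr_ge0 mulr_ge0 // ltW.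
  by move: T41 u1 u2 u3 TQ1; clear -hK; move=> *; lra.
have hV : V / (m * n * im qw ^+ 2) <= c1 ^+ 2 / im qw ^+ 2 * (T ^+ 4 * Q).
  apply: (@le_trans _ _ (c1 ^+ 2 * T ^+ 2 / (m * n * im qw ^+ 2))).
    by apply: ler_wpM2r => //; rewrite invr_ge0 !mulr_ge0 ?sqr_ge0 // ltW.
  rewrite (_ : _ / _ = c1 ^+ 2 / im qw ^+ 2 * (T ^+ 2 * (m * n)^-1)); last by field; rewrite !gt_eqF // exprn_gt0.
  apply: ler_wpM2l; first by rewrite mulr_ge0 // sqr_ge0.
  apply: (@le_trans _ _ (T ^+ 4 * (m^-1 + n^-1))); last by move: T41 TQ1; clear -hK; move=> *; lra.
  by apply: ler_pM => //; rewrite ?sqr_ge0 // invr_ge0 mulr_ge0 // ltW.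
have hV0 : 0 <= V / (m * n * im qw ^+ 2) by apply: divr_ge0 => //; rewrite !mulr_ge0 ?sqr_ge0 // ltW.
have k1 : 0 <= C / im qw ^+ 2 * (T ^+ 4 * Q) by rewrite !mulr_ge0.
have k2 : 0 <= 2 * D * (T ^+ 4 * Q) by rewrite !mulr_ge0.
move: hN hV hV0 k1 k2; move: (V / _) (T ^+ 4 * Q) => v q.
by move: N0; clear -hK; move=> *; rewrite ler_norml; apply/andP; split; lra.
Qed.

Definition nz e T := [seq a <- pts e T | a != 0].
Lemma nz_small e T : fs e -> T < nm e -> nz e T = [::].
Proof.
move=> fe h; case E : (nz e T) => [//|a l]; have : a \in nz e T by rewrite E mem_head.
rewrite mem_filter ptsE // => /andP[a0 /asboolP[ae aT]]; exfalso.
by have := nm_le_sq fe ae a0; have := le_lt_trans aT h; rewrite ltNge => /negP.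
Qed.
Lemma nz_le : exists2 C, 0 <= C & forall e T, fs e -> 0 <= T -> (size (nz e T))%:R <= C * (T / nm e).
Proof.
have [C C0 CP] := pts_le; exists (2 * C); first exact: mulr_ge0.
move=> e T fe T0; have n0 := nm_gt0 fe; have q0 : 0 <= T / nm e by apply: divr_ge0 => //; exact: ltW.
case: (ltP T (nm e)) => h; first by rewrite nz_small //=; nneg.
apply: (@le_trans _ _ (size (pts e T))%:R); first by rewrite ler_nat /nz size_filter count_size.
apply: le_trans (CP e T fe T0) _; have : 1 <= T / nm e by rewrite ler_pdivlMr // mul1r.
by move: (T / nm e) => q q1; nra.
Qed.

Definition ab (a : K) : R := Num.sqrt (sq a).
Lemma ab_sqr a : ab a ^+ 2 = sq a. Proof. by rewrite /ab sqr_sqrtr // sq_ge0. Qed.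
Lemma ab_gt0 a : a != 0 -> 0 < ab a. Proof. by move=> a0; rewrite sqrtr_gt0 sq_gt0. Qed.

(** Halving the radius: the inner disc contributes half of the bound by induction, and the outer
    ring at most 2 / y times the number of its points, which is the other half. Below the norm of
    the ideal there are no nonzero elements. *)
Lemma sum_inv_ab : exists2 C, 0 <= C & forall e x, fs e -> 0 <= x -> \sum_(a <- nz e (x ^+ 2)) (ab a)^-1 <= C * (x / nm e).
Proof.
have [C C0 CP] := nz_le; exists (4 * C); first exact: mulr_ge0.
move=> e x fe x0; have n0 := nm_gt0 fe; set s := Num.sqrt (nm e).
have s0 : 0 < s by rewrite sqrtr_gt0.
have sE : s ^+ 2 = nm e by rewrite sqr_sqrtr // ltW.
have H k y : 0 <= y -> y < 2 ^+ k * s -> \sum_(a <- nz e (y ^+ 2)) (ab a)^-1 <= 4 * C * (y / nm e).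
  elim: k y => [|k ih] y y0; rewrite ?expr0 ?mul1r => ys.
    rewrite nz_small //; last by rewrite -sE ltrXn2r // ltW.
    by rewrite big_nil; nneg; exact: ltW.
  have y2 : 0 <= y / 2 by rewrite divr_ge0.
  have [y0'|yn] := eqVneq y 0.
    have -> : nz e (y ^+ 2) = [::] by apply: nz_small => //; rewrite y0' expr0n.
    by rewrite big_nil y0' mul0r mulr0.
  have ih' := ih (y / 2) y2 _; rewrite (bigID (fun a => sq a <= (y / 2) ^+ 2)) /=.
  have yp : 0 < y by rewrite lt_def yn.
  have e1 : \sum_(a <- nz e (y ^+ 2) | sq a <= (y / 2) ^+ 2) (ab a)^-1 = \sum_(a <- nz e ((y / 2) ^+ 2)) (ab a)^-1.
    rewrite -big_filter; apply: perm_big; apply: uniq_perm; rewrite ?filter_uniq ?pts_uniq // => a.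
    rewrite !mem_filter !ptsE //; apply/andP/andP => [[h1 /andP[h2 /asboolP[h3 h4]]]|[h2 /asboolP[h3 h4]]].
      by split => //; exact/asboolP.
    rewrite h4 h2; split => //; apply/asboolP; split => //; apply: le_trans h4 _.
    by apply: lerXn2r; rewrite ?nnegrE //; qlra.
  have e2 : \sum_(a <- nz e (y ^+ 2) | ~~ (sq a <= (y / 2) ^+ 2)) (ab a)^-1 <= 2 / y * (C * (y ^+ 2 / nm e)).
    apply: (@le_trans _ _ (\sum_(a <- nz e (y ^+ 2)) 2 / y)); last first.
      rewrite big_const_seq count_predT iter_addr_0 -[leLHS]mulr_natr; apply: ler_wpM2l; first by rewrite divr_ge0 // ltW.
      by apply: CP => //; exact: sqr_ge0.
    rewrite big_mkcond /=; apply: ler_sum_in => a; rewrite mem_filter => /andP[a0 _].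
    case: ifP => [h|_]; last by rewrite divr_ge0 // ltW.
    rewrite -[2 / y]invrK lef_pV2 ?posrE ?ab_gt0 ?invr_gt0 ?divr_gt0 // invf_div.
    rewrite -(ler_sqr (_ : y / 2 \is Num.nneg)) ?nnegrE ?sqrtr_ge0 // ab_sqr.
    by apply/ltW; rewrite ltNge.
  rewrite e1; have y2s : y / 2 < 2 ^+ k * s by rewrite ltr_pdivrMr // mulrAC -exprSr.
  have := ih' y2s; rewrite (_ : 2 / y * _ = 2 * C * (y / nm e)) in e2; last by field; rewrite !gt_eqF.
  rewrite (_ : 4 * C * (y / 2 / nm e) = 2 * C * (y / nm e)); last by field; rewrite gt_eqF.
  by qlra.
apply: (H (Num.trunc (x / s)).+1) => //; rewrite -ltr_pdivrMr //.
have /andP[_ h] := truncn_itv (divr_ge0 x0 (ltW s0)); apply: lt_le_trans h _.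
by rewrite -natrX ler_nat; apply/ltnW/ltn_expl.
Qed.

Lemma size_cover (T : Type) (s : seq T) (P Q : pred T) : all (fun a => P a || Q a) s ->
  (size s <= size (seq.filter P s) + size (seq.filter Q s))%N.
Proof.
rewrite !size_filter; elim: s => [//|a s ih] /= /andP[h /ih]; move: (size s) (count _ s) (count _ s) => n1 n2' n3.
by case: (P a) h; case: (Q a) => //= _; lia.
Qed.

(** With r^4 = T and b = |v|, this bounds the smaller of |u|^2 and |u + v|^2 on the region. *)
Definition crA (r b : R) := (if b <= r then r ^+ 2 / b else 0) + 4 * r / b.
Lemma crA_ge0 r b : 0 <= r -> 0 < b -> 0 <= crA r b.
Proof.
move=> r0 b0; apply: addr_ge0; last by apply: divr_ge0; [exact: mulr_ge0|exact: ltW].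
by case: ifP => // _; apply: divr_ge0; [exact: sqr_ge0|exact: ltW].
Qed.
(* For b > r the larger of a, c is at least b / 2, whence a <= 2 r^2 / b^2. *)
Lemma crA_min (a c b r : R) : 0 <= a -> a <= c -> 0 < b -> b <= a + c -> 0 <= r -> a * b * c <= r ^+ 2 ->
  a ^+ 2 <= crA r b.
Proof.
move=> a0 ac b0 bac r0 h; rewrite /crA; have [br|rb] := leP b r.
  have : a ^+ 2 <= r ^+ 2 / b.
    rewrite ler_pdivlMr //; apply: le_trans h; rewrite [leRHS]mulrAC ler_pM2r // expr2; exact: ler_wpM2l.
  by move=> h1; apply: (le_trans h1); rewrite lerDl; apply: divr_ge0; [exact: mulr_ge0|exact: ltW].
rewrite add0r ler_pdivlMr //.
have h1 : a * b ^+ 2 <= 2 * r ^+ 2.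
  have : a * b * b <= a * b * (2 * c) by apply: ler_wpM2l; [apply: mulr_ge0 => //; exact: ltW|qlra].
  by rewrite expr2 mulrA; qlra.
have h2 : (a * b ^+ 2) ^+ 2 <= (2 * r ^+ 2) ^+ 2.
  by apply: lerXn2r => //; rewrite nnegrE; apply: mulr_ge0 => //; exact: sqr_ge0.
have b3 : 0 < b ^+ 3 by rewrite exprn_gt0.
have r3 : r ^+ 3 <= b ^+ 3 by apply: lerXn2r; rewrite ?nnegrE //; qlra.
rewrite -(ler_pM2r b3); apply: (@le_trans _ _ (4 * r * r ^+ 3)); last first.
  by apply: ler_wpM2l => //; exact: mulr_ge0.
have e1 : (a * b ^+ 2) ^+ 2 = a ^+ 2 * b * b ^+ 3 by ring.
have e2 : (2 * r ^+ 2) ^+ 2 = 4 * r * r ^+ 3 by ring.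
by rewrite -e1 -e2.
Qed.

Lemma ab_tri u w : ab w <= ab u + ab (u + w).
Proof.
have h : n2 (pt (u + w) - pt u) <= (ab (u + w) + ab u) ^+ 2.
  by apply: n2B; rewrite ?sqrtr_ge0 // ab_sqr n2_pt.
rewrite addrC -(ler_sqr (_ : ab w \is Num.nneg)) ?nnegrE ?addr_ge0 ?sqrtr_ge0 // ab_sqr.
by apply: le_trans h; rewrite -ptN -ptD n2_pt addrAC subrr add0r.
Qed.

Lemma lamnz_nil x y z T : fs x -> fs y -> fs z -> T < nm (proj x y z) -> lamnz x y z T = [::].
Proof.
move=> fx fy fz h; case E : (lamnz x y z T) => [//|a l]; have : a \in lamnz x y z T by rewrite E mem_head.
rewrite mem_filter lamptsE // => /andP[/andP[_ a0] /asboolP[/Lam_proj h1 [_ h2 _ _]]]; exfalso.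
rewrite /pt2 /= n2_pt in h2.
by have := le_trans (nm_le_sq (fs_proj fx fy fz) h1 a0) h2; rewrite leNgt h.
Qed.

(** For fixed v the possible u lie in one coset of X ∩ Z and in one of two discs of equal radius,
    around 0 and around -v. *)
Lemma lamnz_fiber : exists2 C, 0 <= C & forall x y z r b, fs x -> fs y -> fs z -> 0 <= r -> b != 0 ->
  (size [seq a <- lamnz x y z (r ^+ 4) | a.2 == b])%:R <= C * (crA r (ab b) / nm (emax x z) + 1).
Proof.
have [C C0 CP] := coset_count; exists (2 * C); first exact: mulr_ge0.
move=> x y z r b fx fy fz r0 b0; have fW := fs_emax fx fz; have bp := ab_gt0 b0.
have A0 := crA_ge0 r0 bp; set A := crA r (ab b) in A0 *.
have [uS hS] : let us := [seq c.1 | c <- lampts x y z (r ^+ 4) & c.2 == b] in uniq us /\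
   (forall a, a \in us -> forall c, c \in us -> ide (emax x z) (a - c)).
  split=> [|a]; first by have [] := pts_coset (r ^+ 4) 0 b fx fy fz.
  by have [] := pts_coset (r ^+ 4) a b fx fy fz.
set S := [seq _ | _ <- _ & _] in uS hS.
have cov : all (fun a => (sq a <= A) || (sq (a + b) <= A)) S.
  apply/allP => a0 /mapP[[u w] h -> /=]; move: h; rewrite mem_filter lamptsE // => /= /andP[/eqP -> /asboolP[_ [_ _ _]]].
  rewrite /pt2 /= -ptD !n2_pt => h.
  have h' : ab u * ab b * ab (u + b) <= r ^+ 2.
    rewrite -(ler_sqr (_ : _ * _ \is Num.nneg)) ?nnegrE ?sqr_ge0 ?mulr_ge0 ?sqrtr_ge0 //.
    by rewrite -exprM [(_ * ab (u + b)) ^+ 2]exprMn [(ab u * _) ^+ 2]exprMn !ab_sqr.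
  have [ac|/ltW ca] := leP (ab u) (ab (u + b)).
    by rewrite -(ab_sqr u) (crA_min _ ac) ?sqrtr_ge0 ?ab_tri.
  rewrite -(ab_sqr (u + b)) (crA_min _ ca) ?orbT ?sqrtr_ge0 // ?[_ + ab u]addrC ?ab_tri //.
  by rewrite (_ : _ * _ * _ = ab u * ab b * ab (u + b)) //; ring.
have h0 : (size [seq a <- lamnz x y z (r ^+ 4) | a.2 == b] <= size S)%N.
  rewrite size_map -filter_predI !size_filter; apply: sub_count => a /=.
  by case/andP.
have h1 := leq_trans h0 (size_cover cov).
have H (c : K) : (size [seq a <- S | sq (a + c) <= A])%:R <= C * (A / nm (emax x z) + 1).
  have := CP (emax x z) (- pt c) (Num.sqrt A) [seq a <- S | sq (a + c) <= A] fW (sqrtr_ge0 _) (filter_uniq _ uS).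
  rewrite sqr_sqrtr //; apply.
    by move=> a a'; rewrite !mem_filter => /andP[_ ha] /andP[_ ha']; exact: hS.
  by move=> a; rewrite mem_filter opprK -ptD n2_pt => /andP[].
have H1 := H 0; have H2 := H b; rewrite (eq_filter (a2 := fun a => sq a <= A)) in H1; last by move=> a; rewrite addr0.
have : (size [seq a <- lamnz x y z (r ^+ 4) | a.2 == b])%:R <= (size [seq a <- S | sq a <= A])%:R + (size [seq a <- S | sq (a + b) <= A])%:R :> R.
  by rewrite -natrD ler_nat.
move: H1 H2; move: (_ / _) (size _)%:R (size _)%:R (size _)%:R => q a1 a2 a3 H1 H2 H3; qlra.
Qed.

Lemma sum_crA : exists2 C, 0 <= C & forall e r, fs e -> 0 <= r ->
  \sum_(b <- nz e (r ^+ 4)) crA r (ab b) <= C * (r ^+ 3 / nm e).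
Proof.
have [C C0 CP] := sum_inv_ab; exists (5 * C); first exact: mulr_ge0.
move=> e r fe r0; have n0 := nm_gt0 fe; rewrite big_split /=.
have h1 : \sum_(b <- nz e (r ^+ 4)) 4 * r / ab b <= 4 * C * (r ^+ 3 / nm e).
  rewrite -mulr_sumr (_ : 4 * C * _ = 4 * r * (C * (r ^+ 2 / nm e))); last by ring.
  apply: ler_wpM2l; first exact: mulr_ge0.
  by rewrite (exprM r 2 2); apply: CP => //; exact: sqr_ge0.
have h2 : \sum_(b <- nz e (r ^+ 4)) (if ab b <= r then r ^+ 2 / ab b else 0) <= C * (r ^+ 3 / nm e).
  rewrite -big_mkcond /= (_ : C * _ = r ^+ 2 * (C * (r / nm e))); last by ring.
  apply: le_trans (ler_wpM2l (sqr_ge0 r) (CP e r fe r0)); rewrite mulr_sumr -big_filter.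
  apply: ler_sum_sub; first by rewrite filter_uniq // filter_uniq // pts_uniq.
  - by rewrite filter_uniq // pts_uniq.
  - move=> b; rewrite !mem_filter !ptsE // => /and3P[h1' h2' /asboolP[h3 h4]]; rewrite h2'; apply/asboolP; split => //.
    by rewrite -ab_sqr; apply: lerXn2r; rewrite ?nnegrE ?sqrtr_ge0.
  by move=> b _; apply: mulr_ge0; [exact: sqr_ge0|rewrite invr_ge0 sqrtr_ge0].
by qlra.
Qed.

(** Sum the fibre bound [crA] / m + 1 over the nonzero v in the projection: the 1 gives T / n and
    [crA] gives T^(3/4) / (m n). Without the point v = 0 no further term arises. *)
Lemma lamnz_crude : exists2 C, 0 <= C & forall x y z r, fs x -> fs y -> fs z -> 0 <= r ->
  (size (lamnz x y z (r ^+ 4)))%:R <=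
    C * (r ^+ 4 / nm (proj x y z) + r ^+ 3 / (nm (emax x z) * nm (proj x y z))).
Proof.
have [C C0 CP] := lamnz_fiber; have [D D0 DP] := sum_crA; have [E E0 EP] := nz_le.
exists (C * (D + E)); first by apply: mulr_ge0 => //; exact: addr_ge0.
move=> x y z r fx fy fz r0; have fP := fs_proj fx fy fz; have m0 := nm_gt0 (fs_emax fx fz); have n0 := nm_gt0 fP.
have r40 : 0 <= r ^+ 4 by exact: exprn_ge0.
rewrite (@size_by_snd _ (nz (proj x y z) (r ^+ 4))); last first.
- move=> a; rewrite mem_filter lamptsE // => /andP[/andP[_ a0] /asboolP[/Lam_proj h1 [_ h2 _ _]]].
  by rewrite mem_filter a0 ptsE //; apply/asboolP; split => //; rewrite -n2_pt.
- by rewrite filter_uniq // pts_uniq.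
apply: (@le_trans _ _ (\sum_(b <- nz (proj x y z) (r ^+ 4)) C * (crA r (ab b) / nm (emax x z) + 1))).
  by apply: ler_sum_in => b; rewrite mem_filter => /andP[b0 _]; exact: CP.
rewrite -mulr_sumr -mulrA; apply: ler_wpM2l => //; rewrite big_split /= -mulr_suml.
have h1 := DP _ r fP r0; have h2 := EP _ _ fP r40.
rewrite big_const_seq count_predT iter_addr_0.
have h3 : (\sum_(b <- nz (proj x y z) (r ^+ 4)) crA r (ab b)) / nm (emax x z) <= D * (r ^+ 3 / (nm (emax x z) * nm (proj x y z))).
  by rewrite ler_pdivrMr //; apply: le_trans h1 _; rewrite le_eqVlt; apply/orP; left; apply/eqP; field; rewrite !gt_eqF.
have q1 : 0 <= E * (r ^+ 3 / (nm (emax x z) * nm (proj x y z))).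
  by apply: mulr_ge0 => //; apply: divr_ge0; [exact: exprn_ge0|apply: mulr_ge0; exact: ltW].
have q2 : 0 <= D * (r ^+ 4 / nm (proj x y z)) by apply: mulr_ge0 => //; apply: divr_ge0 => //; exact: ltW.
by qlra.
Qed.

(** The volume is read off from lattice points: for the very fine lattice (1/N) O_K the main term of
    [pts_main] dominates its error, and the crude count bounds it from above. *)
Lemma Vol_crude : exists2 C, 0 <= C & forall T, 1 <= T -> Vol T <= C * r4 T ^+ 3.
Proof.
have [C C0 CP] := pts_main; have [D D0 DP] := lamnz_crude; have w0 := im_qw.
exists (im qw ^+ 2 * (5 * C + 2 * D)); first by nneg.
move=> T T1; have T0 : 0 < T by qlra.
set r := r4 T; have r1 : 1 <= r by exact: r4_ge1.
have rE : r ^+ 4 = T by rewrite r4K // ltW.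
(* The main term has order V(T) N^4 and the error order T^4 N^3, so N >= T^4 suffices. *)
pose N := (Num.trunc (T ^+ 8)).+1; have N1 : T ^+ 8 < N%:R by have /andP[] := truncn_itv (exprn_ge0 8 (ltW T0)).
have sN : sq N%:R = N%:R ^+ 2 by have := sq_int N; rewrite -!pmulrn.
have Nn : (N%:R : K) != 0 by rewrite -sq_gt0 sN exprn_gt0 // ltr0n.
pose e : prm -> int := v ^~ (N%:R^-1); have fe : fs e by exact: fs_v.
have eE : emax e e = e by apply: funext => p; rewrite /emax maxxx.
have pE : proj e e e = e by rewrite /proj /emin /emax; apply: funext => p; rewrite minxx maxxx.
have mE : nm e = (N%:R ^+ 2)^-1.
  by rewrite nm_v ?invr_neq0 // sqV sN.
have N0 : 0 < N%:R :> R by rewrite ltr0n.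
have := CP e e e T _ _ fe fe fe T1 erefl erefl; have := DP e e e r fe fe fe (ltW (lt_le_trans ltr01 r1)); rewrite eE pE rE mE.
have -> : Num.sqrt ((N%:R ^+ 2)^-1 : R) = N%:R^-1 by rewrite sqrtrV ?sqr_ge0 // sqrtr_sqr gtr0_norm.
move: (size _)%:R (Vol T) N%:R N0 N1 => L V n n0 n1; clearbody r; clear CP DP e fe eE pE mE Nn sN N; rewrite !invrK.
set w := im qw in w0 *; clearbody w => h1 h2.
have n2 : T ^+ 4 <= n by apply/ltW; apply: le_lt_trans n1; apply: ler_weXn2l.
have n3 : 1 <= n by apply: le_trans n2; exact: exprn_ege1.
have n4 : 0 < n ^+ 4 by rewrite exprn_gt0.
have T4 : 1 <= T ^+ 4 by exact: exprn_ege1.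
have h3 : V / ((n ^+ 2)^-1 * (n ^+ 2)^-1 * w ^+ 2) <= L + C * T ^+ 4 * (1 + n ^+ 2 + n ^+ 2 + (n^-1 + n^-1) / ((n ^+ 2)^-1 * (n ^+ 2)^-1)).
  by move: h2; rewrite ler_norml => /andP[+ _]; move: (V / _) => k; qlra.
have e1 : V / ((n ^+ 2)^-1 * (n ^+ 2)^-1 * w ^+ 2) = V / w ^+ 2 * n ^+ 4 by field; rewrite !gt_eqF.
have e2 : (n^-1 + n^-1) / ((n ^+ 2)^-1 * (n ^+ 2)^-1) = 2 * n ^+ 3 by field; rewrite gt_eqF.
have e3 : T * n ^+ 2 + r ^+ 3 / ((n ^+ 2)^-1 * (n ^+ 2)^-1) = T * n ^+ 2 + r ^+ 3 * n ^+ 4 by field; rewrite gt_eqF.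
rewrite e3 in h1; rewrite e1 e2 in h3.
have r3 : 1 <= r ^+ 3 by exact: exprn_ege1.
have t1 : T * n ^+ 2 <= r ^+ 3 * n ^+ 4.
  apply: (@le_trans _ _ (n ^+ 4)); last by rewrite ler_peMl // ltW.
  rewrite (exprD n 2 2); apply: ler_wpM2r; first exact: sqr_ge0.
  apply: (@le_trans _ _ n); last by rewrite expr2 ler_peMl // ltW.
  by apply: le_trans n2; rewrite -[leLHS]expr1; apply: ler_weXn2l.
have t2 : T ^+ 4 * (1 + n ^+ 2 + n ^+ 2 + 2 * n ^+ 3) <= 5 * (r ^+ 3 * n ^+ 4).
  apply: (@le_trans _ _ (n * (5 * n ^+ 3))).
    apply: ler_pM => //; first by rewrite exprn_ge0 // ltW.
      by rewrite !addr_ge0 // ?sqr_ge0 // mulr_ge0 // exprn_ge0 // ltW.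
    have i1 : n ^+ 2 <= n ^+ 3 by apply: ler_weXn2l.
    have i2 : 1 <= n ^+ 3 by exact: exprn_ege1.
    qlra.
  rewrite mulrCA -exprS; apply: ler_wpM2l => //; rewrite ler_peMl // ltW //.
have h4 : V / w ^+ 2 * n ^+ 4 <= (5 * C + 2 * D) * r ^+ 3 * n ^+ 4.
  have i1 : D * (T * n ^+ 2 + r ^+ 3 * n ^+ 4) <= D * (2 * (r ^+ 3 * n ^+ 4)) by apply: ler_wpM2l => //; qlra.
  have i2 : C * (T ^+ 4 * (1 + n ^+ 2 + n ^+ 2 + 2 * n ^+ 3)) <= C * (5 * (r ^+ 3 * n ^+ 4)) by exact: ler_wpM2l.
  by qlra.
rewrite ler_pM2r // ler_pdivrMr ?exprn_gt0 // in h4.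
by apply: le_trans h4 _; rewrite le_eqVlt; apply/orP; left; apply/eqP; ring.
Qed.

(** * Summation of the error terms *)
Lemma count_or (T : Type) (s : seq T) (a b c : pred T) : (forall x, a x -> b x || c x) ->
  (count a s <= count b s + count c s)%N.
Proof. by move=> h; rewrite -count_predUI; apply: leq_trans (leq_addr _ _); apply: sub_count. Qed.

Lemma pow2_tau e P : integral e -> uniq P -> (forall p, p \in P -> e p != 0) ->
  exists L : seq (prm -> int), [/\ uniq L, size L = (2 ^ size P)%N &
    forall d, d \in L -> [/\ integral d, forall p, d p <= e p & forall p, p \notin P -> d p = 0]].
Proof.
move=> ie; elim: P => [_ _|p P ih /= /andP[pP uP] H].
  by exists [:: 0]; split => // d; rewrite inE => /eqP ->; split => //; [exact: integral0'|case: ie].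
have [r rP|L [uL sL hL]] := ih uP; first by apply: H; rewrite inE rP orbT.
have inj : injective (fun d : prm -> int => d + dl p) by exact: addIr.
exists (L ++ [seq d + dl p | d <- L]); split.
- rewrite cat_uniq uL map_inj_uniq // uL andbT; apply/hasPn => _ /mapP[d /hL[_ _ d0] ->]; apply/negP => /hL[_ _ d0'].
  by have := d0' p pP; rewrite fctE /dl d0 // eqxx.
- by rewrite size_cat size_map sL expnS mul2n addnn.
move=> d; rewrite mem_cat => /orP[/hL[h1 h2 h3]|/mapP[d' /hL[h1 h2 h3] ->]].
  by split => // r; rewrite inE negb_or => /andP[_]; exact: h3.
split; first by apply: integralD => //; exact: integral_dl.
  move=> r; rewrite fctE /dl; have [->|_] := eqVneq r p; last by rewrite addr0.
  have := H p (mem_head _ _); rewrite h3 //; case: ie => _ /(_ p); lia.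
move=> r; rewrite inE negb_or fctE /dl => /andP[/negPf -> /h3 ->]; exact: addr0.
Qed.

Definition om (B : R) e : nat := count (fun p => e p != 0) (ples (Num.trunc B)).
Lemma om_D B e f : (om B (e + f)%R <= om B e + om B f)%N.
Proof.
apply: count_or => p; rewrite fctE; apply: contraR; rewrite negb_or !negbK => /andP[/eqP -> /eqP ->].
by rewrite addr0.
Qed.

(** The products of distinct prime divisors of e already give 2^omega(e) divisors d, and k^omega(e)
    <= k^omega(d) k^omega(e/d); so the left sum is at most a double sum over d and e/d. *)
Lemma sum_om_double B (k : R) : 1 <= k ->
  \sum_(e <- idl B) (2 * k) ^+ om B e / nm e <= (\sum_(e <- idl B) k ^+ om B e / nm e) ^+ 2.
Proof.
move=> k1; have k0 : 0 <= k by qlra.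
pose g e := k ^+ om B e / nm e; have g0 e : e \in idl B -> 0 <= g e.
  by move=> h; apply: divr_ge0; [exact: exprn_ge0|exact/ltW/(nm_idl_gt0 h)].
rewrite expr2 mulr_suml; under [leRHS]eq_bigr => d _ do rewrite mulr_sumr.
apply: (@le_trans _ _ (\sum_(e <- idl B) \sum_(d <- idl B | `[< forall p, d p <= e p >]) g d * g (e - d))).
  apply: ler_sum_in => e he; have [ie eB] := idlP he; have [fe e0] := ie.
  have [|p|L [uL sL hL]] := @pow2_tau e [seq p <- ples (Num.trunc B) | e p != 0] ie.
  - by rewrite filter_uniq // ples_uniq.
  - by rewrite mem_filter => /andP[].
  have LB d : d \in L -> d \in idl B.
    move=> /hL[[fd d0] de _]; rewrite idlE; apply/asboolP; split; first by split.
    by apply: le_trans eB; apply: nm_le.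
  have pt d : d \in L -> g e <= g d * g (e - d).
    move=> dL; have [[fd d0] de _] := hL d dL; have fed : fs (e - d) by apply: (fs_sub fe fd) => p h1 h2; rewrite !fctE h1 h2 subr0.
    have dE : d + (e - d) = e by rewrite addrC subrK.
    rewrite /g mulrACA -exprD -invfM -nmD // dE; apply: ler_wpM2r; first by rewrite invr_ge0 ltW // nm_gt0.
    by apply: ler_weXn2l => //; rewrite -{1}dE; exact: om_D.
  rewrite -big_filter; apply: (@le_trans _ _ (\sum_(d <- L) g d * g (e - d))); last first.
    apply: ler_sum_sub => //; first by rewrite filter_uniq // idl_uniq.
      by move=> d dL; rewrite mem_filter LB // andbT; apply/asboolP; have [] := hL d dL.
    move=> d; rewrite mem_filter => /andP[/asboolP de hd]; apply: mulr_ge0; first exact: g0.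
    have [[fd d0] dB] := idlP hd; apply: divr_ge0; first exact: exprn_ge0.
    by rewrite nmB //; apply: divr_ge0; exact/ltW/nm_gt0.
  apply: (@le_trans _ _ (\sum_(d <- L) g e)); last exact: ler_sum_in.
  rewrite big_const_seq count_predT iter_addr_0 sL -[leRHS]mulr_natl natrX size_filter -/(om B e) /g.
  by rewrite exprMn mulrA.
rewrite (exchange_big_dep xpredT) //=; apply: ler_sum_in => d hd; have [[fd d0] dB] := idlP hd.
rewrite -big_filter -(big_map (fun e : prm -> int => e - d) predT (fun f => g d * g f)) /=.
apply: ler_sum_sub.
- by rewrite map_inj_uniq ?filter_uniq ?idl_uniq //; exact: addIr.
- exact: idl_uniq.
- move=> _ /mapP[e + ->]; rewrite mem_filter => /andP[/asboolP de /idlP[[fe e0] eB]].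
  have fed : fs (e - d) by apply: (fs_sub fe fd) => p h1 h2; rewrite !fctE h1 h2 subr0.
  rewrite idlE; apply/asboolP; split; first by split => // p; rewrite !fctE subr_ge0.
  by apply: le_trans eB; rewrite nmB // ler_pdivrMr ?nm_gt0 // ler_peMr ?nm_ge1 // ltW // nm_gt0.
by move=> f hf; apply: mulr_ge0; exact: g0.
Qed.

(** Three doublings lead from base 1 to base 8, each squaring the bound 1 + ln B; hence the exponent
    8. *)
Lemma sum_om8 : exists2 C, 0 <= C & forall B, 1 <= B -> \sum_(e <- idl B) 8 ^+ om B e / nm e <= C * (1 + ln B) ^+ 8.
Proof.
have [C C0 CP] := sum_idl_inv; exists (C ^+ 8); first exact: exprn_ge0.
move=> B B1; have := CP B B1; rewrite -exprMn; set x := C * _ => hx.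
have H (k y : R) : 1 <= k -> \sum_(e <- idl B) k ^+ om B e / nm e <= y -> \sum_(e <- idl B) (2 * k) ^+ om B e / nm e <= y ^+ 2.
  move=> k1 h; apply: le_trans (sum_om_double B k1) _; apply: lerXn2r => //; rewrite nnegrE.
    rewrite big_seq; apply: sumr_ge0 => e he; apply: divr_ge0; last exact/ltW/(nm_idl_gt0 he).
    by apply: exprn_ge0; qlra.
  apply: le_trans h; rewrite big_seq; apply: sumr_ge0 => e he; apply: divr_ge0; last exact/ltW/(nm_idl_gt0 he).
  by apply: exprn_ge0; qlra.
have h1 : \sum_(e <- idl B) 1 ^+ om B e / nm e <= x.
  by apply: le_trans hx; apply: ler_sum_in => e _; rewrite expr1n mul1r.
have h2 := H _ _ (lexx 1) h1; have h4 := H _ _ (_ : 1 <= 2 * 1) h2; have h8 := H _ _ (_ : 1 <= 2 * (2 * 1)) (h4 _).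
rewrite (_ : (8 : R) = 2 * (2 * (2 * 1))); last by ring.
by rewrite (exprM x 2 4) (exprM (x ^+ 2) 2 2); apply: h8; qlra.
Qed.

(** After inserting the fourth root the summand is a constant times N^(-3/4); its sum is dominated
    by the largest norms, N near Z / c, so no logarithm appears and c^(-1/4) is gained. *)
Lemma sav1 : exists2 C, 0 <= C & forall B Z c, 0 < Z -> 1 <= c ->
  \sum_(e <- idl B | c * nm e <= Z) (nm e)^-1 / r4 (Z / nm e) <= C / r4 c.
Proof.
have [C C0 CP] := sum_idl_r43; exists C => // B Z c Z0 c1.
have c0 : 0 < c by qlra.
have rZ := r4_gt0 Z0; have rc := r4_gt0 c0.
apply: (@le_trans _ _ ((r4 Z)^-1 * \sum_(e <- idl (Z / c)) (r4 (nm e) ^+ 3)^-1)); last first.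
  have := CP (Z / c) (divr_ge0 (ltW Z0) (ltW c0)); rewrite (r4M _ (ltW Z0)) (r4V (ltW c0)) => h.
  rewrite mulrC ler_pdivrMr //; apply: le_trans h _; rewrite le_eqVlt; apply/orP; left; apply/eqP; field.
  by rewrite gt_eqF.
rewrite mulr_sumr -big_filter.
apply: (@le_trans _ _ (\sum_(e <- [seq e <- idl B | c * nm e <= Z]) (r4 Z)^-1 * (r4 (nm e) ^+ 3)^-1)).
  apply: ler_sum_in => e; rewrite mem_filter => /andP[_ he]; have n0 := nm_idl_gt0 he; have r0 := r4_gt0 n0.
  rewrite (r4M _ (ltW Z0)) (r4V (ltW n0)) invfM invrK -{1}(r4K (ltW n0)) le_eqVlt; apply/orP; left; apply/eqP; field.
  by rewrite !gt_eqF.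
apply: ler_sum_sub; rewrite ?filter_uniq ?idl_uniq //.
  move=> e; rewrite mem_filter => /andP[h /idlP[ie _]]; rewrite idlE; apply/asboolP; split => //.
  by rewrite ler_pdivlMr // mulrC.
by move=> e he; apply: mulr_ge0; rewrite invr_ge0 ?exprn_ge0 // r4_ge0.
Qed.

(** Reduced to [sav1] with the square root of Z, because Z / N^2 is at least its own square root in
    the range of summation. *)
Lemma sav2 : exists2 C, 0 <= C & forall B Z, 0 < Z ->
  \sum_(e <- idl B | nm e ^+ 2 <= Z) (nm e)^-1 / r4 (Z / nm e ^+ 2) <= C.
Proof.
have [C C0 CP] := sav1; exists C => // B Z Z0; set z := Num.sqrt Z.
have z0 : 0 < z by rewrite sqrtr_gt0.
have zE : z ^+ 2 = Z by rewrite sqr_sqrtr // ltW.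
have := CP B z 1 z0 (lexx _); rewrite r4_1 divr1; apply: le_trans.
rewrite big_seq_cond [leRHS]big_seq_cond.
have cE e : (e \in idl B) && (nm e ^+ 2 <= Z) = (e \in idl B) && (1 * nm e <= z).
  have [he|//] := boolP (e \in idl B); have n0 := nm_idl_gt0 he.
  by rewrite mul1r /= -zE ler_sqr ?nnegrE // ltW.
rewrite (eq_bigl _ _ cE); apply: ler_sum => e /andP[he]; rewrite mul1r => nz; have n0 := nm_idl_gt0 he.
apply: ler_wpM2l; first by rewrite invr_ge0 ltW.
have q1 : 1 <= z / nm e by rewrite ler_pdivlMr // mul1r.
rewrite lef_pV2 ?posrE ?r4_gt0 ?divr_gt0 ?exprn_gt0 //; apply: r4_le.
by rewrite -zE -expr_div_n expr2 ler_peMl // (le_trans ler01).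
Qed.

Lemma sum_tups_rcons2 (T : Type) (l : seq T) n (G : seq T -> R) :
  \sum_(s <- tups l n.+2) G s = \sum_(s <- tups l n) \sum_(e <- l) \sum_(f <- l) G (s ++ [:: e; f]).
Proof.
elim: n G => [|n ih] G.
  rewrite sum_tupsS sum_tups0; apply: eq_bigr => e _; rewrite sum_tupsS; apply: eq_bigr => f _.
  by rewrite sum_tups0.
by rewrite sum_tupsS [RHS]sum_tupsS; apply: eq_bigr => c _; rewrite ih.
Qed.
Lemma sum_tups_prod (T : Type) (l : seq T) n (f : T -> R) :
  \sum_(s <- tups l n) \prod_(e <- s) f e = (\sum_(e <- l) f e) ^+ n.
Proof.
elim: n => [|n ih]; first by rewrite sum_tups0 big_nil expr0.
rewrite sum_tupsS exprS -ih mulr_suml; apply: eq_bigr => c _; rewrite mulr_sumr; apply: eq_bigr => s _.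
by rewrite big_cons.
Qed.

Definition reidx (idx : seq nat) (s : seq (prm -> int)) := [seq nth 0 s i | i <- idx].
Lemma reidxK idx idx' s : size s = size idx' -> all (fun i => i < size idx)%N idx' ->
  [seq nth 0%N idx i | i <- idx'] = seq.iota 0 (size idx') -> reidx idx' (reidx idx s) = s.
Proof.
move=> ss h E; rewrite /reidx.
have -> : [seq nth 0 [seq nth 0 s j | j <- idx] i | i <- idx'] = [seq nth 0 s (nth 0%N idx i) | i <- idx'].
  by apply/eq_in_map => i /(allP h) hi; rewrite (nth_map 0%N).
by rewrite (map_comp (nth 0 s)) E -ss map_nth_iota0 // take_size.
Qed.
Lemma sum_tups_perm (l : seq (prm -> int)) n idx idx' (G : seq (prm -> int) -> R) : uniq l ->
  perm_eq idx (seq.iota 0 n) -> perm_eq idx' (seq.iota 0 n) ->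
  [seq nth 0%N idx i | i <- idx'] = seq.iota 0 n -> [seq nth 0%N idx' i | i <- idx] = seq.iota 0 n ->
  \sum_(s <- tups l n) G (reidx idx s) = \sum_(s <- tups l n) G s.
Proof.
move=> ul p p' E E'; rewrite -(big_map (reidx idx) predT G); apply: perm_big.
have si : size idx = n by rewrite (perm_size p) size_iota.
have si' : size idx' = n by rewrite (perm_size p') size_iota.
have H i : perm_eq i (seq.iota 0 n) -> forall s, s \in tups l n -> reidx i s \in tups l n.
  move=> pi s; rewrite !tupsE => /andP[/eqP sn a].
  have ps : perm_eq (reidx i s) s by rewrite /reidx (perm_trans (perm_map _ pi)) // -sn map_nth_iota0 // take_size.
  by rewrite (perm_size ps) (eq_all_r (perm_mem ps)) sn eqxx.
have sz s : s \in tups l n -> size s = n by rewrite tupsE => /andP[/eqP].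
have lt i j : perm_eq i (seq.iota 0 n) -> size j = n -> all (fun k => k < size j)%N i.
  by move=> pi ->; rewrite (perm_all _ pi); apply/allP => k; rewrite mem_iota.
have K1 s : size s = n -> reidx idx' (reidx idx s) = s.
  by move=> h; apply: reidxK; rewrite ?si' //; exact: lt.
have K2 s : size s = n -> reidx idx (reidx idx' s) = s.
  by move=> h; apply: reidxK; rewrite ?si //; exact: lt.
apply: uniq_perm; last 1 first.
- move=> s; apply/mapP/idP => [[s' /(H _ p) hs' ->//]|hs]; exists (reidx idx' s); first exact: H.
  by rewrite K2 // (sz s hs).
- rewrite map_inj_in_uniq ?tups_uniq // => s t /sz hs /sz ht Est.
  by rewrite -(K1 s hs) -(K1 t ht) Est.
exact: tups_uniq.
Qed.

Definition WT (s : seq (prm -> int)) : R := \prod_(e <- s) (nm e)^-1.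

(** Four ideals are summed with weight 1/N and cost four logarithms, all that the error term of the
    theorem allows besides log log B. The permutation [idx] selects the two ideals that are summed
    first, where the saving has to be found. *)
Lemma region idx idx' : perm_eq idx (seq.iota 0 6) -> perm_eq idx' (seq.iota 0 6) ->
  [seq nth 0%N idx i | i <- idx'] = seq.iota 0 6 -> [seq nth 0%N idx' i | i <- idx] = seq.iota 0 6 ->
  exists2 C, 0 <= C & forall B k (G : seq (prm -> int) -> R), 1 <= B -> 0 <= k ->
  (forall a b c d, a \in idl B -> b \in idl B -> c \in idl B -> d \in idl B ->
    \sum_(e <- idl B) \sum_(f <- idl B) G (reidx idx [:: a; b; c; d; e; f]) <= k * (nm a * nm b * nm c * nm d)^-1) ->
  \sum_(s <- tups (idl B) 6) G s <= C * (k * (1 + ln B) ^+ 4).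
Proof.
move=> h1 h2 h3 h4; have [C C0 CP] := sum_idl_inv; exists (C ^+ 4); first exact: exprn_ge0.
move=> B k G B1 k0 H; rewrite -(sum_tups_perm G (idl_uniq B) h1 h2 h3 h4) (sum_tups_rcons2 _ 4).
apply: (@le_trans _ _ (\sum_(s <- tups (idl B) 4) k * WT s)).
  apply: ler_sum_in => s; rewrite tupsE => /andP[]; case: s => [|a [|b [|c [|d [|? ?]]]]] // _ /and5P[ha hb hc hd _].
  by apply: le_trans (H a b c d ha hb hc hd) _; rewrite /WT !big_cons big_nil mulr1 !invfM !mulrA.
rewrite -mulr_sumr sum_tups_prod (_ : C ^+ 4 * _ = k * (C * (1 + ln B)) ^+ 4); last by rewrite exprMn; ring.
 apply: ler_wpM2l => //; apply: lerXn2r; rewrite ?nnegrE.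
- by rewrite big_seq; apply: sumr_ge0 => e he; rewrite invr_ge0 ltW // (nm_idl_gt0 he).
- by apply: mulr_ge0 => //; apply: addr_ge0 => //; exact: ln_ge0.
exact: CP.
Qed.

Definition mf (y : seq R) : R := if y is [:: y1; y2; y4; y6; y3; y5] then y3 / (y1 * y4 * y5) else 0.
(** For a tuple s: [Tq] is T = B / J, and [nq] and [mq] are the norms n and m of the projection and
    of the kernel. *)
Definition Tq (B : R) s : R := B / Jf (nms s).
Definition nq s : R := nth 0 (nms s) 5 / nf (nms s).
Definition mq s : R := mf (nms s).
Definition low s : bool := nth 0 (nms s) 4 <= nth 0 (nms s) 5.

(** In m [WT] the norm y3 cancels, so the ideals with y3 <= y5 give O(y5), which cancels one of the
    two factors 1 / y5, and y4 occurs with exponent -2. Neither of these two sums costs a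
    logarithm. *)
Lemma reg_a : exists2 C, 0 <= C & forall B, 1 <= B ->
  \sum_(s <- tups (idl B) 6) ic (low s) * (mq s * WT s) <= C * (1 + ln B) ^+ 4.
Proof.
have [|||| C C0 CP] := @region [:: 0; 1; 4; 2; 5; 3]%N [:: 0; 1; 3; 5; 2; 4]%N => //.
have [D D0 DP] := size_idl_le; have [E E0 EP] := sum_idl_r46.
exists (C * (D * E)); first by rewrite !mulr_ge0.
move=> B B1; rewrite -mulrA; apply: CP => //; first exact: mulr_ge0.
move=> a b c d ha hb hc hd; have [a0 b0 c0 d0] := And4 (nm_idl_gt0 ha) (nm_idl_gt0 hb) (nm_idl_gt0 hc) (nm_idl_gt0 hd).
have a1 := nm_idl_ge1 ha.
rewrite /reidx /= /mq /low /WT /nms.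
apply: (@le_trans _ _ (\sum_(e <- idl B) D * (nm a * nm b * nm c * nm d)^-1 * (r4 (nm e) ^+ 6)^-1)); last first.
  rewrite -mulr_sumr mulrAC; apply: ler_wpM2r; first by rewrite invr_ge0 !mulr_ge0 // ltW.
  by apply: ler_wpM2l => //; apply: EP; qlra.
apply: ler_sum_in => e he; have e0 := nm_idl_gt0 he; have e1 := nm_idl_ge1 he.
apply: (@le_trans _ _ (\sum_(f <- idl B) ic (nm f <= nm d) * ((nm a * nm b * nm c * nm d)^-1 / nm d * (r4 (nm e) ^+ 6)^-1))).
  apply: ler_sum_in => f hf; have f0 := nm_idl_gt0 hf; rewrite [nth _ _ _]/= [nth _ _ _]/= /mf /= !big_cons big_nil.
  apply: ler_wpM2l; first exact: ic_ge0.
  have -> : nm f / (nm a * nm e * nm d) * ((nm a)^-1 * ((nm b)^-1 * ((nm e)^-1 * ((nm c)^-1 * ((nm f)^-1 * ((nm d)^-1 * 1)))))) =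
    (nm a * nm b * nm c * nm d)^-1 / nm d * ((nm a)^-1 / nm e ^+ 2) by field; rewrite !gt_eqF.
  apply: ler_wpM2l; first by rewrite divr_ge0 ?invr_ge0 ?mulr_ge0 // ltW.
  have r1 := r4_ge1 e1; have r0 : 0 < r4 (nm e) by qlra.
  apply: (@le_trans _ _ (nm e ^+ 2)^-1).
    by rewrite ler_piMl ?invr_ge0 ?sqr_ge0 // invf_le1.
  rewrite lef_pV2 ?posrE ?exprn_gt0 // -{2}(r4K (ltW e0)) -exprM.
  exact: ler_weXn2l.
rewrite -mulr_suml; have := DP (nm d) (ltW d0); have [_ dB] := idlP hd.
have -> : (size (idl (nm d)))%:R = \sum_(f <- idl B) ic (nm f <= nm d) :> R.
  transitivity (\sum_(e <- idl (nm d)) (1 : R)); first by rewrite big_const_seq count_predT iter_addr_0.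
  by rewrite -(sum_idl_ind (fun=> 1) dB); apply: eq_bigr => f _; rewrite mulr1.
move=> h; have q0 : 0 <= (nm a * nm b * nm c * nm d)^-1 / nm d * (r4 (nm e) ^+ 6)^-1.
  by rewrite !mulr_ge0 ?invr_ge0 ?mulr_ge0 ?exprn_ge0 ?r4_ge0 // ltW.
apply: le_trans (ler_wpM2r q0 h) _; rewrite le_eqVlt; apply/orP; left; apply/eqP.
by move: (r4 _ ^+ 6)^-1 => q; field; rewrite !gt_eqF.
Qed.

Lemma Jf_gt0 y1 y2 y4 y6 y3 y5 : 0 < y1 -> 0 < y2 -> 0 < y4 -> 0 < y6 -> 0 < y3 -> 0 < y5 -> 0 < Jf [:: y1; y2; y4; y6; y3; y5].
Proof. by move=> *; rewrite /Jf !mulr_gt0 // exprn_gt0. Qed.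

(** Five ideals cost five logarithms, but the sum over y5 gains t^(-1/4) by [sav1]; for t = (1 + ln
    B)^4 one logarithm is recovered. *)
Lemma reg_1 : exists2 C, 0 <= C & forall B t, 1 <= B -> 1 <= t ->
  \sum_(s <- tups (idl B) 6) ic ((Jf (nms s) <= B) && (t <= Tq B s)) * (WT s / r4 (Tq B s)) <= C * ((1 + ln B) ^+ 5 / r4 t).
Proof.
have [|||| C C0 CP] := @region [:: 0; 1; 2; 3; 4; 5]%N [:: 0; 1; 2; 3; 4; 5]%N => //.
have [D D0 DP] := sum_idl_inv; have [E E0 EP] := sav1.
exists (C * (D * E)); first by rewrite !mulr_ge0.
move=> B t B1 t1; have l0 : 0 <= ln B by exact: ln_ge0.
have q0 : 0 <= (r4 t)^-1 by rewrite invr_ge0 r4_ge0.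
rewrite (_ : C * _ * _ = C * (D * E * ((1 + ln B) / r4 t) * (1 + ln B) ^+ 4)); last by rewrite (exprS _ 4); ring.
apply: CP => //; first by rewrite !mulr_ge0 // addr_ge0.
move=> a b c d ha hb hc hd; have [a0 b0 c0 d0] := And4 (nm_idl_gt0 ha) (nm_idl_gt0 hb) (nm_idl_gt0 hc) (nm_idl_gt0 hd).
rewrite /reidx /= /Tq /WT /nms /=; set P := nm a * nm b * nm c * nm d.
have P0 : 0 < P by rewrite /P !mulr_gt0.
apply: (@le_trans _ _ (\sum_(e <- idl B) E / r4 t / P * (nm e)^-1)); last first.
  rewrite -mulr_sumr; apply: le_trans (ler_wpM2l _ (DP B B1)) _; first by rewrite !mulr_ge0 // invr_ge0 ltW.
  by rewrite le_eqVlt; apply/orP; left; apply/eqP; ring.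
apply: ler_sum_in => e he; have e0 := nm_idl_gt0 he.
set Q := nm a ^+ 3 * nm b ^+ 2 * nm c ^+ 2 * nm d ^+ 2 * nm e.
have Q0 : 0 < Q by rewrite /Q !mulr_gt0 // exprn_gt0.
have BQ : 0 < B / Q by apply: divr_gt0 => //; qlra.
apply: (@le_trans _ _ ((P * nm e)^-1 * \sum_(f <- idl B | t * nm f <= B / Q) (nm f)^-1 / r4 (B / Q / nm f))); last first.
  apply: le_trans (ler_wpM2l _ (EP B (B / Q) t BQ t1)) _; first by rewrite invr_ge0 mulr_ge0 // ltW.
  by rewrite invfM le_eqVlt; apply/orP; left; apply/eqP; ring.
rewrite mulr_sumr [leRHS]big_mkcond /=; apply: ler_sum_in => f hf; have f0 := nm_idl_gt0 hf.
have E1 : (t <= B / (Q * nm f)) = (t * nm f <= B / Q) by rewrite !ler_pdivlMr ?mulr_gt0 // mulrA (mulrAC t Q).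
rewrite -/Q E1; case: ifP => h; last by rewrite andbF /= mul0r.
have -> : B / (Q * nm f) = B / Q / nm f by rewrite invfM mulrA.
rewrite !big_cons big_nil mulr1.
have -> : (nm a)^-1 * ((nm b)^-1 * ((nm c)^-1 * ((nm d)^-1 * ((nm e)^-1 * (nm f)^-1)))) = (P * nm e)^-1 / nm f.
  by rewrite /P; field; rewrite !gt_eqF.
rewrite [leRHS]mulrA; apply: ler_piMl; last exact: ic_le1.
by rewrite !mulr_ge0 ?invr_ge0 ?r4_ge0 ?mulr_ge0 // ltW.
Qed.

(** If n lies in a window of ratio b, so does y5 once y1, y2, y6, y3 are fixed, at the cost 1 + ln
    b; y4 has exponent 2 in J and is summed by [sav2]. *)
Lemma reg_2 : exists2 C, 0 <= C & forall B a b, 1 <= B -> 0 < a -> 1 <= b ->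
  \sum_(s <- tups (idl B) 6) ic ((Jf (nms s) <= B) && (a <= nq s <= a * b)) * (WT s / r4 (Tq B s))
    <= C * ((1 + ln B) ^+ 4 * (1 + ln b)).
Proof.
have [|||| C C0 CP] := @region [:: 0; 1; 5; 2; 3; 4]%N [:: 0; 1; 3; 4; 5; 2]%N => //.
have [D D0 DP] := sum_idl_window; have [E E0 EP] := sav2.
exists (C * (D * E)); first by rewrite !mulr_ge0.
move=> B w b' B1 w0 b1; have l0 : 0 <= ln b' by exact: ln_ge0.
rewrite (_ : C * _ * _ = C * (D * E * (1 + ln b') * (1 + ln B) ^+ 4)); last by ring.
apply: CP => //; first by rewrite !mulr_ge0 // addr_ge0.
move=> a b c d ha hb hc hd; have [a0 b0 c0 d0] := And4 (nm_idl_gt0 ha) (nm_idl_gt0 hb) (nm_idl_gt0 hc) (nm_idl_gt0 hd).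
rewrite /reidx /= /Tq /WT /nq /nms /=; set P := nm a * nm b * nm c * nm d.
have P0 : 0 < P by rewrite /P !mulr_gt0.
apply: (@le_trans _ _ (\sum_(e <- idl B | w * P <= nm e <= w * P * b') E / P * (nm e)^-1)); last first.
  rewrite -mulr_sumr; apply: le_trans (ler_wpM2l _ (DP B (w * P) b' (mulr_gt0 w0 P0) b1)) _; first by rewrite !mulr_ge0 // invr_ge0 ltW.
  by rewrite le_eqVlt; apply/orP; left; apply/eqP; ring.
rewrite [leRHS]big_mkcond /=; apply: ler_sum_in => e he; have e0 := nm_idl_gt0 he.
have E1 : (w <= nm e / P <= w * b') = (w * P <= nm e <= w * P * b') by rewrite ler_pdivlMr // ler_pdivrMr // (mulrAC w b').
case: ifP => h1; last first.
  by rewrite big1 // => f _; rewrite -/P E1 h1 andbF /= mul0r.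
set Q := nm a ^+ 3 * nm b ^+ 2 * nm c ^+ 2 * nm d * nm e.
have Q0 : 0 < Q by rewrite /Q !mulr_gt0 // exprn_gt0.
have BQ : 0 < B / Q by apply: divr_gt0 => //; qlra.
apply: (@le_trans _ _ ((P * nm e)^-1 * \sum_(f <- idl B | nm f ^+ 2 <= B / Q) (nm f)^-1 / r4 (B / Q / nm f ^+ 2))); last first.
  apply: le_trans (ler_wpM2l _ (EP B (B / Q) BQ)) _; first by rewrite invr_ge0 mulr_ge0 // ltW.
  by rewrite invfM le_eqVlt; apply/orP; left; apply/eqP; ring.
rewrite mulr_sumr [leRHS]big_mkcond /=; apply: ler_sum_in => f hf; have f0 := nm_idl_gt0 hf.
have -> : nm a ^+ 3 * nm b ^+ 2 * nm f ^+ 2 * nm c ^+ 2 * nm d * nm e = Q * nm f ^+ 2 by rewrite /Q; ring.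
rewrite (_ : (Q * nm f ^+ 2 <= B) = (nm f ^+ 2 <= B / Q)); last by rewrite ler_pdivlMr // mulrC.
case: ifP => h; last by rewrite /= mul0r.
have -> : B / (Q * nm f ^+ 2) = B / Q / nm f ^+ 2 by rewrite invfM mulrA.
rewrite !big_cons big_nil mulr1.
have -> : (nm a)^-1 * ((nm b)^-1 * ((nm f)^-1 * ((nm c)^-1 * ((nm d)^-1 * (nm e)^-1)))) = (P * nm e)^-1 / nm f.
  by rewrite /P; field; rewrite !gt_eqF.
rewrite [leRHS]mulrA; apply: ler_piMl; last exact: ic_le1.
by rewrite !mulr_ge0 ?invr_ge0 ?r4_ge0 ?mulr_ge0 // ltW.
Qed.

(** The same for m: here y3 runs over the window once y1, y4, y5 are fixed, and y6 is summed by
    [sav2]. *)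
Lemma reg_3 : exists2 C, 0 <= C & forall B a b, 1 <= B -> 0 < a -> 1 <= b ->
  \sum_(s <- tups (idl B) 6) ic ((Jf (nms s) <= B) && (a <= mq s <= a * b)) * (WT s / r4 (Tq B s))
    <= C * ((1 + ln B) ^+ 4 * (1 + ln b)).
Proof.
have [|||| C C0 CP] := @region [:: 0; 1; 2; 5; 4; 3]%N [:: 0; 1; 2; 5; 4; 3]%N => //.
have [D D0 DP] := sum_idl_window; have [E E0 EP] := sav2.
exists (C * (D * E)); first by rewrite !mulr_ge0.
move=> B w b' B1 w0 b1; have l0 : 0 <= ln b' by exact: ln_ge0.
rewrite (_ : C * _ * _ = C * (D * E * (1 + ln b') * (1 + ln B) ^+ 4)); last by ring.
apply: CP => //; first by rewrite !mulr_ge0 // addr_ge0.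
move=> a b c d ha hb hc hd; have [a0 b0 c0 d0] := And4 (nm_idl_gt0 ha) (nm_idl_gt0 hb) (nm_idl_gt0 hc) (nm_idl_gt0 hd).
rewrite /reidx /= /Tq /WT /mq /nms /= /mf; set P := nm a * nm b * nm c * nm d.
set p := nm a * nm c * nm d; have p0 : 0 < p by rewrite /p !mulr_gt0.
have P0 : 0 < P by rewrite /P !mulr_gt0.
apply: (@le_trans _ _ (\sum_(e <- idl B | w * p <= nm e <= w * p * b') E / P * (nm e)^-1)); last first.
  rewrite -mulr_sumr; apply: le_trans (ler_wpM2l _ (DP B (w * p) b' (mulr_gt0 w0 p0) b1)) _; first by rewrite !mulr_ge0 // invr_ge0 ltW.
  by rewrite le_eqVlt; apply/orP; left; apply/eqP; ring.
rewrite [leRHS]big_mkcond /=; apply: ler_sum_in => e he; have e0 := nm_idl_gt0 he.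
have E1 : (w <= nm e / p <= w * b') = (w * p <= nm e <= w * p * b') by rewrite ler_pdivlMr // ler_pdivrMr // (mulrAC w b').
case: ifP => h1; last first.
  by rewrite big1 // => f _; rewrite -/p E1 h1 andbF /= mul0r.
set Q := nm a ^+ 3 * nm b ^+ 2 * nm c ^+ 2 * nm e * nm d.
have Q0 : 0 < Q by rewrite /Q !mulr_gt0 // exprn_gt0.
have BQ : 0 < B / Q by apply: divr_gt0 => //; qlra.
apply: (@le_trans _ _ ((P * nm e)^-1 * \sum_(f <- idl B | nm f ^+ 2 <= B / Q) (nm f)^-1 / r4 (B / Q / nm f ^+ 2))); last first.
  apply: le_trans (ler_wpM2l _ (EP B (B / Q) BQ)) _; first by rewrite invr_ge0 mulr_ge0 // ltW.
  by rewrite invfM le_eqVlt; apply/orP; left; apply/eqP; ring.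
rewrite mulr_sumr [leRHS]big_mkcond /=; apply: ler_sum_in => f hf; have f0 := nm_idl_gt0 hf.
have -> : nm a ^+ 3 * nm b ^+ 2 * nm c ^+ 2 * nm f ^+ 2 * nm e * nm d = Q * nm f ^+ 2 by rewrite /Q; ring.
rewrite (_ : (Q * nm f ^+ 2 <= B) = (nm f ^+ 2 <= B / Q)); last by rewrite ler_pdivlMr // mulrC.
case: ifP => h; last by rewrite /= mul0r.
have -> : B / (Q * nm f ^+ 2) = B / Q / nm f ^+ 2 by rewrite invfM mulrA.
rewrite !big_cons big_nil mulr1.
have -> : (nm a)^-1 * ((nm b)^-1 * ((nm c)^-1 * ((nm f)^-1 * ((nm e)^-1 * (nm d)^-1)))) = (P * nm e)^-1 / nm f.
  by rewrite /P; field; rewrite !gt_eqF.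
rewrite [leRHS]mulrA; apply: ler_piMl; last exact: ic_le1.
by rewrite !mulr_ge0 ?invr_ge0 ?r4_ge0 ?mulr_ge0 // ltW.
Qed.

Definition o8 (B : R) (s : seq (prm -> int)) : R := \prod_(e <- s) 8 ^+ om B e.
Lemma reg_4 : exists2 C, 0 <= C & forall B, 1 <= B ->
  \sum_(s <- tups (idl B) 6) o8 B s * WT s <= C * ((1 + ln B) ^+ 8) ^+ 6.
Proof.
have [C C0 CP] := sum_om8; exists (C ^+ 6); first exact: exprn_ge0.
move=> B B1; rewrite /o8 /WT; under eq_bigr => s _ do rewrite -big_split /=.
rewrite sum_tups_prod -(exprMn 6 C); apply: lerXn2r; rewrite ?nnegrE ?CP //.
  by rewrite big_seq; apply: sumr_ge0 => e he; apply: divr_ge0; rewrite ?exprn_ge0 // ltW // (nm_idl_gt0 he).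
by apply: mulr_ge0 => //; apply: exprn_ge0; apply: addr_ge0 => //; exact: ln_ge0.
Qed.

Lemma tup_ids B s : 1 <= B -> s \in tups (idl B) 6 ->
  [/\ 0 < Tq B s, 0 < WT s, 0 < nq s & 0 < mq s] /\
  [/\ Tq B s * wf (nms s) = B * WT s, Tq B s / nq s = B * (mq s * WT s),
   low s -> mq s <= 1 & Jf (nms s) <= B -> 1 <= Tq B s].
Proof.
move=> B1; rewrite tupsE => /andP[]; case: s => [|a [|b [|c [|d [|e [|f [|? ?]]]]]]] // _ /and5P[ha hb hc hd /and3P[he hf _]].
have [a0 b0 c0 d0] := And4 (nm_idl_gt0 ha) (nm_idl_gt0 hb) (nm_idl_gt0 hc) (nm_idl_gt0 hd).
have [e0 f0 a1 c1] := And4 (nm_idl_gt0 he) (nm_idl_gt0 hf) (nm_idl_ge1 ha) (nm_idl_ge1 hc).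
have B0 : 0 < B by qlra.
rewrite /Tq /WT /nq /mq /low /nms /= /mf !big_cons big_nil; split; last split.
- by split; rewrite ?divr_gt0 ?Jf_gt0 ?mulr_gt0 ?invr_gt0 ?exprn_gt0.
- by field; rewrite !gt_eqF.
- by field; rewrite !gt_eqF.
- move=> h; rewrite ler_pdivrMr ?mulr_gt0 // mul1r; apply: (le_trans h).
  by rewrite ler_peMl ?mulr_ege1 // ltW.
by rewrite ler_pdivlMr ?mul1r // !mulr_gt0 // exprn_gt0.
Qed.

Lemma ic3 b c d : b || c || d -> 1 <= ic b + ic c + ic d.
Proof. by rewrite /ic; case: b; case: c; case: d => //= _; rewrite -!natrD ler1n. Qed.

(** In order: no points for n > T, the crude bound, and the asymptotic bound. In the last, T^4 and
    the number of prime divisors enter with large powers, which are harmless once m and n are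
    tiny. *)
Definition err_hyp (A B : R) (E : seq (prm -> int) -> R) := forall s, s \in tups (idl B) 6 -> Jf (nms s) <= B -> low s ->
  [/\ Tq B s < nq s -> E s <= 0, nq s <= Tq B s -> E s <= A * (Tq B s / nq s + r4 (Tq B s) ^+ 3 * wf (nms s))
    & nq s <= 1 -> E s <= A * (o8 B s * Tq B s ^+ 4 * wf (nms s) * (Num.sqrt (mq s) + Num.sqrt (nq s)))].

(* Tuples are sorted by the size of T = B / J and of m, n: the crude bound is used if T is large or
   if m or n lies in a window of logarithmic length, the asymptotic one otherwise. *)
Lemma error_total (A : R) : 0 <= A -> exists2 C, 0 <= C & forall B E, 1 <= B -> err_hyp A B E ->
  \sum_(s <- tups (idl B) 6 | (Jf (nms s) <= B) && low s) E s <=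
  C * (B * ((1 + ln B) ^+ 4 * (1 + ln (1 + ln B)))).
Proof.
move=> A0; have [Ca Ca0 Pa] := reg_a; have [C1 C10 P1] := reg_1; have [C2 C20 P2] := reg_2.
have [C3 C30 P3] := reg_3; have [C4 C40 P4] := reg_4.
(* The asymptotic case loses (1 + ln B)^48 through [reg_4] and, as T < (1 + ln B)^4 there, (1 + ln
   B)^12 through T^3; [u] is chosen to cancel both. Its logarithm is only O(log log B), the cost of
   the windows. *)
pose k := (8 * 6 + 12)%N; exists (A * (Ca + C1 + C2 * (k + k + 4).+1%:R + C3 * (k + k).+1%:R + 2 * C4)).
  by rewrite mulr_ge0 // !addr_ge0 // mulr_ge0.
move=> B E B1 hE; have B0 : 0 <= B by exact: le_trans ler01 B1.
set l := 1 + ln B; have l1 : 1 <= l by rewrite /l; have := ln_ge0 B1; qlra.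
have l0 : 0 < l by qlra.
pose u := l ^+ k; have u1 : 1 <= u by exact: exprn_ege1.
have u0 : 0 < u by qlra.
have a0 : 0 < (u ^+ 2)^-1 by rewrite invr_gt0 exprn_gt0.
have b1 : 1 <= u ^+ 2 * l ^+ 4 by rewrite mulr_ege1 // exprn_ege1.
have b2 : 1 <= u ^+ 2 by exact: exprn_ege1.
have l4 : 1 <= l ^+ 4 by exact: exprn_ege1.
have s1 := P1 B _ B1 l4; have s2 := P2 B _ _ B1 a0 b1; have s3 := P3 B _ _ B1 a0 b2.
have sa := Pa B B1; have s4 := P4 B B1; rewrite -/l in s1 s2 s3 sa s4.
have lnl : 0 <= ln l by exact: ln_ge0.
have lnX n : ln (l ^+ n) = n%:R * ln l by rewrite lnXn // mulr_natl.
rewrite (r4X4 (ltW l0)) in s1.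
have e1 : l ^+ 5 / l = l ^+ 4 by rewrite exprSr mulfK // gt_eqF.
have e2 : ln (u ^+ 2 * l ^+ 4) = (k + k + 4)%:R * ln l.
  by rewrite /u -exprM -exprD lnX muln2 addnn.
have e3 : ln (u ^+ 2) = (k + k)%:R * ln l by rewrite /u -exprM lnX muln2 addnn.
rewrite e1 in s1; rewrite e2 in s2; rewrite e3 in s3.
pose W s := WT s / r4 (Tq B s).
pose G s := ic (low s) * (mq s * WT s) + ic ((Jf (nms s) <= B) && (l ^+ 4 <= Tq B s)) * W s
  + ic ((Jf (nms s) <= B) && ((u ^+ 2)^-1 <= nq s <= (u ^+ 2)^-1 * (u ^+ 2 * l ^+ 4))) * W s
  + ic ((Jf (nms s) <= B) && ((u ^+ 2)^-1 <= mq s <= (u ^+ 2)^-1 * u ^+ 2)) * W s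
  + 2 * l ^+ 12 / u * (o8 B s * WT s).
have H s : s \in tups (idl B) 6 -> Jf (nms s) <= B -> low s -> E s <= A * B * G s.
  move=> hs hJ hl; have [h1 h2 h3] := hE s hs hJ hl.
  have [[T0 W0 n0 m0] [i1 i2 i3 i4]] := tup_ids B1 hs; have m1 := i3 hl; have T1 := i4 hJ.
  have o0 : 0 <= o8 B s by apply: prodr_ge0 => e _; exact: exprn_ge0.
  have r0 : 0 < r4 (Tq B s) by exact: r4_gt0.
  have W'0 : 0 <= W s by apply: divr_ge0; exact: ltW.
  have i5 : r4 (Tq B s) ^+ 3 * wf (nms s) = B * W s.
    apply: (mulIf (lt0r_neq0 r0)); rewrite mulrAC -exprSr (r4K (ltW T0)) i1 /W mulrA mulfVK //.
    by rewrite gt_eqF.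
  rewrite /G icT // hJ !andTb.
  have K1 : 0 <= mq s * WT s by apply: mulr_ge0; exact: ltW.
  have K2 b : 0 <= ic b * W s by apply: mulr_ge0 => //; exact: ic_ge0.
  have K3 : 0 <= 2 * l ^+ 12 / u * (o8 B s * WT s).
    by rewrite !mulr_ge0 ?invr_ge0 ?exprn_ge0 // ltW.
  have AB0 : 0 <= A * B by exact: mulr_ge0.
  have [nT|Tn] := leP (nq s) (Tq B s); last first.
    apply: le_trans (h1 Tn) _; apply: mulr_ge0 => //.
    by rewrite mul1r; apply: addr_ge0 K3; do 3 (apply: addr_ge0; last exact: K2); exact: K1.
  have crude b c d : b || c || d -> E s <= A * B * (1 * (mq s * WT s) + ic b * W s + ic c * W s + ic d * W s +
      2 * l ^+ 12 / u * (o8 B s * WT s)).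
    move=> hb; apply: le_trans (h2 nT) _; rewrite i5 i2 -mulrA; apply: ler_wpM2l => //.
    rewrite -mulrDr; apply: ler_wpM2l; first exact: B0.
    have : 1 <= ic b + ic c + ic d.
      exact: ic3.
    have := ic_ge0 b; move: (ic b) (ic c) (ic d) (W s) W'0 K1 K3 => x y z w w0 k1 k3 x0 xyz.
    have : 0 <= (x + y + z - 1) * w by apply: mulr_ge0 _ w0; rewrite subr_ge0.
    by move: k1 k3; clear -hK; move=> *; lra.
  have [t|t] := leP (l ^+ 4) (Tq B s); first by apply: crude.
  have [n'|n'] := leP ((u ^+ 2)^-1) (nq s).
    apply: crude; rewrite mulKf ?gt_eqF ?exprn_gt0 //=.
    by rewrite (ltW (le_lt_trans nT t)).
  have [m'|m'] := leP ((u ^+ 2)^-1) (mq s).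
    by apply: crude; rewrite mulVf ?gt_eqF ?exprn_gt0 //= m1 orbT.
  have n1 : nq s <= 1 by apply: le_trans (ltW n') _; rewrite invf_le1 // exprn_gt0.
  apply: le_trans (h3 n1) _; rewrite -(mulrA A B); apply: ler_wpM2l => //.
  have sqle (x : R) : x < (u ^+ 2)^-1 -> Num.sqrt x <= u^-1.
    move=> h; rewrite -[leRHS](gtr0_norm (_ : 0 < u^-1)) ?invr_gt0 // -sqrtr_sqr; apply: ler_wsqrtr.
    by rewrite exprVn ltW.
  have S := lerD (sqle _ m') (sqle _ n').
  apply: (@le_trans _ _ (o8 B s * (l ^+ 12 * (B * WT s)) * (u^-1 + u^-1))).
    have wf0 : 0 <= wf (nms s) by rewrite -(pmulr_rge0 _ T0) i1; apply: mulr_ge0; [exact: B0|exact: ltW].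
    apply: ler_pM; [|apply: addr_ge0; exact: sqrtr_ge0| |exact: S].
      by apply: mulr_ge0 => //; apply: mulr_ge0 => //; apply: exprn_ge0; exact: ltW.
    rewrite -mulrA; apply: ler_wpM2l => //; rewrite exprSr -mulrA i1; apply: ler_wpM2r.
      by apply: mulr_ge0; [exact: B0|exact: ltW].
    by rewrite (exprM l 4 3); apply: lerXn2r; rewrite ?nnegrE ?ltW // exprn_gt0.
  have -> : o8 B s * (l ^+ 12 * (B * WT s)) * (u^-1 + u^-1) = B * (2 * l ^+ 12 / u * (o8 B s * WT s)) by ring.
  apply: ler_wpM2l; first exact: B0.
  by rewrite !andFb (_ : ic false = 0) // !mul0r !addr0 mul1r lerDr.
have G0 s : s \in tups (idl B) 6 -> 0 <= G s.
  move=> hs; have [[T0 W0 n0 m0] _] := tup_ids B1 hs.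
  have W'0 : 0 <= W s by apply: divr_ge0; [exact: ltW|exact: r4_ge0].
  have o0 : 0 <= o8 B s by apply: prodr_ge0 => e _; exact: exprn_ge0.
  have v0 : 0 <= u^-1 by rewrite invr_ge0 ltW.
  have icM b x : 0 <= x -> 0 <= ic b * x by move=> x0; apply: mulr_ge0 => //; exact: ic_ge0.
  apply: addr_ge0; last first.
    apply: mulr_ge0; last by apply: mulr_ge0 => //; exact: ltW.
    by apply: mulr_ge0 => //; apply: mulr_ge0 => //; apply: exprn_ge0; exact: ltW.
  do 3 (apply: addr_ge0; last exact: icM).
  by apply: icM; apply: mulr_ge0; exact: ltW.
apply: (@le_trans _ _ (A * B * \sum_(s <- tups (idl B) 6) G s)).
  rewrite mulr_sumr big_mkcond /=; apply: ler_sum_in => s hs; case: ifP => [/andP[hJ hl]|_]; first exact: H.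
  by apply: mulr_ge0; [exact: mulr_ge0|exact: G0].
rewrite [leRHS]mulrACA.
apply: ler_wpM2l; first exact: mulr_ge0.
have -> : \sum_(s <- tups (idl B) 6) G s = \sum_(s <- tups (idl B) 6) ic (low s) * (mq s * WT s) +
  \sum_(s <- tups (idl B) 6) ic ((Jf (nms s) <= B) && (l ^+ 4 <= Tq B s)) * W s +
  \sum_(s <- tups (idl B) 6) ic ((Jf (nms s) <= B) && ((u ^+ 2)^-1 <= nq s <= (u ^+ 2)^-1 * (u ^+ 2 * l ^+ 4))) * W s +
  \sum_(s <- tups (idl B) 6) ic ((Jf (nms s) <= B) && ((u ^+ 2)^-1 <= mq s <= (u ^+ 2)^-1 * u ^+ 2)) * W s +
  2 * l ^+ 12 / u * \sum_(s <- tups (idl B) 6) o8 B s * WT s by rewrite mulr_sumr -!big_split.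
have L0 : l ^+ 4 <= l ^+ 4 * (1 + ln l) by apply: ler_peMr; [apply: exprn_ge0; exact: ltW|rewrite lerDl].
have L1 n : 1 + n%:R * ln l <= n.+1%:R * (1 + ln l).
  by rewrite -natr1; have : 0 <= n%:R :> R by []; nra.
have L2 (C x y : R) : 0 <= C -> x <= C * l ^+ 4 -> l ^+ 4 * (1 + ln l) = y -> x <= C * y.
  by move=> C0 h <-; apply: le_trans h _; exact: ler_wpM2l.
have L3 (C x : R) n : 0 <= C -> x <= C * (l ^+ 4 * (1 + n%:R * ln l)) -> x <= C * n.+1%:R * (l ^+ 4 * (1 + ln l)).
  move=> C0 h; apply: le_trans h _; rewrite -mulrA; apply: ler_wpM2l => //; rewrite mulrCA; apply: ler_wpM2l => //.
  by rewrite exprn_ge0 // ltW.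
have L4 : 2 * l ^+ 12 / u * (\sum_(s <- tups (idl B) 6) o8 B s * WT s) <= 2 * C4 * (l ^+ 4 * (1 + ln l)).
  apply: (@le_trans _ _ (2 * l ^+ 12 / u * (C4 * (l ^+ 8) ^+ 6))).
    apply: ler_wpM2l; last exact: s4.
    apply: mulr_ge0; last by rewrite invr_ge0; exact: ltW.
    by apply: mulr_ge0 => //; apply: exprn_ge0; exact: ltW.
  have -> : 2 * l ^+ 12 / u * (C4 * (l ^+ 8) ^+ 6) = 2 * C4 * (l ^+ 12 * (l ^+ 8) ^+ 6 / u) by ring.
  apply: ler_wpM2l; first exact: mulr_ge0.
  by rewrite -exprM -exprD addnC divff ?gt_eqF //; apply: le_trans L0.
have q1 := L2 _ _ _ Ca0 sa erefl; have q2 := L2 _ _ _ C10 s1 erefl.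
have q3 := L3 _ _ _ C20 s2; have q4 := L3 _ _ _ C30 s3.
set Y := l ^+ 4 * _ in q1 q2 q3 q4 L4 *.
rewrite (_ : _ * Y = Ca * Y + C1 * Y + C2 * (k + k + 4).+1%:R * Y + C3 * (k + k).+1%:R * Y + 2 * C4 * Y); last by rewrite !mulrDl.
apply: lerD; last exact: L4.
apply: lerD; last exact: q4.
apply: lerD; last exact: q3.
by apply: lerD; [exact: q1|exact: q2].
Qed.

(** * The torsor parametrization *)
(* With a, b, g the valuations of u, v, u + v at a prime: the exponents of the six ideals attached to (u, v),
   listed as e1, e2, e4, e6, e3, e5. *)
Definition etal (a b g : int) : seq int :=
  let c := Num.max 0 (Num.max (- a) (- b)) in
  let x := Num.min a c in let y := Num.min b c in let z := Num.min g 0 in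
  [:: - (2 * c) - Num.min x 0 - Num.min y 0 - z; Num.min x 0 + c - Num.max 0 x; Num.min y 0 + c - Num.max 0 y; z + c;
      Num.max 0 x; Num.max 0 y].
(** The minimum of the three valuations is attained at least twice. *)
Definition ultra (a b g : int) : bool := [&& (a <= g) || (b <= g), (b <= a) || (g <= a) & (a <= b) || (g <= b)].
(** The coprimality conditions on the six ideals: a prime may divide two of them only for the index
    pairs 12, 14, 16, 23 and 45. *)
Definition allowed (b : seq bool) : bool :=
  if b is [:: b1; b2; b4; b6; b3; b5] then
   ~~ [|| b1 && (b3 || b5), b2 && [|| b4, b5 | b6], b3 && [|| b4, b5 | b6], b4 && b6 | b5 && b6] else false.
(** Exactness of the parameters at a prime means that the valuation of v ([A8]), of u ([A7]) or of u
    + v ([A9]) takes its least possible value, each under the given condition on the pattern. *)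
Definition A8 (b : seq bool) : bool := if b is [:: b1; b2; b4; b6; b3; b5] then [|| b1, b2, b3, b4 | b6] else false.
Definition A7 (b : seq bool) : bool := if b is [:: b1; b2; b4; b6; b3; b5] then [|| b1, b2, b4 | b5] && ~~ b6 else false.
Definition A9 (b : seq bool) : bool := if b is [:: b1; b2; b4; b6; b3; b5] then [&& b1, ~~ b2 & ~~ b4] else false.

Lemma hlocE q b : size b = 6 -> hloc q b = ic (allowed b) * ((1 - ic (A8 b) * q^-1) * (1 - (ic (A7 b) + ic (A9 b)) * q^-1)).
Proof.
case: b => [|b1 [|b2 [|b4 [|b6 [|b3 [|b5 [|? ?]]]]]]] // _; rewrite /hloc /allowed /A8 /A7 /A9.
case: ifP => _; first by rewrite /ic mul0r.
rewrite (_ : ic (~~ false) = 1) // mul1r; case: ifP => _; first by rewrite {3}/ic mul1r.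
by rewrite {3}/ic mul0r subr0.
Qed.

Ltac mmc := repeat (match goal with
  | |- context [Order.max (- ?x) (- ?y)] => case: (leP (- x) (- y)) => ?
  | |- context [Order.max 0 ?x] => case: (leP 0 x) => ?
  | |- context [Order.min ?x ?y] => case: (leP x y) => ? end; try (by exfalso; lia)).
Lemma etal_ge0 a b g : ultra a b g -> all (fun i : int => 0 <= i) (etal a b g).
Proof. rewrite /ultra /etal /= => /and3P[h1 h2 h3]; mmc; lia. Qed.
Lemma etal_ge a b g k1 k2 k4 k6 k3 k5 : ultra a b g -> etal a b g = [:: k1; k2; k4; k6; k3; k5] ->
  [/\ k3 - k1 - k4 - k5 - k6 <= a, k5 - k1 - k2 - k3 - k6 <= b & - (k1 + k2 + k3 + k4 + k5) <= g].
Proof. by rewrite /ultra /etal => /and3P[h1 h2 h3] [<- <- <- <- <- <-]; mmc; split; lia. Qed.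
(** The left side is the exponent of J, the right side minus the exponent of the ideal generated by
    the coordinates of the point; so J is the inverse norm of that ideal. *)
Lemma etal_fid a b g k1 k2 k4 k6 k3 k5 : ultra a b g -> etal a b g = [:: k1; k2; k4; k6; k3; k5] ->
  3 * k1 + 2 * k2 + 2 * k4 + 2 * k6 + k3 + k5 = - Num.min a (Num.min b (Num.min 0 (Num.min (a + b) (a + b + g)))).
Proof. by rewrite /ultra /etal => /and3P[h1 h2 h3] [<- <- <- <- <- <-]; mmc; lia. Qed.

Lemma etal_allowed a b g : ultra a b g -> allowed [seq i != 0 | i : int <- etal a b g].
Proof. rewrite /ultra /etal /= => /and3P[h1 h2 h3]; mmc; lia. Qed.

(** Inside the lattice given by the lower bounds x, y, z, having exactly the parameters s amounts to
    at most three non-divisibilities. The cases are: which two of a, b, g share the minimum, and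
    which parameters vanish. *)
Lemma etal_exact a b g k1 k2 k4 k6 k3 k5 : ultra a b g -> 0 <= k1 -> 0 <= k2 -> 0 <= k4 -> 0 <= k6 -> 0 <= k3 -> 0 <= k5 ->
  let s := [:: k1; k2; k4; k6; k3; k5] in let bs := [seq i != 0 | i : int <- s] in
  let x := k3 - k1 - k4 - k5 - k6 in let y := k5 - k1 - k2 - k3 - k6 in let z := - (k1 + k2 + k3 + k4 + k5) in
  allowed bs -> x <= a -> y <= b -> z <= g ->
  (etal a b g == s) = [&& ~~ (A8 bs && (y + 1 <= b)), ~~ (A7 bs && (x + 1 <= a)) & ~~ (A9 bs && (z + 1 <= g))].
Proof.
have d (k : int) : 0 <= k -> k = 0 \/ 0 < k /\ (k == 0) = false by lia.
move=> /and3P[u1 u2 u3] /d d1 /d d2 /d d4 /d d6 /d d3 /d d5; rewrite /= !eqseq_cons !andbT.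
have : (b = a /\ a <= g) \/ (g = a /\ a <= b) \/ (g = b /\ b <= a) by clear -u1 u2 u3; lia.
clear d u1 u2 u3 => -[[-> u]|[[-> u]|[-> u]]]; case: d1 => [->|[p1 q1]]; case: d3 => [->|[p3 q3]]; rewrite ?eqxx ?q1 ?q3 //=;
  case: d5 => [->|[p5 q5]]; rewrite ?eqxx ?q5 //=; case: d2 => [->|[p2 q2]]; rewrite ?eqxx ?q2 //=;
  case: d4 => [->|[p4 q4]]; rewrite ?eqxx ?q4 //=; case: d6 => [->|[p6 q6]]; rewrite ?eqxx ?q6 ?orbT //=;
  move=> _ hx hy hz; repeat (match goal with H : (_ == 0) = false |- _ => clear H end); mmc; lia.
Qed.

(** The conditions for u and u + v together imply the one for v, so in the inclusion-exclusion the
    terms 79 and 789 cancel and six of eight terms remain. *)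
Lemma etal_79 a b g k1 k2 k4 k6 k3 k5 : ultra a b g -> 0 <= k1 -> 0 <= k2 -> 0 <= k4 -> 0 <= k6 -> 0 <= k3 -> 0 <= k5 ->
  let bs := [seq i != 0 | i : int <- [:: k1; k2; k4; k6; k3; k5]] in
  allowed bs -> A7 bs -> A9 bs -> k3 - k1 - k4 - k5 - k6 + 1 <= a -> - (k1 + k2 + k3 + k4 + k5) + 1 <= g ->
  A8 bs && (k5 - k1 - k2 - k3 - k6 + 1 <= b).
Proof. by rewrite /ultra => /and3P[u1 u2 u3] h1 h2 h4 h6 h3 h5 /=; lia. Qed.

(** One more divisibility by p of u or of u + v multiplies m by the norm of p, one more of v
    multiplies n by it. The case of both u and u + v never has to be considered, by [etal_79]. *)
Lemma shift_int k1 k2 k4 k6 k3 k5 (b7 b8 b9 : bool) : 0 <= k1 -> 0 <= k2 -> 0 <= k4 -> 0 <= k6 -> 0 <= k3 -> 0 <= k5 ->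
  let bs := [seq i != 0 | i : int <- [:: k1; k2; k4; k6; k3; k5]] in
  let x := k3 - k1 - k4 - k5 - k6 in let y := k5 - k1 - k2 - k3 - k6 in let z := - (k1 + k2 + k3 + k4 + k5) in
  allowed bs -> [&& b7 ==> A7 bs, b9 ==> A9 bs & ~~ (b7 && b9)] ->
  Num.max (x + b7%:Z) (z + b9%:Z) = Num.max x z + (b7 || b9)%:Z /\
  Num.max (y + b8%:Z) (Num.min (x + b7%:Z) (z + b9%:Z)) = Num.max y (Num.min x z) + b8%:Z.
Proof.
move=> h1 h2 h4 h6 h3 h5 /= al hb.
have h : 0 <= b7%:Z <= 1 /\ 0 <= b8%:Z <= 1 by case: (b7); case: (b8).
by move: hb; case: b7 h; case: b9; case: b8 => //= h hb; split; mmc; lia.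
Qed.
Lemma lxyz_int k1 k2 k4 k6 k3 k5 : 0 <= k1 -> 0 <= k2 -> 0 <= k4 -> 0 <= k6 -> 0 <= k3 -> 0 <= k5 ->
  let x := k3 - k1 - k4 - k5 - k6 in let y := k5 - k1 - k2 - k3 - k6 in let z := - (k1 + k2 + k3 + k4 + k5) in
  allowed [seq i != 0 | i : int <- [:: k1; k2; k4; k6; k3; k5]] ->
  Num.max x z = k3 - k1 - k4 - k5 /\ Num.max y (Num.min x z) = y.
Proof. by move=> h1 h2 h4 h6 h3 h5 /= al; split; mmc; lia. Qed.

(* The valuation of u + w, or a value exceeding every bound that matters if u + w = 0. *)
Definition gv p (u w : K) : int := if u + w == 0 then `|v p u| + 1 else v p (u + w).
Lemma ultra_v p u w : u != 0 -> w != 0 -> ultra (v p u) (v p w) (gv p u w).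
Proof.
move=> u0 w0; rewrite /ultra /gv; have [E|n0] := eqVneq (u + w) 0.
  have -> : w = - u by apply/eqP; rewrite -addr_eq0 addrC E.
  by rewrite vN lexx /= andbT ltW // ltzD1 ler_norm.
have H (x y : K) : x != 0 -> y != 0 -> x + y != 0 -> (v p x <= v p (x + y)) || (v p y <= v p (x + y)).
  move=> x0 y0 xy; case: (leP (v p x) (v p y)) => h; first by rewrite (v_ultra x0 y0 xy).
  by rewrite (v_ultra x0 y0 xy (ltW h)) ?orbT.
have nu : - u != 0 by rewrite oppr_eq0.
have nw : - w != 0 by rewrite oppr_eq0.
have e1 : - w + (u + w) = u by rewrite addrCA addNr addr0.
have e2 : - u + (u + w) = w by rewrite addKr.
rewrite H //; have := H _ _ nw n0; rewrite e1 vN => /(_ u0) ->.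
by have := H _ _ nu n0; rewrite e2 vN => /(_ w0) ->.
Qed.
Definition locs p (s : seq (prm -> int)) : seq int := [seq e p | e <- s].
Definition okp s p (a : K * K) : bool := etal (v p a.1) (v p a.2) (gv p a.1 a.2) == locs p s.
(* The fractional ideals whose common constraint u in X, v in Y, u + v in Z is necessary for (u, v) to have parameters s. *)
Definition lx (s : seq (prm -> int)) : prm -> int := if s is [:: e1; e2; e4; e6; e3; e5] then e3 - e1 - e4 - e5 - e6 else 0.
Definition ly (s : seq (prm -> int)) : prm -> int := if s is [:: e1; e2; e4; e6; e3; e5] then e5 - e1 - e2 - e3 - e6 else 0.
Definition lz (s : seq (prm -> int)) : prm -> int := if s is [:: e1; e2; e4; e6; e3; e5] then - (e1 + e2 + e3 + e4 + e5) else 0.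
Definition cnt P s x y z (T : R) : R := \sum_(a <- lamnz x y z T) ic (all (fun p => okp s p a) P).
Definition sh (b : bool) e p : prm -> int := e + (if b then dl p else 0).
Lemma shE b e p q : sh b e p q = e q + (b && (q == p))%:Z.
Proof. by rewrite /sh fD; case: b => //; rewrite dlE natz. Qed.
Lemma fs_sh b e p : fs e -> fs (sh b e p).
Proof. by move=> fe; apply: fsD => //; case: b; [exact: fs_dl|exact: fs0]. Qed.

Lemma lamnzE x y z T a : fs x -> fs y ->
  (a \in lamnz x y z T) = `[< [/\ a.1 != 0, a.2 != 0, Lam x y z a & Rg T (pt2 a)] >].
Proof.
move=> fx fy; rewrite mem_filter lamptsE //; apply/andP/asboolP => [[/andP[h1 h2] /asboolP[h3 h4]] //|[h1 h2 h3 h4]].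
by rewrite h1 h2; split => //; apply/asboolP.
Qed.
Lemma lamnz_uniq x y z T : uniq (lamnz x y z T).
Proof. by rewrite filter_uniq // lampts_uniq. Qed.

Lemma ide_sh b e p x : x != 0 -> ide (sh b e p) x <-> ide e x /\ (b ==> (e p + 1 <= v p x)).
Proof.
move=> x0; split.
  move=> [/eqP h|h]; first by rewrite (negPf x0) in h.
  split; first by right => q; apply: le_trans (h q); rewrite shE lerDl.
  by apply/implyP => bt; have := h p; rewrite shE bt eqxx.
move=> [[/eqP h|h] h']; first by rewrite (negPf x0) in h.
right => q; rewrite shE; have [->|_] := eqVneq q p; last by rewrite andbF addr0.
by rewrite andbT; case: b h' => //= _; rewrite addr0.
Qed.

Lemma Lam_sh b7 b8 b9 x y z p a : a.1 != 0 -> a.2 != 0 -> z p <= 0 ->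
  Lam (sh b7 x p) (sh b8 y p) (sh b9 z p) a <->
  Lam x y z a /\ [&& b7 ==> (x p + 1 <= v p a.1), b8 ==> (y p + 1 <= v p a.2) & b9 ==> (z p + 1 <= gv p a.1 a.2)].
Proof.
move=> a1 a2 z0; have hz : ide (sh b9 z p) (a.1 + a.2) <-> ide z (a.1 + a.2) /\ (b9 ==> (z p + 1 <= gv p a.1 a.2)).
  rewrite /gv; have [->|n0] := eqVneq (a.1 + a.2) 0; last exact: ide_sh.
  split=> [_|_]; last by left.
  by split; [left|apply/implyP => _; rewrite lerD2r (le_trans z0)].
split=> [[/(ide_sh _ _ _ a1)[h1 h2] /(ide_sh _ _ _ a2)[h3 h4] /hz[h5 h6]]|[[h1 h2 h3] /and3P[h4 h5 h6]]].
  by split => //; rewrite h2 h4 h6.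
by split; [exact/(ide_sh _ _ _ a1)|exact/(ide_sh _ _ _ a2)|exact/hz].
Qed.

Lemma cnt_sh b7 b8 b9 P s x y z T p : fs x -> fs y -> fs z -> z p <= 0 ->
  \sum_(a <- lamnz x y z T) ic (all (fun p => okp s p a) P) * ic [&& b7 ==> (x p + 1 <= v p a.1), b8 ==> (y p + 1 <= v p a.2)
     & b9 ==> (z p + 1 <= gv p a.1 a.2)] = cnt P s (sh b7 x p) (sh b8 y p) (sh b9 z p) T.
Proof.
move=> fx fy fz z0; rewrite /cnt; pose c (a : K * K) := [&& b7 ==> (x p + 1 <= v p a.1), b8 ==> (y p + 1 <= v p a.2) & b9 ==> (z p + 1 <= gv p a.1 a.2)].
transitivity (\sum_(a <- [seq a <- lamnz x y z T | c a]) ic (all (fun p => okp s p a) P)).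
  rewrite [RHS]big_filter [RHS]big_mkcond /=; apply: eq_bigr => a _; rewrite -/(c a); case: ifP => _; rewrite ?mulr0 //.
  by rewrite /ic mulr1.
apply: perm_big; apply: uniq_perm; [apply: filter_uniq; exact: lamnz_uniq|exact: lamnz_uniq|move=> a].
rewrite [LHS]mem_filter (lamnzE _ _ _ fx fy) (lamnzE _ _ _ (fs_sh _ _ fx) (fs_sh _ _ fy)).
apply/andP/asboolP => [[h1 /asboolP[h2 h3 h4 h5]]|[h2 h3 /(Lam_sh _ _ _ _ _ h2 h3 z0)[h4 h1] h5]].
  by split => //; apply/(Lam_sh _ _ _ _ _ h2 h3 z0).
by split => //; apply/asboolP.
Qed.

Lemma loc6 (e1 e2 e4 e6 e3 e5 : prm -> int) p : supp p [:: e1; e2; e4; e6; e3; e5] =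
  [seq i != 0 | i : int <- [:: e1 p; e2 p; e4 p; e6 p; e3 p; e5 p]].
Proof. by []. Qed.
Lemma lxE (e1 e2 e4 e6 e3 e5 : prm -> int) p : lx [:: e1; e2; e4; e6; e3; e5] p = e3 p - e1 p - e4 p - e5 p - e6 p.
Proof. by rewrite /lx !fctE. Qed.
Lemma lyE (e1 e2 e4 e6 e3 e5 : prm -> int) p : ly [:: e1; e2; e4; e6; e3; e5] p = e5 p - e1 p - e2 p - e3 p - e6 p.
Proof. by rewrite /ly !fctE. Qed.
Lemma lzE (e1 e2 e4 e6 e3 e5 : prm -> int) p : lz [:: e1; e2; e4; e6; e3; e5] p = - (e1 p + e2 p + e3 p + e4 p + e5 p).
Proof. by rewrite /lz !fctE. Qed.

Definition tup6 (s : seq (prm -> int)) := size s = 6 /\ forall e, e \in s -> integral e.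
Lemma tup6P s : tup6 s -> exists e1 e2 e4 e6 e3 e5, s = [:: e1; e2; e4; e6; e3; e5] /\
  [/\ integral e1, integral e2, integral e4, integral e6 & integral e3 /\ integral e5].
Proof.
case=> sz h; case: s sz h => [|e1 [|e2 [|e4 [|e6 [|e3 [|e5 [|? ?]]]]]]] // _ h.
exists e1, e2, e4, e6, e3, e5; split => //.
by split; last split; apply: h; rewrite !inE eqxx ?orbT.
Qed.
Lemma fs_lxyz s : tup6 s -> [/\ fs (lx s), fs (ly s) & fs (lz s)].
Proof.
move=> /tup6P[e1 [e2 [e4 [e6 [e3 [e5 [-> [[f1 _] [f2 _] [f4 _] [f6 _] [[f3 _] [f5 _]]]]]]]]]].
have B (e f : prm -> int) : fs e -> fs f -> fs (e - f) by move=> fe ff; apply: fsD => //; exact: fsN.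
rewrite /lx /ly /lz; split; first exact: (B _ _ (B _ _ (B _ _ (B _ _ f3 f1) f4) f5) f6).
  exact: (B _ _ (B _ _ (B _ _ (B _ _ f5 f1) f2) f3) f6).
exact: (fsN (fsD (fsD (fsD (fsD f1 f2) f3) f4) f5)).
Qed.
Lemma lz_le0 s p : tup6 s -> lz s p <= 0.
Proof.
move=> /tup6P[e1 [e2 [e4 [e6 [e3 [e5 [-> [[_ f1] [_ f2] [_ f4] [_ f6] [[_ f3] [_ f5]]]]]]]]]].
by rewrite lzE; have := f1 p; have := f2 p; have := f3 p; have := f4 p; have := f5 p; lia.
Qed.

(* The condition at p is a product of at most six signed divisibility conditions. *)
Lemma okp_expand s p x y z (a : K * K) : tup6 s -> allowed (supp p s) -> x p = lx s p -> y p = ly s p -> z p = lz s p ->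
  a.1 != 0 -> a.2 != 0 -> Lam x y z a -> let b := supp p s in
  let c b7 b8 b9 := ic [&& b7 ==> (x p + 1 <= v p a.1), b8 ==> (y p + 1 <= v p a.2) & b9 ==> (z p + 1 <= gv p a.1 a.2)] in
  ic (okp s p a) = c false false false - ic (A8 b) * c false true false - ic (A7 b) * c true false false
    - ic (A9 b) * c false false true + ic (A8 b && A7 b) * c true true false + ic (A8 b && A9 b) * c false true true.
Proof.
move=> h6 al ex ey ez a1 a2 [l1 l2 l3] b c.
have hx : x p <= v p a.1 by case: l1 => [/eqP|->//]; rewrite (negPf a1).
have hy : y p <= v p a.2 by case: l2 => [/eqP|->//]; rewrite (negPf a2).
have hz : z p <= gv p a.1 a.2.
  rewrite /gv; case: eqP => [_|/eqP n0]; first by rewrite ez (le_trans (lz_le0 p h6)).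
  by case: l3 => [/eqP|->//]; rewrite (negPf n0).
rewrite ex in hx; rewrite ey in hy; rewrite ez in hz.
have u := ultra_v p a1 a2; rewrite /c /b ex ey ez; clear c b ex ey ez l1 l2 l3.
move: h6 al hx hy hz => /tup6P[e1 [e2 [e4 [e6 [e3 [e5 [-> [[_ f1] [_ f2] [_ f4] [_ f6] [[_ f3] [_ f5]]]]]]]]]].
rewrite /okp loc6 lxE lyE lzE => al hx hy hz.
rewrite /locs /= (etal_exact u) //.
have := etal_79 u (f1 p) (f2 p) (f4 p) (f6 p) (f3 p) (f5 p) al; move: al hx hy hz => _ _ _ _ /=.
move: (_ + 1 <= v p a.1) (_ + 1 <= v p a.2) (_ + 1 <= gv p _ _) => c7 c8 c9.
move: ([|| _, _, _, _ | _]) ([|| _, _, _ | _] && _) ([&& _, _ & _]) => {e1 e2 e4 e6 e3 e5 f1 f2 f3 f4 f5 f6} b8 b7 b9.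
clear -hK; rewrite /ic; case: b7; case: b8; case: b9; case: c7; case: c8; case: c9 => //= h; try (by have := h isT isT isT isT); lra.
Qed.

Lemma nm_emax_proj b7 b8 b9 s p x y z : tup6 s -> fs x -> fs y -> fs z -> allowed (supp p s) ->
  x p = lx s p -> y p = ly s p -> z p = lz s p ->
  [&& b7 ==> A7 (supp p s), b9 ==> A9 (supp p s) & ~~ (b7 && b9)] ->
  nm (emax (sh b7 x p) (sh b9 z p)) = nm (emax x z) * (if b7 || b9 then (qn p)%:R else 1) /\
  nm (proj (sh b7 x p) (sh b8 y p) (sh b9 z p)) = nm (proj x y z) * (if b8 then (qn p)%:R else 1).
Proof.
move=> h6 fx fy fz al ex ey ez hb.
have E (b : bool) e : fs e -> nm e * (if b then (qn p)%:R else 1) = nm (sh b e p).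
  by move=> fe; rewrite /sh; case: b; rewrite ?addr0 ?mulr1 // nmD ?nm_dl //; exact: fs_dl.
have [H1 H2] : Num.max (x p + b7%:Z) (z p + b9%:Z) = Num.max (x p) (z p) + (b7 || b9)%:Z /\
  Num.max (y p + b8%:Z) (Num.min (x p + b7%:Z) (z p + b9%:Z)) = Num.max (y p) (Num.min (x p) (z p)) + b8%:Z.
  rewrite ex ey ez; move: h6 al hb => /tup6P[e1 [e2 [e4 [e6 [e3 [e5 [-> [[_ f1] [_ f2] [_ f4] [_ f6] [[_ f3] [_ f5]]]]]]]]]].
  by rewrite lxE lyE lzE loc6 => al hb; apply: shift_int.
rewrite (E _ _ (fs_emax fx fz)) (E _ _ (fs_proj fx fy fz)); split; congr nm; apply: funext => q; rewrite shE /proj /emax /emin !shE.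
  by have [->|_] := eqVneq q p; rewrite ?andbT ?andbF ?addr0.
by have [->|_] := eqVneq q p; rewrite ?andbT ?andbF ?addr0.
Qed.

(** * The sieve over primes *)

Definition e0 (m n : R) : R := 1 + m^-1 + n^-1 + (Num.sqrt m + Num.sqrt n) / (m * n).
(** The error bound only decreases as the lattice becomes sparser, so all lattices in the sieve
    share the bound of the initial one. *)
Lemma e0_le m n m' n' : 0 < m -> 0 < n -> m <= m' -> n <= n' -> e0 m' n' <= e0 m n.
Proof.
move=> m0 n0 mm nn; have m0' : 0 < m' by exact: lt_le_trans mm.
have n0' : 0 < n' by exact: lt_le_trans nn.
have E (a b : R) : 0 < a -> 0 < b -> (Num.sqrt a + Num.sqrt b) / (a * b) = (Num.sqrt a)^-1 / b + (Num.sqrt b)^-1 / a.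
  move=> a0 b0; have sa : 0 < Num.sqrt a by rewrite sqrtr_gt0.
  have sb : 0 < Num.sqrt b by rewrite sqrtr_gt0.
  rewrite -{2}(sqr_sqrtr (ltW a0)) -{2}(sqr_sqrtr (ltW b0)) -[in RHS](sqr_sqrtr (ltW a0)) -[in RHS](sqr_sqrtr (ltW b0)).
  by rewrite !sqrtr_sqr !gtr0_norm //; field; rewrite !gt_eqF.
have I (a b : R) : 0 < a -> a <= b -> b^-1 <= a^-1 by move=> a0 ab; rewrite lef_pV2 ?posrE // (lt_le_trans a0).
have S (a b : R) : 0 < a -> a <= b -> (Num.sqrt b)^-1 <= (Num.sqrt a)^-1.
  by move=> a0 ab; apply: I; rewrite ?sqrtr_gt0 // ler_wsqrtr.
rewrite /e0 !E //; apply: lerD; first by apply: lerD; [apply: lerD|]; rewrite ?I.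
by apply: lerD; apply: ler_pM; rewrite ?invr_ge0 ?sqrtr_ge0 ?S ?I // ltW.
Qed.
Lemma e0_ge0 m n : 0 < m -> 0 < n -> 0 <= e0 m n.
Proof.
by move=> m0 n0; rewrite /e0; do !apply: addr_ge0 => //; rewrite ?invr_ge0 ?(ltW m0) ?(ltW n0) //;
  apply: divr_ge0; [apply: addr_ge0; exact: sqrtr_ge0|apply: mulr_ge0; exact: ltW].
Qed.

(** At a prime dividing some ideal the count splits into at most six counts; 8 instead of 6 is a
    power of 2, as suits [sum_om_double]. *)
Definition o8P P (s : seq (prm -> int)) : R := \prod_(p <- P) (if has (fun e => e p != 0) s then 8 else 1).
Lemma o8P_ge1 P s : 1 <= o8P P s.
Proof.
rewrite /o8P; elim: P => [|p P ih]; first by rewrite big_nil.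
by rewrite big_cons mulr_ege1 //; case: ifP => _ //; rewrite ler1n.
Qed.

(** The main terms of the six counts factor as (1 - [8]/q) (1 - ([7] + [9])/q), which is the density
    [hloc] of an allowed pattern; the errors just add up. *)
Lemma six_terms (q : R) (b7 b8 b9 : bool) (N : bool -> bool -> bool -> R) (M E : R) : 0 <= E ->
  (forall c7 c8 c9, [&& c7 ==> b7, c8 ==> b8, c9 ==> b9 & ~~ (c7 && c9)] ->
     `|N c7 c8 c9 - M * ((if c7 || c9 then q^-1 else 1) * (if c8 then q^-1 else 1))| <= E) ->
  `|N false false false - ic b8 * N false true false - ic b7 * N true false false - ic b9 * N false false true
   + ic (b8 && b7) * N true true false + ic (b8 && b9) * N false true true
   - (1 - ic b8 * q^-1) * (1 - (ic b7 + ic b9) * q^-1) * M| <= (if [|| b7, b8 | b9] then 8 else 1) * E.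
Proof.
move=> E0 H; have := H false false false isT; have := H false true false; have := H true false false; have := H false false true.
have := H true true false; have := H false true true; clear H; rewrite /ic !mulr1 ?mul1r.
move: (q^-1) (N false false false) (N false true false) (N true false false) (N false false true) (N true true false) (N false true true) => r n0 n8 n7 n9 n87 n89.
have A (a b d : R) : `|a - b| <= d -> a - b <= d /\ b - a <= d by rewrite ler_norml => /andP[h1 h2]; split; qlra.
case: b7; case: b8; case: b9 => /= h89 h87 h9 h7 h8 /A[h0 h0'];
  try (have /A[i7 i7'] := h7 isT); try (have /A[i8 i8'] := h8 isT); try (have /A[i9 i9'] := h9 isT);
  try (have /A[i87 i87'] := h87 isT); try (have /A[i89 i89'] := h89 isT); clear A h7 h8 h9 h87 h89;
  rewrite ler_norml; apply/andP; split; qlra.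
Qed.

Lemma supp_has p s : tup6 s -> A8 (supp p s) || A7 (supp p s) || A9 (supp p s) -> has (fun e => e p != 0) s.
Proof.
move=> /tup6P[e1 [e2 [e4 [e6 [e3 [e5 [-> _]]]]]]]; rewrite loc6 /=.
by case: (e1 p != 0); case: (e2 p != 0); case: (e4 p != 0); case: (e6 p != 0); case: (e3 p != 0); case: (e5 p != 0).
Qed.
Lemma okp_allowed s p a : a.1 != 0 -> a.2 != 0 -> okp s p a -> allowed (supp p s).
Proof.
move=> a1 a2 /eqP E; have := etal_allowed (ultra_v p a1 a2).
by rewrite E /locs /supp -map_comp.
Qed.

(** Induction on P. The lattice is only required to agree with [lx s], [ly s], [lz s] at the primes
    of P, because the primes already treated have made it sparser. *)
Lemma sieve : exists2 C, 0 <= C & forall s T P x y z, tup6 s -> 1 <= T -> uniq P -> fs x -> fs y -> fs z ->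
  (forall p, p \in P -> [/\ x p = lx s p, y p = ly s p & z p = lz s p]) ->
  (forall p, [/\ lx s p <= x p, ly s p <= y p & lz s p <= z p]) ->
  `|cnt P s x y z T - theta hloc P s * (Vol T / (nm (emax x z) * nm (proj x y z) * im qw ^+ 2))|
    <= C * T ^+ 4 * e0 (nm (emax (lx s) (lz s))) (nm (proj (lx s) (ly s) (lz s))) * o8P P s.
Proof.
have [C C0 CP] := pts_main; exists C => // s T P x y z h6 T1.
have [fx0 fy0 fz0] := fs_lxyz h6.
set E := C * T ^+ 4 * _; have E0 : 0 <= E.
  rewrite /E; apply: mulr_ge0; first by apply: mulr_ge0 => //; apply: exprn_ge0; qlra.
  by apply: e0_ge0; apply: nm_gt0; [exact: fs_emax|exact: fs_proj].
elim: P x y z => [|p P ih] x y z /= uP fx fy fz hP hge.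
  rewrite /theta /o8P !big_nil mul1r mulr1 /cnt /= big_const_seq count_predT iter_addr_0.
  apply: le_trans (CP x y z T _ _ fx fy fz T1 erefl erefl) _; rewrite /E; apply: ler_wpM2l.
    by rewrite mulr_ge0 // exprn_ge0 //; qlra.
  have f1 := fs_emax fx fz; have f2 := fs_proj fx fy fz; have f3 := fs_emax fx0 fz0; have f4 := fs_proj fx0 fy0 fz0.
  apply: e0_le; [exact: nm_gt0|exact: nm_gt0|apply: nm_le => // q|apply: nm_le => // q]; have [h1 h2 h3] := hge q.
    by rewrite /emax ge_max !le_max h1 h3 orbT.
  rewrite /proj /emax /emin ge_max !le_max h2 /=; apply/orP; right.
  by rewrite le_min !ge_min h1 h3 orbT.
move: uP => /andP[pP uP]; have [ex ey ez] := hP p (mem_head _ _).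
rewrite /theta /o8P !big_cons -/(theta hloc P s) -/(o8P P s) hlocE; last by rewrite size_map; case: h6.
have [al|nal] := boolP (allowed (supp p s)); last first.
  have -> : cnt (p :: P) s x y z T = 0.
    rewrite /cnt big_seq big1 // => a; rewrite mem_filter => /andP[/andP[a1 a2] _] /=.
    by rewrite (negPf (contra (okp_allowed a1 a2) nal)).
  rewrite (_ : ic false = 0) // !mul0r subr0 normr0; apply: mulr_ge0 => //; apply: mulr_ge0; first by case: ifP.
  by apply: (le_trans ler01); exact: o8P_ge1.
set b := supp p s; rewrite (_ : ic true = 1) // mul1r.
pose N b7 b8 b9 := cnt P s (sh b7 x p) (sh b8 y p) (sh b9 z p) T.
pose X := theta hloc P s * (Vol T / (nm (emax x z) * nm (proj x y z) * im qw ^+ 2)).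
have zp : z p <= 0 by rewrite ez; exact: lz_le0.
have -> : cnt (p :: P) s x y z T = N false false false - ic (A8 b) * N false true false - ic (A7 b) * N true false false
    - ic (A9 b) * N false false true + ic (A8 b && A7 b) * N true true false + ic (A8 b && A9 b) * N false true true.
  rewrite /N -!(cnt_sh _ _ _ P s T fx fy fz zp) !mulr_sumr -!sumrB -!big_split /= /cnt.
  rewrite big_seq [RHS]big_seq; apply: eq_bigr => a; rewrite lamnzE // => /asboolP[a1 a2 La _] /=.
  have -> : ic (okp s p a && all (fun q => okp s q a) P) = ic (all (fun q => okp s q a) P) * ic (okp s p a).
    by rewrite /ic mulrC; case: (okp s p a); rewrite ?mul1r ?mul0r.
  rewrite (okp_expand h6 al ex ey ez a1 a2 La) -/b /=; move: (ic (all _ _)) => w.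
  by ring.
have Q0 := qn_gt0 p; set q := (qn p)%:R in Q0 *.
have o0 : 0 <= o8P P s by apply: (le_trans ler01); exact: o8P_ge1.
have E'0 : 0 <= E * o8P P s by exact: mulr_ge0.
have H c7 c8 c9 : [&& c7 ==> A7 b, c8 ==> A8 b, c9 ==> A9 b & ~~ (c7 && c9)] ->
    `|N c7 c8 c9 - X * ((if c7 || c9 then q^-1 else 1) * (if c8 then q^-1 else 1))| <= E * o8P P s.
  move=> /and4P[d7 d8 d9 d79].
  have hb : [&& c7 ==> A7 b, c9 ==> A9 b & ~~ (c7 && c9)] by rewrite d7 d9.
  have [h1 h2] := @nm_emax_proj c7 c8 c9 s p x y z h6 fx fy fz al ex ey ez hb.
  have := ih (sh c7 x p) (sh c8 y p) (sh c9 z p) uP (fs_sh _ _ fx) (fs_sh _ _ fy) (fs_sh _ _ fz).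
  rewrite h1 h2 -/q; set X' := theta hloc P s * _.
  have -> : X * ((if c7 || c9 then q^-1 else 1) * (if c8 then q^-1 else 1)) = X'.
    rewrite /X /X'; have m0 := nm_gt0 (fs_emax fx fz); have n0 := nm_gt0 (fs_proj fx fy fz); have w0 := im_qw.
    clearbody q; move: (theta hloc P s) (Vol T) (nm _) (nm _) (im qw) m0 n0 w0 => t vol m n w m0 n0 w0.
    by case: (c7 || c9); case: (c8); field; rewrite !gt_eqF.
  apply.
    move=> r rP; have [g1 g2 g3] : [/\ x r = lx s r, y r = ly s r & z r = lz s r] by apply: hP; rewrite inE rP orbT.
    rewrite !shE g1 g2 g3; have -> : (r == p) = false by apply/eqP => rp; rewrite -rp rP in pP.
    by rewrite !andbF !addr0.
  move=> r; have [g1 g2 g3] := hge r; rewrite !shE.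
  by split; [apply: (le_trans g1)|apply: (le_trans g2)|apply: (le_trans g3)]; rewrite lerDl.
have := six_terms E'0 H; rewrite (_ : _ * X = (1 - ic (A8 b) / q) * (1 - (ic (A7 b) + ic (A9 b)) / q) * theta hloc P s *
  (Vol T / (nm (emax x z) * nm (proj x y z) * im qw ^+ 2))); last by rewrite /X !mulrA.
move=> h; apply: (le_trans h); rewrite mulrCA; apply: ler_wpM2l => //; apply: ler_wpM2r => //.
have [hh|] := boolP [|| A7 b, A8 b | A9 b]; last by case: ifP => // _ _; rewrite ler1n.
by rewrite (supp_has h6) //; move: hh; rewrite orbCA orbA.
Qed.

Lemma tup6_idl B s : s \in tups (idl B) 6 -> tup6 s.
Proof.
move=> h; split; last exact: integral_tups h.
by move: h; rewrite tupsE => /andP[/eqP].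
Qed.
Definition lats s T := lamnz (lx s) (ly s) (lz s) T.
Definition Pl (B : R) := ples (Num.trunc B).
Lemma supp_Pl B s p : s \in tups (idl B) 6 -> p \notin Pl B -> all (fun e => e p == 0) s.
Proof.
rewrite tupsE => /andP[_ /allP h] hp; apply/allP => e /h /idlP[ie eB]; apply: contraR hp => ep.
rewrite plesE; have := le_trans (nm_ge_qn ie ep) eB; rewrite -(@ler_nat R) => h1.
have B0 : 0 <= B by apply: le_trans h1.
by have := truncn_ge_nat (qn p) B0; rewrite h1 ler_nat => ->.
Qed.

Lemma prod_if_has P s (c : R) : 1 <= c ->
  \prod_(p <- P) (if has (fun e => e p != 0) s then c else 1) <= \prod_(e <- s) c ^+ count (fun p => e p != 0) P.
Proof.
move=> c1; have c0 : 0 <= c by qlra.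
elim: P => [|p P ih]; first by rewrite big_nil big1 // => e _; rewrite /= expr0.
rewrite big_cons; under [leRHS]eq_bigr => e _ do rewrite /= exprD.
rewrite big_split /=; apply: ler_pM => //; first by case: ifP.
  apply: prodr_ge0 => q _; by case: ifP.
elim: s {ih} => [|e s ih]; first by rewrite big_nil.
rewrite big_cons /=; have g1 : 1 <= \prod_(f <- s) c ^+ (f p != 0)%R.
  by elim: (s) => [|f t iht]; rewrite ?big_nil // big_cons mulr_ege1 // exprn_ege1.
case: (e p != 0) => /=; last by rewrite expr0 mul1r.
by rewrite expr1 ler_peMr.
Qed.
Lemma o8P_le B s : o8P (Pl B) s <= o8 B s.
Proof. by apply: prod_if_has; rewrite ler1n. Qed.

Lemma allowed_nm B s : s \in tups (idl B) 6 -> all (fun p => allowed (supp p s)) (Pl B) ->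
  nm (emax (lx s) (lz s)) = mq s /\ nm (proj (lx s) (ly s) (lz s)) = nq s.
Proof.
move=> hs ha; have h6 := tup6_idl hs.
have al p : allowed (supp p s).
  have [/(allP ha) //|/(supp_Pl hs) h] := boolP (p \in Pl B).
  case: h6 => sz _; rewrite /supp (_ : [seq e p != 0 | e <- s] = nseq 6 false) //.
  by apply: (@eq_from_nth _ false) => [|i]; rewrite size_map ?sz // => hi;
    rewrite (nth_map 0) ?sz // nth_nseq hi; apply/negbTE; rewrite negbK; apply: (allP h); rewrite mem_nth ?sz.
move: h6 al => /tup6P[e1 [e2 [e4 [e6 [e3 [e5 [-> [i1 i2 i4 i6 [i3 i5]]]]]]]]] al.
have E p := lxyz_int (proj2 i1 p) (proj2 i2 p) (proj2 i4 p) (proj2 i6 p) (proj2 i3 p) (proj2 i5 p) (al p).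
have -> : emax (lx [:: e1; e2; e4; e6; e3; e5]) (lz [:: e1; e2; e4; e6; e3; e5]) = e3 - (e1 + e4 + e5).
  by apply: funext => p; have [h _] := E p; rewrite /emax lxE lzE h !fctE; lia.
have -> : proj (lx [:: e1; e2; e4; e6; e3; e5]) (ly [:: e1; e2; e4; e6; e3; e5]) (lz [:: e1; e2; e4; e6; e3; e5]) = e5 - (e1 + e2 + e6 + e3).
  by apply: funext => p; have [_ h] := E p; rewrite /proj /emax /emin lxE lyE lzE h !fctE; lia.
case: i1 i2 i4 i6 i3 i5 => [f1 _] [f2 _] [f4 _] [f6 _] [f3 _] [f5 _].
have f14 := fsD f1 f4; have f145 := fsD f14 f5; have f12 := fsD f1 f2; have f126 := fsD f12 f6; have f1263 := fsD f126 f3.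
by rewrite (nmB f3 f145) (nmD f14 f5) (nmD f1 f4) (nmB f5 f1263) (nmD f126 f3) (nmD f12 f6) (nmD f1 f2).
Qed.

Definition n2q s : R := nq (swl s).
(** Cut off at n <= 1 and n' <= 1: for n > T there are no points, but the volumes would add up to
    the order of the main term. The form is symmetric so that the swap preserves it. *)
Definition mainB B s : R := ic ((nq s <= 1) && (n2q s <= 1)) * (Theta B s * (Vol (Tq B s) * wf (nms s) / im qw ^+ 2)).
Definition cntB B s : R := cnt (Pl B) s (lx s) (ly s) (lz s) (Tq B s).

Lemma Theta_bounds B s : tup6 s -> 0 <= Theta B s <= 1.
Proof.
move=> [sz _]; rewrite /Theta /theta; have H p : 0 <= hloc (qn p)%:R (supp p s) <= 1 by apply: hloc_bounds; exact: qn_ge2.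
elim: (ples _) => [|p P /andP[i1 i2]]; first by rewrite big_nil lexx ler01.
by rewrite big_cons; have /andP[j1 j2] := H p; rewrite mulr_ge0 //= mulr_ile1.
Qed.

Lemma cnt_err : exists2 A, 0 <= A & forall B, 1 <= B -> err_hyp A B (fun s => `|cntB B s - mainB B s|).
Proof.
have [C C0 CP] := lamnz_crude; have [D D0 DP] := Vol_crude; have [F F0 FP] := sieve.
have w0 := im_qw; have w2 : 0 < im qw ^+ 2 by rewrite exprn_gt0.
have A0 : 0 <= C + D / im qw ^+ 2 + 5 * F.
  by apply: addr_ge0; [apply: addr_ge0 => //; apply: divr_ge0 => //; exact: ltW|exact: mulr_ge0].
exists (C + D / im qw ^+ 2 + 5 * F) => //.
move=> B B1 s hs hJ hl; have h6 := tup6_idl hs; have [fx fy fz] := fs_lxyz h6.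
have [[T0 W0 n0 m0] [i1 i2 i3 i4]] := tup_ids B1 hs; have m1 := i3 hl; have T1 := i4 hJ.
have wf0 : 0 <= wf (nms s) by rewrite -(pmulr_rge0 _ T0) i1; apply: mulr_ge0; [qlra|exact: ltW].
have [th0 th1] : 0 <= Theta B s /\ Theta B s <= 1 by have /andP[] := Theta_bounds B h6.
have mn : (mq s * nq s)^-1 = wf (nms s).
  have E : Tq B s / nq s = mq s * (Tq B s * wf (nms s)) by rewrite i1 i2; ring.
  apply: (mulfI (lt0r_neq0 T0)); apply: (mulfI (lt0r_neq0 m0)); rewrite -E; field.
  by rewrite !gt_eqF.
have V0 := Vol_ge0 (Tq B s).
have r0 : 0 < r4 (Tq B s) by exact: r4_gt0.
have m_le : mainB B s <= D / im qw ^+ 2 * (r4 (Tq B s) ^+ 3 * wf (nms s)) /\ 0 <= mainB B s.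
  have v0 : 0 <= Vol (Tq B s) * wf (nms s) / im qw ^+ 2 by rewrite divr_ge0 ?mulr_ge0 // ltW.
  split; last by apply: mulr_ge0 (ic_ge0 _) _; exact: mulr_ge0.
  apply: le_trans (ler_piMl (mulr_ge0 th0 v0) (ic_le1 _)) _; apply: le_trans (ler_piMl v0 th1) _.
  rewrite (_ : D / _ * _ = D * r4 (Tq B s) ^+ 3 * wf (nms s) / im qw ^+ 2); last by ring.
  apply: ler_wpM2r; first by rewrite invr_ge0 ltW.
  by apply: ler_wpM2r => //; exact: DP.
have [al|nal] := boolP (all (fun p => allowed (supp p s)) (Pl B)); last first.
  have c0 : cntB B s = 0.
    rewrite /cntB /cnt big_seq big1 // => a; rewrite mem_filter => /andP[/andP[a1 a2] _].
    case E : (all _ _) => //; case/negP: nal; apply/allP => p hp.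
    by apply: okp_allowed a1 a2 _; exact: (allP E).
  have t0 : Theta B s = 0.
    move: nal => /allPn[p hp /negbTE hp']; rewrite /Theta /theta (big_rem p) //= hlocE ?hp'; last by rewrite size_map; case: h6.
    by rewrite /ic !mul0r.
  have -> : `|cntB B s - mainB B s| = 0 by rewrite c0 /mainB t0 mul0r mulr0 subrr normr0.
  split=> // _; apply: mulr_ge0 => //.
    by apply: addr_ge0; [apply: divr_ge0; exact: ltW|apply: mulr_ge0 => //; apply: exprn_ge0; exact: ltW].
  apply: mulr_ge0; last by apply: addr_ge0; exact: sqrtr_ge0.
  apply: mulr_ge0 => //; apply: mulr_ge0; last by apply: exprn_ge0; exact: ltW.
  by apply: prodr_ge0 => e _; exact: exprn_ge0.
have [mE nE] := allowed_nm hs al.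
have cle : 0 <= cntB B s <= (size (lats s (Tq B s)))%:R.
  rewrite /cntB /cnt; apply/andP; split; first by apply: sumr_ge0 => a _; exact: ic_ge0.
  rewrite -sum1_size natr_sum; apply: ler_sum_in => a _; exact: ic_le1.
split.
- move=> Tn; have E : lats s (Tq B s) = [::] by apply: lamnz_nil => //; rewrite nE.
  have -> : cntB B s = 0 by apply/eqP; rewrite eq_le; move: cle; rewrite E => /andP[-> ->].
  have -> : mainB B s = 0 by rewrite /mainB [nq s <= 1]leNgt (le_lt_trans T1 Tn) /= (_ : ic false = 0) // mul0r.
  by rewrite subrr normr0.
- move=> nT; have := CP _ _ _ (r4 (Tq B s)) fx fy fz (ltW r0); rewrite (r4K (ltW T0)) mE nE -/(lats s (Tq B s)) mn => hC.
  have [ml m0'] := m_le; have /andP[c0 c1'] := cle.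
  have q1 : 0 <= Tq B s / nq s by apply: divr_ge0; exact: ltW.
  have q2 : 0 <= r4 (Tq B s) ^+ 3 * wf (nms s) by apply: mulr_ge0 => //; apply: exprn_ge0; exact: ltW.
  have h1 : `|cntB B s - mainB B s| <= C * (Tq B s / nq s + r4 (Tq B s) ^+ 3 * wf (nms s)) + D / im qw ^+ 2 * (r4 (Tq B s) ^+ 3 * wf (nms s)).
    move: (cntB B s) (mainB B s) (_ / nq s) (_ * wf _) (size _)%:R q1 q2 ml m0' c0 c1' hC => c m t r z q1 q2 ml m0' c0 c1' hC.
    have : 0 <= D / im qw ^+ 2 * r by rewrite mulr_ge0 // divr_ge0 // ltW.
    by move: q1 q2 ml m0' c0 c1' hC; clear -hK; move=> *; rewrite ler_norml; apply/andP; split; lra.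
  apply: le_trans h1 _; move: (_ / nq s) (_ * wf _) q1 q2 => t r q1 q2.
  have k1 : 0 <= D / im qw ^+ 2 * t by rewrite mulr_ge0 // divr_ge0 // ltW.
  have k2 : 0 <= 5 * F * (t + r) by rewrite !mulr_ge0 // addr_ge0.
  by qlra.
(* For tuples with y3 <= y5 the second cut-off holds automatically, so n <= 1 alone makes [mainB]
   the volume term of the sieve. *)
move=> n1; have n21 : n2q s <= 1.
  move: hs hl; rewrite tupsE => /andP[]; case: (s) => [|a [|b [|c [|d [|e [|f [|? ?]]]]]]] // _ /and5P[ha hb hc hd /and3P[he hf _]].
  rewrite /low /n2q /nq /= => ef.
  have [a1 c1' d1 f1] := And4 (nm_idl_ge1 ha) (nm_idl_ge1 hc) (nm_idl_ge1 hd) (nm_idl_ge1 hf).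
  have g1 : 1 <= nm a * nm c * nm d by rewrite !mulr_ege1.
  rewrite ler_pdivrMr ?mul1r; last by rewrite !mulr_gt0 // (nm_idl_gt0 ha, nm_idl_gt0 hc, nm_idl_gt0 hd, nm_idl_gt0 hf).
  by apply: (le_trans ef); rewrite ler_peMl //; qlra.
have := FP s (Tq B s) (Pl B) _ _ _ h6 T1 (ples_uniq _) fx fy fz (fun p _ => And3 erefl erefl erefl) (fun p => And3 (lexx _) (lexx _) (lexx _)).
rewrite mE nE; have -> : theta hloc (Pl B) s * (Vol (Tq B s) / (mq s * nq s * im qw ^+ 2)) = mainB B s.
  rewrite /mainB n1 n21 /= {1}/ic mul1r /Theta -/(Pl B) -mn; congr (_ * _).
  by rewrite invfM mulrA.
rewrite -/(cntB B s) => h; apply: le_trans h _.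
have e5 : e0 (mq s) (nq s) <= 5 * (wf (nms s) * (Num.sqrt (mq s) + Num.sqrt (nq s))).
  have sl (x : R) : 0 < x -> x <= 1 -> x <= Num.sqrt x.
    move=> x0 x1; rewrite -{1}(sqr_sqrtr (ltW x0)) expr2 ler_piMl ?sqrtr_ge0 //.
    by rewrite -sqrtr1 ler_wsqrtr.
  set S := Num.sqrt _ + _; rewrite -mn (_ : 5 * _ = 5 * S / (mq s * nq s)); last by ring.
  have -> : e0 (mq s) (nq s) = (mq s * nq s + nq s + mq s + S) / (mq s * nq s) by rewrite /e0 -/S; field; rewrite !gt_eqF.
  apply: ler_wpM2r; first by rewrite invr_ge0 mulr_ge0 // ltW.
  have := sl _ m0 m1; have := sl _ n0 n1; have : mq s * nq s <= nq s by rewrite ler_piMl // ltW.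
  by move: (mq s * nq s) => k; have := sqrtr_ge0 (mq s); have := sqrtr_ge0 (nq s); rewrite /S; qlra.
have o0 : 0 <= o8P (Pl B) s by apply: (le_trans ler01); exact: o8P_ge1.
have oo := o8P_le B s; have T4 : 0 <= Tq B s ^+ 4 by apply: exprn_ge0; exact: ltW.
set S := Num.sqrt _ + _ in e5 *; have S0 : 0 <= wf (nms s) * S by apply: mulr_ge0 => //; apply: addr_ge0; exact: sqrtr_ge0.
apply: (@le_trans _ _ (F * Tq B s ^+ 4 * (5 * (wf (nms s) * S)) * o8 B s)).
  apply: ler_pM => //; first by apply: mulr_ge0; [exact: mulr_ge0|exact: e0_ge0].
  by apply: ler_wpM2l => //; exact: mulr_ge0.
have -> : F * Tq B s ^+ 4 * (5 * (wf (nms s) * S)) * o8 B s = 5 * F * (o8 B s * Tq B s ^+ 4 * wf (nms s) * S) by ring.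
apply: ler_wpM2r; last by have : 0 <= D / im qw ^+ 2 by [rewrite divr_ge0 // ltW]; qlra.
rewrite -mulrA; apply: mulr_ge0 => //; apply: mulr_ge0 => //; exact: le_trans oo.
Qed.

(** * The points of U *)
Definition eta (a : K * K) : seq (prm -> int) :=
  mkseq (fun i p => nth 0 (etal (v p a.1) (v p a.2) (gv p a.1 a.2)) i) 6.
Lemma locs_eta a p : locs p (eta a) = etal (v p a.1) (v p a.2) (gv p a.1 a.2).
Proof. by []. Qed.
Lemma etal00 (g : int) : 0 <= g -> etal 0 0 g = nseq 6 0.
Proof. by move=> g0; rewrite /etal (min_idPr g0). Qed.
Lemma fs_eta a e : a.1 != 0 -> a.2 != 0 -> e \in eta a -> integral e.
Proof.
move=> a1 a2 he; suff H i : (i < 6)%N -> integral (fun p => nth 0 (etal (v p a.1) (v p a.2) (gv p a.1 a.2)) i).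
  by move: he; rewrite !inE => /orP[/eqP ->|/orP[/eqP ->|/orP[/eqP ->|/orP[/eqP ->|/orP[/eqP ->|/eqP ->]]]]]; exact: H.
move=> i6; split; last first.
  by move=> p; have /(all_nthP 0) h := etal_ge0 (ultra_v p a1 a2); exact: h.
have F : finite_set ([set p | v p a.1 != 0] `|` [set p | v p a.2 != 0] `|` [set p | v p (a.1 + a.2) != 0]).
  by rewrite !finite_setU; split; [split; [exact: (fs_v a.1)|exact: (fs_v a.2)]|exact: (fs_v (a.1 + a.2))].
apply: sub_finite_set F => p /= h; have [h1|h1] := eqVneq (v p a.1) 0; last by left; left.
have [h2|h2] := eqVneq (v p a.2) 0; last by left; right.
right; apply: contra_neq h => h3; rewrite h1 h2 etal00 ?nth_nseq ?if_same //.
by rewrite /gv h3 h1; case: eqP.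
Qed.
Lemma tup6_eta a : a.1 != 0 -> a.2 != 0 -> tup6 (eta a).
Proof. by move=> a1 a2; split => // e; exact: fs_eta. Qed.

Definition M1 (u w : R * R) : R :=
  Num.max (n2 u) (Num.max (n2 w) (Num.max 1 (Num.max (n2 u * n2 w) (n2 u * n2 w * n2 (u + w))))).
Lemma M1_le u w T : (M1 u w <= T) = [&& n2 u <= T, n2 w <= T, 1 <= T, n2 u * n2 w <= T & n2 u * n2 w * n2 (u + w) <= T].
Proof. by rewrite /M1 !ge_max. Qed.
Lemma M1_ge1 u w : 1 <= M1 u w.
Proof. by rewrite /M1 !le_max lexx !orbT. Qed.

Definition Uset (B : R) : set (K * K) := [set a | [/\ a.1 != 0, a.2 != 0 & M1 (pt a.1) (pt a.2) * Jf (nms (eta a)) <= B]].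
Definition Ulist (B : R) : seq (K * K) :=
  flatten [seq [seq a <- lats s (Tq B s) | all (fun p => okp s p a) (Pl B)] | s <- tups (idl B) 6 & Jf (nms s) <= B].

(** The parameters are tested only at the primes of norm at most B. At all others s is trivial, so
    lattice membership makes u, v and u + v integral there, which forces trivial parameters. *)
Lemma lats_eta B s a : 0 <= B -> s \in tups (idl B) 6 -> a \in lats s (Tq B s) -> all (fun p => okp s p a) (Pl B) -> eta a = s.
Proof.
move=> B0 hs ha /allP hok; have h6 := tup6_idl hs; have [fx fy fz] := fs_lxyz h6.
move: ha; rewrite /lats lamnzE // => /asboolP[a1 a2 [l1 l2 l3] _].
have E p : locs p (eta a) = locs p s.
  rewrite locs_eta; have [hp|hp] := boolP (p \in Pl B); first by apply/eqP/hok.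
  have z := supp_Pl hs hp; have z' : locs p s = nseq 6 0.
    apply: (@eq_from_nth _ 0) => [|i]; rewrite size_map (proj1 h6) ?size_nseq // => i6.
    by rewrite (nth_map 0) ?(proj1 h6) // nth_nseq i6; apply/eqP/(allP z); rewrite mem_nth ?(proj1 h6).
  have [x0 y0 z0] : [/\ lx s p = 0, ly s p = 0 & lz s p = 0].
    have [e1 [e2 [e4 [e6 [e3 [e5 [sE _]]]]]]] := tup6P h6; move: z'; rewrite sE lxE lyE lzE => -[-> -> -> -> -> ->].
    by [].
  have g1 : 0 <= v p a.1 by case: l1 => [/eqP|/(_ p)]; rewrite ?(negPf a1) ?x0.
  have g2 : 0 <= v p a.2 by case: l2 => [/eqP|/(_ p)]; rewrite ?(negPf a2) ?y0.
  have g3 : 0 <= gv p a.1 a.2.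
    by rewrite /gv; case: eqP => // /eqP n0; case: l3 => [/eqP|/(_ p)]; rewrite ?(negPf n0) ?z0.
  by rewrite z' /etal; move: g1 g2 g3; move: (v p a.1) (v p a.2) (gv p _ _) => i j k hi hj hk;
    rewrite (max_idPl (_ : Num.max (- i) (- j) <= 0)) ?ge_max ?oppr_le0 ?hi // !(min_idPr _) // !maxxx minxx.
apply: (@eq_from_nth _ 0); first by rewrite (proj1 h6).
move=> i i6; have i6' : (i < size s)%N by rewrite (proj1 h6).
apply: funext => p; have := congr1 (fun t => nth 0 t i) (E p).
by rewrite /locs !(nth_map 0).
Qed.

Lemma Ulist_uniq B : 0 <= B -> uniq (Ulist B).
Proof.
move=> B0; rewrite /Ulist; set S := [seq s <- _ | _].
have uS : uniq S by rewrite filter_uniq // tups_uniq // idl_uniq.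
have hS s : s \in S -> s \in tups (idl B) 6 by rewrite mem_filter => /andP[].
elim: S uS hS => [//|s S ih] /= /andP[sS uS] hS.
rewrite cat_uniq ih //; last by move=> t tS; apply: hS; rewrite inE tS orbT.
rewrite filter_uniq ?lamnz_uniq // andbT /=; apply/hasPn => a /flatten_mapP[t tS]; rewrite mem_filter => /andP[ok1 l1].
apply/negP; rewrite mem_filter => /andP[ok2 l2].
have e1 := lats_eta B0 (hS t (_ : t \in s :: S)) l1 ok1; have e2 := lats_eta B0 (hS s (mem_head _ _)) l2 ok2.
by move: sS; rewrite -e2 e1 ?tS // inE tS orbT.
Qed.
Lemma size_Ulist B : (size (Ulist B))%:R = \sum_(s <- tups (idl B) 6 | Jf (nms s) <= B) cntB B s.
Proof.
rewrite /Ulist -big_filter; elim: [seq _ <- _ | _] => [|s S ih]; first by rewrite big_nil.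
rewrite big_cons /= size_cat natrD ih; congr (_ + _); rewrite /cntB /cnt size_filter -sum1_count natr_sum big_mkcond /=.
by apply: eq_bigr => a _; rewrite /ic; case: (all _ _).
Qed.

Lemma Jf_ge s e : tup6 s -> e \in s -> nm e <= Jf (nms s).
Proof.
move=> /tup6P[e1 [e2 [e4 [e6 [e3 [e5 [-> [i1 i2 i4 i6 [i3 i5]]]]]]]]].
have g f : integral f -> 1 <= nm f by case=> ff f0; exact: nm_ge1.
have [g1 g2 g4 g6] := And4 (g _ i1) (g _ i2) (g _ i4) (g _ i6); have [g3 g5] := conj (g _ i3) (g _ i5).
have R1 (x y : R) : 1 <= x -> 1 <= y -> x <= x * y by move=> x1 y1; rewrite ler_peMr //; qlra.
have E (x y1 y2 y3 y4 y5 : R) n1 n2 n3 n4 n5 n6 : 1 <= x -> 1 <= y1 -> 1 <= y2 -> 1 <= y3 -> 1 <= y4 -> 1 <= y5 ->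
    x <= x * (x ^+ n1 * (y1 ^+ n2 * (y2 ^+ n3 * (y3 ^+ n4 * (y4 ^+ n5 * y5 ^+ n6))))).
  by move=> *; apply: R1 => //; do 5 (apply: mulr_ege1; first exact: exprn_ege1); exact: exprn_ege1.
rewrite /nms /= !inE => /orP[/eqP ->|/orP[/eqP ->|/orP[/eqP ->|/orP[/eqP ->|/orP[/eqP ->|/eqP ->]]]]].
- by apply: le_trans (E _ _ _ _ _ _ 2%N 2%N 2%N 2%N 1%N 1%N g1 g2 g4 g6 g3 g5) _; rewrite le_eqVlt; apply/orP; left; apply/eqP; ring.
- by apply: le_trans (E _ _ _ _ _ _ 1%N 3%N 2%N 2%N 1%N 1%N g2 g1 g4 g6 g3 g5) _; rewrite le_eqVlt; apply/orP; left; apply/eqP; ring.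
- by apply: le_trans (E _ _ _ _ _ _ 1%N 3%N 2%N 2%N 1%N 1%N g4 g1 g2 g6 g3 g5) _; rewrite le_eqVlt; apply/orP; left; apply/eqP; ring.
- by apply: le_trans (E _ _ _ _ _ _ 1%N 3%N 2%N 2%N 1%N 1%N g6 g1 g2 g4 g3 g5) _; rewrite le_eqVlt; apply/orP; left; apply/eqP; ring.
- by apply: le_trans (E _ _ _ _ _ _ 0%N 3%N 2%N 2%N 2%N 1%N g3 g1 g2 g4 g6 g5) _; rewrite le_eqVlt; apply/orP; left; apply/eqP; ring.
by apply: le_trans (E _ _ _ _ _ _ 0%N 3%N 2%N 2%N 2%N 1%N g5 g1 g2 g4 g6 g3) _; rewrite le_eqVlt; apply/orP; left; apply/eqP; ring.
Qed.

Lemma Ulist_mem B a : 0 < B -> (a \in Ulist B) = `[< Uset B a >].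
Proof.
move=> B0; apply/idP/asboolP.
  move=> /flatten_mapP[s]; rewrite mem_filter => /andP[hJ hs]; rewrite mem_filter => /andP[ok l].
  have sE := lats_eta (ltW B0) hs l ok; have h6 := tup6_idl hs; have [fx fy fz] := fs_lxyz h6.
  move: l; rewrite /lats lamnzE // => /asboolP[a1 a2 _ [r1 r2 r3 r4']].
  have J0 : 0 < Jf (nms s).
    move: h6 => /tup6P[e1 [e2 [e4 [e6 [e3 [e5 [-> [[f1 _] [f2 _] [f4 _] [f6 _] [[f3 _] [f5 _]]]]]]]]]].
    by apply: Jf_gt0; exact: nm_gt0.
  split => //; rewrite sE -ler_pdivlMr // -/(Tq B s) M1_le; apply/and5P; split => //.
  by rewrite /Tq ler_pdivlMr // mul1r.
case=> a1 a2 h; have h6 := tup6_eta a1 a2.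
have J1 : 0 < Jf (nms (eta a)).
  have [e1 [e2 [e4 [e6 [e3 [e5 [-> [[f1 _] [f2 _] [f4 _] [f6 _] [[f3 _] [f5 _]]]]]]]]]] := tup6P h6.
  by apply: Jf_gt0; exact: nm_gt0.
have hJ : Jf (nms (eta a)) <= B by apply: le_trans h; rewrite ler_peMl ?M1_ge1 // ltW.
have hs : eta a \in tups (idl B) 6.
  rewrite tupsE (proj1 h6) eqxx; apply/allP => e he; rewrite /= idlE; apply/asboolP; split; first exact: (proj2 h6).
  by apply: le_trans hJ; exact: Jf_ge.
apply/flatten_mapP; exists (eta a); first by rewrite mem_filter hJ.
have [fx fy fz] := fs_lxyz h6.
rewrite mem_filter; apply/andP; split; first by apply/allP => p _; rewrite /okp locs_eta.
rewrite /lats lamnzE //; apply/asboolP; split => //.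
  have G p := @etal_ge (v p a.1) (v p a.2) (gv p a.1 a.2) _ _ _ _ _ _ (ultra_v p a1 a2) (locs_eta a p).
  split; [right => p|right => p|].
  - by have [g _ _] := G p; apply: le_trans g; rewrite /lx /= !fctE.
  - by have [_ g _] := G p; apply: le_trans g; rewrite /ly /= !fctE.
  have [z0|z0] := eqVneq (a.1 + a.2) 0; [by left|right => p].
  rewrite (_ : v p (a.1 + a.2) = gv p a.1 a.2); last by rewrite /gv (negPf z0).
  by have [_ _ g] := G p; apply: le_trans g; rewrite /lz /= !fctE.
by move: h; rewrite -ler_pdivlMr // -/(Tq B _) M1_le => /and5P[h1 h2 _ h4 h5]; split.
Qed.

Definition vec (a : K * K) : 'rV[K]_5 := \row_i nth 0 [:: a.1; a.2; 1; a.1 * a.2; - (a.1 * a.2 * (a.1 + a.2))] i.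
Lemma forall5 (P : 'I_5 -> Prop) : P (inord 0) -> P (inord 1) -> P (inord 2) -> P (inord 3) -> P (inord 4) -> forall i, P i.
Proof.
move=> h0 h1 h2 h3 h4 i; rewrite -(inord_val i); case: i => [[|[|[|[|[|i]]]]] hi] //=.
Qed.
Lemma vec_inord a (i : nat) : (i < 5)%N ->
  vec a 0 (inord i) = nth 0 [:: a.1; a.2; 1; a.1 * a.2; - (a.1 * a.2 * (a.1 + a.2))] i.
Proof. by move=> i5; rewrite mxE inordK. Qed.
Lemma row5_eq (x y : 'rV[K]_5) : (forall i, (i < 5)%N -> x 0 (inord i) = y 0 (inord i)) -> x = y.
Proof. by move=> h; apply/rowP; apply: forall5; exact: h. Qed.

Lemma onSurface_scale c (x : 'rV[K]_5) : onSurface x -> onSurface (c *: x).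
Proof.
have E i : (c *: x) 0 i = c * x 0 i by rewrite mxE.
rewrite /onSurface !E; move: (x 0 (inord 0)) (x 0 (inord 1)) (x 0 (inord 2)) (x 0 (inord 3)) (x 0 (inord 4)).
move=> x0 x1 x2 x3 x4 [h1 h2]; split.
  have -> : c * x0 * (c * x1) - c * x2 * (c * x3) = c ^+ 2 * (x0 * x1 - x2 * x3) by ring.
  by rewrite h1 mulr0.
have -> : c * x0 * (c * x3) + c * x1 * (c * x3) + c * x2 * (c * x4) = c ^+ 2 * (x0 * x3 + x1 * x3 + x2 * x4) by ring.
by rewrite h2 mulr0.
Qed.
Lemma onSurface_vec a : onSurface (vec a).
Proof. by rewrite /onSurface !vec_inord //=; split; ring. Qed.
Lemma vec_neq0 a : vec a != 0.
Proof. by apply/eqP => /rowP/(_ (inord 2)); rewrite vec_inord // mxE => /eqP; rewrite oner_eq0. Qed.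

(** The y's are the coordinates of a vector y with third coordinate 0; the first two equations come
    from y on S, the last two from the sum of y and (u, w, 1, uw, -uw(u + w)) on S. *)
Lemma line_alg (u w y0 y1 y3 y4 : K) : u != 0 -> w != 0 -> y0 * y1 = 0 -> (y0 + y1) * y3 = 0 ->
  (y0 + u) * (y1 + w) = y3 + u * w -> (y0 + u + y1 + w) * (y3 + u * w) + y4 - u * w * (u + w) = 0 ->
  [/\ y0 = 0, y1 = 0, y3 = 0 & y4 = 0].
Proof.
move=> u0 w0 h1 h2 h3 h4.
have [z0 z1] : y0 = 0 /\ y1 = 0.
  have e3 : y3 = y0 * y1 + y0 * w + u * y1 by rewrite -[y3](addrK (u * w)) -h3; ring.
  move/eqP: h1; rewrite mulf_eq0 => /orP[] /eqP z; split => //; move: h2; rewrite e3 z.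
    rewrite !mul0r !add0r => /eqP; rewrite mulrCA !mulf_eq0 (negPf u0) /= orbb => /eqP; exact.
  rewrite !mulr0 !addr0 add0r => /eqP; rewrite !mulf_eq0 (negPf w0) orbF orbb => /eqP; exact.
have z3 : y3 = 0 by rewrite -[y3](addrK (u * w)) -h3 z0 z1 !add0r subrr.
by split => //; rewrite -h4 z0 z1 z3; ring.
Qed.

(* On a line in S through vec a there is a point y with third coordinate 0; polarizing the two quadrics forces y = 0. *)
Lemma pointOnU_vec a : a.1 != 0 -> a.2 != 0 -> pointOnU <[vec a]>%VS.
Proof.
move=> a1 a2; split.
  split; first by rewrite dim_vline vec_neq0.
  by move=> _ /vlineP[c ->]; apply: onSurface_scale; exact: onSurface_vec.
move=> L [dL sL]; apply/negP => sub.
have [y yL yn] : exists2 y, y \in L & y \notin <[vec a]>%VS.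
  apply/subvPn; apply/negP => /dimvS; rewrite dL dim_vline vec_neq0 //.
pose z := y - y 0 (inord 2) *: vec a.
have zL : z \in L by rewrite rpredB // rpredZ // (subvP sub) // memv_line.
have z2 : z 0 (inord 2) = 0 by rewrite !mxE inordK //= mulr1 subrr.
have q1 := sL _ zL; have q2 := sL _ (rpredD zL (subvP sub _ (memv_line (vec a)))).
have E i : (z + vec a) 0 i = z 0 i + vec a 0 i by rewrite mxE.
move: q1 q2; rewrite /onSurface !E z2 !vec_inord //= !mul0r !subr0 !addr0 !add0r !mul1r => -[r1 r2] [/subr0_eq r3 r4].
rewrite -mulrDl in r2; have [|s0 s1 s3 s4] := line_alg (y4 := z 0 (inord 4)) a1 a2 r1 r2 r3; first by rewrite -r4; ring.
case/negP: yn; have : z = 0.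
  apply: row5_eq => -[|[|[|[|[|i]]]]] // _; by rewrite ?s0 ?s1 ?z2 ?s3 ?s4 mxE.
by move/eqP; rewrite subr_eq0 => /eqP ->; rewrite rpredZ // memv_line.
Qed.

Lemma coord_line (i j : 'I_5) : i != j -> exists2 L : {vspace 'rV[K]_5}, \dim L = 2%N &
  forall x, (x \in L) = [forall k, (k != i) ==> (k != j) ==> (x 0 k == 0)].
Proof.
move=> ij; pose e (k : 'I_5) : 'rV[K]_5 := delta_mx 0 k.
have eE k l : e k 0 l = (l == k)%:R by rewrite mxE eqxx eq_sym.
exists (<[e i]> + <[e j]>)%VS.
  have H k : e k != 0 by apply/eqP => /rowP/(_ k); rewrite eE eqxx mxE => /eqP; rewrite oner_eq0.
  rewrite dimv_disjoint_sum ?dim_vline ?H //; apply/eqP; rewrite -subv0; apply/subvP => x.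
  rewrite memv_cap => /andP[/vlineP[c ->] /vlineP[d E]]; rewrite memv0.
  have := congr1 (fun r : 'rV_5 => r 0 i) E; rewrite !mxE !eqxx /= mulr1 (negPf ij) mulr0 => ->.
  by rewrite scale0r.
move=> x; apply/memv_addP/forallP => [[_ /vlineP[c ->] [_ /vlineP[d ->] ->]] k|h].
  by apply/implyP => ki; apply/implyP => kj; rewrite mxE !(mxE _ _ 0 k) !eqxx /= (negPf ki) (negPf kj) !mulr0 addr0.
exists (x 0 i *: e i); first by rewrite rpredZ // memv_line.
exists (x 0 j *: e j); first by rewrite rpredZ // memv_line.
apply/rowP => k; rewrite !mxE !eqxx /=.
have [->|ki] := eqVneq k i; first by rewrite (negPf ij) mulr0 mulr1 addr0.
have [->|kj] := eqVneq k j; first by rewrite mulr0 mulr1 add0r.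
by rewrite !mulr0 addr0; apply/eqP; have := h k; rewrite ki kj.
Qed.

(** If x0, x1 or x2 vanishes, the equations put the point on one of the five coordinate lines of S.
    Otherwise, after scaling to x2 = 1, they determine x3 and x4. *)
Lemma pointOnU_form (P : {vspace 'rV[K]_5}) : pointOnU P -> exists a, [/\ a.1 != 0, a.2 != 0 & P = <[vec a]>%VS].
Proof.
move=> [[dP sP] nL]; set x := vpick P.
have x0 : x != 0 by rewrite vpick0 -dimv_eq0 dP.
have xP : x \in P by exact: memv_pick.
have PE : P = <[x]>%VS by apply/eqP; rewrite eq_sym eqEdim -memvE xP dP dim_vline x0.
have [q1 q2] := sP _ xP; set X := fun i => x 0 (inord i).
have nz (i j : nat) : (i < 5)%N -> (j < 5)%N -> i != j ->
    (forall y : 'rV[K]_5, (forall k, (k < 5)%N -> k != i -> k != j -> y 0 (inord k) = 0) -> onSurface y) ->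
    ~ (forall k, (k < 5)%N -> k != i -> k != j -> X k = 0).
  move=> i5 j5 ij hL hx; have [|L dL LE] := @coord_line (inord i) (inord j).
    by apply: contra ij => /eqP /(congr1 (@nat_of_ord 5)); rewrite !inordK // => ->.
  have I5 (k l : nat) : (k < 5)%N -> (l < 5)%N -> ((inord k : 'I_5) == inord l) = (k == l).
    by move=> k5 l5; rewrite -val_eqE /= !inordK.
  have M (y : 'rV[K]_5) : y \in L <-> forall k, (k < 5)%N -> k != i -> k != j -> y 0 (inord k) = 0.
    rewrite LE; split=> [/forallP h k k5 ki kj|h].
      by have := h (inord k); rewrite !I5 // ki kj => /eqP.
    by apply/forallP => k; apply/implyP => ki; apply/implyP => kj; rewrite -(inord_val k) h //;
      [apply: contra ki|apply: contra kj] => /eqP <-; rewrite inord_val.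
  have /negP := nL L (conj dL (fun y yL => hL y ((M y).1 yL))); apply.
  by rewrite PE -memvE; apply/(M x).2.
have S (y : 'rV[K]_5) : y 0 (inord 0) * y 0 (inord 1) = 0 -> y 0 (inord 2) * y 0 (inord 3) = 0 ->
    (y 0 (inord 0) + y 0 (inord 1)) * y 0 (inord 3) = 0 -> y 0 (inord 2) * y 0 (inord 4) = 0 -> onSurface y.
  by move=> e1 e2 e3 e4; rewrite /onSurface e1 e2 -mulrDl e3 e4 subr0 addr0.
(* The digits in the names are the two coordinates that may be nonzero on the line. *)
have n34 : ~ (X 0%N = 0 /\ X 1%N = 0 /\ X 2%N = 0).
  move=> [z0 [z1 z2]]; apply: (nz 3%N 4%N) => // [y h|[|[|[|[|[|k]]]]] //].
  by apply: S; rewrite ?(h 0%N) ?(h 1%N) ?(h 2%N) // ?mul0r // addr0 mul0r.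
have n14 : ~ (X 0%N = 0 /\ X 2%N = 0 /\ X 3%N = 0).
  move=> [z0 [z1 z2]]; apply: (nz 1%N 4%N) => // [y h|[|[|[|[|[|k]]]]] //].
  by apply: S; rewrite ?(h 0%N) ?(h 3%N) ?(h 2%N) // ?mul0r ?mulr0.
have n04 : ~ (X 1%N = 0 /\ X 2%N = 0 /\ X 3%N = 0).
  move=> [z0 [z1 z2]]; apply: (nz 0%N 4%N) => // [y h|[|[|[|[|[|k]]]]] //].
  by apply: S; rewrite ?(h 1%N) ?(h 3%N) ?(h 2%N) // ?mul0r ?mulr0.
have n12 : ~ (X 0%N = 0 /\ X 3%N = 0 /\ X 4%N = 0).
  move=> [z0 [z1 z2]]; apply: (nz 1%N 2%N) => // [y h|[|[|[|[|[|k]]]]] //].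
  by apply: S; rewrite ?(h 0%N) ?(h 3%N) ?(h 4%N) // ?mul0r ?mulr0.
have n02 : ~ (X 1%N = 0 /\ X 3%N = 0 /\ X 4%N = 0).
  move=> [z0 [z1 z2]]; apply: (nz 0%N 2%N) => // [y h|[|[|[|[|[|k]]]]] //].
  by apply: S; rewrite ?(h 1%N) ?(h 3%N) ?(h 4%N) // ?mul0r ?mulr0.
have E1 : X 0%N * X 1%N = X 2%N * X 3%N by exact: subr0_eq q1.
have E2 : (X 0%N + X 1%N) * X 3%N + X 2%N * X 4%N = 0 by rewrite mulrDl.
clear nz S q1 q2.
have x2 : X 2%N != 0.
  apply/eqP => z2; move: E1 E2; rewrite z2 !mul0r addr0 => /eqP + /eqP.
  rewrite !mulf_eq0 => /orP[] /eqP z /orP[/eqP z'|/eqP z'].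
  - by apply: n34; rewrite z; split => //; split => //; rewrite -z' z add0r.
  - by apply: n14.
  - by apply: n34; rewrite z; split => //; rewrite -z' z addr0.
  by apply: n04.
have Z34 : X 3%N = 0 -> X 4%N = 0.
  by move=> z3; move: E2; rewrite z3 mulr0 add0r => /eqP; rewrite mulf_eq0 (negPf x2) => /eqP.
have nx0 : X 0%N != 0.
  apply/eqP => z0; have z3 : X 3%N = 0 by move/esym/eqP: E1; rewrite z0 mul0r mulf_eq0 (negPf x2) => /eqP.
  by apply: n12; split => //; split => //; exact: Z34.
have nx1 : X 1%N != 0.
  apply/eqP => z1; have z3 : X 3%N = 0 by move/esym/eqP: E1; rewrite z1 mulr0 mulf_eq0 (negPf x2) => /eqP.
  by apply: n02; split => //; split => //; exact: Z34.
have X3 : X 3%N = X 0%N * X 1%N / X 2%N by rewrite E1 mulrC mulKf.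
have X4 : X 4%N = - ((X 0%N + X 1%N) * X 3%N) / X 2%N.
  by apply: (mulfI x2); rewrite mulrCA divff // mulr1; apply/eqP; rewrite -addr_eq0 addrC E2.
exists (X 0%N / X 2%N, X 1%N / X 2%N); rewrite /= !mulf_neq0 ?invr_eq0 //; split => //.
have xE : x = X 2%N *: vec (X 0%N / X 2%N, X 1%N / X 2%N).
  apply: row5_eq => i i5; rewrite [RHS]mxE vec_inord // -[LHS]/(X i).
  case: i i5 => [|[|[|[|[|i]]]]] // _ /=; rewrite ?X4 ?X3; by field.
by apply/eqP; rewrite PE eqEdim !dim_vline x0 vec_neq0 andbT -memvE xE rpredZ // memv_line.
Qed.

Lemma memv_vec_inj a b : <[vec a]>%VS = <[vec b]>%VS -> a = b.
Proof.
move=> E; have /vlineP[c cE] : vec a \in <[vec b]>%VS by rewrite -E memv_line.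
have H i : (i < 5)%N -> vec a 0 (inord i) = c * vec b 0 (inord i) by move=> _; rewrite cE mxE.
have := H 2%N isT; rewrite !vec_inord //= mulr1 => c1'.
have := H 0%N isT; have := H 1%N isT; rewrite !vec_inord //= -c1' !mul1r.
by case: a {E cE H}; case: b => ? ? ? ? /= -> ->.
Qed.

(** The exponent at p of the ideal generated by the five coordinates of [vec a]. *)
Definition mine (a : K * K) : prm -> int := fun p =>
  Num.min (v p a.1) (Num.min (v p a.2) (Num.min 0 (Num.min (v p a.1 + v p a.2) (v p a.1 + v p a.2 + gv p a.1 a.2)))).
Lemma Jf_mine a : a.1 != 0 -> a.2 != 0 -> fs (mine a) /\ Jf (nms (eta a)) = (nm (mine a))^-1.
Proof.
move=> a1 a2; have [e1 [e2 [e4 [e6 [e3 [e5 [E [[f1 _] [f2 _] [f4 _] [f6 _] [[f3 _] [f5 _]]]]]]]]]] := tup6P (tup6_eta a1 a2).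
have H : mine a = - (e1 *+ 3 + e2 *+ 2 + e4 *+ 2 + e6 *+ 2 + e3 + e5).
  apply: funext => p; have := locs_eta a p; rewrite E => /esym /(etal_fid (ultra_v p a1 a2)) h.
  by rewrite /mine -[LHS]opprK -h !fctE !natmulfctE; lia.
have g1 := fsMn 3 f1; have g2 := fsMn 2 f2; have g4 := fsMn 2 f4; have g6 := fsMn 2 f6.
have h12 := fsD g1 g2; have h4 := fsD h12 g4; have h6 := fsD h4 g6; have h3 := fsD h6 f3; have h5 := fsD h3 f5.
rewrite H; split; first exact: fsN.
rewrite nmN // invrK E /nms /=.
have nX e n : fs e -> nm (e *+ n) = nm e ^+ n.
  by move=> fe; elim: n => [|n ih]; rewrite ?mulr0n ?nm0 ?expr0 // mulrSr exprSr nmD ?ih //; exact: fsMn.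
by rewrite (nmD h3 f5) (nmD h6 f3) (nmD h4 g6) (nmD h12 g4) (nmD g1 g2) !nX.
Qed.

Lemma coord_vec c a : c != 0 -> a.1 != 0 -> a.2 != 0 -> coord_ideal (c *: vec a) = ide (mine a + v ^~ c).
Proof.
move=> c0 a1 a2; have E i : (i < 5)%N -> (c *: vec a) 0 (inord i) =
    c * nth 0 [:: a.1; a.2; 1; a.1 * a.2; - (a.1 * a.2 * (a.1 + a.2))] i.
  by move=> i5; rewrite mxE vec_inord.
have V x p : x != 0 -> v p (c * x) = v p x + v p c by move=> x0; rewrite vM // addrC.
have a12 : a.1 * a.2 != 0 by rewrite mulf_neq0.
have mem i : ide (mine a + v ^~ c) ((c *: vec a) 0 i).
  move: i; apply: forall5; rewrite E //=; [right => p|right => p|right => p|right => p|].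
  - by rewrite fD V // lerD2r /mine !ge_min lexx.
  - by rewrite fD V // lerD2r /mine !ge_min lexx !orbT.
  - by rewrite fD V ?oner_neq0 // v1 lerD2r /mine !ge_min lexx !orbT.
  - by rewrite fD V // vM // lerD2r /mine !ge_min lexx !orbT.
  have [->|z0] := eqVneq (a.1 + a.2) 0; first by rewrite mulr0 oppr0 mulr0; left.
  right => p; rewrite fD V ?oppr_eq0 ?mulf_neq0 // vN vM // vM // lerD2r /mine /gv (negPf z0) !ge_min lexx !orbT.
  done.
have [z1 zD zM] := ide_submod (mine a + v ^~ c).
apply/seteqP; split => y.
  move=> [b /= hb <-]; elim/big_ind: _ => // i _; apply: zM; [exact: hb|exact: mem].
pose J := coord_ideal (c *: vec a).
have Jm : OK_submodule J.
  split.
  - by exists (fun=> 0) => [i|]; [exact: O0|rewrite big1 // => i _; rewrite mul0r].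
  - move=> x z [b /= hb <-] [d /= hd <-]; exists (fun i => b i + d i) => [i|]; first by apply: OD; [exact: hb|exact: hd].
    by rewrite -big_split /=; apply: eq_bigr => i _; rewrite mulrDl.
  move=> r x hr [b /= hb <-]; exists (fun i => r * b i) => [i|]; first by apply: OM => //; exact: hb.
  by rewrite mulr_sumr; apply: eq_bigr => i _; rewrite mulrA.
have Jx i : J ((c *: vec a) 0 i).
  exists (fun j => (j == i)%:R) => [j|]; first by case: (j == i); [exact: O1|exact: O0].
  by rewrite (bigD1 i) //= eqxx mul1r big1 ?addr0 // => j /negPf ->; rewrite mul0r.
move=> hy; have [->|y0] := eqVneq y 0; first by case: Jm.
case: hy => [/eqP h|hy]; first by rewrite (negPf y0) in h.
apply: (local_global Jm); first by exists ((c *: vec a) 0 (inord 2)) => //; rewrite E //= mulr1.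
move=> p; have {hy} := hy p; rewrite fD => hy.
have W i (x : K) : (i < 5)%N -> nth 0 [:: a.1; a.2; 1; a.1 * a.2; - (a.1 * a.2 * (a.1 + a.2))] i = x -> x != 0 ->
    v p x <= mine a p -> exists2 z, J z & z != 0 /\ v p z <= v p y.
  move=> i5 xi x0 h; exists ((c *: vec a) 0 (inord i)) => //; rewrite E // xi; split; first by rewrite mulf_neq0.
  by rewrite V //; apply: le_trans hy; rewrite lerD2r.
have one := oner_neq0 K.
have [l1|l1] := leP (v p a.1) (mine a p); first exact: (W 0%N _ isT erefl a1 l1).
have [l2|l2] := leP (v p a.2) (mine a p); first exact: (W 1%N _ isT erefl a2 l2).
have [l3|l3] := leP 0 (mine a p); first by apply: (W 2%N _ isT erefl one); rewrite v1.
have [l4|l4] := leP (v p a.1 + v p a.2) (mine a p); first by apply: (W 3%N _ isT erefl a12); rewrite vM.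
have l5 : v p a.1 + v p a.2 + gv p a.1 a.2 <= mine a p.
  by move: l1 l2 l3 l4; rewrite /mine; move: (v p a.1) (v p a.2) (gv p _ _) => i j k; lia.
(* If u + v = 0 the last coordinate is 0; the large value of [gv] prevents it from being the
   minimum. *)
have [z0|z0] := eqVneq (a.1 + a.2) 0.
  exfalso; move: l4 l5; rewrite /gv z0 eqxx; move: (mine a p) (v p a.1) (v p a.2) => m i j; lia.
apply: (W 4%N _ isT erefl); first by rewrite oppr_eq0 mulf_neq0.
by rewrite vN vM // vM //; move: l5; rewrite /gv (negPf z0).
Qed.

(** The scalar relating the picked vector to [vec a] cancels, because the norm of a principal ideal
    is the squared absolute value of its generator. *)
Lemma height_vecE a : a.1 != 0 -> a.2 != 0 -> height iota <[vec a]>%VS = M1 (pt a.1) (pt a.2) * Jf (nms (eta a)).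
Proof.
move=> a1 a2; have [fm ->] := Jf_mine a1 a2.
have /vlineP[c cE] := memv_pick <[vec a]>%VS.
have c0 : c != 0.
  apply/eqP => c0; move/eqP: cE; rewrite c0 scale0r vpick0 -dimv_eq0 dim_vline vec_neq0 //.
rewrite /height cE /height_vec coord_vec // fracNorm_ide; last by apply: fsD => //; exact: fs_v.
rewrite nmD ?nm_v //; last exact: fs_v.
have s0 : 0 < sq c by rewrite sq_gt0.
have -> : \big[Num.max/0]_(i < 5) sqnorm (iota ((c *: vec a) 0 i)) = sq c * M1 (pt a.1) (pt a.2).
  have sqN (x : K) : sq (- x) = sq x by rewrite !sqE reN imN !sqrrN.
  have E (i : 'I_5) : sqnorm (iota ((c *: vec a) 0 i)) = sq c * sq (vec a 0 i) by rewrite mxE -sqM.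
  under eq_bigr => i _ do rewrite E.
  rewrite !big_ord_recl big_ord0 /= !mxE /= sq1 sqN !sqM /M1 -ptD !n2_pt mulr1.
  rewrite (max_idPl (_ : 0 <= sq c * (sq a.1 * sq a.2 * sq (a.1 + a.2)))); last first.
    by apply: mulr_ge0; [exact: sq_ge0|apply: mulr_ge0; [apply: mulr_ge0|]; exact: sq_ge0].
  by rewrite !maxr_pMr ?ltW // mulr1.
by field; rewrite !gt_eqF // nm_gt0.
Qed.

Lemma ncard_list (T : choiceType) (A : set T) (l : seq T) : uniq l -> (forall x, A x <-> x \in l) -> ncard A = size l.
Proof.
move=> ul h; have -> : A = [set` [fset x | x in l]%fset].
  by apply/seteqP; split => x; rewrite h => hx; [apply/imfsetP; exists x|case/imfsetP: hx => y /= hy ->].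
by rewrite /ncard set_fsetK card_in_imfset //= undup_id.
Qed.

Lemma countU_sum B : 0 < B -> (countU iota B)%:R = \sum_(s <- tups (idl B) 6 | Jf (nms s) <= B) cntB B s.
Proof.
move=> B0; rewrite -size_Ulist -(size_map (fun a => <[vec a]>%VS)); congr (_%:R).
apply: ncard_list; first by rewrite map_inj_uniq ?Ulist_uniq ?ltW // => a b; exact: memv_vec_inj.
move=> P; split=> [[/pointOnU_form[a [a1 a2 ->]] h]|/mapP[a + ->]].
  by apply: map_f; rewrite Ulist_mem //; apply/asboolP; split => //; rewrite -height_vecE.
rewrite Ulist_mem // => /asboolP[a1 a2 h]; split; first exact: pointOnU_vec.
by rewrite height_vecE.
Qed.

Definition us B s : seq (K * K) := [seq a <- lats s (Tq B s) | all (fun p => okp s p a) (Pl B)].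
Lemma cntB_us B s : cntB B s = (size (us B s))%:R.
Proof.
rewrite /cntB /cnt size_filter -sum1_count natr_sum [in RHS]big_mkcond /=.
by apply: eq_bigr => a _; rewrite /ic; case: (all _ _).
Qed.
Lemma us_mem B s a : 0 < B -> s \in tups (idl B) 6 -> Jf (nms s) <= B ->
  (a \in us B s) = `[< Uset B a >] && (eta a == s).
Proof.
move=> B0 hs hJ; rewrite -(Ulist_mem a B0); apply/idP/andP=> [h|[/flatten_mapP[t]]].
  split; first by apply/flatten_mapP; exists s => //; rewrite mem_filter hJ.
  by move: h; rewrite mem_filter => /andP[ok l]; rewrite (lats_eta (ltW B0) hs l ok).
rewrite mem_filter => /andP[_ ht] h /eqP <-; move: (h); rewrite mem_filter => /andP[ok l].
by rewrite (lats_eta (ltW B0) ht l ok).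
Qed.

Definition swp (a : K * K) : K * K := (a.2, a.1).
Lemma swpK : involutive swp. Proof. by case. Qed.
Lemma eta_swp a : eta (swp a) = swl (eta a).
Proof.
have E p i : nth 0 (etal (v p a.2) (v p a.1) (gv p a.2 a.1)) i =
    nth 0 (swl (etal (v p a.1) (v p a.2) (gv p a.1 a.2))) i.
  have -> : gv p a.2 a.1 = gv p a.1 a.2.
    rewrite /gv addrC; case: eqP => // /eqP; rewrite addr_eq0 => /eqP ->; by rewrite vN.
  by rewrite /etal (maxC (- v p a.2)) /swl; congr (nth _ _ _); congr cons; ring.
have L (T : Type) (x1 x2 x3 x4 x5 x6 y1 y2 y3 y4 y5 y6 : T) : x1 = y1 -> x2 = y2 -> x3 = y3 -> x4 = y4 -> x5 = y5 -> x6 = y6 ->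
    [:: x1; x2; x3; x4; x5; x6] = [:: y1; y2; y3; y4; y5; y6] by move=> -> -> -> -> -> ->.
apply: L; apply: funext => p.
- exact: (E p 0%N).
- exact: (E p 1%N).
- exact: (E p 2%N).
- exact: (E p 3%N).
- exact: (E p 4%N).
exact: (E p 5%N).
Qed.
Lemma M1C u w : M1 u w = M1 w u.
Proof.
apply/eqP; rewrite eq_le; suff H u' w' : M1 u' w' <= M1 w' u' by rewrite !H.
have := lexx (M1 w' u'); rewrite {1}M1_le => /and5P[h1 h2 h3 h4 h5]; rewrite M1_le h1 h2 h3.
by rewrite (addrC u') (mulrC (n2 u')) h4 h5.
Qed.
Lemma Jf_swl s : Jf (nms (swl s)) = Jf (nms s).
Proof. by case: s => [|a1 [|a2 [|a4 [|a6 [|a3 [|a5 [|? ?]]]]]]] //=; rewrite /nms /=; ring. Qed.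
Lemma wf_swl s : wf (nms (swl s)) = wf (nms s).
Proof. by case: s => [|a1 [|a2 [|a4 [|a6 [|a3 [|a5 [|? ?]]]]]]] //=; rewrite /nms /=; ring. Qed.
Lemma Uset_swp B a : Uset B (swp a) <-> Uset B a.
Proof. suff : ([/\ a.2 != 0, a.1 != 0 & M1 (pt a.2) (pt a.1) * Jf (nms (eta (swp a))) <= B] <-> Uset B a) by [].
by rewrite (eta_swp a) Jf_swl M1C; split=> -[]. Qed.
Lemma swl_tups B s : (swl s \in tups (idl B) 6) = (s \in tups (idl B) 6).
Proof. by rewrite !tupsE (perm_size (perm_swl s)) (eq_all_r (perm_mem (perm_swl s))). Qed.

Lemma cntB_swl B s : 0 < B -> s \in tups (idl B) 6 -> Jf (nms s) <= B -> cntB B (swl s) = cntB B s.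
Proof.
move=> B0 hs hJ; rewrite !cntB_us -(size_map swp (us B s)); congr (_%:R); apply: perm_size.
have U t : uniq (us B t) by rewrite filter_uniq // lamnz_uniq.
apply: uniq_perm => //; first by rewrite (map_inj_uniq (inv_inj swpK)).
move=> a; have -> : (a \in map swp (us B s)) = (swp a \in us B s).
  by rewrite -{1}(swpK a) (mem_map (inv_inj swpK)).
have h1 : swl s \in tups (idl B) 6 by rewrite swl_tups.
have h2 : Jf (nms (swl s)) <= B by rewrite Jf_swl.
have e1 : `[< Uset B a >] = `[< Uset B (swp a) >] by apply/asboolP/asboolP => /Uset_swp.
have e2 : (eta a == swl s) = (eta (swp a) == s).
  by apply/eqP/eqP => [E|<-]; rewrite eta_swp ?swlK // E swlK.
by move: (us_mem a B0 h1 h2) (us_mem (swp a) B0 hs hJ); rewrite e1 e2 => -> ->.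
Qed.
Lemma mainB_swl B s : mainB B (swl s) = mainB B s.
Proof. by rewrite /mainB /n2q swlK andbC /Theta theta_swl /Tq Jf_swl wf_swl. Qed.

Lemma count_err : exists2 C, 0 <= C & forall B, 1 <= B ->
  `|(countU iota B)%:R - \sum_(s <- tups (idl B) 6 | Jf (nms s) <= B) mainB B s| <=
  C * (B * ((1 + ln B) ^+ 4 * (1 + ln (1 + ln B)))).
Proof.
have [A A0 AP] := cnt_err; have [C C0 CP] := error_total A0; exists (2 * C) => [|B B1]; first by rewrite mulr_ge0.
have B0 : 0 < B by qlra.
rewrite countU_sum // -sumrB; apply: le_trans (ler_norm_sum _ _ _) _.
set G := fun s => `|cntB B s - mainB B s|; rewrite -/G.
have := CP B G B1 (AP B B1); set X := _ * _ => h.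
rewrite (bigID low); suff : \sum_(s <- tups (idl B) 6 | (Jf (nms s) <= B) && ~~ low s) G s <= X.
  move=> h'; rewrite (_ : 2 * C * _ = X + X); last by rewrite /X; ring.
  exact: lerD h h'.
apply: le_trans h; rewrite big_mkcond [leRHS]big_mkcond -[leRHS](sum_tups_swl _ (idl_uniq B)).
apply: ler_sum_in => s hs; rewrite -/(G s) -/(G (swl s)); have sz : size s = 6 by move: (hs); rewrite tupsE => /andP[/eqP].
rewrite Jf_swl; case: (boolP (Jf (nms s) <= B)) => hJ //=.
have -> : G (swl s) = G s by rewrite /G cntB_swl // mainB_swl.
have g0 : 0 <= G s by exact: normr_ge0.
case: (boolP (low s)) => [_|nl] /=; first by case: ifP.
rewrite (_ : low (swl s)) //; move: nl; rewrite /low -ltNge => /ltW.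
by move: sz; case: (s) => [|a1 [|a2 [|a4 [|a6 [|a3 [|a5 [|? ?]]]]]]].
Qed.

(** * The main term *)
Local Notation X4 := ((R * R) * (R * R))%type.
Definition Mx (x : X4) : R := M1 x.1 x.2.
Lemma Mx_le x T : 1 <= T -> (Mx x <= T) = `[< Rg T x >].
Proof.
move=> T1; rewrite /Mx M1_le T1 /=; apply/and4P/asboolP => [[]|[]]; by split.
Qed.
Lemma Mx_ge1 x : 1 <= Mx x. Proof. exact: M1_ge1. Qed.
Lemma Mx_gt0 x : 0 < Mx x. Proof. exact: lt_le_trans ltr01 (Mx_ge1 x). Qed.

Lemma measurable_Mx : measurable_fun setT Mx.
Proof.
have mn : measurable_fun setT (n2 : R * R -> R) by exact: measurable_n2.
have m1 : measurable_fun setT (fun x : X4 => n2 x.1) by exact: measurableT_comp.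
have m2' : measurable_fun setT (fun x : X4 => n2 x.2) by exact: measurableT_comp.
have m12 : measurable_fun setT (fun x : X4 => n2 x.1 * n2 x.2) by exact: measurable_funM.
have m3 := measurable_n2D; rewrite /Mx /M1.
apply: measurable_maxr => //; apply: measurable_maxr => //; apply: measurable_maxr => //.
by apply: measurable_maxr => //; exact: measurable_funM.
Qed.

(** An integrable majorant with an additional logarithm, which arises when ln (B / M) is replaced by
    ln B. *)
Definition gx x : R := (1 + ln (Mx x)) / Mx x.
Lemma dyadic256 (m : R) : 1 <= m -> exists k : nat, 256 ^+ k <= m <= 256 ^+ k.+1.
Proof.
move=> m1; have H n : m <= 256 ^+ n -> exists k : nat, 256 ^+ k <= m <= 256 ^+ k.+1.
  elim: n => [|n ih] h; first by exists 0%N; rewrite expr0 m1 (le_trans h) // expr1 expr0 ler1n.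
  by have [/ih //|h'] := leP m (256 ^+ n); exists n; rewrite h (ltW h').
apply: (H (Num.trunc m).+1); have /andP[_ /ltW h] := truncn_itv (le_trans ler01 m1).
apply: (le_trans h); rewrite -natrX ler_nat; apply: ltnW; exact: ltn_expl.
Qed.
(** The ratio 256 = 4^4 makes the fourth roots exact: on the k-th shell the volume is O(64^k) and
    [gx] is at most 9 / 128^k, which leaves a geometric series in 1/2. *)
Lemma gx_le x : exists k : nat, Mx x <= 256 ^+ k.+1 /\ gx x <= 9 / 128 ^+ k.
Proof.
have [k /andP[h1 h2]] := dyadic256 (Mx_ge1 x); exists k; split => //; have M0 := Mx_gt0 x.
have l2 : ln (2 : R) <= 1.
  have := @le_ln1Dx R 1 ltac:(lra); by rewrite (_ : 1 + 1 = 2 :> R) //; qlra.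
have hl : ln (Mx x) <= 8 * k.+1%:R.
  have e256 : 256 = 2 ^+ 8 :> R by rewrite -natrX.
  have q0 : 0 < 2 ^+ 8 :> R by rewrite exprn_gt0.
  move: h2; rewrite e256 -(ler_ln M0 (exprn_gt0 k.+1 q0)) => h2; apply: (le_trans h2).
  rewrite (lnXn _ q0) -(mulr_natr (ln (2 ^+ 8)) k.+1) ler_wpM2r //.
  by rewrite lnXn // -(mulr_natr (ln 2) 8); qlra.
have k2 : k.+1%:R <= 2 ^+ k :> R by rewrite -natrX ler_nat; exact: ltn_expl.
rewrite /gx ler_pdivrMr // mulrAC ler_pdivlMr ?exprn_gt0 //.
apply: (@le_trans _ _ (9 * 2 ^+ k * 128 ^+ k)).
  apply: ler_wpM2r; first exact: exprn_ge0.
  by have : 1 <= 2 ^+ k :> R by [rewrite exprn_ege1 // ler1n]; qlra.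
by rewrite -mulrA -exprMn ler_wpM2l // (_ : 2 * 128 = 256 :> R) // -natrM.
Qed.
Lemma gx_ge x : (Mx x)^-1 <= gx x.
Proof. by rewrite -[leLHS]mul1r ler_wpM2r ?invr_ge0 ?(ltW (Mx_gt0 x)) // lerDl ln_ge0 // Mx_ge1. Qed.
Lemma measurable_gx : measurable_fun setT gx.
Proof.
have mM := measurable_Mx; rewrite (_ : gx = (fun x => (1 + ln (Mx x)) * expR (- ln (Mx x)))).
  have ml : measurable_fun setT (fun x => ln (Mx x)) by exact: measurableT_comp.
  apply: measurable_funM; first by apply: measurable_funD.
  by apply: measurableT_comp => //; exact: measurable_funN.
by apply/funext => x; rewrite /gx expRN lnK // posrE Mx_gt0.
Qed.

Lemma integrable_gx : m4.-integrable setT (EFin \o gx).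
Proof.
apply/integrableP; split; first by apply/measurable_EFinP; exact: measurable_gx.
have [C C0 CP] := Vol_crude.
pose a (k : nat) x := ((9 / 128 ^+ k * \1_(Rg (256 ^+ k.+1)) x : R)%:E).
have a0 k x : (0 <= a k x)%E by rewrite lee_fin mulr_ge0 // divr_ge0 // exprn_ge0.
have ma k : measurable_fun setT (a k).
  by apply/measurable_EFinP; apply: measurable_funM => //; apply: measurable_indic; exact: measurable_Rg.
have mS : measurable_fun setT (fun x => \sum_(k <oo) a k x)%E.
  by apply: ge0_emeasurable_sum => //= k x _ _; exact: a0.
apply: le_lt_trans (_ : (\int[m4]_x (\sum_(k <oo) a k x)) < _)%E.
  apply: ge0_le_integral => //.
  - by apply: measurableT_comp => //; by apply/measurable_EFinP; exact: measurable_gx.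
  move=> x _; have g0 : 0 <= gx x by apply: le_trans (gx_ge x); rewrite invr_ge0 (ltW (Mx_gt0 x)).
  have [k [h1 h2]] := gx_le x; rewrite /= ger0_norm //.
  apply: le_trans (nneseries_lim_ge k.+1 (fun n _ _ => a0 n x)).
  rewrite big_nat_recr //=; apply: (@le_trans _ _ (a k x)); last by rewrite leeDr // sume_ge0.
  rewrite lee_fin indicE mem_set ?mulr1 //.
  by apply/asboolP; rewrite -Mx_le // exprn_ege1 // ler1n.
rewrite integral_nneseries //.
have [c cE c0] : exists2 c, c = 9 * (64 * (2 * C)) & 0 <= c.
  exists (9 * (64 * (2 * C))) => //; exact: mulr_ge0 (ler0n R 9) (mulr_ge0 (ler0n R 64) (mulr_ge0 (ler0n R 2) C0)).
apply: le_lt_trans (_ : (\sum_(k <oo) (c / (2 ^ k.+1)%:R)%:E) < _)%E; last first.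
  exact: le_lt_trans (epsilon_trick0 xpredT c0) (ltry _).
apply: lee_nneseries => k _; first by move=> _; apply: integral_ge0 => x _; exact: a0.
have T1 : 1 <= 256 ^+ k.+1 :> R by rewrite exprn_ege1 // ler1n.
rewrite /a; under eq_integral do rewrite EFinM.
have q0 : 0 <= 9 / 128 ^+ k :> R by rewrite divr_ge0 // exprn_ge0.
rewrite ge0_integralZl_EFin //; last by apply/measurable_EFinP; apply: measurable_indic; exact: measurable_Rg.
rewrite integral_indic ?setIT //; last exact: measurable_Rg.
rewrite [X in (_ * X)%E]VolE ?(le_trans ler01) // -EFinM lee_fin.
have e256 : 256 = 4 ^+ 4 :> R by rewrite -natrX.
have e64 : 4 ^+ 3 = 64 :> R by rewrite -natrX.
have e128 : 128 = 64 * 2 :> R by rewrite -natrM.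
have := CP _ T1; have -> : r4 (256 ^+ k.+1) = 4 ^+ k.+1 :> R by rewrite e256 exprAC r4X4 // exprn_ge0.
move=> h; apply: (@le_trans _ _ (9 / 128 ^+ k * (C * (4 ^+ k.+1) ^+ 3))).
  by rewrite ler_wpM2l // divr_ge0 // exprn_ge0.
rewrite le_eqVlt; apply/orP; left; apply/eqP.
rewrite cE natrX exprAC e64 e128 exprMn !exprS.
have : 64 ^+ k != 0 :> R by rewrite expf_neq0.
have : 2 ^+ k != 0 :> R by rewrite expf_neq0.
by move: (64 ^+ k) (2 ^+ k) => x y x0 y0; field; rewrite x0 y0.
Qed.
Lemma integrable_Minv : m4.-integrable setT (EFin \o (fun x => (Mx x)^-1)).
Proof.
apply: le_integrable integrable_gx => //.
  apply/measurable_EFinP; rewrite (_ : (fun x => _) = (fun x => expR (- ln (Mx x)))).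
    by apply: measurableT_comp => //; apply: measurable_funN; apply: measurableT_comp => //; exact: measurable_Mx.
  by apply/funext => x; rewrite expRN lnK // posrE Mx_gt0.
move=> x _; have := gx_ge x; have : 0 < (Mx x)^-1 by rewrite invr_gt0 Mx_gt0.
by move=> h1 h2; rewrite lee_fin !ger0_norm // ltW // (lt_le_trans h1).
Qed.
Definition W4 : R := \int[m4]_x (Mx x)^-1.

Lemma Rint_ic (c J B : R) : 0 < J -> 0 <= B ->
  m4.-integrable setT (EFin \o (fun x => c * ic (J <= B / Mx x))) /\
  \int[m4]_x (c * ic (J <= B / Mx x)) = c * (if J <= B then Vol (B / J) else 0).
Proof.
move=> J0 B0.
have E : (fun x => ic (J <= B / Mx x)) = \1_(if J <= B then Rg (B / J) else set0).
  apply/funext => x; rewrite indicE /ic; congr (_%:R); congr nat_of_bool; rewrite ler_pdivlMr ?Mx_gt0 // mulrC -ler_pdivlMr //.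
  case: (leP J B) => h.
    have T1 : 1 <= B / J by rewrite ler_pdivlMr // mul1r.
    by rewrite Mx_le //; apply/asboolP/idP => [hh|/set_mem //]; exact: mem_set.
  rewrite in_set0; apply/negP => h'; have := le_trans (Mx_ge1 x) h'.
  by rewrite ler_pdivlMr // mul1r leNgt h.
have mA : measurable (if J <= B then Rg (B / J) else set0) by case: ifP => // _; exact: measurable_Rg.
have vA : m4 (if J <= B then Rg (B / J) else set0) = (if J <= B then Vol (B / J) else 0)%:E.
  by case: ifP => h; [rewrite VolE // divr_ge0 // ltW|rewrite measure0].
have iA : m4.-integrable setT (EFin \o \1_(if J <= B then Rg (B / J) else set0)).
  apply/integrableP; split; first exact/measurable_EFinP/measurable_indic.
  set A := (if _ then _ else _) in mA vA *.
  have E2 : (\int[m4]_x `|(EFin \o \1_A) x| = m4 A)%E.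
    by rewrite -[in RHS](setIT A) -integral_indic //; apply: eq_integral => x _; rewrite /= ger0_norm.
  by rewrite [X in (X < _)%E]E2 [X in (X < _)%E]vA ltry.
rewrite -E in iA; split; first exact: integrableZl iA.
rewrite RintegralZl // E /Rintegral integral_indic ?setIT //.
by rewrite [X in fine X]vA.
Qed.

Lemma Rint_sum (I : eqType) (l : seq I) (F : I -> X4 -> R) : (forall i, i \in l -> m4.-integrable setT (EFin \o F i)) ->
  m4.-integrable setT (EFin \o (fun x => \sum_(i <- l) F i x)) /\
  \int[m4]_x (\sum_(i <- l) F i x) = \sum_(i <- l) \int[m4]_x F i x.
Proof.
elim: l => [|i l ih] h.
  have E : (fun x => \sum_(i <- [::]) F i x) = cst 0 by apply/funext => x; rewrite big_nil.
  rewrite E big_nil; split; first by apply: integrable0.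
  by rewrite /Rintegral integral0.
have [|h1 h2] := ih; first by move=> j jl; apply: h; rewrite inE jl orbT.
have hi : m4.-integrable setT (EFin \o F i) by apply: h; rewrite mem_head.
have E : (fun x => \sum_(j <- i :: l) F j x) = (fun x => F i x + \sum_(j <- l) F j x).
  by apply/funext => x; rewrite big_cons.
rewrite E big_cons -h2; split; last exact: RintegralD.
by have := integrableD measurableT hi h1.
Qed.

Local Notation K0 := (rho ^+ 6 / k0 * euler_product R K).
(** The product n n' = 1 / (y1^2 y2 y4 y6^2) is at most 1, so n > 1 and n' > 1 exclude each other,
    and the indicator of the cut-off is 1 minus the two others. *)
Lemma FQ_ic B X s : 1 <= B -> s \in tups (idl B) 6 ->
  (FQ false X (nms s) - FQ true X (nms s) - FQ true X (swl (nms s))) * Theta B s =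
  ic ((nq s <= 1) && (n2q s <= 1)) * (Theta B s * wf (nms s)) * ic (Jf (nms s) <= X).
Proof.
move=> B1 hs; rewrite -map_swl -/(nms (swl s)) /FQ Jf_swl wf_swl /= andbT.
have N t : t \in tups (idl B) 6 -> (nf (nms t) < nth 0 (nms t) 5) = ~~ (nq t <= 1).
  move=> ht; rewrite -ltNge /nq; have [[_ _ q0 _] _] := tup_ids B1 ht.
  rewrite ltr_pdivlMr ?mul1r //; move: ht; rewrite tupsE => /andP[].
  case: (t) => [|a [|b [|c [|d [|f [|g [|? ?]]]]]]] // _ /and5P[ha hb hc hd /and3P[hf _ _]].
  by rewrite /= !mulr_gt0 // (nm_idl_gt0 ha, nm_idl_gt0 hb, nm_idl_gt0 hd, nm_idl_gt0 hf).
rewrite !N ?swl_tups // -/(n2q s).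
have no2 : (nq s <= 1) || (n2q s <= 1).
  rewrite -[nq s <= 1]negbK -[n2q s <= 1]negbK -negb_and -N // /n2q -N ?swl_tups //.
  move: hs; rewrite tupsE => /andP[].
  case: (s) => [|a [|b [|c [|d [|f [|g [|? ?]]]]]]] // _ /and5P[ha hb hc hd /and3P[hf hg _]].
  apply/negP => /andP[]; rewrite /nms /=.
  have [a1 b1 c1' d1] := And4 (nm_idl_ge1 ha) (nm_idl_ge1 hb) (nm_idl_ge1 hc) (nm_idl_ge1 hd).
  have [f1 g1] := conj (nm_idl_ge1 hf) (nm_idl_ge1 hg).
  have E (x y z t : R) : 1 <= x -> 1 <= y -> 1 <= z -> 0 <= t -> t <= x * y * z * t.
    by move=> x1 y1 z1 t0; rewrite ler_peMl // !mulr_ege1.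
  have := E _ _ _ (nm f) a1 b1 d1 ltac:(lra); have := E _ _ _ (nm g) a1 c1' d1 ltac:(lra).
  qlra.
by case: (Jf _ <= X); case: (nq s <= 1) no2; case: (n2q s <= 1) => //= _; rewrite /ic /=; ring.
Qed.

(** V(B / J) is the measure of the set M <= B / J, equivalently J <= B / M; so summation over tuples
    and integration over (u, v) can be interchanged. *)
Lemma Qsum_int B : 1 <= B -> m4.-integrable setT (EFin \o (fun x => Qsum B (B / Mx x))) /\
  \int[m4]_x Qsum B (B / Mx x) = im qw ^+ 2 * \sum_(s <- tups (idl B) 6 | Jf (nms s) <= B) mainB B s.
Proof.
move=> B1; have B0 : 0 <= B by qlra.
set l := tups (idl B) 6.
pose c s := ic ((nq s <= 1) && (n2q s <= 1)) * (Theta B s * wf (nms s)).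
have E : (fun x => Qsum B (B / Mx x)) = (fun x => \sum_(s <- l) c s * ic (Jf (nms s) <= B / Mx x)).
  by apply/funext => x; apply: eq_big_seq => s hs; exact: FQ_ic.
have J0 s : s \in l -> 0 < Jf (nms s).
  move=> hs; have [[T0 _ _ _] _] := tup_ids B1 hs; move: T0; rewrite /Tq pmulr_rgt0 ?invr_gt0 //; qlra.
have H s (hs : s \in l) := Rint_ic (c s) (J0 s hs) B0.
have [h1 h2] := @Rint_sum _ l (fun s x => c s * ic (Jf (nms s) <= B / Mx x)) (fun s hs => proj1 (H s hs)).
rewrite E; split => //; rewrite h2 mulr_sumr [RHS]big_mkcond; apply: eq_big_seq => s hs.
rewrite (proj2 (H s hs)); case: ifP => _; last by rewrite mulr0.
by rewrite /mainB /c -/(Tq B s); field; rewrite gt_eqF // im_qw.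
Qed.

Lemma expr5_diff (a b : R) : 0 <= b -> b <= a -> a ^+ 5 - b ^+ 5 <= 5 * a ^+ 4 * (a - b).
Proof.
move=> b0 ba; have a0 : 0 <= a by qlra.
rewrite subrXX mulrC ler_wpM2r ?subr_ge0 // !big_ord_recr big_ord0 /= add0r expr0 mulr1 mul1r.
have h n m : (n + m = 4)%N -> a ^+ n * b ^+ m <= a ^+ 4.
  by move=> <-; rewrite exprD ler_wpM2l ?exprn_ge0 // lerXn2r ?nnegrE.
have := h 3%N 1%N erefl; have := h 2%N 2%N erefl; have := h 1%N 3%N erefl; have := h 0%N 4%N erefl.
by rewrite expr0 mul1r; move: (a ^+ 4) (b ^+ 4) => x y; rewrite /bump /=; qlra.
Qed.

(** For M <= B, replacing the fifth power of ln (B / M) by that of ln B costs O(ln^4 B ln M). For M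
    > B the sum is empty and ln B < ln M bounds the main term in the same way. *)
Lemma Qsum_ptw : exists2 C, 0 <= C & forall B x, 1 <= B ->
  `|Qsum B (B / Mx x) - K0 * (B * ln B ^+ 5) * (Mx x)^-1| <= C * (B * (1 + ln B) ^+ 4) * gx x.
Proof.
have [C C0 CP] := Qsum_main; set k := K0 in CP *; exists (C + 5 * `|k|) => [|B x B1].
  by rewrite addr_ge0 // mulr_ge0.
have M1' := Mx_ge1 x; have M0 := Mx_gt0 x; have B0 : 0 < B by qlra.
have lM : 0 <= ln (Mx x) by exact: ln_ge0.
have lB : 0 <= ln B by exact: ln_ge0.
have l4 : ln B ^+ 4 <= (1 + ln B) ^+ 4 by rewrite lerXn2r ?nnegrE //; qlra.
have l40 : 0 <= ln B ^+ 4 by exact: exprn_ge0.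
have X0 : 0 < B / Mx x by exact: divr_gt0.
have k0' := normr_ge0 k.
suff H : `|Qsum B (B / Mx x) - k * (B / Mx x * ln B ^+ 5)| <= (C + 5 * `|k|) * (B / Mx x * ((1 + ln B) ^+ 4 * (1 + ln (Mx x)))).
  rewrite (_ : k * _ * _ = k * (B / Mx x * ln B ^+ 5)); last by ring.
  by apply: (le_trans H); rewrite le_eqVlt; apply/orP; left; apply/eqP; rewrite /gx; ring.
set X := B / Mx x; have [hM|hM] := leP (Mx x) B.
  have X1 : 1 <= X by rewrite ler_pdivlMr // mul1r.
  have XB : X <= B by rewrite ler_pdivrMr // ler_peMr // ltW.
  have lX : ln X = ln B - ln (Mx x) by rewrite lnM ?posrE ?invr_gt0 // lnV ?posrE.
  have d5 : 0 <= ln B ^+ 5 - ln X ^+ 5 <= 5 * ln B ^+ 4 * ln (Mx x).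
    have lX0 : 0 <= ln X by exact: ln_ge0.
    have lXB : ln X <= ln B by rewrite lX; qlra.
    rewrite (_ : ln (Mx x) = ln B - ln X) ?expr5_diff ?andbT ?subr_ge0 ?lerXn2r ?nnegrE //.
    by rewrite lX opprB addrCA subrr addr0.
  rewrite (_ : _ - _ = Qsum B X - k * (X * ln X ^+ 5) - k * X * (ln B ^+ 5 - ln X ^+ 5)); last by ring.
  apply: le_trans (ler_normB _ _) _; rewrite 2!normrM (gtr0_norm (X0 : 0 < X)) (ger0_norm (proj1 (andP d5))).
  have h1 : C * (X * (1 + ln B) ^+ 4) <= C * (X * ((1 + ln B) ^+ 4 * (1 + ln (Mx x)))).
    apply: ler_wpM2l => //; apply: ler_wpM2l; first exact: ltW.
    by rewrite ler_peMr ?(le_trans l40) //; qlra.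
  have h2 : `|k| * X * (ln B ^+ 5 - ln X ^+ 5) <= 5 * `|k| * (X * ((1 + ln B) ^+ 4 * (1 + ln (Mx x)))).
    rewrite (_ : 5 * _ * _ = `|k| * X * (5 * ((1 + ln B) ^+ 4 * (1 + ln (Mx x))))); last by ring.
    apply: ler_wpM2l; first by rewrite mulr_ge0 // ltW.
    apply: (le_trans (proj2 (andP d5))); rewrite -mulrA ler_wpM2l //.
    by apply: ler_pM => //; qlra.
  rewrite mulrDl; apply: lerD; last exact: h2.
  exact: le_trans (CP _ _ X1 XB) h1.
have X1 : X < 1 by rewrite ltr_pdivrMr // mul1r.
have -> : Qsum B X = 0.
  apply: big1_seq => s /= hs; rewrite FQ_ic // (icF (_ : ~~ (Jf (nms s) <= X))) ?mulr0 // -ltNge; apply: (lt_le_trans X1).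
  have h6 := tup6_idl hs; have [a [b [c [d [f [g [sE [[fa a0] _ _ _ _]]]]]]]] := tup6P h6.
  by apply: (le_trans (nm_ge1 fa a0)); apply: Jf_ge => //; rewrite sE mem_head.
rewrite sub0r normrN normrM (normrM X) (gtr0_norm (X0 : 0 < X)) (ger0_norm (exprn_ge0 5 lB)).
have lBM : ln B <= ln (Mx x) by rewrite ler_ln ?posrE // ltW.
have h3 : ln B ^+ 5 <= (1 + ln B) ^+ 4 * (1 + ln (Mx x)) by rewrite exprSr ler_pM //; qlra.
have q0 : 0 <= X * ((1 + ln B) ^+ 4 * (1 + ln (Mx x))).
  by rewrite mulr_ge0 ?(ltW X0) // mulr_ge0 ?exprn_ge0 //; qlra.
apply: le_trans (_ : `|k| * (X * ((1 + ln B) ^+ 4 * (1 + ln (Mx x)))) <= _).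
  by rewrite ler_wpM2l // ler_wpM2l // ltW.
by apply: ler_wpM2r => //; qlra.
Qed.

Lemma main_integral : exists2 C, 0 <= C & forall B, 1 <= B ->
  `|\sum_(s <- tups (idl B) 6 | Jf (nms s) <= B) mainB B s - K0 * W4 / im qw ^+ 2 * (B * ln B ^+ 5)| <=
  C * (B * (1 + ln B) ^+ 4).
Proof.
have [C C0 CP] := Qsum_ptw; have w0 := im_qw; have w2 : 0 < im qw ^+ 2 by rewrite exprn_gt0.
set G := \int[m4]_x gx x.
have G0 : 0 <= G by apply: Rintegral_ge0 => x _; apply: le_trans (gx_ge x); rewrite invr_ge0 (ltW (Mx_gt0 x)).
exists (C * G / im qw ^+ 2) => [|B B1]; first by rewrite divr_ge0 ?mulr_ge0 // ltW.
have [i1 e1] := Qsum_int B1.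
set S := \sum_(s <- _ | _) _ in e1 *.
have i2 : m4.-integrable setT (EFin \o (fun x => K0 * (B * ln B ^+ 5) * (Mx x)^-1)) by exact: integrableZl integrable_Minv.
have i3 : m4.-integrable setT (EFin \o (fun x => C * (B * (1 + ln B) ^+ 4) * gx x)) by exact: integrableZl integrable_gx.
have i4 : m4.-integrable setT (EFin \o (fun x => Qsum B (B / Mx x) - K0 * (B * ln B ^+ 5) * (Mx x)^-1)).
  by have := integrableB measurableT i1 i2.
have h : `|im qw ^+ 2 * S - K0 * (B * ln B ^+ 5) * W4| <= C * (B * (1 + ln B) ^+ 4) * G.
  rewrite -e1 /W4 -(RintegralZl _ measurableT integrable_Minv) -(RintegralB measurableT i1 i2).
  apply: (le_trans (le_normr_Rintegral measurableT i4)).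
  rewrite /G -(RintegralZl _ measurableT integrable_gx).
  apply: le_Rintegral => //; first exact: (integrable_norm i4).
  by move=> x _; exact: CP.
set k := K0 in h *; rewrite -(ler_pM2l w2) -{1}(gtr0_norm w2) -normrM.
have E (w s a b d : R) : w != 0 -> w * (s - a * b / w * d) = w * s - a * d * b by move=> ?; field.
rewrite E ?gt_eqF //; apply: (le_trans h); rewrite le_eqVlt; apply/orP; left; apply/eqP; field.
by rewrite gt_eqF.
Qed.

(** * The archimedean density *)
(** Regroups the last two real coordinates into one complex variable; applied twice to the sixfold
    product. *)
Lemma product_assoc d (T : measurableType d) (m : {sigma_finite_measure set T -> \bar R}) (A : set (T * (R * R))) :
  measurable A -> ((m \x mu) \x mu)%E ((fun p : T * R * R => (p.1.1, (p.1.2, p.2))) @^-1` A) = (m \x mC)%E A.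
Proof.
move=> mA; set A' := _ @^-1` A.
have mA' : measurable A'.
  rewrite -[A']setTI; have : measurable_fun setT (fun p : T * R * R => (p.1.1, (p.1.2, p.2))).
    apply: measurable_fun_pair; first exact: (measurableT_comp measurable_fst measurable_fst).
    by apply: measurable_fun_pair => //; exact: (measurableT_comp measurable_snd measurable_fst).
  by apply => //; exact: measurableT.
transitivity (\int[(m \x mu)%E]_p mu (xsection A' p))%E; first by [].
have H := @fubini_tonelli1 _ _ _ _ R m mu (mu \o xsection A') (measurable_fun_xsection mu mA') (fun w => measure_ge0 mu _).
etransitivity; first exact: H.
apply: eq_integral => t _; rewrite /= /fubini_F; transitivity (\int[mu]_x mu (xsection (xsection A t) x))%E => //.
by apply: eq_integral => x _; congr (mu _); apply/seteqP; split => y; rewrite /xsection /= !inE /= inE.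
Qed.

(** The squared absolute value is uniformly distributed with density [c1] on the half-line.
    Uniqueness of Lebesgue measure concerns the whole line, so its restriction to the negative
    half-line is added first. *)
Lemma n2_push (B : set R) : measurable B -> mC (n2 @^-1` B) = (c1%:E * mu (B `&` `[0%R, +oo[))%E.
Proof.
move=> mB; have c0 := c1_gt0; have ci : 0 <= c1^-1 by rewrite invr_ge0 ltW.
have [m1 m1E] := @pushforward_scaled _ _ (measurableTypeR R * measurableTypeR R)%type (measurableTypeR R) mC n2 _ measurable_n2 ci.
have mneg : measurable (`]-oo, 0%R[ : set (measurableTypeR R)) by exact: measurable_itv.
pose m' := measure_add m1 (mrestr mu mneg).
have m'E A : m' A = ((c1^-1)%:E * mC (n2 @^-1` A) + mu (A `&` `]-oo, 0%R[))%E.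
  by rewrite /m' measure_addE m1E.
have dE t : 0 <= t -> mC (disc t) = (c1 * t)%:E by exact: m2_disc.
have D (x y : R) : 0 <= x -> x <= y -> mC (n2 @^-1` `]x, y]) = (c1 * (y - x))%:E.
  move=> x0 xy; have -> : n2 @^-1` `]x, y] = disc y `\` disc x.
    apply/seteqP; split => z; rewrite /disc /= in_itv /=.
      by move=> /andP[h1 h2]; split => //; apply/negP; rewrite -ltNge.
    by move=> [h1 /negP]; rewrite -ltNge => ->.
  rewrite measureD; [|exact: measurable_disc|exact: measurable_disc|]; last first.
    by rewrite [X in (X < _)%E]m2_disc ?ltry // (le_trans x0).
  rewrite (_ : disc y `&` disc x = disc x).
    transitivity (mC (disc y) - mC (disc x))%E => //.
    by rewrite !dE ?(le_trans x0) // -EFinB mulrBr.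
  by apply/seteqP; split => z [] // h; split => //; exact: le_trans h xy.
have itv (x y : R) : x <= y -> mu `]x, y] = (y - x)%:E.
  move=> xy; rewrite lebesgue_measure_itv /= lte_fin EFinB; case: ltP => // yx.
  by rewrite -EFinB (le_anti (introT andP (conj xy yx))) subrr.
have U : forall A, measurable A -> mu A = m' A.
  apply: lebesgue_measure_unique => _ [[x y] _ <-].
  suff : mu `]x, y]%classic = m' `]x, y]%classic by []; rewrite m'E.
  have [yx|/ltW xy] := leP y x.
    rewrite (_ : `]x, y]%classic = set0) ?preimage_set0 ?set0I ?measure0 ?mule0 ?adde0 //.
    by rewrite set_itv_ge // bnd_simp -leNgt.
  rewrite itv //; have [y0|y0] := ltP y 0.
    rewrite (_ : n2 @^-1` _ = set0); last first.
      apply/seteqP; split => z //=; rewrite in_itv /= => /andP[_ h]; have := n2_ge0 z; qlra.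
    rewrite measure0 mule0 add0e setIidl ?itv // => z /=; rewrite !in_itv /= => /andP[_]; qlra.
  have [x0|x0] := leP 0 x.
    rewrite D // (_ : _ `&` _ = set0); last by apply/seteqP; split => z //= []; rewrite !in_itv /= => /andP[]; qlra.
    by rewrite measure0 adde0 -EFinM mulKf // gt_eqF.
  rewrite (_ : n2 @^-1` _ = disc y); last first.
    apply/seteqP; split => z; rewrite /disc /= in_itv /=; first by case/andP.
    by move=> ->; rewrite andbT (lt_le_trans x0 (n2_ge0 z)).
  rewrite mCE m2_disc // -EFinM mulKf ?gt_eqF //.
  rewrite (_ : _ `&` _ = `]x, 0[%classic); last first.
    by apply/seteqP; split => z /=; rewrite !in_itv /=; [case=> /andP[-> _] -> | move=> /andP[h1 h2]; split => //; apply/andP; split => //; qlra].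
  by rewrite lebesgue_measure_itv /= lte_fin x0 -EFinB -EFinD sub0r.
rewrite U; last by apply: measurableI => //; exact: measurable_itv.
rewrite m'E -setIA (_ : _ `&` `]-oo, 0%R[ = set0).
  rewrite setI0 measure0 adde0 muleA -EFinM divff ?gt_eqF // mul1e; congr (mC _).
  by apply/seteqP; split => z /=; [move=> h; split => //; rewrite in_itv /= n2_ge0|case].
by apply/seteqP; split => z //= []; rewrite !in_itv /= andbT; qlra.
Qed.

Lemma int_n2 (F : R -> \bar R) : measurable_fun setT F -> (forall t, 0 <= F t)%E ->
  (\int[mC]_z F (n2 z) = c1%:E * \int[mu]_(t in `[0%R, +oo[) F t)%E.
Proof.
move=> mF F0; have mI : measurable (`[0, +oo[ : set (measurableTypeR R)) by exact: measurable_itv.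
have mF' : measurable_fun (`[0, +oo[ : set (measurableTypeR R)) F by exact: measurable_funTS.
have -> : setT = n2 @^-1` `[0, +oo[ by apply/esym/seteqP; split => z //= _; rewrite in_itv /= n2_ge0.
have := @ge0_integral_pushforward _ _ (measurableTypeR R * measurableTypeR R)%type (measurableTypeR R) R n2 measurable_n2 mC _ F mI mF' (fun t _ => F0 t) => <-.
transitivity (\int[mscale (NngNum (ltW c1_gt0)) mu]_(t in `[0%R, +oo[) F t)%E; last by rewrite ge0_integral_mscale.
apply: eq_measure_integral; first exact: measurable_n2.
move=> mm A mA AI; have := n2_push mA.
by rewrite (setIidl AI); exact.
Qed.

(** The Gaussian exp(-|z|^2) integrates to [c1] by the distribution of |z|^2 and to pi as a product
    of two one-dimensional integrals. *)
Lemma c1_pi : c1 = pi.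
Proof.
have [mg g0] : measurable_fun setT (fun t : R => (expR (- t))%:E) /\ forall t : R, (0 <= (expR (- t))%:E)%E.
  split => [|t]; last by rewrite lee_fin expR_ge0.
  by apply/measurable_EFinP; apply: measurableT_comp => //; exact: measurable_funN.
have := int_n2 mg g0; have -> : (\int[mu]_(t in `[0%R, +oo[) (expR (- t))%:E = 1)%E.
  rewrite -(integral_exponential_pdf (ltr01 : 0 < 1 :> R)) [in LHS]integral_mkcond.
  apply: eq_integral => t _; rewrite /exponential_pdf !patchE; case: ifP => // _.
  by rewrite mul1r mulN1r.
have gE : (fun z => (expR (- n2 z))%:E) = (fun z : R * R => (gauss_fun z.1 * gauss_fun z.2)%:E).
  by apply/funext => z; rewrite /gauss_fun -expRD /n2 opprD.
have mgs := @measurable_gauss_fun R.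
rewrite mule1 gE => h; apply/EFin_inj; rewrite -h [LHS]fubini_tonelli1.
- rewrite /fubini_F /=; under eq_integral => x _.
    under eq_integral do rewrite EFinM.
    rewrite ge0_integralZl_EFin ?gauss_fun_ge0 //; first rewrite integralT_gauss.
    over.
  - by move=> y _; rewrite lee_fin gauss_fun_ge0.
  - exact/measurable_EFinP.
  have s0 : (0 <= (Num.sqrt pi : R)%:E)%E by rewrite lee_fin sqrtr_ge0.
  rewrite ge0_integralZr //; [|exact/measurable_EFinP|by move=> y _; rewrite lee_fin gauss_fun_ge0].
  by rewrite integralT_gauss -EFinM -expr2 sqr_sqrtr // pi_ge0.
- by apply/measurable_EFinP; apply: measurable_funM; exact: measurableT_comp.
by move=> z; rewrite lee_fin mulr_ge0 ?gauss_fun_ge0.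
Qed.

Lemma int_pow (M : R) : 0 < M ->
  (\int[mu]_(t in `[0%R, +oo[) (t ^+ 2 * ic (t ^+ 3 * M <= 1))%:E = (3^-1 * M^-1)%:E)%E.
Proof.
move=> M0; set a := expR (- ln M / 3); have a0 : 0 < a by exact: expR_gt0.
have a3 : a ^+ 3 = M^-1 by rewrite /a -expRM_natl mulrCA divff // mulr1 expRN lnK.
have E : (\int[mu]_(t in `[0%R, +oo[) (t ^+ 2 * ic (t ^+ 3 * M <= 1))%:E = \int[mu]_(t in `[0%R, a]) (t ^+ 2)%:E)%E.
  rewrite integral_mkcond [RHS]integral_mkcond; apply: eq_integral => t _; rewrite !patchE !mem_setE !in_itv /= andbT.
  case: (leP 0 t) => //= t0; have -> : (t ^+ 3 * M <= 1) = (t <= a).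
    by rewrite -ler_pdivlMr // div1r -a3 ler_pXn2r // nnegrE ltW.
  by case: (t <= a); rewrite /ic ?mulr1 ?mulr0.
have d (t : R) : is_derive t 1 (fun t => t ^+ 3 / 3) (t ^+ 2).
  apply: is_derive_eq; have s (x y : R) : x *: y = x * y by [].
  by rewrite !s !mulr0 mulr1; field.
have c (t : R) : {for t, continuous (fun t : R => t ^+ 3 / 3)}.
  by apply: differentiable_continuous; apply/derivable1_diffP; have [] := d t.
rewrite E (@continuous_FTC2 _ (fun t => t ^+ 2) (fun t => t ^+ 3 / 3)) //.
- by rewrite expr0n mul0r -EFinB subr0 a3 mulrC.
- by apply: continuous_subspaceT => t; exact: exprn_continuous.
- split.
  + by move=> t _; have [] := d t.
  + by apply: cvg_at_right_filter; exact: c.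
  + by apply: cvg_at_left_filter; exact: c.
by move=> t _; rewrite derive1E; have [_ ->] := d t.
Qed.

Lemma int_disc3 (M : R) : 0 < M ->
  (\int[mC]_z (n2 z ^+ 2 * ic (n2 z ^+ 3 * M <= 1))%:E = (c1 / 3 * M^-1)%:E)%E.
Proof.
move=> M0; rewrite (@int_n2 (fun t => (t ^+ 2 * ic (t ^+ 3 * M <= 1))%:E)).
- by rewrite int_pow // -EFinM mulrA.
- apply/measurable_EFinP; apply: measurable_funM; first exact: measurable_funX.
  rewrite (_ : (fun t => _) = \1_[set t : R | t ^+ 3 * M <= 1]).
    apply: measurable_indic; rewrite -[X in measurable X]setTI; apply: measurable_fun_le => //.
    by apply: measurable_funM => //; exact: measurable_funX.
  by apply/funext => t; rewrite indicE /ic mem_setE.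
by move=> t; rewrite lee_fin mulr_ge0 ?sqr_ge0 // ic_ge0.
Qed.

Definition Om : set (X4 * (R * R)) := [set q | [/\ n2 q.1.1 * n2 q.2 ^+ 2 <= 1, n2 q.1.2 * n2 q.2 ^+ 2 <= 1,
  n2 q.2 ^+ 3 <= 1, n2 q.1.1 * n2 q.1.2 * n2 q.2 <= 1 & n2 q.1.1 * n2 q.1.2 * n2 (q.1.1 + q.1.2) <= 1]].
Lemma measurable_Om : measurable Om.
Proof.
have mn : measurable_fun setT (n2 : R * R -> R) by exact: measurable_n2.
have m1 : measurable_fun setT (fun q : X4 * (R * R) => n2 q.1.1).
  by apply: (measurableT_comp mn); exact: (measurableT_comp measurable_fst measurable_fst).
have m2' : measurable_fun setT (fun q : X4 * (R * R) => n2 q.1.2).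
  by apply: (measurableT_comp mn); exact: (measurableT_comp measurable_snd measurable_fst).
have m3 : measurable_fun setT (fun q : X4 * (R * R) => n2 q.2) by exact: measurableT_comp.
have m4' : measurable_fun setT (fun q : X4 * (R * R) => n2 (q.1.1 + q.1.2)) by exact: (measurableT_comp measurable_n2D).
have mle (h : X4 * (R * R) -> R) : measurable_fun setT h -> measurable [set x | h x <= 1].
  by move=> mh; rewrite -[X in measurable X]setTI; exact: measurable_fun_le.
have m12 : measurable_fun setT (fun q : X4 * (R * R) => n2 q.1.1 * n2 q.1.2) by exact: measurable_funM.
rewrite (_ : Om = [set q | n2 q.1.1 * n2 q.2 ^+ 2 <= 1] `&` [set q | n2 q.1.2 * n2 q.2 ^+ 2 <= 1] `&` [set q | n2 q.2 ^+ 3 <= 1]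
  `&` [set q | n2 q.1.1 * n2 q.1.2 * n2 q.2 <= 1] `&` [set q | n2 q.1.1 * n2 q.1.2 * n2 (q.1.1 + q.1.2) <= 1]).
  by do 4?apply: measurableI; apply: mle => //; try (by apply: measurable_funM => //; exact: measurable_funX); exact: measurable_funX.
by apply/seteqP; split => x [] //; move=> [[[]]].
Qed.

(* For z <> 0 the substitution z_0 = z u, z_1 = z w (here only up to a rotation) turns the conditions into ||z||^3 M(u, w) <= 1. *)
Lemma Om_section (z : R * R) : 0 < n2 z ->
  m4 (ysection Om z) = ((n2 z ^+ 2)%:E * m4 [set x | (n2 z ^+ 3 * Mx x <= 1)%R])%E.
Proof.
move=> z0; set r := Num.sqrt (n2 z); have r0 : 0 < r by rewrite sqrtr_gt0.
have r2 : r ^+ 2 = n2 z by rewrite sqr_sqrtr // ltW.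
have mf : measurable_fun setT (fun z : R * R => (r * z.1, r * z.2)).
  by apply: measurable_fun_pair; apply: measurable_funM.
have cc : 0 < r ^+ 2 by rewrite exprn_gt0.
have H (B : set (R * R)) : measurable B -> mC B = ((r ^+ 2)%:E * mC ((fun z : R * R => (r * z.1, r * z.2)%R) @^-1` B))%E.
  by move=> mB; exact: m2_scale.
have mS : measurable (ysection Om z) by apply: measurable_ysection; exact: measurable_Om.
rewrite (@product_scaling _ _ _ _ mC mC _ _ _ _ _ mf mf cc cc H H mS) -expr2 r2; congr (_ * m4 _)%E.
have E y : n2 (r * y.1, r * y.2) = n2 z * n2 y by rewrite -r2 /n2 /=; ring.
have E' (y w : R * R) : n2 ((r * y.1, r * y.2) + (r * w.1, r * w.2)) = n2 z * n2 (y + w) by rewrite -r2 /n2 /=; ring.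
have t3 : 0 < n2 z ^+ 3 by rewrite exprn_gt0.
have L (y : R) : (y <= (n2 z ^+ 3)^-1) = (n2 z ^+ 3 * y <= 1) by rewrite -[leRHS]div1r ler_pdivlMr // mulrC.
have e1 (t a : R) : t * a * t ^+ 2 = t ^+ 3 * a by ring.
have e4 (t a b : R) : t * a * (t * b) * t = t ^+ 3 * (a * b) by ring.
have e5 (t a b c : R) : t * a * (t * b) * (t * c) = t ^+ 3 * (a * b * c) by ring.
have MM x : (n2 z ^+ 3 * Mx x <= 1) = [&& n2 z ^+ 3 * n2 x.1 <= 1, n2 z ^+ 3 * n2 x.2 <= 1, n2 z ^+ 3 <= 1,
    n2 z ^+ 3 * (n2 x.1 * n2 x.2) <= 1 & n2 z ^+ 3 * (n2 x.1 * n2 x.2 * n2 (x.1 + x.2)) <= 1].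
  by rewrite -L /Mx M1_le !L mulr1.
apply/seteqP; split => x; rewrite /ysection /= inE /Om /= E' !E !e1 e4 e5 MM.
  by move=> [h1 h2 h3 h4 h5]; apply/and5P.
by move=> /and5P[h1 h2 h3 h4 h5].
Qed.

(** The section over z has measure |z|^4 times that of |z|^6 M <= 1, except over the null set z = 0;
    integrating over z first turns this into c1 / (3 M). *)
Lemma vol_Om : (\int[mC]_z m4 (ysection Om z) = (c1 / 3 * W4)%:E)%E.
Proof.
have mO := measurable_Om; have d0 : mC (disc 0) = 0%E by rewrite mCE m2_disc // mulr0.
pose F (q : X4 * (R * R)) := (n2 q.2 ^+ 2 * ic (n2 q.2 ^+ 3 * Mx q.1 <= 1))%:E.
have mn : measurable_fun setT (fun q : X4 * (R * R) => n2 q.2) by apply: measurableT_comp => //; exact: measurable_n2.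
have mM : measurable_fun setT (fun q : X4 * (R * R) => Mx q.1) by apply: measurableT_comp => //; exact: measurable_Mx.
have mF : measurable_fun setT F.
  apply/measurable_EFinP; apply: measurable_funM; first exact: measurable_funX.
  rewrite (_ : (fun q => _) = \1_[set q : X4 * (R * R) | n2 q.2 ^+ 3 * Mx q.1 <= 1]).
    apply: measurable_indic; rewrite -[X in measurable X]setTI; apply: measurable_fun_le => //.
    by apply: measurable_funM => //; exact: measurable_funX.
  by apply/funext => t; rewrite indicE /ic mem_setE.
have F0 q : (0 <= F q)%E by rewrite lee_fin mulr_ge0 ?sqr_ge0 // ic_ge0.
have E2 : (\int[mC]_z m4 (ysection Om z) = \int[mC]_z \int[m4]_x F (x, z))%E.
  apply: ge0_ae_eq_integral => //.
  - exact: (measurable_fun_ysection (sfprod mC mC)).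
  - exact: (@measurable_fun_fubini_tonelli_G _ _ _ _ R (sfprod mC mC) F mF F0).
  - by move=> z _; exact: integral_ge0.
  exists (disc 0); split; [exact: measurable_disc|exact: d0|].
  move=> z; apply: contra_notP => /= /negP; rewrite /disc /= -ltNge => z0 _; rewrite Om_section // /F /=.
  under [RHS]eq_integral do rewrite EFinM.
  have mz : measurable [set x | (n2 z ^+ 3 * Mx x <= 1)%R].
    rewrite -[X in measurable X]setTI; apply: measurable_fun_le => //.
    by apply: measurable_funM => //; exact: measurable_Mx.
  rewrite (_ : (fun x => (n2 z ^+ 2)%:E * _)%E = (fun x => (n2 z ^+ 2)%:E * (\1_[set x | (n2 z ^+ 3 * Mx x <= 1)%R] x)%:E)%E).
    rewrite ge0_integralZl_EFin ?sqr_ge0 //; first by rewrite integral_indic ?setIT.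
    by apply/measurable_EFinP; exact: measurable_indic.
  by apply/funext => x; rewrite indicE /ic mem_setE.
have E3 : (\int[mC]_z \int[m4]_x F (x, z) = \int[m4]_x \int[mC]_z F (x, z))%E.
  have H1 := @fubini_tonelli1 _ _ _ _ R (sfprod mC mC) mC F mF F0.
  by have H2 := @fubini_tonelli2 _ _ _ _ R (sfprod mC mC) mC F mF F0; rewrite H1 in H2; exact/esym.
rewrite E2 E3 /F /=; under eq_integral do rewrite int_disc3 ?Mx_gt0 //.
rewrite -(RintegralZl (c1 / 3) measurableT integrable_Minv) /Rintegral fineK //.
exact: (integrable_fin_num measurableT (integrableZl measurableT (c1 / 3) integrable_Minv)).
Qed.

(** The factor 12 / pi meets c1 / 3 = pi / 3, which leaves 4. *)
Lemma omega_W4 : omega_infty R = 4 * W4.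
Proof.
pose phi (p : R * R * R * R * R * R) := (p.1.1, (p.1.2, p.2)).
pose psi (q : R * R * R * R * (R * R)) := (((q.1.1.1.1, q.1.1.1.2), (q.1.1.2, q.1.2)), q.2).
have dE : @omega_domain R = phi @^-1` (psi @^-1` Om).
  have sqE (a b : R) : sqnorm (a +i* b)%C = n2 (a, b) by rewrite /sqnorm /= sqr_sqrtr // addr_ge0 ?sqr_ge0.
  have sD (a b c d : R) : sqnorm ((a +i* b)%C + (c +i* d)%C) = n2 ((a, b) + (c, d)) by exact: sqE.
  have sM (z w : R[i]) : sqnorm (z * w) = sqnorm z * sqnorm w by rewrite /sqnorm ComplexField.Normc.normcM exprMn.
  have s3 (z : R[i]) : sqnorm (z ^+ 3) = sqnorm z ^+ 3 by rewrite !exprSr !expr0 !mul1r (sM (z * z)) (sM z).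
  apply/seteqP; split; move=> [[[[[x0 y0] x1] y1] x2] y2];
    rewrite /omega_domain /Om /= !big_cons big_nil !ge_max s3 !sM sD !sqE -?expr2 ler01 andbT.
    by move=> /and5P[].
  by move=> [h1 h2 h3 h4 h5]; apply/and5P.
have mpsi : measurable (psi @^-1` Om).
  rewrite -[X in measurable X]setTI; have : measurable_fun setT psi; last by apply => //; exact: measurable_Om.
  have m1 := @measurable_fst _ _ (R * R * R * R)%type (R * R)%type.
  do 2?apply: measurable_fun_pair => //; try apply: measurable_fun_pair; repeat
    first [exact: measurable_fst|exact: measurable_snd|apply: measurableT_comp].
have mphi : measurable (phi @^-1` (psi @^-1` Om)).
  rewrite -[X in measurable X]setTI; have : measurable_fun setT phi; last by apply => //; exact: mpsi.
  apply: measurable_fun_pair; first exact: (measurableT_comp measurable_fst measurable_fst).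
  by apply: measurable_fun_pair => //; exact: (measurableT_comp measurable_snd measurable_fst).
have V : (mu \x mu \x mu \x mu \x mu \x mu)%E (@omega_domain R) = (c1 / 3 * W4)%:E.
  rewrite dE [LHS](@product_assoc _ _ (sfprod (sfprod (sfprod mu mu) mu) mu) _ mpsi) -vol_Om.
  transitivity (((sfprod (sfprod (sfprod mu mu) mu) mu) \x^ mC)%E (psi @^-1` Om)).
    by apply: product_measure_unique => //= *; rewrite product_measure2E.
  apply: eq_integral => z _ /=; have mS : measurable (ysection Om z) by apply: measurable_ysection; exact: measurable_Om.
  have SE : ysection (psi @^-1` Om) z = (fun p : R * R * R * R => (p.1.1, (p.1.2, p.2))) @^-1` ysection Om z.
    by apply/seteqP; split => x; rewrite /ysection /= !inE.
  by rewrite SE; exact: (@product_assoc _ _ (sfprod mu mu) _ mS).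
rewrite /omega_infty Rintegral_cst; last by rewrite dE.
rewrite [X in fine X]V /= c1_pi; have := pi_gt0 R; move: (pi : R) => x x0; field.
by rewrite gt_eqF.
Qed.

(** * The discriminant *)
(** The imaginary part of cj x times y, that is, the signed area spanned by x and y. *)
Definition crs (x y : K) : R := re x * im y - im x * re y.
Lemma re_scale (r : rat) x : re (r *: x) = ratr r * re x.
Proof. by rewrite -mulr_algl reM re_rat im_rat mul0r subr0. Qed.
Lemma im_scale (r : rat) x : im (r *: x) = ratr r * im x.
Proof. by rewrite -mulr_algl imM re_rat im_rat mul0r addr0. Qed.

(* crs (x e0) e1 + crs e0 (x e1) = 2 re x crs e0 e1, and both terms on the left are diagonal coefficients times crs e0 e1. *)
Lemma trace_re n (e : n.-tuple K) x : n = 2%N -> basis_of fullv e -> ratr (\sum_i coord e i (x * e`_i)) = 2 * re x :> R.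
Proof.
move=> n2; subst n => be; have cE y : y = coord e ord0 y *: e`_0 + coord e (lift ord0 ord0) y *: e`_1.
  by rewrite {1}(coord_basis be (memvf y)) !big_ord_recl big_ord0 addr0.
rewrite !big_ord_recl big_ord0 addr0 /=; move: (cE (x * e`_0)) (cE (x * e`_1)).
have c0 : crs e`_0 e`_1 != 0.
  case: hK => _ [y]; rewrite -/(im y) (cE y); apply: contraNneq => h.
  have := cE 1; set p := coord e _ 1; set q := coord e _ 1 => h1.
  have h2 : 1 = ratr p * re e`_0 + ratr q * re e`_1 by rewrite -!re_scale -reD -h1 re1.
  have h3 : 0 = ratr p * im e`_0 + ratr q * im e`_1 by rewrite -!im_scale -imD -h1 im1.
  rewrite imD !im_scale; move: (ratr (coord e ord0 y)) (ratr (coord e (lift ord0 ord0) y)) => a b.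
  move: h h2 h3; rewrite /crs; move: (re e`_0) (re e`_1) (im e`_0) (im e`_1) (ratr p) (ratr q) => a0 a1 b0 b1 s t h h2 h3.
  have E : (s * a0 + t * a1) * (a * b0 + b * b1) - (s * b0 + t * b1) * (a * a0 + b * a1) = (s * b - t * a) * (a0 * b1 - b0 * a1) by ring.
  by move: E; rewrite -h2 -h3 h mul1r mul0r subr0 mulr0 => ->.
move: (coord e _ (x * e`_0)) (coord e _ (x * e`_0)) (coord e _ (x * e`_1)) (coord e _ (x * e`_1)) => a b c d h0 h1.
have E : crs (x * e`_0) e`_1 + crs e`_0 (x * e`_1) = 2 * re x * crs e`_0 e`_1 by rewrite /crs !reM !imM; ring.
apply: (mulIf c0); rewrite -E h0 h1 /crs !reD !imD !re_scale !im_scale rmorphD /=; ring.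
Qed.

(** The determinant of the traces is -4 [crs]^2, and an integral basis differs from 1, [qw] by a
    matrix of determinant 1 or -1. The size is a variable equal to 2, because in the discriminant it
    is the dimension of K. *)
Lemma det_crs n (w : 'I_n -> K) (t : K -> rat) : n = 2%N -> (forall x, ratr (t x) = 2 * re x :> R) ->
  (forall i, OO (w i)) -> (forall x, OO x -> exists a : {ffun 'I_n -> int}, x = \sum_i w i *~ a i) ->
  ratr (\det (\matrix_(i, j) t (w i * w j))) = - 4 * im qw ^+ 2 :> R.
Proof.
move=> n2; subst n => tE wO wB; rewrite (expand_det_row _ ord0) !big_ord_recl big_ord0 /cofactor !det_mx11 !mxE addr0 /=.
set i0 : 'I_2 := ord0; set i1 : 'I_2 := lift ord0 ord0.
rewrite (_ : lift i1 0 = i0); last exact: val_inj.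
rewrite addn0 /bump /= expr0 expr1 mul1r mulN1r.
rewrite rmorphD !rmorphM rmorphN /= !tE !reM.
have [k [l h0]] := O_qwE (wO i0); have [m [n h1]] := O_qwE (wO i1).
have E x : OO x -> exists a b : int, x = w i0 *~ a + w i1 *~ b.
  by move=> /wB[a ->]; exists (a i0), (a i1); rewrite !big_ord_recl big_ord0 addr0.
have O1 : OO 1 by exact: (O_int 1).
have [p [q g0]] := E _ O1; have [r [s g1]] := E _ O_qw; have w0 := im_qw.
have reZ (x : K) (a : int) : re (x *~ a) = a%:~R * re x by rewrite -(mulrzl x) reM re_int im_int mul0r subr0.
have imZ (x : K) (a : int) : im (x *~ a) = a%:~R * im x by rewrite -(mulrzl x) imM re_int im_int mul0r addr0.
have cI (x y : K) (a b c d : int) : crs (x *~ a + y *~ b) (x *~ c + y *~ d) = (a * d - b * c)%:~R * crs x y.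
  by rewrite /crs !reD !imD !reZ !imZ rmorphB !rmorphM /=; ring.
have cw : crs (w i0) (w i1) = (k * n - l * m)%:~R * im qw.
  rewrite h0 h1 !(mulrzl qw) cI.
  by rewrite /crs re1 im1 mul1r mul0r subr0.
have ci : im qw = ((p * s - q * r) * (k * n - l * m))%:~R * im qw.
  transitivity (crs (w i0 *~ p + w i1 *~ q) (w i0 *~ r + w i1 *~ s)); last by rewrite cI cw intrM mulrA.
  by rewrite -g0 -g1 /crs re1 im1 mul1r mul0r subr0.
have u : ((p * s - q * r) * (k * n - l * m))%:~R = 1%:~R :> R.
  by apply: (mulIf (lt0r_neq0 w0)); rewrite -ci mul1r.
move/intr_inj: u => u; have c2 : (k * n - l * m) ^+ 2 = 1.
  move: u; move: (p * s - q * r) (k * n - l * m) => x y /(congr1 absz) /eqP; rewrite abszM muln_eq1 => /andP[_ /eqP hy].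
  by rewrite -[_ ^+ _]real_normK ?num_real // -abszE hy.
have -> : im qw ^+ 2 = crs (w i0) (w i1) ^+ 2 by rewrite cw exprMn -rmorphXn c2 mul1r.
by rewrite /crs; ring.
Qed.

Lemma integral_basis_exists n : n = 2%N -> exists w : 'I_n -> K, (forall i, OO (w i)) /\
  forall x, OO x -> exists! a : {ffun 'I_n -> int}, x = \sum_i w i *~ a i.
Proof.
move=> n2; subst n; exists (fun i => if i == ord0 then 1 else qw); split=> [i|x /O_qwE[k [l ->]]].
  by case: ifP => _; [exact: (O_int 1)|exact: O_qw].
exists [ffun i => if i == ord0 then k else l]; split; first by rewrite !big_ord_recl big_ord0 !ffunE /= addr0 mulrzl.
move=> a; rewrite !big_ord_recl big_ord0 /= addr0 => h; have w0 := im_qw.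
have hl : l = a (lift ord0 ord0).
  apply: (@intr_inj R); apply: (mulIf (lt0r_neq0 w0)); have := congr1 im h.
  by rewrite -(mulrzl qw) !imD !imM !re_int !im_int; qlra.
have hk : k = a ord0.
  by apply: (@intr_inj R); move: h; rewrite -hl -(mulrzl qw) => /addIr /(congr1 re); rewrite !re_int.
apply/ffunP => i; rewrite ffunE; case: eqP => [->//|/eqP i0].
by rewrite hl; congr (a _); apply: val_inj; case: i i0 => [[|[|i]]].
Qed.

Lemma discriminantE : ratr (discriminant K) = - 4 * im qw ^+ 2 :> R.
Proof.
have d2 := proj1 hK.
have H : exists D, is_discriminant K D.
  have [w [wO wB]] := integral_basis_exists d2.
  by exists (\det (\matrix_(i, j) traceQ (w i * w j))); exists w.
rewrite /discriminant; have [w [wO wB] ->] := xgetPex 0 H; apply: det_crs => //.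
  by move=> x; exact: trace_re d2 (vbasisP _).
by move=> x /wB[a [h _]]; exists a.
Qed.

(** * The leading constant and the final estimate *)

Lemma ln3_gt1 : 1 < ln (3 : R).
Proof.
(* This says ln (6/5) >= 1/6, and (6/5)^6 = 2.985984 is just below 3. *)
have h : ln (1 + - 6^-1) <= - 6^-1 :> R by apply: le_ln1Dx; qlra.
have e65 : 1 + - 6^-1 = (6 / 5)^-1 :> R by field.
rewrite e65 in h.
have h6 : (6 / 5) ^+ 6 < 3 :> R by rewrite !exprS expr0; qlra.
rewrite lnV ?posrE in h; last qlra.
have p0 : 0 < (6 / 5) ^+ 6 :> R by rewrite exprn_gt0 //; qlra.
have : ln ((6 / 5) ^+ 6) < ln 3 :> R by rewrite ltr_ln ?posrE.
rewrite lnXn; last qlra.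
by rewrite -(mulr_natr (ln (6 / 5)) 6); qlra.
Qed.

(** With w = [im qw] the discriminant is -4 w^2, so (2 pi)^6 / Delta^4 = pi^6 / (4 w^8). The 4
    cancels against [omega_W4], six factors of w belong to rho^6, and two to the covolume of a
    rank-4 lattice. *)
Lemma leading_constantE : leading_constant R K = rho ^+ 6 / k0 * euler_product R K * W4 / im qw ^+ 2.
Proof.
rewrite /leading_constant discriminantE omega_W4 k0E rhoE c1_pi; have w0 := im_qw.
move: (classNumber K)%:R (unitCount K)%:R (euler_product R K) W4 (pi : R) (im qw) w0 => h u eu W p w w0.
have w1 : w != 0 by rewrite gt_eqF.
have [->|u0] := eqVneq u 0; first by rewrite expr0n /= ?(mulr0, invr0, mul0r, expr0n).
by field; rewrite u0 w1.
Qed.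

(** Since ln ln 3 > 0, ln ln B is bounded below on B >= 3, and constants can be absorbed into it. *)
Lemma log_bounds : exists2 D, 0 <= D & forall B : R, 3 <= B ->
  (1 + ln B) ^+ 4 <= D * (ln B ^+ 4 * ln (ln B)) /\ (1 + ln B) ^+ 4 * (1 + ln (1 + ln B)) <= D * (ln B ^+ 4 * ln (ln B)).
Proof.
have l3 := ln3_gt1; set d := ln (ln 3 : R); have d0 : 0 < d by exact: ln_gt0.
exists (16 * (2 / d + 1)) => [|B B3]; first by rewrite mulr_ge0 // addr_ge0 // divr_ge0 // ltW.
have lB : ln 3 <= ln B by rewrite ler_ln ?posrE //; qlra.
have L1 : 1 <= ln B by qlra.
have dB : d <= ln (ln B) by rewrite (ler_ln (lt_trans ltr01 l3) (lt_le_trans ltr01 L1)).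
move: (ln B) lB L1 dB => L lB L1 dB; have L0 : 0 < L by qlra.
have h1 : (1 + L) ^+ 4 <= 16 * L ^+ 4.
  have e16 : 16 = 2 ^+ 4 :> R by rewrite -natrX.
  rewrite e16 -exprMn lerXn2r ?nnegrE //; qlra.
have h2 : 1 + ln (1 + L) <= (2 / d + 1) * ln L.
  have : ln (1 + L) <= 1 + ln L.
    apply: (@le_trans _ _ (ln (2 * L))); first by rewrite ler_ln ?posrE //; qlra.
    rewrite lnM ?posrE // lerD2r; have := @le_ln1Dx R 1 ltac:(lra); by rewrite (_ : 1 + 1 = 2 :> R) //; qlra.
  have : 2 <= 2 / d * ln L by rewrite mulrAC ler_pdivlMr // ler_pM2l.
  by rewrite mulrDl mul1r; qlra.
have l0 : 0 <= ln (1 + L) by apply: ln_ge0; qlra.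
have p0 : 0 <= (1 + L) ^+ 4 by apply: exprn_ge0; qlra.
have h3 : (1 + L) ^+ 4 * (1 + ln (1 + L)) <= 16 * (2 / d + 1) * (L ^+ 4 * ln L).
  rewrite (_ : 16 * _ * _ = 16 * L ^+ 4 * ((2 / d + 1) * ln L)); last by ring.
  by apply: ler_pM => //; qlra.
by split => //; apply: le_trans h3; rewrite ler_peMr //; qlra.
Qed.

Lemma countU_asymptotics : exists C : R, forall B : R, 3 <= B ->
  `|(countU iota B)%:R - leading_constant R K * B * ln B ^+ 5| <= C * (B * ln B ^+ 4 * ln (ln B)).
Proof.
have [C C0 CP] := count_err; have [E E0 EP] := main_integral; have [D D0 DP] := log_bounds.
exists ((C + E) * D) => B B3; have B1 : 1 <= B by qlra.
have B0 : 0 <= B by qlra.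
have [d1 d2] := DP B B3; move: (CP B B1) (EP B B1); rewrite -leading_constantE.
set S := \sum_(s <- _ | _) _ => h1 h2.
rewrite -mulrA (_ : (countU iota B)%:R - _ = (countU iota B)%:R - S + (S - leading_constant R K * (B * ln B ^+ 5))).
  2: by rewrite addrA subrK.
apply: le_trans (ler_normD _ _) _; apply: le_trans (lerD h1 h2) _.
rewrite (_ : _ * D * _ = C * (B * (D * (ln B ^+ 4 * ln (ln B)))) + E * (B * (D * (ln B ^+ 4 * ln (ln B))))); last by ring.
by apply: lerD; apply: ler_wpM2l => //; exact: ler_wpM2l.
Qed.

End Manin.

Theorem theorem1p1 (R : realType) (K : fieldExtType rat)
    (iota : {rmorphism K -> R[i]}) (hK : imaginary_quadratic iota) :
  exists C : R, forall B : R, 3 <= B ->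
    `| (countU iota B)%:R - leading_constant R K * B * ln B ^+ 5 |
      <= C * (B * ln B ^+ 4 * ln (ln B)).
Proof. exact: countU_asymptotics hK. Qed.
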